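(* (i) Let $\Lambda\subset\mathbb R^n$ be a selfdual lattice with $\sigma(\Lambda)=n-8$ and of minimum $2$. Then every nonempty shell of $\Lambda$ and every nonempty shell of $\mathrm{Sh}(\Lambda)$ is a spherical $3$-design. (ii) The shells $(2D_8)^+_m$ with $m=4^a$, $a\ge1$, are spherical $3\tfrac12$-designs. (iii) The shells $(4A_5)^+_m$ and $(5D_4)^+_m$ with $m=4^a$, $a\ge1$, and the shells $(2D_8)^+_m$ with $m=2a+1$, $a\ge1$, are spherical $5$-designs. (iv) Every nonempty shell of the shorter Leech lattice and of its shadow is a spherical $7$-design.
   Context: A selfdual lattice is an integral lattice equal to its dual; it is even if all norms $\langle x,x\rangle$ are even. Shadow: $\mathrm{Sh}(\Lambda)=\Lambda$ if even; otherwise $\mathrm{Sh}(\Lambda)=\Lambda_0^\sharp\setminus\Lambda$ where $\Lambda_0$ is the sublattice of vectors of even norm. $\sigma(\Lambda)=4\min\{\langle x,x\rangle:x\in\mathrm{Sh}(\Lambda)\}$. Shell $A_m=\{x\in A:\langle x,x\rangle=m\}$. For a norm-2 root system $R$, $R^+$ denotes the (unique up to isometry, in ranks $\le23$) selfdual lattice of minimum at least $2$ whose set of norm-2 vectors is $R$; here $(2D_8)^+$ (rank 16), $(4A_5)^+$ and $(5D_4)^+$ (rank 20) are such lattices, with $kR$ the orthogonal union of $k$ copies of the standard root system $R$. The shorter Leech lattice is the (unique) selfdual lattice of rank $23$ with minimum $3$. Designs (antipodal sets $X$): $(C_{2j})$ means $\sum_{x\in X}P(x)=0$ for all homogeneous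 harmonic $P$ of degree $2j$; $t$-design iff $(C_{2j})$ for $2\le 2j\le t$; $3\tfrac12$-design iff $(C_2)$ and $(C_6)$ hold. *)

(* Defs.v *)
From HB Require Import structures.
From mathcomp Require Import all_boot all_order all_algebra.
From mathcomp Require Import reals.
From mathcomp Require Import mpoly.

Set Implicit Arguments.
Unset Strict Implicit.
Unset Printing Implicit Defensive.

Import Order.TTheory GRing.Theory Num.Theory.
Local Open Scope ring_scope.

Section Lattices.
Variable R : realType.

Definition dot {n} (x y : 'rV[R]_n) : R := \sum_(i < n) x ord0 i * y ord0 i.
Definition nrm {n} (x : 'rV[R]_n) : R := dot x x.

Definition is_int (r : R) : Prop := exists z : int, r = z%:~R.
Definition is_even_num (r : R) : Prop := exists z : int, r = (2 * z)%:~R.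

Variable n : nat.
Implicit Types (L A : 'rV[R]_n -> Prop) (x y : 'rV[R]_n).

Definition lattice_of (B : 'M[R]_n) : 'rV[R]_n -> Prop :=
  fun x => exists z : 'rV[int]_n, x = map_mx (fun k : int => k%:~R) z *m B.

Definition dual L : 'rV[R]_n -> Prop := fun y => forall x, L x -> is_int (dot x y).
Definition integral L : Prop := forall x y, L x -> L y -> is_int (dot x y).
Definition selfdual L : Prop := integral L /\ (forall y, dual L y <-> L y).
Definition even_lattice L : Prop := forall x, L x -> is_even_num (nrm x).

Definition even_sub L : 'rV[R]_n -> Prop := fun x => L x /\ is_even_num (nrm x).

Definition shadow L : 'rV[R]_n -> Prop := fun x =>
  (even_lattice L /\ L x) \/ (~ even_lattice L /\ dual (even_sub L) x /\ ~ L x).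

Definition sigma_is L (s : R) : Prop :=
  (exists x, shadow L x /\ 4 * nrm x = s) /\ (forall x, shadow L x -> s <= 4 * nrm x).

Definition min_is L (m : R) : Prop :=
  (exists x, L x /\ x != 0 /\ nrm x = m) /\ (forall x, L x -> x != 0 -> m <= nrm x).
Definition min_ge L (m : R) : Prop := forall x, L x -> x != 0 -> m <= nrm x.

Definition shell A (m : R) : 'rV[R]_n -> Prop := fun x => A x /\ nrm x = m.

Definition harmonic (p : {mpoly R[n]}) : Prop :=
  \sum_(i < n) mderiv i (mderiv i p) = 0.

Definition evalv (p : {mpoly R[n]}) x : R := meval (fun i => x ord0 i) p.

Definition condC (X : 'rV[R]_n -> Prop) (k : nat) : Prop :=
  forall s : seq 'rV[R]_n, uniq s -> (forall x, x \in s <-> X x) ->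
  forall p : {mpoly R[n]}, p \is [in R[n], k.-homog] -> harmonic p ->
    \sum_(x <- s) evalv p x = 0.

Definition design (t : nat) X : Prop :=
  forall j : nat, (1 <= j)%N -> (2 * j <= t)%N -> condC X (2 * j).

Definition design_3half X : Prop := condC X 2 /\ condC X 6.

Definition roots L : 'rV[R]_n -> Prop := fun x => L x /\ nrm x = 2.

Definition roots_iso L N (S : 'rV[R]_N -> Prop) : Prop :=
  exists f : 'rV[R]_n -> 'rV[R]_N,
    (forall x, roots L x -> S (f x)) /\
    (forall z : 'rV[R]_N, S z -> exists x, roots L x /\ f x = z) /\
    (forall x y, roots L x -> roots L y -> dot (f x) (f y) = dot x y).

End Lattices.

Section RootSystems.
Variable R : realType.

Definition intvec {N} (y : 'rV[R]_N) : Prop := forall i, is_int (y ord0 i).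

(* k D_l in R^(k*l) (l >= 2): integer vectors of norm 2 supported in one block of
   l consecutive coordinates (i.e. +-e_i +- e_j, i,j in the same block) *)
Definition rootsD (k l : nat) : 'rV[R]_(k * l) -> Prop := fun y =>
  intvec y /\ nrm y = 2 /\
  (forall i j : 'I_(k * l), y ord0 i != 0 -> y ord0 j != 0 -> (i %/ l = j %/ l)%N).

(* k A_{l-1} in R^(k*l): as above, with each block having coordinate sum 0
   (i.e. e_i - e_j, i,j in the same block) *)
Definition rootsA (k l : nat) : 'rV[R]_(k * l) -> Prop := fun y =>
  rootsD y /\
  (forall b : nat, \sum_(i < k * l | (i %/ l == b)%N) y ord0 i = 0).

End RootSystems.

(* Main.v *)
(** A selfdual lattice L of rank n and a harmonic form P of even degree k give three theta series,
    sum P(x) t^|x|^2 over L, its alternating version, and the same sum over the shadow, where t = exp(pi i tau).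
    Poisson summation shows that tau |-> tau + 1 and tau |-> -1/tau permute them like the Jacobi functions
    theta_3, theta_4, theta_2, up to the factor (tau/i)^(n/2) tau^k.  The product f1 f2 f3 of such a triple divided by
    (theta_2 theta_3 theta_4)^(n+2k) has invariant modulus and, if f1 and f2 vanish to order o at t = 0 and f3 to order o3,
    it is t^e times a power series with e = 2 o + o3 - (n+2k)/4.  When e > 0 a Cauchy estimate on the line Im tau = 1/2,
    which -1/tau sends into Im tau >= 1 after a translation, bounds a high power of it by a fraction of its
    own supremum, so it vanishes.

    This settles (i) directly.  In (iv) the norms of the shadow are congruent to 23/4 mod 2 and the degree 2 case
    excludes norm 7/4, after which the criterion applies for k = 2, 4, 6.  In ranks 16 and 20 the number of roots determines
    the theta series of L, hence the minimum of the shadow, and then the degree 4 and 6 series up to a scalar as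
    explicit products of Jacobi functions; Landen's transformation relates their coefficients at 4^(a+1) and 4^a. *)

Require Import Defs.
From HB Require Import structures.
From mathcomp Require Import all_boot all_order all_algebra.
From mathcomp Require Import boolp classical_sets reals complex.
From mathcomp Require Import mpoly.
From mathcomp Require Import ring lra zify.
From mathcomp Require topology normedtype.
From mathcomp Require Import sequences exp trigo.

Set Implicit Arguments.
Unset Strict Implicit.
Unset Printing Implicit Defensive.

Import Order.TTheory GRing.Theory Num.Theory.
Local Open Scope ring_scope.
Local Notation Re := complex.Re.
Local Notation Im := complex.Im.

(** * Unordered sums of complex families *)

(** All analysis rests on absolutely summable families; no contour integral and no notion of
    holomorphic function occurs. The Gaussian integral is bypassed: g times a Riemann sum of exp(-pi
    (g x + s)^2) is asymptotically independent of g and s, because its derivative along a path of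
    parameters is an exact derivative in x, and the common limit follows from the self-reciprocity
    of exp(-pi x^2). Harmonic forms are handled as sums of powers of linear forms: Poisson summation
    with a translation by r a is expanded in powers of r, and harmonicity kills all terms but one.
    The vanishing argument uses only moduli, hence no multiplier system, and its Cauchy estimate
    averages over roots of unity. On the line Im tau = 1/2 the number r = |t| = exp(-pi/2) satisfies
    r / (1 - r) < 1, and from there upwards the leading terms of the Jacobi series dominate, so that
    these functions have no zeros there. In ranks 16 and 20 the criterion shows that three
    coefficients determine a triple of the weights at hand. *)

Definition cn {R : realType} (z : R[i]) : R := Num.sqrt (Re z ^+ 2 + Im z ^+ 2).
Notation "x %:Co" := (real_complex_def (Phant _) x) (at level 1, left associativity, format "x %:Co").

Section Modulus.
Variable R : realType.
Implicit Types z w : R[i].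

Lemma cnE z : cn z = ComplexField.Normc.normc z.
Proof. by case: z. Qed.
Lemma cn_ge0 z : 0 <= cn z. Proof. exact: sqrtr_ge0. Qed.
Lemma cn0 : cn (0 : R[i]) = 0.
Proof. by rewrite cnE ComplexField.Normc.normc0. Qed.
Lemma cn1 : cn (1 : R[i]) = 1.
Proof. by rewrite cnE ComplexField.Normc.normc1. Qed.
Lemma cn_eq0 z : cn z = 0 -> z = 0.
Proof. by rewrite cnE => /ComplexField.Normc.eq0_normc. Qed.
Lemma cn_gt0 z : (0 < cn z) = (z != 0).
Proof.
rewrite lt_def cn_ge0 andbT; congr (~~ _).
by apply/eqP/eqP => [/cn_eq0|->]; rewrite ?cn0.
Qed.
Lemma cnM z w : cn (z * w) = cn z * cn w.
Proof. by rewrite !cnE ComplexField.Normc.normcM. Qed.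
Lemma cnD z w : cn (z + w) <= cn z + cn w.
Proof. by rewrite !cnE le_normcD. Qed.
Lemma cnN z : cn (- z) = cn z.
Proof. by rewrite /cn; case: z => a b /=; rewrite !sqrrN. Qed.
Lemma cnB z w : cn (z - w) <= cn z + cn w.
Proof. by rewrite -(cnN w) cnD. Qed.
Lemma cn_distC z w : cn (z - w) = cn (w - z).
Proof. by rewrite -cnN opprB. Qed.
Lemma cnV z : cn z^-1 = (cn z)^-1.
Proof. by rewrite !cnE ComplexField.Normc.normcV. Qed.
Lemma cnX z n : cn (z ^+ n) = cn z ^+ n.
Proof. by elim: n => [|n IH]; rewrite ?expr0 ?cn1// !exprS cnM IH. Qed.
Lemma cn_real (x : R) : cn x%:Co = `|x|.
Proof. by rewrite /cn /= expr0n addr0 sqrtr_sqr. Qed.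
Lemma cn_sum (I : Type) (s : seq I) (P : pred I) (f : I -> R[i]) :
  cn (\sum_(i <- s | P i) f i) <= \sum_(i <- s | P i) cn (f i).
Proof.
elim/big_rec2: _ => [|i x y _ H]; first by rewrite cn0.
by apply: (le_trans (cnD _ _)); rewrite lerD2l.
Qed.
Lemma cn_nat n : cn (n%:R : R[i]) = n%:R.
Proof.
have -> : (n%:R : R[i]) = (n%:R : R)%:Co by rewrite rmorph_nat.
by rewrite cn_real normr_nat.
Qed.
Lemma Re_le_cn z : `|Re z| <= cn z.
Proof.
rewrite -sqrtr_sqr /cn ler_wsqrtr// lerDl; exact: sqr_ge0.
Qed.
Lemma Im_le_cn z : `|Im z| <= cn z.
Proof.
rewrite -sqrtr_sqr /cn ler_wsqrtr// lerDr; exact: sqr_ge0.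
Qed.
Lemma cn_le_ReIm z : cn z <= `|Re z| + `|Im z|.
Proof.
case: z => a b; rewrite [Re _]/= [Im _]/=.
have -> : (a +i* b)%C = a%:Co + 'i%C * b%:Co by apply/eqP; rewrite eq_complex /=; apply/andP; split; apply/eqP; ring.
apply: (le_trans (cnD _ _)); rewrite cnM !cn_real.
have -> : cn ('i%C : R[i]) = 1 by rewrite /cn /= expr0n expr1n add0r sqrtr1.
by rewrite mul1r.
Qed.
Lemma cn_sqr z : cn z ^+ 2 = Re z ^+ 2 + Im z ^+ 2.
Proof. by rewrite /cn sqr_sqrtr// addr_ge0 ?sqr_ge0. Qed.
Lemma cReD z w : Re (z + w) = Re z + Re w. Proof. by case: z; case: w. Qed.
Lemma cImD z w : Im (z + w) = Im z + Im w. Proof. by case: z; case: w. Qed.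
Lemma cReN z : Re (- z) = - Re z. Proof. by case: z. Qed.
Lemma cImN z : Im (- z) = - Im z. Proof. by case: z. Qed.
Lemma cReM z w : Re (z * w) = Re z * Re w - Im z * Im w.
Proof. by case: z; case: w. Qed.
Lemma cImM z w : Im (z * w) = Re z * Im w + Im z * Re w.
Proof. by case: z; case: w. Qed.
Lemma complex_ext z w : Re z = Re w -> Im z = Im w -> z = w.
Proof. by case: z w => a b [c d] /= -> ->. Qed.
Lemma cn_le0 z : (forall e : R, 0 < e -> cn z <= e) -> z = 0.
Proof.
move=> H; apply: cn_eq0; apply/eqP; rewrite eq_le cn_ge0 andbT.
by apply/ler_addgt0Pr => e /H; rewrite add0r.
Qed.
End Modulus.

Section Sums.
Variable R : realType.
Local Notation C := R[i].

(** Limit along the net of finite subsets of [I], a finite subset being a duplicate-free list; no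
    order of summation enters. *)
Definition hassum (I : eqType) (f : I -> C) (a : C) :=
  forall e : R, 0 < e -> exists s0 : seq I, forall s, uniq s ->
    {subset s0 <= s} -> cn (\sum_(i <- s) f i - a) <= e.

Definition rbsum (I : eqType) (h : I -> R) :=
  exists M : R, forall s, uniq s -> \sum_(i <- s) h i <= M.

Definition bsum (I : eqType) (f : I -> C) := rbsum (fun i => cn (f i)).

Lemma subset_sum_le (I : eqType) (h : I -> R) (s t : seq I) :
  (forall i, 0 <= h i) -> uniq s -> uniq t -> {subset s <= t} ->
  \sum_(i <- s) h i <= \sum_(i <- t) h i.
Proof.
move=> h0 us ut st.
rewrite [X in _ <= X](bigID (mem s) predT) /= -[X in X <= _]addr0 lerD ?sumr_ge0//.
rewrite -[X in _ <= X]big_filter (perm_big (filter (mem s) t))//.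
apply: uniq_perm; rewrite ?filter_uniq// => x.
by rewrite mem_filter /=; case xs: (x \in s) => //=; rewrite (st _ xs).
Qed.

Lemma rbsum_sup (I : eqType) (h : I -> R) : (forall i, 0 <= h i) -> rbsum h ->
  exists S : R, (forall s, uniq s -> \sum_(i <- s) h i <= S) /\
   (forall e, 0 < e -> exists s0, uniq s0 /\
     forall s, uniq s -> {subset s0 <= s} -> S - e <= \sum_(i <- s) h i).
Proof.
move=> h0 [M HM].
pose A : set R := [set x | exists s, uniq s /\ x = \sum_(i <- s) h i]%classic.
have hsA : has_sup A.
  split; first by exists 0, [::]; rewrite big_nil.
  by exists M => x [s [us ->]]; exact: HM.
exists (sup A); split.
  by move=> s us; apply: ub_le_sup; [exact: hsA.2|exists s].
move=> e e0; have [x [s [us ->]] Hx] := @sup_adherent R A e e0 hsA.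
exists s; split=> // t ut st; apply: (le_trans (ltW Hx)).
exact: subset_sum_le.
Qed.

Lemma hassum_unique (I : eqType) (f : I -> C) a b : hassum f a -> hassum f b -> a = b.
Proof.
move=> ha hb; apply/eqP; rewrite -subr_eq0; apply/eqP; apply: cn_le0 => e e0.
have e2 : 0 < e / 2 by rewrite divr_gt0.
have [s Hs] := ha _ e2; have [t Ht] := hb _ e2.
pose r := undup (s ++ t).
have Hs1 : {subset s <= r} by move=> x xs; rewrite mem_undup mem_cat xs.
have Ht1 : {subset t <= r} by move=> x xs; rewrite mem_undup mem_cat xs orbT.
have := Hs r (undup_uniq _) Hs1; have := Ht r (undup_uniq _) Ht1.
set z := \sum_(i <- r) _ => h1 h2.
have -> : a - b = (z - b) - (z - a) by ring.
by apply: (le_trans (cnB _ _)); lra.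
Qed.

Lemma hassum_ext (I : eqType) (f g : I -> C) a : f =1 g -> hassum f a -> hassum g a.
Proof.
move=> fg ha e /ha [s Hs]; exists s => t ut st.
by rewrite -(eq_bigr _ (fun i _ => fg i)); exact: Hs.
Qed.

Lemma hassumD (I : eqType) (f g : I -> C) a b : hassum f a -> hassum g b ->
  hassum (fun i => f i + g i) (a + b).
Proof.
move=> ha hb e e0.
have e2 : 0 < e / 2 by rewrite divr_gt0.
have [s Hs] := ha _ e2; have [t Ht] := hb _ e2.
exists (s ++ t) => r ur str.
have Hs1 : {subset s <= r} by move=> x xs; apply: str; rewrite mem_cat xs.
have Ht1 : {subset t <= r} by move=> x xs; apply: str; rewrite mem_cat xs orbT.
have h1 := Hs r ur Hs1; have h2 := Ht r ur Ht1.
rewrite big_split /= opprD addrACA.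
by apply: (le_trans (cnD _ _)); lra.
Qed.

Lemma hassumZ (I : eqType) (f : I -> C) a c : hassum f a ->
  hassum (fun i => c * f i) (c * a).
Proof.
move=> ha e e0.
have k0 : 0 < cn c + 1 by rewrite ltr_wpDl ?cn_ge0.
have [s Hs] := ha _ (divr_gt0 e0 k0).
exists s => t ut st; rewrite -mulr_sumr -mulrBr cnM.
have := Hs t ut st; rewrite ler_pdivlMr// => h.
apply: le_trans h; rewrite mulrC ler_wpM2l ?cn_ge0//; lra.
Qed.

Lemma hassumN (I : eqType) (f : I -> C) a : hassum f a -> hassum (fun i => - f i) (- a).
Proof.
move=> /(hassumZ (-1)); rewrite mulN1r; apply: hassum_ext => i; exact: mulN1r.
Qed.

Lemma hassumB (I : eqType) (f g : I -> C) a b : hassum f a -> hassum g b ->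
  hassum (fun i => f i - g i) (a - b).
Proof. by move=> ha /hassumN hb; exact: hassumD. Qed.

Lemma hassum0 (I : eqType) : hassum (fun _ : I => 0) 0.
Proof. by move=> e e0; exists [::] => s _ _; rewrite big1// subrr cn0 ltW. Qed.

Lemma hassum_sum (I : eqType) (J : Type) (s : seq J) (f : J -> I -> C) (a : J -> C) :
  (forall j, hassum (f j) (a j)) ->
  hassum (fun i => \sum_(j <- s) f j i) (\sum_(j <- s) a j).
Proof.
move=> H; elim: s => [|j s IH].
  by rewrite big_nil; apply: hassum_ext (@hassum0 I) => i; rewrite big_nil.
rewrite big_cons; apply: hassum_ext (hassumD (H j) IH) => i.
by rewrite big_cons.
Qed.

Lemma hassum_le (I : eqType) (f : I -> C) a (M : R) : hassum f a ->
  (forall s, uniq s -> \sum_(i <- s) cn (f i) <= M) -> cn a <= M.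
Proof.
move=> ha HM; apply/ler_addgt0Pr => e e0.
have [s Hs] := ha _ e0.
have h : cn (\sum_(i <- undup s) f i - a) <= e.
  by apply: Hs; [exact: undup_uniq|move=> x; rewrite mem_undup].
have h2 := HM _ (undup_uniq s).
have h3 := cn_sum (undup s) predT f.
have -> : a = \sum_(i <- undup s) f i - (\sum_(i <- undup s) f i - a) by ring.
by apply: (le_trans (cnB _ _)); lra.
Qed.

Lemma rbsum_le (I : eqType) (h k : I -> R) : (forall i, h i <= k i) -> rbsum k -> rbsum h.
Proof.
move=> hk [M HM]; exists M => s us; apply: le_trans (HM s us).
exact: ler_sum.
Qed.

Lemma rbsumZ (I : eqType) (h : I -> R) c : 0 <= c -> rbsum h -> rbsum (fun i => c * h i).
Proof.
by move=> c0 [M HM]; exists (c * M) => s us; rewrite -mulr_sumr ler_wpM2l ?HM.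
Qed.

Lemma rbsumD (I : eqType) (h k : I -> R) : rbsum h -> rbsum k -> rbsum (fun i => h i + k i).
Proof.
by move=> [M HM] [N HN]; exists (M + N) => s us; rewrite big_split lerD ?HM ?HN.
Qed.

Lemma rbsum_inj (I J : eqType) (h : I -> R) (g : J -> I) : injective g ->
  rbsum h -> rbsum (fun j => h (g j)).
Proof.
move=> gi [M HM]; exists M => s us.
rewrite -(big_map g predT h); apply: HM; by rewrite map_inj_uniq.
Qed.

Lemma hassum_bij (I J : eqType) (f : I -> C) (g : J -> I) (g' : I -> J) a :
  cancel g g' -> cancel g' g -> hassum f a -> hassum (fun j => f (g j)) a.
Proof.
move=> gK g'K ha e e0; have [s Hs] := ha _ e0.
exists (map g' s) => t ut st.
rewrite -(big_map g predT f); apply: Hs.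
  by rewrite map_inj_uniq//; exact: can_inj gK.
move=> x xs; rewrite -(g'K x); apply: map_f; apply: st; exact: map_f.
Qed.

(** Real and imaginary parts are split into positive and negative parts, and each of the four
    families converges to the supremum of its finite sums. *)
Lemma bsum_hassum (I : eqType) (f : I -> C) : bsum f -> exists a, hassum f a.
Proof.
move=> bf.
have pos (g : I -> R) : (forall i, `|g i| <= cn (f i)) ->
    exists S, forall e, 0 < e -> exists s0 : seq I, forall s, uniq s ->
    {subset s0 <= s} -> `|\sum_(i <- s) g i - S| <= e.
  move=> gf.
  (* [sg] will be 1 or -1, so that positive and negative parts are treated at once. *)
  have g1 (sg : R) : `|sg| = 1 -> exists S, forall e, 0 < e -> exists s0 : seq I, forall s, uniq s ->
    {subset s0 <= s} -> `|\sum_(i <- s) Num.max (sg * g i) 0 - S| <= e.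
    move=> sg1.
    have h0 i : 0 <= Num.max (sg * g i) 0 by rewrite le_max lexx orbT.
    have [|S [S1 S2]] := @rbsum_sup I (fun i => Num.max (sg * g i) 0) h0.
      apply: rbsum_le bf => i; rewrite ge_max cn_ge0 andbT.
      by apply: le_trans (gf i); rewrite -[X in _ <= X]mul1r -sg1 -normrM ler_norm.
    exists S => e e0; have [s0 [us0 Hs0]] := S2 _ e0.
    exists s0 => s us ss; have := Hs0 s us ss; have := S1 s us.
    by rewrite ler_norml => h1 h2; apply/andP; split; lra.
  have [|S1 H1] := g1 1; first by rewrite normr1.
  have [|S2 H2] := g1 (-1); first by rewrite normrN1.
  exists (S1 - S2) => e e0.
  have e2 : 0 < e / 2 by rewrite divr_gt0.
  have [s Hs] := H1 _ e2; have [t Ht] := H2 _ e2.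
  exists (s ++ t) => r ur str.
  have h1 : {subset s <= r} by move=> x xs; apply: str; rewrite mem_cat xs.
  have h2 : {subset t <= r} by move=> x xs; apply: str; rewrite mem_cat xs orbT.
  have -> : \sum_(i <- r) g i = \sum_(i <- r) Num.max (1 * g i) 0 - \sum_(i <- r) Num.max (-1 * g i) 0.
    rewrite -sumrB; apply: eq_bigr => i _; rewrite mul1r mulN1r.
    by rewrite !maxEle; case: ifP; case: ifP => *; lra.
  rewrite opprD opprK addrACA; apply: (le_trans (ler_normD _ _)).
  rewrite [X in _ <= X](_ : e = e / 2 + e / 2); last by field.
  apply: lerD; first exact: Hs.
  by rewrite -normrN opprD !opprK; exact: Ht.
have [|A HA] := pos (fun i => Re (f i)); first by move=> i; exact: Re_le_cn.
have [|B HB] := pos (fun i => Im (f i)); first by move=> i; exact: Im_le_cn.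
exists (A +i* B)%C => e e0.
have e2 : 0 < e / 2 by rewrite divr_gt0.
have [s Hs] := HA _ e2; have [t Ht] := HB _ e2.
exists (s ++ t) => r ur str.
have h1 : `|\sum_(i <- r) Re (f i) - A| <= e / 2.
  by apply: Hs => // x xs; apply: str; rewrite mem_cat xs.
have h2 : `|\sum_(i <- r) Im (f i) - B| <= e / 2.
  by apply: Ht => // x xs; apply: str; rewrite mem_cat xs orbT.
have RS : Re (\sum_(i <- r) f i) = \sum_(i <- r) Re (f i).
  by apply: (big_morph _ (@cReD R)).
have IS : Im (\sum_(i <- r) f i) = \sum_(i <- r) Im (f i).
  by apply: (big_morph _ (@cImD R)).
apply: (le_trans (cn_le_ReIm _)); rewrite cReD cImD cReN cImN RS IS /=; lra.
Qed.

(** A total function: families without a sum get the value 0. *)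
Definition tsum (I : eqType) (f : I -> C) : C :=
  if pselect (exists a, hassum f a) is left h then sval (cid h) else 0.

Lemma tsumP (I : eqType) (f : I -> C) a : hassum f a -> tsum f = a.
Proof.
move=> ha; rewrite /tsum; case: pselect => [h|[]]; last by exists a.
by case: (cid h) => b /= hb; exact: hassum_unique hb ha.
Qed.

Lemma bsumP (I : eqType) (f : I -> C) : bsum f -> hassum f (tsum f).
Proof. by move=> /bsum_hassum [a ha]; rewrite (tsumP ha). Qed.

Lemma eq_tsum (I : eqType) (f g : I -> C) : f =1 g -> tsum f = tsum g.
Proof. by move=> /funext ->. Qed.

(** Each of the finitely many rows met is cut off with error e/2 divided by their number, along
    lists large enough for [big] to contain the list that approximates the total. *)
Lemma hassum_prod (I J : eqType) (F : I * J -> C) (g : I -> C) a :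
  hassum F a -> (forall i, hassum (fun j => F (i, j)) (g i)) -> hassum g a.
Proof.
move=> hF hg e e0.
have e2 : 0 < e / 2 by rewrite divr_gt0.
have [s0 Hs0] := hF _ e2.
exists (map fst s0) => s us ss.
pose k : R := (size s).+1%:R.
have k0 : 0 < k by rewrite ltr0n.
have ek : 0 < e / 2 / k by rewrite divr_gt0.
have [T HT] := boolp.choice (fun i => hg i _ ek).
pose T' i := undup (T i ++ map snd s0).
pose big := [seq (i, j) | i <- s, j <- T' i].
have ub : uniq big.
  by apply: allpairs_uniq_dep => //= [i _|]; [exact: undup_uniq|move=> [x1 x2] [y1 y2] _ _ [-> ->]].
have l1_bounded : {subset s0 <= big}.
  move=> [i j] ij; apply/allpairsPdep; exists i, j; split=> //.
    by apply: ss; apply/mapP; exists (i, j).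
  by rewrite mem_undup mem_cat; apply/orP; right; apply/mapP; exists (i, j).
have h1 := Hs0 _ ub l1_bounded.
have h2 : cn (\sum_(i <- s) (g i - \sum_(j <- T' i) F (i, j))) <= e / 2.
  apply: (le_trans (cn_sum _ _ _)).
  have : \sum_(i <- s) cn (g i - \sum_(j <- T' i) F (i, j)) <= \sum_(i <- s) (e / 2 / k).
    apply: ler_sum => i _; rewrite cn_distC; apply: HT; first exact: undup_uniq.
    by move=> x xT; rewrite mem_undup mem_cat xT.
  move=> h; apply: (le_trans h); rewrite big_const_seq count_predT iter_addr_0.
  rewrite -[X in X <= _]mulr_natl mulrCA -[X in _ <= X]mulr1 ler_wpM2l ?(ltW e2)//.
  by rewrite ler_pdivrMr// mul1r ler_nat.
rewrite sumrB in h2.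
have E : \sum_(ij <- big) F ij = \sum_(i <- s) \sum_(j <- T' i) F (i, j).
  by rewrite big_allpairs_dep.
have -> : \sum_(i <- s) g i - a = (\sum_(i <- s) g i - \sum_(i <- s) \sum_(j <- T' i) F (i, j))
   + (\sum_(ij <- big) F ij - a) by rewrite E; ring.
apply: (le_trans (cnD _ _)).
by rewrite [X in _ <= X](_ : e = e / 2 + e / 2); [exact: lerD|field].
Qed.

Lemma rbsum_prod (I J : eqType) (h : I * J -> R) (k : I -> R) :
  (forall p, 0 <= h p) ->
  (forall i t, uniq t -> \sum_(j <- t) h (i, j) <= k i) -> rbsum k -> rbsum h.
Proof.
move=> h0 hk [M HM]; exists M => s us.
pose A := undup (map fst s); pose B := undup (map snd s).
pose big := [seq (i, j) | i <- A, j <- B].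
have ub : uniq big.
  by apply: allpairs_uniq; rewrite ?undup_uniq// => [[x1 x2] [y1 y2] _ _ [-> ->]].
apply: (@le_trans _ _ (\sum_(p <- big) h p)).
  apply: subset_sum_le => // -[i j] ij; apply/allpairsP; exists (i, j) => /=.
  by split=> //; rewrite mem_undup; apply/mapP; exists (i, j).
rewrite big_allpairs_dep; apply: le_trans (HM A (undup_uniq _)).
by apply: ler_sum => i _; apply: hk; exact: undup_uniq.
Qed.

Lemma bsum_prodM (I J : eqType) (f : I -> R) (g : J -> R) :
  (forall i, 0 <= f i) -> (forall j, 0 <= g j) ->
  rbsum f -> rbsum g -> rbsum (fun p : I * J => f p.1 * g p.2).
Proof.
move=> f0 g0 bf [M HM].
apply: (@rbsum_prod _ _ _ (fun i => f i * M)) => [p|i t ut|] /=.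
- exact: mulr_ge0.
- by rewrite -mulr_sumr ler_wpM2l ?HM.
- have M0 : 0 <= M by have := HM [::] isT; rewrite big_nil.
  by apply: rbsum_le (rbsumZ M0 bf) => i; rewrite mulrC.
Qed.

Lemma hassum_swap (I J : eqType) (F : I * J -> C) a :
  hassum F a -> hassum (fun p : J * I => F (p.2, p.1)) a.
Proof.
apply: (@hassum_bij _ _ _ (fun p : J * I => (p.2, p.1)) (fun p : I * J => (p.2, p.1))).
  by case.
by case.
Qed.

Lemma hassum_fin (I : eqType) (f : I -> C) (s : seq I) : uniq s ->
  (forall i, i \notin s -> f i = 0) -> hassum f (\sum_(i <- s) f i).
Proof.
move=> us f0 e e0; exists s => t ut st.
rewrite [X in cn (X - _)](bigID (mem s)) /= [X in cn (_ + X - _)]big1 => [|i /f0 //].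
rewrite addr0 -big_filter (perm_big s) ?subrr ?cn0 ?ltW//.
apply: uniq_perm; rewrite ?filter_uniq// => x.
by rewrite mem_filter /=; case xs: (x \in s) => //=; rewrite (st _ xs).
Qed.

Lemma rbsum_tail (I : eqType) (h : I -> R) : (forall i, 0 <= h i) -> rbsum h ->
  forall e, 0 < e -> exists s0 : seq I, forall s, uniq s -> (forall i, i \in s -> i \notin s0) ->
  \sum_(i <- s) h i <= e.
Proof.
move=> h0 /(rbsum_sup h0) [S [S1 S2]] e e0.
have [s0 [us0 Hs0]] := S2 _ e0.
exists s0 => s us dis.
have u : uniq (s0 ++ s).
  rewrite cat_uniq us0 us andbT /=; apply/hasPn => x /dis.
  by [].
have := S1 _ u; rewrite big_cat /=; have := Hs0 s0 us0 (fun x => id).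
by move=> *; lra.
Qed.

End Sums.

(** * Reindexing, fibres and Cauchy products of unordered sums *)

Section MoreSums.
Variable R : realType.
Local Notation C := R[i].

(** The partial inverse [g'] marks the image of [g], outside which [f] vanishes, and pulls finite
    lists of indices back through [pmap]. *)
Lemma hassum_extend (I J : eqType) (f : I -> C) (g : J -> I) (g' : I -> option J) a :
  (forall j, g' (g j) = Some j) -> (forall i j, g' i = Some j -> g j = i) ->
  (forall i, g' i = None -> f i = 0) -> hassum (fun j => f (g j)) a -> hassum f a.
Proof.
move=> g'g gg' f0 ha e e0; have [s0 H0] := ha _ e0.
exists (map g s0) => s us ss.
have gi : injective g by move=> x y E; apply: Some_inj; rewrite -!g'g E.
have E : \sum_(i <- s) f i = \sum_(j <- pmap g' s) f (g j).
  elim: s {us ss} => [|i s IH]; first by rewrite !big_nil.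
  rewrite big_cons /=; case E: (g' i) => [j|] /=.
    by rewrite big_cons IH (gg' _ _ E).
  by rewrite f0// add0r.
rewrite E; apply: H0.
  apply: (@map_uniq _ _ g).
  rewrite (_ : map g (pmap g' s) = [seq i <- s | isSome (g' i)]) ?filter_uniq//.
  elim: s {us ss E} => [|i s IH] //=; case E: (g' i) => [j|] //=.
  by rewrite IH (gg' _ _ E).
move=> j js; rewrite mem_pmap; apply/mapP; exists (g j); last by rewrite g'g.
by apply: ss; apply: map_f.
Qed.

Lemma hassumM (I J : eqType) (f : I -> C) (g : J -> C) a b :
  bsum f -> bsum g -> hassum f a -> hassum g b ->
  hassum (fun p : I * J => f p.1 * g p.2) (a * b).
Proof.
move=> bf bg ha hb.
have bfg : bsum (fun p : I * J => f p.1 * g p.2).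
  apply: rbsum_le (bsum_prodM _ _ bf bg) => [p|i|j]; rewrite ?cn_ge0//.
  by rewrite cnM.
have [T hT] := bsum_hassum bfg.
have h1 : hassum (fun i => f i * b) T.
  by apply: (hassum_prod hT) => i /=; exact: hassumZ.
suff -> : a * b = T by [].
have h2 := hassumZ b ha; rewrite mulrC.
by apply: hassum_unique h2 _; apply: hassum_ext h1 => i; exact: mulrC.
Qed.

(** The family is spread over the graph of [g] inside [I * J], where it can be summed by columns
    instead of rows. *)
Lemma hassum_fiber (I J : eqType) (f : I -> C) (g : I -> J) a : bsum f -> hassum f a ->
  hassum (fun j => tsum (fun i => if g i == j then f i else 0)) a.
Proof.
move=> bf ha.
pose F (p : I * J) := if g p.1 == p.2 then f p.1 else 0.
have hF : hassum F a.
  apply: (@hassum_extend _ I F (fun i => (i, g i))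
     (fun p => if g p.1 == p.2 then Some p.1 else None)) => /=.
  - by move=> j; rewrite eqxx.
  - by move=> [i j] k /=; case: eqP => // <- [->].
  - by move=> [i j] /=; rewrite /F /=; case: eqP.
  - by apply: hassum_ext ha => i; rewrite /F /= eqxx.
apply: (hassum_prod (hassum_swap hF)) => j; apply: bsumP.
apply: rbsum_le bf => i; rewrite /F /=; case: ifP => //; rewrite cn0 cn_ge0 //.
Qed.

Lemma hassum_nat_lim (f : nat -> C) a : hassum f a ->
  forall e, 0 < e -> exists N, forall n, (N <= n)%N -> cn (\sum_(0 <= k < n) f k - a) <= e.
Proof.
move=> ha e e0; have [s Hs] := ha _ e0.
exists (\max_(i <- s) i).+1 => n Nn; apply: Hs; first exact: iota_uniq.
move=> x xs; rewrite mem_index_iota /= (leq_trans _ Nn)// ltnS.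
exact: (@leq_bigmax_seq _ _ predT id).
Qed.

Lemma hassum_of_lim (f : nat -> C) a : bsum f ->
  (forall e, 0 < e -> exists N, forall n, (N <= n)%N -> cn (\sum_(0 <= k < n) f k - a) <= e) ->
  hassum f a.
Proof.
move=> bf H; suff -> : a = tsum f by exact: bsumP.
apply/eqP; rewrite -subr_eq0; apply/eqP; apply: cn_le0 => e e0.
have e2 : 0 < e / 2 by rewrite divr_gt0.
have [N1 H1] := H _ e2; have [N2 H2] := hassum_nat_lim (bsumP bf) e2.
have h1 := H1 _ (leq_maxl N1 N2); have h2 := H2 _ (leq_maxr N1 N2).
move: h1 h2; set S := \sum_(_ <= _ < _) _ => h1 h2.
rewrite (_ : _ - _ = (S - tsum f) - (S - a)); last by ring.
by apply: (le_trans (cnB _ _)); lra.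
Qed.

Lemma sum_ord_iota (V : nmodType) n (F : nat -> V) : \sum_(i < n) F i = \sum_(i <- iota 0 n) F i.
Proof. by rewrite -(big_mkord predT F) /index_iota subn0. Qed.

(** The pair (i, j) is moved to (i + j, i): the product family becomes a family on a triangle whose
    rows sum to the Cauchy coefficients. *)
Lemma hassum_cauchy (a b : nat -> C) A B : bsum a -> bsum b -> hassum a A -> hassum b B ->
  bsum (fun n => \sum_(i < n.+1) a i * b (n - i)%N) /\
  hassum (fun n => \sum_(i < n.+1) a i * b (n - i)%N) (A * B).
Proof.
move=> ba bb ha hb.
pose F (p : nat * nat) := if (p.2 <= p.1)%N then a p.2 * b (p.1 - p.2)%N else 0.
have hF : hassum F (A * B).
  apply: (@hassum_extend _ (nat * nat)%type F (fun p => (p.1 + p.2, p.1)%N)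
    (fun p => if (p.2 <= p.1)%N then Some (p.2, (p.1 - p.2)%N) else None)).
  - by move=> [i j] /=; rewrite leq_addr addKn.
  - by move=> [i j] [k l] /=; case: ifP => // ji [<- <-]; rewrite subnKC.
  - by move=> [i j]; rewrite /F /=; case: ifP.
  - apply: hassum_ext (hassumM ba bb ha hb) => -[i j].
    by rewrite /F /= leq_addr addKn.
have row n : hassum (fun j => F (n, j)) (\sum_(i < n.+1) a i * b (n - i)%N).
  have -> : \sum_(i < n.+1) a i * b (n - i)%N = \sum_(i <- iota 0 n.+1) F (n, i).
    rewrite -(sum_ord_iota n.+1 (fun i => F (n, i))); apply: eq_bigr => i _.
    by rewrite /F /= -ltnS ltn_ord.
  apply: hassum_fin; first exact: iota_uniq.
  by move=> i; rewrite mem_iota add0n ltnS /= /F /= => /negbTE ->.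
split; last exact: (hassum_prod hF row).
have bF : rbsum (fun p : nat * nat => cn (a p.1) * cn (b p.2)).
  by apply: (bsum_prodM _ _ ba bb) => i; exact: cn_ge0.
case: bF => M HM; exists M => s us.
pose big := [seq (i, (n - i)%N) | n <- s, i <- iota 0 n.+1].
apply: (@le_trans _ _ (\sum_(p <- big) cn (a p.1) * cn (b p.2))).
  rewrite big_allpairs_dep; apply: ler_sum => n _.
  apply: (le_trans (cn_sum _ _ _)).
  rewrite -(sum_ord_iota n.+1 (fun i => cn (a i) * cn (b (n - i)%N))).
  by apply: ler_sum => i _; rewrite cnM.
apply: HM; apply: allpairs_uniq_dep => // [n _|]; first exact: iota_uniq.
move=> _ _ /allpairsPdep [n [i [_ + ->]]] /allpairsPdep [m [j [_ + ->]]] /=.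
rewrite !mem_iota !add0n !ltnS /= => h1 h2 [E1 E2].
have -> : n = m by lia.
by have -> : i = j by lia.
Qed.

Lemma hassum_split_nat (f : nat -> C) a n : hassum f a ->
  hassum (fun k => f (k + n)%N) (a - \sum_(0 <= k < n) f k).
Proof.
move=> ha.
pose g k := if (k < n)%N then f k else 0.
have hg : hassum g (\sum_(0 <= k < n) f k).
  rewrite (_ : \sum_(_ <= _ < _) _ = \sum_(k <- index_iota 0 n) g k).
    apply: hassum_fin; first exact: iota_uniq.
    by move=> i; rewrite mem_index_iota /= /g; case: ifP.
  by apply: eq_big_nat => i /= ni; rewrite /g ni.
have h := hassumB ha hg.
apply: (@hassum_bij _ nat nat (fun k => f (k + n)%N) id id) => //.
move=> e e0; have [s0 H0] := h _ e0.
exists [seq (k - n)%N | k <- s0 & (n <= k)%N] => s us ss.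
have E : \sum_(i <- [seq (k + n)%N | k <- s] ++ iota 0 n) (f i - g i) = \sum_(k <- s) f (k + n)%N.
  rewrite big_cat big_map /= [X in _ + X]big_seq [X in _ + X]big1 ?addr0.
    by apply: eq_bigr => k _; rewrite /g ltnNge leq_addl subr0.
  by move=> i; rewrite mem_iota add0n /= /g => ->; rewrite subrr.
rewrite -E; apply: H0.
  rewrite cat_uniq iota_uniq map_inj_uniq ?us ?andbT /=; last by move=> x y; lia.
  by apply/hasPn => x; rewrite mem_iota /= add0n => xn; apply/mapP => -[k _]; lia.
move=> x xs; rewrite mem_cat mem_iota add0n /=.
case: (ltnP x n) => [xn|nx]; rewrite ?orbT// orbF; apply/mapP; exists (x - n)%N; last by lia.
by apply: ss; apply/mapP; exists x; rewrite // mem_filter nx.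
Qed.

End MoreSums.

(** * Real series of exp, cos and sin in epsilon form *)

Section RealSeries.
Import topology normedtype.
Import numFieldNormedType.Exports.
Local Open Scope classical_set_scope.
Variable R : realType.

Lemma cvg_eps (u : nat -> R) (l : R) : (u @ \oo --> l) ->
  forall e, 0 < e -> exists N, forall n, (N <= n)%N -> `|u n - l| <= e.
Proof.
move=> /cvgrPdist_le H e e0; have [N _ HN] := H e e0.
by exists N => n Nn; rewrite distrC; apply: HN.
Qed.

Lemma expR_lim (x : R) e : 0 < e -> exists N, forall n, (N <= n)%N ->
  `|\sum_(0 <= k < n) x ^+ k / k`!%:R - expR x| <= e.
Proof. by apply: cvg_eps; exact: (is_cvg_series_exp_coeff x). Qed.

Lemma cos_lim (x : R) e : 0 < e -> exists N, forall n, (N <= n)%N ->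
  `|\sum_(0 <= k < n) (~~ odd k)%:R * (-1) ^+ k./2 * x ^+ k / k`!%:R - cos x| <= e.
Proof.
have h : series (cos_coeff x) @ \oo --> cos x.
  by rewrite cos.unlock; exact: is_cvg_series_cos_coeff.
exact: (cvg_eps h).
Qed.

Lemma sin_lim (x : R) e : 0 < e -> exists N, forall n, (N <= n)%N ->
  `|\sum_(0 <= k < n) (odd k)%:R * (-1) ^+ k.-1./2 * x ^+ k / k`!%:R - sin x| <= e.
Proof.
have h : series (sin_coeff x) @ \oo --> sin x.
  by rewrite sin.unlock; exact: is_cvg_series_sin_coeff.
exact: (cvg_eps h).
Qed.

End RealSeries.

(** * The complex exponential *)

Section ComplexExponential.
Variable R : realType.
Local Notation C := R[i].
Implicit Types (z w : C) (x : R).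

(** Built from the real functions, so that the addition law is trigonometry; the power series is
    recovered in [hassum_exp]. *)
Definition cexp z : C := (expR (Re z))%:Co * Complex (cos (Im z)) (sin (Im z)).

Lemma cexpD z w : cexp (z + w) = cexp z * cexp w.
Proof.
rewrite /cexp cReD cImD expRD cosD sinD; apply: complex_ext; rewrite !(cReM, cImM) /=; ring.
Qed.

Lemma cexp0 : cexp 0 = 1.
Proof. by rewrite /cexp /= expR0 cos0 sin0 mul1r. Qed.

Lemma cn_cexp z : cn (cexp z) = expR (Re z).
Proof.
rewrite /cexp cnM cn_real ger0_norm ?expR_ge0//.
by rewrite /cn /= cos2Dsin2 sqrtr1 mulr1.
Qed.

Lemma cexp_neq0 z : cexp z != 0.
Proof. by rewrite -cn_gt0 cn_cexp expR_gt0. Qed.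

Lemma cexpN z : cexp (- z) = (cexp z)^-1.
Proof. by apply: (mulIf (cexp_neq0 z)); rewrite -cexpD addNr cexp0 mulVf ?cexp_neq0. Qed.

Lemma cexp_real x : cexp x%:Co = (expR x)%:Co.
Proof. by rewrite /cexp /= cos0 sin0 mulr1. Qed.

Lemma expR_partial x : 0 <= x -> forall s : seq nat, uniq s ->
  \sum_(k <- s) x ^+ k / k`!%:R <= expR x.
Proof.
move=> x0 s us; apply/ler_addgt0Pr => e e0.
have [N HN] := expR_lim x e0.
have := HN _ (leq_maxl N (\max_(i <- s) i).+1).
set n := maxn _ _ => h.
have h2 : \sum_(k <- s) x ^+ k / k`!%:R <= \sum_(0 <= k < n) x ^+ k / k`!%:R.
  apply: subset_sum_le => //; first by move=> i; rewrite divr_ge0 ?exprn_ge0.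
    exact: iota_uniq.
  move=> i is_; rewrite mem_index_iota /= /n (leq_trans _ (leq_maxr _ _))// ltnS.
  exact: (@leq_bigmax_seq _ _ predT id).
by apply: (le_trans h2); move: h; rewrite ler_norml => /andP[_]; rewrite lerBlDl.
Qed.

Lemma cn_expc z k : cn (z ^+ k / k`!%:R) = cn z ^+ k / k`!%:R.
Proof. by rewrite cnM cnX cnV cn_nat. Qed.

Lemma bsum_expc z : bsum (fun k => z ^+ k / k`!%:R).
Proof.
exists (expR (cn z)) => s us.
under eq_bigr do rewrite cn_expc.
by apply: expR_partial; rewrite ?cn_ge0.
Qed.

Lemma hassum_exp_real x : hassum (fun k => x%:Co ^+ k / k`!%:R) (cexp x%:Co).
Proof.
apply: hassum_of_lim; first exact: bsum_expc.
move=> e e0; have [N HN] := expR_lim x e0; exists N => n Nn.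
rewrite cexp_real (_ : \sum_(_ <= _ < _) _ = (\sum_(0 <= k < n) x ^+ k / k`!%:R)%:Co).
  by rewrite -rmorphB cn_real HN.
rewrite rmorph_sum; apply: eq_bigr => k _.
by rewrite rmorphM rmorphXn fmorphV rmorph_nat.
Qed.

Lemma hassum_exp_imag x : hassum (fun k => (Complex 0 x) ^+ k / k`!%:R) (cexp (Complex 0 x)).
Proof.
apply: hassum_of_lim; first exact: bsum_expc.
move=> e e0; have e2 : 0 < e / 2 by rewrite divr_gt0.
have [N HN] := cos_lim x e2; have [M HM] := sin_lim x e2.
exists (maxn N M) => n Nn.
have h1 := HN n (leq_trans (leq_maxl _ _) Nn); have h2 := HM n (leq_trans (leq_maxr _ _) Nn).
have term k : (Complex 0 x) ^+ k / k`!%:R = Complex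
   ((~~ odd k)%:R * (-1) ^+ k./2 * x ^+ k / k`!%:R) ((odd k)%:R * (-1) ^+ k.-1./2 * x ^+ k / k`!%:R) :> C.
  have i2 : (Complex 0 x : C) ^+ 2 = (- x ^+ 2)%:Co by apply: complex_ext; rewrite expr2 !(cReM, cImM) /=; ring.
  have E : (Complex 0 x : C) ^+ k = Complex ((~~ odd k)%:R * (-1) ^+ k./2 * x ^+ k)
       ((odd k)%:R * (-1) ^+ k.-1./2 * x ^+ k).
    rewrite -[k in LHS]odd_double_half -mul2n exprD exprM i2 -rmorphXn /=.
    have Ex : x ^+ k = x ^+ (odd k) * (x ^+ 2) ^+ k./2.
      by rewrite -exprM -exprD mul2n odd_double_half.
    have EN : (- x ^+ 2) ^+ k./2 = (-1) ^+ k./2 * (x ^+ 2) ^+ k./2.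
      by rewrite -[- x ^+ 2]mulN1r exprMn.
    rewrite EN Ex {EN Ex}; set X := (x ^+ 2) ^+ _; set S := (-1) ^+ _.
    case ok: (odd k).
      have -> : k.-1./2 = k./2 by rewrite -[k in k.-1]odd_double_half ok /= doubleK.
      rewrite -/S.
      have -> : nat_of_bool (~~ true) = 0%N by [].
      have e1t : nat_of_bool true = 1%N by [].
      by rewrite e1t !expr1 mulr1n mulr0n; apply: complex_ext; rewrite !(cReM, cImM) /=; ring.
    have -> : nat_of_bool (~~ false) = 1%N by [].
    have e1f : nat_of_bool false = 0%N by [].
    by rewrite e1f !expr0 mulr1n mulr0n; apply: complex_ext; rewrite !(cReM, cImM) /=; ring.
  rewrite E (_ : (k`!%:R : C)^-1 = (k`!%:R^-1)%:Co); last by rewrite fmorphV rmorph_nat.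
  by apply: complex_ext; rewrite !(cReM, cImM) /=; ring.
apply: (le_trans (cn_le_ReIm _)); rewrite cReD cImD cReN cImN.
have -> : Re (\sum_(0 <= k < n) (Complex 0 x) ^+ k / k`!%:R) =
  \sum_(0 <= k < n) (~~ odd k)%:R * (-1) ^+ k./2 * x ^+ k / k`!%:R.
  by rewrite (big_morph _ (@cReD R) (erefl : Re (0:C) = 0)); apply: eq_bigr => k _; rewrite term.
have -> : Im (\sum_(0 <= k < n) (Complex 0 x) ^+ k / k`!%:R) =
  \sum_(0 <= k < n) (odd k)%:R * (-1) ^+ k.-1./2 * x ^+ k / k`!%:R.
  by rewrite (big_morph _ (@cImD R) (erefl : Im (0:C) = 0)); apply: eq_bigr => k _; rewrite term.
have -> : Re (cexp (Complex 0 x)) = cos x by rewrite /cexp cReM /= expR0; ring.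
have -> : Im (cexp (Complex 0 x)) = sin x by rewrite /cexp cImM /= expR0; ring.
lra.
Qed.

(** By the binomial theorem the series at a + i b is the Cauchy product of the series at a and at i
    b. *)
Lemma hassum_exp z : hassum (fun k => z ^+ k / k`!%:R) (cexp z).
Proof.
case: z => a b; have -> : Complex a b = a%:Co + Complex 0 b by apply: complex_ext; rewrite /= ?addr0 ?add0r.
rewrite cexpD mulrC.
have [_ h] := hassum_cauchy (bsum_expc (Complex 0 b)) (bsum_expc a%:Co) (hassum_exp_imag b) (hassum_exp_real a).
apply: hassum_ext h => n; rewrite exprDn mulr_suml; apply: eq_bigr => i _.
have lein : (i <= n)%N by rewrite -ltnS.
have f0 k : (k`!%:R : C) != 0 by rewrite pnatr_eq0 -lt0n fact_gt0.
have E : (n`!%:R : C) = 'C(n, i)%:R * i`!%:R * (n - i)`!%:R.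
  by rewrite -!natrM -(bin_fact lein) mulnA.
have b0 : ('C(n, i)%:R : C) != 0 by rewrite pnatr_eq0 -lt0n bin_gt0.
have key (X Y F1 F2 : C) k : k%:R != 0 :> C -> F1 != 0 -> F2 != 0 ->
    Y / F1 * (X / F2) = (X * Y *+ k) / (k%:R * F1 * F2).
  by move=> *; rewrite -[X * Y *+ k]mulr_natr; field; apply/and3P.
by rewrite E; apply: key.
Qed.

Lemma cexp_bound1 z : cn (cexp z - 1) <= cn z * expR (cn z).
Proof.
have := hassum_split_nat 1 (hassum_exp z).
rewrite big_nat1 expr0 invr1 mul1r => h.
apply: (hassum_le h) => s us.
have := expR_partial (cn_ge0 z) us; have z0 := cn_ge0 z => H.
apply: le_trans (ler_wpM2l z0 H); rewrite mulr_sumr; apply: ler_sum => k _.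
rewrite cn_expc addn1 exprS -mulrA ler_wpM2l//.
rewrite ler_wpM2l ?exprn_ge0// lef_pV2 ?posrE ?ltr0n ?fact_gt0//.
by rewrite ler_nat factS leq_pmull.
Qed.

Lemma cexp_bound2 z : cn (cexp z - 1 - z) <= cn z ^+ 2 * expR (cn z).
Proof.
have := hassum_split_nat 2 (hassum_exp z).
rewrite unlock /= expr0 expr1 !invr1 !mulr1 addr0 opprD addrA => h.
apply: (hassum_le h) => s us.
have := expR_partial (cn_ge0 z) us; have z0 := cn_ge0 z => H.
apply: le_trans (ler_wpM2l (exprn_ge0 2 z0) H); rewrite mulr_sumr; apply: ler_sum => k _.
rewrite cn_expc exprD [_ ^+ k * _]mulrC -mulrA ler_wpM2l ?exprn_ge0//.
rewrite ler_wpM2l ?exprn_ge0// lef_pV2 ?posrE ?ltr0n ?fact_gt0//.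
rewrite ler_nat addn2 !factS mulnA; apply: leq_pmull; by rewrite muln_gt0.
Qed.

Definition ip (x : R) : C := Complex 0 (2 * pi * x).

Definition e1 (x : R) : C := cexp (ip x).

Lemma ipD x y : ip (x + y) = ip x + ip y.
Proof. by apply: complex_ext; rewrite /= ?addr0// mulrDr. Qed.
Lemma e1D x y : e1 (x + y) = e1 x * e1 y.
Proof. by rewrite /e1 ipD cexpD. Qed.
Lemma e10 : e1 0 = 1.
Proof. by rewrite /e1 /ip mulr0 cexp0. Qed.
Lemma cn_e1 x : cn (e1 x) = 1.
Proof. by rewrite /e1 cn_cexp /= expR0. Qed.
Lemma e11 : e1 1 = 1.
Proof.
rewrite /e1 /ip /cexp /= expR0 mul1r mulr1.
by apply: complex_ext; rewrite /= mulr_natl ?cos2pi ?sin2pi.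
Qed.
Lemma e1N x : e1 (- x) = (e1 x)^-1.
Proof.
have h : e1 x != 0 by exact: cexp_neq0.
by apply: (mulIf h); rewrite -e1D addNr e10 mulVf.
Qed.
Lemma e1_mulrn x n : e1 (x *+ n) = e1 x ^+ n.
Proof. by elim: n => [|n IH]; rewrite ?mulr0n ?e10// mulrS e1D IH exprS. Qed.
Lemma e1_nat n : e1 n%:R = 1.
Proof. by rewrite e1_mulrn e11 expr1n. Qed.
Lemma e1_int (m : int) : e1 m%:~R = 1.
Proof.
case: m => n; rewrite ?NegzE; first by rewrite -pmulrn e1_nat.
by rewrite mulrNz e1N -pmulrn e1_nat invr1.
Qed.

Lemma e1_half : e1 2^-1 = -1.
Proof.
rewrite /e1 /ip /cexp /= expR0 mul1r (_ : 2 * pi * 2^-1 = pi); last by field.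
by rewrite cospi sinpi; apply: complex_ext; rewrite /= ?oppr0.
Qed.

(** On this range cos(2 pi x) <= 0, so the real part of the difference is at most -1. *)
Lemma e1_chord_far x : 4^-1 <= `|x| <= 2^-1 -> 1 <= cn (e1 x - 1).
Proof.
move=> /andP[x1 x2].
have p0 : 0 < pi :> R by exact: pi_gt0.
have c0 : cos (2 * pi * x) <= 0.
  rewrite -cos_norm normrM (ger0_norm (_ : 0 <= 2 * pi)); last by lra.
  rewrite (_ : 2 * pi * `|x| = (2 * pi * `|x| - pi / 2) + pi / 2); last by ring.
  rewrite cosDpihalf oppr_le0; apply: sin_ge0_pi; apply/andP; split.
    have : 2 * pi * 4^-1 <= 2 * pi * `|x| by rewrite ler_wpM2l; lra.
    lra.
  have : 2 * pi * `|x| <= 2 * pi * 2^-1 by rewrite ler_wpM2l; lra.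
  lra.
apply: le_trans (Re_le_cn _); rewrite cReD cReN /e1 /cexp cReM /= expR0 mul0r subr0 mul1r.
rewrite ler0_norm; lra.
Qed.

(* Doubling: |e(2x) - 1| = |e(x) - 1| |e(x) + 1| <= 2 |e(x) - 1|. *)
Lemma e1_chord x : `|x| <= 2^-1 -> 2 * `|x| <= cn (e1 x - 1).
Proof.
move=> x2; have [->|x0] := eqVneq x 0; first by rewrite normr0 mulr0 cn_ge0.
have dbl y : cn (e1 (2 * y) - 1) <= 2 * cn (e1 y - 1).
  rewrite (_ : e1 (2 * y) - 1 = (e1 y + 1) * (e1 y - 1)); last first.
    by rewrite mulr_natl e1_mulrn; ring.
  rewrite cnM ler_wpM2r ?cn_ge0//; apply: (le_trans (cnD _ _)).
  by rewrite cn_e1 cn1; lra.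
suff H (j : nat) : forall y : R, 4^-1 / 2 ^+ j <= `|y| <= 2^-1 -> 2 * `|y| <= cn (e1 y - 1).
  have xp : 0 < `|x| by rewrite normr_gt0.
  apply: (H (Num.Def.truncn (`|x|^-1)).+1); rewrite x2 andbT.
  set k := (Num.truncn _).
  have h1 : `|x|^-1 < k.+1%:R by apply: truncnS_gt.
  have h2 : (k.+1%:R : R) <= 2 ^+ k.+1.
    by rewrite -natrX ler_nat ltnW// ltn_expl.
  have h3 : `|x|^-1 <= 2 ^+ k.+1 by apply: le_trans h2; exact: ltW.
  have p2 : 0 < (2 ^+ k.+1 : R) by rewrite exprn_gt0.
  rewrite ler_pdivrMr// -ler_pdivrMl// mulrC.
  apply: le_trans h3; rewrite ler_piMl ?invr_ge0//; lra.
elim: j => [|j IH] y /andP[y1 y2].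
  rewrite expr0 divr1 in y1.
  have := @e1_chord_far y; rewrite y1 y2 => /(_ isT); lra.
case: (lerP 4^-1 `|y|) => y3.
  have := @e1_chord_far y; rewrite y3 y2 => /(_ isT); lra.
have := IH (2 * y); rewrite normrM ger0_norm// => H.
have {}H : 2 * (2 * `|y|) <= cn (e1 (2 * y) - 1).
  apply: H; apply/andP; split; last by lra.
  have : 2 * (4^-1 / 2 ^+ j.+1) <= 2 * `|y| by rewrite ler_wpM2l.
  by rewrite (_ : 2 * (4^-1 / 2 ^+ j.+1) = 4^-1 / 2 ^+ j)// exprS; field; rewrite expf_neq0 ?pnatr_eq0.
have := dbl y; lra.
Qed.

Lemma e1_eq1 x : e1 x = 1 -> exists m : int, x = m%:~R.
Proof.
move=> h; pose k := Num.floor (x + 2^-1).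
have kx : k%:~R <= x + 2^-1 by apply: floor_le.
have xk : x + 2^-1 < (k + 1)%:~R by rewrite floorD1_gt.
exists k; pose d := x - k%:~R.
have d2 : `|d| <= 2^-1.
  by rewrite /d ler_norml; move: xk; rewrite intrD => xk; apply/andP; split; lra.
have hd : e1 d = 1 by rewrite /d e1D h e1N e1_int invr1 mul1r.
have := e1_chord d2; rewrite hd subrr cn0 => H.
have /eqP : `|d| = 0 by apply/eqP; rewrite eq_le normr_ge0 andbT; lra.
by rewrite normr_eq0 subr_eq0 => /eqP.
Qed.

End ComplexExponential.

(** * Poisson summation in one variable *)

Section IntSums.
Variable R : realType.

Lemma geometric_partial (r : R) (s : seq nat) : 0 <= r < 1 -> uniq s ->
  \sum_(n <- s) r ^+ n <= (1 - r)^-1.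
Proof.
move=> /andP[r0 r1] us.
set N := (\max_(i <- s) i).+1.
apply: (@le_trans _ _ (\sum_(n <- iota 0 N) r ^+ n)).
  apply: subset_sum_le => //; [by move=> i; exact: exprn_ge0|exact: iota_uniq|].
  move=> i si; rewrite mem_iota /= add0n /N ltnS.
  exact: (@leq_bigmax_seq _ _ predT id).
rewrite -[N]subn0 -/(index_iota 0 N) big_mkord.
have r1' : 0 < 1 - r by rewrite subr_gt0.
rewrite -[X in _ <= X]mul1r ler_pdivlMr// mulrC -opprB mulNr -subrX1 opprB.
by rewrite gerBl exprn_ge0.
Qed.

Lemma rbsum_int_of_nat (f : nat -> R) M : (forall n, 0 <= f n) ->
  (forall s : seq nat, uniq s -> \sum_(n <- s) f n <= M) ->
  forall s : seq int, uniq s -> \sum_(z <- s) f `|z|%N <= M + M.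
Proof.
move=> f0 HM s us; rewrite (bigID (fun z : int => 0 <= z)) /=.
apply: lerD.
  rewrite -big_filter -(big_map absz predT f); apply: HM.
  rewrite map_inj_in_uniq ?filter_uniq// => x y.
  rewrite !mem_filter => /andP[x0 _] /andP[y0 _] E; lia.
rewrite -big_filter -(big_map absz predT f); apply: HM.
rewrite map_inj_in_uniq ?filter_uniq// => x y.
rewrite !mem_filter => /andP[x0 _] /andP[y0 _] E; lia.
Qed.

Lemma expRN_le (c : R) : 0 < c -> (1 - expR (- c))^-1 <= 1 + c^-1.
Proof.
move=> c0; have h := expR_ge1Dx c.
have h1 : expR (- c) <= (1 + c)^-1.
  by rewrite expRN lef_pV2 ?posrE ?expR_gt0//; lra.
have h2 : 1 - (1 + c)^-1 <= 1 - expR (- c) by lra.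
have h3 : 1 - (1 + c)^-1 = c / (1 + c) by field; lra.
have h4 : 0 < c / (1 + c) by rewrite divr_gt0//; lra.
have -> : 1 + c^-1 = (c / (1 + c))^-1 by field; apply/andP; split; lra.
by rewrite lef_pV2 ?posrE//; lra.
Qed.

Lemma absz_intr (z : int) : (`|z|%N%:R : R) = `|z%:~R|.
Proof. by rewrite -intr_norm -abszE pmulrn. Qed.

Lemma geometric_int (c : R) (s : seq int) : 0 < c -> uniq s ->
  \sum_(z <- s) expR (- (c * `|z%:~R|)) <= 2 * (1 + c^-1).
Proof.
move=> c0 us; pose f n := expR (- c) ^+ n.
rewrite mulr_natl mulr2n.
have -> : \sum_(z <- s) expR (- (c * `|z%:~R|)) = \sum_(z <- s) f `|z|%N.
  apply: eq_bigr => z _; rewrite /f -expRM_natr; congr expR.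
  by rewrite absz_intr; ring.
apply: rbsum_int_of_nat => // [n|t ut]; first by rewrite exprn_ge0 ?expR_ge0.
apply: le_trans (expRN_le c0); apply: geometric_partial => //.
by rewrite expR_ge0 expR_lt1 oppr_lt0.
Qed.

(** Bounds the Riemann sums of exp(-d x^2) uniformly over the meshes h <= 1. *)
Definition gauss_const (d : R) : R := 2 * (1 + d^-1) * expR d.

(* x^2 >= |x| - 1 turns a Gaussian into a geometric progression. *)
Lemma gauss_int (d h : R) (s : seq int) : 0 < d -> 0 < h <= 1 -> uniq s ->
  h * \sum_(j <- s) expR (- (d * (j%:~R * h) ^+ 2)) <= gauss_const d.
Proof.
move=> d0 /andP[h0 h1] us; rewrite /gauss_const.
have e0 := expR_gt0 d.
have step : \sum_(j <- s) expR (- (d * (j%:~R * h) ^+ 2)) <=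
    (\sum_(j <- s) expR (- (d * h * `|j%:~R|))) * expR d.
  rewrite mulr_suml; apply: ler_sum => j _; rewrite -expRD ler_expR.
  have -> : - (d * h * `|j%:~R|) + d = - (d * (h * `|j%:~R| - 1)) by ring.
  rewrite lerN2 ler_pM2l//.
  have -> : (j%:~R * h) ^+ 2 = (h * `|j%:~R|) ^+ 2 by rewrite !exprMn real_normK ?num_real// mulrC.
  set y := h * _; have := sqr_ge0 (2 * y - 1); rewrite !expr2; nra.
have dh : 0 < d * h by exact: mulr_gt0.
have g := geometric_int dh us.
apply: (@le_trans _ _ (h * (2 * (1 + (d * h)^-1) * expR d))).
  by rewrite ler_pM2l//; apply: (le_trans step); rewrite ler_pM2r.
rewrite mulrA ler_pM2r// mulrCA ler_pM2l// mulrDr mulr1 lerD//.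
rewrite invfM mulrCA divff ?mulr1// gt_eqF//.
Qed.

Lemma rbsum_gauss (d : R) : 0 < d -> rbsum (fun j : int => expR (- (d * j%:~R ^+ 2))).
Proof.
move=> d0; exists (gauss_const d) => s us.
have := @gauss_int d 1 s d0; rewrite ltr01 lexx mul1r => /(_ isT us).
by under eq_bigr do rewrite mulr1.
Qed.

Lemma rbsum_gauss_mesh (d h : R) : 0 < d -> 0 < h <= 1 ->
  rbsum (fun j : int => expR (- (d * (j%:~R * h) ^+ 2))).
Proof.
move=> d0 hh; exists (h^-1 * gauss_const d) => s us.
have h0 : 0 < h by case/andP: hh.
by rewrite ler_pdivlMl//; apply: gauss_int.
Qed.

(** Over an initial segment of length n the sum stays below 2 - 1/n, by induction. *)
Lemma invsq_partial (s : seq nat) : uniq s -> \sum_(n <- s) ((n.+1%:R : R) ^- 2) <= 2.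
Proof.
move=> us; set N := (\max_(i <- s) i).+1.
apply: (@le_trans _ _ (\sum_(n <- iota 0 N) ((n.+1%:R : R) ^- 2))).
  apply: subset_sum_le => //; [by move=> i; rewrite invr_ge0 exprn_ge0|exact: iota_uniq|].
  move=> i si; rewrite mem_iota /= add0n /N ltnS.
  exact: (@leq_bigmax_seq _ _ predT id).
rewrite -[N]subn0 -/(index_iota 0 N) big_mkord.
have H n : \sum_(i < n.+1) ((i.+1%:R : R) ^- 2) <= 2 - n.+1%:R^-1.
  elim: n => [|n IH]; first by rewrite big_ord_recr big_ord0 /= expr1n; lra.
  rewrite big_ord_recr /=; apply: le_trans (lerD IH (lexx _)) _.
  have p1 : 0 < (n.+1%:R : R) by rewrite ltr0n.
  rewrite -[n.+2%:R]natr1; set x := n.+1%:R in p1 *.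
  have -> : 2 - x^-1 + (x + 1) ^- 2 = 2 - (x + 1)^-1 - (x^-1 * (x + 1) ^- 2).
    by field; apply/andP; split; lra.
  by rewrite gerBl mulr_ge0// invr_ge0 ?exprn_ge0//; lra.
by apply: (le_trans (H _)); rewrite gerBl invr_ge0.
Qed.

Lemma rbsum_invsq : rbsum (fun k : int => (k%:~R : R) ^- 2).
Proof.
exists (2 + 2) => s us.
have := @rbsum_int_of_nat (fun n => if n is k.+1 then (k.+1%:R : R) ^- 2 else 0) 2.
move=> H; apply: le_trans (H _ _ s us).
- apply: ler_sum => z _; rewrite -[z%:~R ^+ 2]real_normK ?num_real// -absz_intr.
  by case: `|z|%N => //=; rewrite expr0n invr0.
- by case=> // n; rewrite invr_ge0 exprn_ge0.
- move=> t ut.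
  rewrite (bigID (fun n => n == 0%N)) /= big1 ?add0r; last by case.
  rewrite -big_filter.
  have := @invsq_partial [seq n.-1 | n <- t & n != 0%N] => HH.
  apply: le_trans (HH _); last first.
    rewrite map_inj_in_uniq ?filter_uniq// => x y; rewrite !mem_filter; clear; lia.
  rewrite big_map big_seq [X in _ <= X]big_seq; apply: ler_sum => n.
  by rewrite mem_filter; case: n.
Qed.

End IntSums.

(** * Second-order estimates for complex Gaussians *)

Section RiemannSums.
Variable R : realType.
Local Notation C := R[i].
Implicit Types (g s l : C) (x h : R).

Definition gE g s x : C := cexp (- (pi%:Co * (g * x%:Co + s) ^+ 2)).
(** Increment of the exponent of [gE] when g x + s moves by l h. *)
Definition gW g s l x h : C := - (pi%:Co * (2 * (g * x%:Co + s) * l * h%:Co + (l * h%:Co) ^+ 2)).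

Lemma gE_move g s g' s' x h :
  gE (g + g' * h%:Co) (s + s' * h%:Co) x = gE g s x * cexp (gW g s (g' * x%:Co + s') x h).
Proof. by rewrite /gE /gW -cexpD; congr cexp; ring. Qed.

Lemma gE_shift g s x h : gE g s (x + h) = gE g s x * cexp (gW g s g x h).
Proof. by rewrite /gE /gW -cexpD; congr cexp; rewrite rmorphD /=; ring. Qed.

Lemma gE_shiftN g s x h : gE g s (x - h) = gE g s x * cexp (gW g s (- g) x h).
Proof. by rewrite /gE /gW -cexpD; congr cexp; rewrite rmorphB /=; ring. Qed.

Lemma lin_bound g s x (c : R) : cn g <= c -> cn s <= c -> cn (g * x%:Co + s) <= c * (1 + `|x|).
Proof.
move=> gc sc; apply: (le_trans (cnD _ _)); rewrite cnM cn_real.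
have : cn g * `|x| <= c * `|x| by rewrite ler_wpM2r.
by lra.
Qed.

Lemma gW_bound g s l x h (c : R) : 1 <= c -> cn g <= c -> cn s <= c ->
  cn l <= c * (1 + `|x|) -> 0 <= h <= 1 ->
  cn (gW g s l x h) <= 3 * pi * c ^+ 2 * h * (1 + `|x|) ^+ 2.
Proof.
move=> c1 gc sc lc /andP[h0 h1].
have p0 := @pi_gt0 R.
have := lin_bound x gc sc; set a := cn (g * _ + _) => ha.
have a0 : 0 <= a by exact: cn_ge0.
have l0 := cn_ge0 l.
rewrite /gW cnN cnM cn_real ger0_norm ?(ltW p0)//.
have X1 : 1 <= 1 + `|x| by rewrite lerDl.
set X := 1 + `|x| in ha lc X1 *.
have h2 : cn (2 * (g * x%:Co + s) * l * h%:Co + (l * h%:Co) ^+ 2) <= 3 * c ^+ 2 * h * X ^+ 2.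
  apply: (le_trans (cnD _ _)); rewrite cnX !cnM cn_real ger0_norm// -/a.
  rewrite (_ : cn 2 = 2); last by rewrite cn_nat.
  have b1 : a * cn l <= (c * X) * (c * X) by rewrite ler_pM.
  have b2 : cn l * cn l <= (c * X) * (c * X) by rewrite ler_pM.
  have b3 : h * h <= h by rewrite -[X in _ <= X]mulr1 ler_wpM2l.
  have b4 : a * cn l * h <= (c * X) * (c * X) * h by rewrite ler_wpM2r.
  have b5 : (cn l * cn l) * (h * h) <= (c * X) * (c * X) * h by rewrite ler_pM ?mulr_ge0.
  have -> : 2 * a * cn l * h = 2 * (a * cn l * h) by ring.
  have -> : (cn l * h) ^+ 2 = (cn l * cn l) * (h * h) by ring.
  have -> : 3 * c ^+ 2 * h * X ^+ 2 = 3 * ((c * X) * (c * X) * h) by ring.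
  lra.
apply: (@le_trans _ _ (pi * (3 * c ^+ 2 * h * X ^+ 2))).
  by rewrite ler_wpM2l ?(ltW p0).
by rewrite le_eqVlt; apply/orP; left; apply/eqP; ring.
Qed.

Lemma poly_gauss (m : R) x : 0 < m -> (1 + `|x|) ^+ 6 <= 8 * (1 + 6 / m) ^+ 3 * expR (m / 2 * x ^+ 2).
Proof.
move=> m0.
have x2 : `|x| ^+ 2 = x ^+ 2 by rewrite real_normK ?num_real.
have h1 : (1 + `|x|) ^+ 2 <= 2 * (1 + x ^+ 2).
  by rewrite -x2; have := sqr_ge0 (1 - `|x|); rewrite !expr2; nra.
have h2 : 1 + x ^+ 2 <= (1 + 6 / m) * expR (m / 6 * x ^+ 2).
  have e1 := expR_ge1Dx (m / 6 * x ^+ 2).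
  have k0 : 0 < 6 / m by rewrite divr_gt0.
  apply: (@le_trans _ _ ((1 + 6 / m) * (1 + m / 6 * x ^+ 2))); last by rewrite ler_wpM2l//; lra.
  have -> : (1 + 6 / m) * (1 + m / 6 * x ^+ 2) = 1 + x ^+ 2 + (6 / m + m / 6 * x ^+ 2).
    by field; rewrite gt_eqF.
  by rewrite lerDl addr_ge0 ?(ltW k0)// mulr_ge0 ?sqr_ge0//; lra.
have h3 : ((1 + `|x|) ^+ 2) ^+ 3 <= (2 * ((1 + 6 / m) * expR (m / 6 * x ^+ 2))) ^+ 3.
  apply: lerXn2r; rewrite ?nnegrE ?sqr_ge0//.
    by rewrite !mulr_ge0// ?expR_ge0// addr_ge0// divr_ge0// ltW.
  by apply: (le_trans h1); rewrite ler_pM2l.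
rewrite -exprM in h3; apply: (le_trans h3).
rewrite !exprMn -expRM_natr (_ : m / 6 * x ^+ 2 * 3%:R = m / 2 * x ^+ 2); last by field.
rewrite le_eqVlt; apply/orP; left; apply/eqP; ring.
Qed.

(** Half of the decay exp(-2 m x^2) is kept; the other half absorbs the polynomial and the factor
    exp(a h (1 + |x|)^2), whose quadratic exponent is small enough once 4 a h <= m. *)
Lemma gauss_absorb (m a h x : R) : 0 < m -> 0 <= a -> 0 <= h -> 4 * a * h <= m ->
  (1 + `|x|) ^+ 6 * expR (a * h * (1 + `|x|) ^+ 2) * expR (- (2 * m * x ^+ 2)) <=
  8 * (1 + 6 / m) ^+ 3 * expR m * expR (- (m * x ^+ 2)).
Proof.
move=> m0 a0 h0 ah.
have x2 : `|x| ^+ 2 = x ^+ 2 by rewrite real_normK ?num_real.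
have h1 : (1 + `|x|) ^+ 2 <= 2 * (1 + x ^+ 2).
  by rewrite -x2; have := sqr_ge0 (1 - `|x|); rewrite !expr2; nra.
have xx := sqr_ge0 x.
have h2 : a * h * (1 + `|x|) ^+ 2 <= m + m / 2 * x ^+ 2.
  apply: (@le_trans _ _ (a * h * (2 * (1 + x ^+ 2)))); first by rewrite ler_wpM2l ?mulr_ge0.
  have : (4 * a * h) * (1 + x ^+ 2) <= m * (1 + x ^+ 2) by rewrite ler_wpM2r//; lra.
  by lra.
have h3 := poly_gauss x m0.
have K0 : 0 <= 8 * (1 + 6 / m) ^+ 3.
  by rewrite mulr_ge0// exprn_ge0// addr_ge0// divr_ge0// ltW.
apply: (@le_trans _ _ ((8 * (1 + 6 / m) ^+ 3 * expR (m / 2 * x ^+ 2)) * expR (m + m / 2 * x ^+ 2) * expR (- (2 * m * x ^+ 2)))).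
  rewrite ler_wpM2r ?expR_ge0// ler_pM ?expR_ge0 ?exprn_ge0 ?addr_ge0//.
  by rewrite ler_expR.
rewrite -!mulrA -!expRD !ler_wpM2l ?exprn_ge0 ?addr_ge0 ?divr_ge0 ?(ltW m0)//.
by rewrite ler_expR; lra.
Qed.

(** For parameters moving with speeds g' and s', the derivative of g [gE] in the parameter equals
    the derivative of (g' x + s') [gE] in x, both being g' E(y) + g (g' x + s') E'(y) with y = g x +
    s and E(y) = exp(-pi y^2). This is the error in the discrete version of that identity. *)
Definition stepD g s g' s' x h : C :=
  (g + g' * h%:Co) * gE (g + g' * h%:Co) (s + s' * h%:Co) x - g * gE g s x -
  ((g' * (x + h)%:Co + s') * gE g s (x + h) - (g' * x%:Co + s') * gE g s x).

(** Second difference in x, which gives the decay in k^2 of the Fourier coefficients. *)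
Definition diff2 g s x h : C := gE g s (x + h) + gE g s (x - h) - 2 * gE g s x.

(** Once [gE g s x] is factored out, the terms of first order in h cancel. The rest is h^2 times a
    polynomial in |x| of degree at most 6 times exp(a h (1 + |x|)^2), which [gauss_absorb]
    controls. *)
Lemma stepD_bound (c M m : R) : 1 <= c -> 0 < m -> 0 <= M ->
  exists K h0, [/\ 0 <= K, 0 < h0 & forall g s g' s', cn g <= c -> cn s <= c -> cn g' <= c -> cn s' <= c ->
   (forall x, cn (gE g s x) <= M * expR (- (2 * m * x ^+ 2))) ->
   forall h x, 0 < h <= h0 ->
    cn (stepD g s g' s' x h) <= K * h ^+ 2 * expR (- (m * x ^+ 2)) /\
    cn (diff2 g s x h) <= K * h ^+ 2 * expR (- (m * x ^+ 2))].
Proof.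
move=> c1 m0 M0; have p0 := @pi_gt0 R.
have c0 : 0 < c by lra.
have [a a0 WB] : exists2 a : R, 0 < a & forall g s l x h, cn g <= c -> cn s <= c ->
    cn l <= c * (1 + `|x|) -> 0 <= h <= 1 -> cn (gW g s l x h) <= a * h * (1 + `|x|) ^+ 2.
  exists (3 * pi * c ^+ 2) => [|*]; last exact: gW_bound.
  by rewrite mulr_gt0 ?exprn_gt0// mulr_gt0.
(* Sum of the coefficients of the remainders estimated below: the first three summands serve
   [stepD], the last two [diff2]. *)
pose K' := 2 * c * a ^+ 2 + 2 * a * c + 2 * pi * c ^+ 3 + 2 * a ^+ 2 + 2 * pi * c ^+ 2.
have n1 : 0 <= 2 * c * a ^+ 2 by rewrite !mulr_ge0 ?(ltW a0) ?(ltW c0).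
have n2 : 0 <= 2 * a * c by rewrite !mulr_ge0 ?(ltW a0) ?(ltW c0).
have n3 : 0 <= 2 * pi * c ^+ 3 by rewrite !mulr_ge0 ?(ltW p0) ?(ltW c0).
have n4 : 0 <= 2 * a ^+ 2 by rewrite !mulr_ge0 ?(ltW a0).
have n5 : 0 <= 2 * pi * c ^+ 2 by rewrite !mulr_ge0 ?(ltW p0) ?(ltW c0).
have K'0 : 0 <= K' by rewrite /K'; lra.
pose B := 8 * (1 + 6 / m) ^+ 3 * expR m.
have B0 : 0 <= B.
  by rewrite /B mulr_ge0 ?expR_ge0// mulr_ge0// exprn_ge0// addr_ge0// divr_ge0// ltW.
exists (M * K' * B), (Num.min 1 (m / (4 * a))); split.
- by rewrite mulr_ge0// mulr_ge0.
- by rewrite lt_min ltr01 divr_gt0// mulr_gt0.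
move=> g s g' s' gc sc g'c s'c HE h x /andP[h0].
rewrite le_min => /andP[h1 hm].
have h01 : 0 <= h <= 1 by rewrite ltW.
have X1 : 1 <= 1 + `|x| by rewrite lerDl.
pose X := 1 + `|x|; rewrite -/X in X1.
have X0 : 0 <= X by lra.
have hXX (i j : nat) : (i <= j)%N -> X ^+ i <= X ^+ j by move=> ij; rewrite ler_weXn2l.
pose T := expR (a * h * X ^+ 2).
have T1 : 1 <= T by rewrite -expR0 ler_expR !mulr_ge0 ?exprn_ge0 ?(ltW a0) ?(ltW h0).
have T0 : 0 <= T by lra.
have wb l : cn l <= c * X -> cn (gW g s l x h) <= a * h * X ^+ 2.
  by move=> lc; apply: WB.
have E1 l : cn l <= c * X -> cn (cexp (gW g s l x h) - 1) <= a * h * X ^+ 2 * T.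
  move=> /wb hw; apply: (le_trans (cexp_bound1 _)).
  by rewrite ler_pM ?cn_ge0 ?expR_ge0// ler_expR.
have E2 l : cn l <= c * X -> cn (cexp (gW g s l x h) - 1 - gW g s l x h) <= a ^+ 2 * h ^+ 2 * X ^+ 4 * T.
  move=> /wb hw; apply: (le_trans (cexp_bound2 _)).
  rewrite ler_pM ?exprn_ge0 ?cn_ge0 ?expR_ge0//; last by rewrite ler_expR.
  rewrite (_ : _ * X ^+ 4 = (a * h * X ^+ 2) ^+ 2); last by ring.
  by apply: lerXn2r; rewrite ?nnegrE ?cn_ge0// !mulr_ge0 ?exprn_ge0 ?(ltW a0) ?(ltW h0).
have fin (z : C) : cn z <= K' * h ^+ 2 * X ^+ 6 * T ->
    cn (gE g s x * z) <= M * K' * B * h ^+ 2 * expR (- (m * x ^+ 2)).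
  move=> hz; rewrite cnM.
  apply: (@le_trans _ _ ((M * expR (- (2 * m * x ^+ 2))) * (K' * h ^+ 2 * X ^+ 6 * T))).
    by rewrite ler_pM ?cn_ge0// HE.
  have ah : 4 * a * h <= m.
    by move: hm; rewrite ler_pdivlMr ?mulr_gt0// => hm; lra.
  have := gauss_absorb x m0 (ltW a0) (ltW h0) ah; rewrite -/X -/T -/B => HB.
  have -> : M * expR (- (2 * m * x ^+ 2)) * (K' * h ^+ 2 * X ^+ 6 * T) =
     M * K' * h ^+ 2 * (X ^+ 6 * T * expR (- (2 * m * x ^+ 2))) by ring.
  have -> : M * K' * B * h ^+ 2 * expR (- (m * x ^+ 2)) = M * K' * h ^+ 2 * (B * expR (- (m * x ^+ 2))) by ring.
  by rewrite ler_wpM2l// mulr_ge0 ?exprn_ge0 ?(ltW h0)// mulr_ge0.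
have lg : cn g <= c * X by apply: (le_trans gc); rewrite ler_peMr// ltW.
have lgN : cn (- g) <= c * X by rewrite cnN.
have ll : cn (g' * x%:Co + s') <= c * X by exact: lin_bound.
have hT i (k : R) : (i <= 6)%N -> 0 <= k -> k * h ^+ 2 * X ^+ i * T <= k * h ^+ 2 * X ^+ 6 * T.
  by move=> i6 k0; rewrite ler_wpM2r// ler_wpM2l ?hXX// mulr_ge0 ?exprn_ge0// ltW.
split.
- set l := g' * x%:Co + s' in ll *.
  (* The number l is the speed of g x + s in the parameter, and g its speed in x. The linear parts
     of the two exponentials, weighted by g and l, cancel up to the last summand, which is of order
     h^2. *)
  have -> : stepD g s g' s' x h = gE g s x * (g * (cexp (gW g s l x h) - 1 - gW g s l x h)
      + (g' * h%:Co) * ((cexp (gW g s l x h) - 1) - (cexp (gW g s g x h) - 1))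
      - l * (cexp (gW g s g x h) - 1 - gW g s g x h)
      + (- pi%:Co * h%:Co ^+ 2 * l * g * (l - g))).
    by rewrite /stepD gE_move gE_shift -/l /gW rmorphD /= /l; ring.
  apply: fin.
  have b1 : cn (g * (cexp (gW g s l x h) - 1 - gW g s l x h)) <= c * a ^+ 2 * h ^+ 2 * X ^+ 6 * T.
    rewrite cnM; apply: (@le_trans _ _ (c * (a ^+ 2 * h ^+ 2 * X ^+ 4 * T))).
      by rewrite ler_pM ?cn_ge0 ?E2.
    rewrite (_ : _ * _ = c * a ^+ 2 * h ^+ 2 * X ^+ 4 * T); last by ring.
    by apply: hT => //; rewrite mulr_ge0 ?exprn_ge0 ?(ltW a0) ?(ltW c0).
  have b2 : cn ((g' * h%:Co) * ((cexp (gW g s l x h) - 1) - (cexp (gW g s g x h) - 1))) <= 2 * a * c * h ^+ 2 * X ^+ 6 * T.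
    rewrite !cnM cn_real ger0_norm ?(ltW h0)//.
    apply: (@le_trans _ _ (c * h * (a * h * X ^+ 2 * T + a * h * X ^+ 2 * T))).
      rewrite ler_pM ?mulr_ge0 ?cn_ge0 ?(ltW h0)//; first by rewrite ler_wpM2r// ltW.
      by apply: (le_trans (cnB _ _)); apply: lerD; apply: E1.
    rewrite (_ : _ * _ = 2 * a * c * h ^+ 2 * X ^+ 2 * T); last by ring.
    by apply: hT => //; rewrite !mulr_ge0 ?(ltW a0) ?(ltW c0).
  have b3 : cn (l * (cexp (gW g s g x h) - 1 - gW g s g x h)) <= c * a ^+ 2 * h ^+ 2 * X ^+ 6 * T.
    rewrite cnM; apply: (@le_trans _ _ ((c * X) * (a ^+ 2 * h ^+ 2 * X ^+ 4 * T))).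
      by rewrite ler_pM ?cn_ge0 ?E2.
    rewrite (_ : _ * _ = c * a ^+ 2 * h ^+ 2 * X ^+ 5 * T); last by ring.
    by apply: hT => //; rewrite mulr_ge0 ?exprn_ge0 ?(ltW a0) ?(ltW c0).
  have b4 : cn (- pi%:Co * h%:Co ^+ 2 * l * g * (l - g)) <= 2 * pi * c ^+ 3 * h ^+ 2 * X ^+ 6 * T.
    rewrite cnM cnM cnM cnM cnN cnX !cn_real !ger0_norm ?(ltW h0) ?(ltW p0)//.
    apply: (@le_trans _ _ (pi * h ^+ 2 * (c * X) * (c * X) * (c * X + c * X))).
      rewrite ler_pM ?mulr_ge0 ?exprn_ge0 ?cn_ge0 ?(ltW h0) ?(ltW p0)//.
        rewrite ler_pM ?mulr_ge0 ?exprn_ge0 ?cn_ge0 ?(ltW h0) ?(ltW p0)//.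
        by rewrite ler_wpM2l ?mulr_ge0 ?exprn_ge0 ?(ltW h0) ?(ltW p0).
      by apply: (le_trans (cnB _ _)); apply: lerD.
    rewrite (_ : _ * _ = 2 * pi * c ^+ 3 * h ^+ 2 * X ^+ 3); last by ring.
    apply: (@le_trans _ _ (2 * pi * c ^+ 3 * h ^+ 2 * X ^+ 3 * T)).
      by rewrite ler_peMr// !mulr_ge0 ?exprn_ge0 ?(ltW c0) ?(ltW p0) ?(ltW h0).
    by apply: hT => //; rewrite !mulr_ge0 ?exprn_ge0 ?(ltW p0) ?(ltW c0).
  have e0 : 0 <= h ^+ 2 * X ^+ 6 * T by rewrite !mulr_ge0 ?exprn_ge0 ?(ltW h0).
  apply: (@le_trans _ _ ((2 * c * a ^+ 2 + 2 * a * c + 2 * pi * c ^+ 3) * (h ^+ 2 * X ^+ 6 * T))).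
    apply: (le_trans (cnD _ _)).
    apply: (le_trans (lerD (cnB _ _) (lexx _))).
    apply: (le_trans (lerD (lerD (cnD _ _) (lexx _)) (lexx _))); lra.
  rewrite (_ : K' * h ^+ 2 * X ^+ 6 * T = K' * (h ^+ 2 * X ^+ 6 * T)); last by ring.
  by rewrite ler_wpM2r// /K'; lra.
- have -> : diff2 g s x h = gE g s x * ((cexp (gW g s g x h) - 1 - gW g s g x h)
      + (cexp (gW g s (- g) x h) - 1 - gW g s (- g) x h) - 2 * pi%:Co * h%:Co ^+ 2 * g ^+ 2).
    by rewrite /diff2 gE_shift gE_shiftN /gW; ring.
  apply: fin.
  have b1 l : cn l <= c * X -> cn (cexp (gW g s l x h) - 1 - gW g s l x h) <= a ^+ 2 * h ^+ 2 * X ^+ 6 * T.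
    move=> /E2 lc; apply: (le_trans lc); apply: hT => //; exact: exprn_ge0 (ltW a0).
  have b2 : cn (2 * pi%:Co * h%:Co ^+ 2 * g ^+ 2) <= 2 * pi * c ^+ 2 * h ^+ 2 * X ^+ 6 * T.
    rewrite cnM cnM cnM !cnX !cn_real !ger0_norm ?(ltW h0) ?(ltW p0)// cn_nat.
    apply: (@le_trans _ _ (2 * pi * h ^+ 2 * c ^+ 2)).
      rewrite ler_wpM2l ?mulr_ge0 ?exprn_ge0 ?(ltW h0) ?(ltW p0)//.
      by apply: lerXn2r; rewrite ?nnegrE ?cn_ge0 ?(ltW c0).
    apply: (@le_trans _ _ (2 * pi * c ^+ 2 * h ^+ 2 * X ^+ 0 * T)).
      rewrite expr0 mulr1 (_ : 2 * pi * h ^+ 2 * c ^+ 2 = 2 * pi * c ^+ 2 * h ^+ 2); last by ring.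
      by rewrite ler_peMr// !mulr_ge0 ?exprn_ge0 ?(ltW c0) ?(ltW p0) ?(ltW h0).
    by apply: hT => //; rewrite !mulr_ge0 ?exprn_ge0 ?(ltW p0) ?(ltW c0).
  have e0 : 0 <= h ^+ 2 * X ^+ 6 * T by rewrite !mulr_ge0 ?exprn_ge0 ?(ltW h0).
  apply: (@le_trans _ _ ((2 * a ^+ 2 + 2 * pi * c ^+ 2) * (h ^+ 2 * X ^+ 6 * T))).
    apply: (le_trans (cnB _ _)).
    apply: (le_trans (lerD (cnD _ _) (lexx _))).
    have := b1 g lg; have := b1 (- g) lgN; lra.
  rewrite (_ : K' * h ^+ 2 * X ^+ 6 * T = K' * (h ^+ 2 * X ^+ 6 * T)); last by ring.
  by rewrite ler_wpM2r// /K'; lra.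
Qed.

End RiemannSums.

(** * Invariance of Riemann sums and decay of their Fourier coefficients *)

Section PoissonOne.
Variable R : realType.
Local Notation C := R[i].
Implicit Types (g s : C) (x h : R).

(** The sector |arg g| < pi/4, where exp(-pi g^2 x^2) decays. It is convex, contains 1, and is
    stable under inversion and positive scaling. *)
Definition cone g := `|Im g| < Re g.

(** The constants depend on c and mu alone, so the bound is uniform along a path of parameters. *)
Lemma gE_coercive g s (c mu : R) : 1 <= c -> 0 < mu -> cn g <= c -> cn s <= c ->
  `|Im g| + mu <= Re g -> forall x,
  cn (gE g s x) <= expR (pi * (8 * c ^+ 4 / mu ^+ 2 + c ^+ 2)) * expR (- (2 * (mu ^+ 2 / 4) * x ^+ 2)).
Proof.
move=> c1 mu0 gc sc hmu x.
have p2 := @pi_ge2 R.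
have mu2 : 0 < mu ^+ 2 by rewrite exprn_gt0.
rewrite /gE cn_cexp -expRD ler_expR cReN cReM /= mul0r subr0.
have -> : Re ((g * x%:Co + s) ^+ 2) = (Re g * x + Re s) ^+ 2 - (Im g * x + Im s) ^+ 2.
  by rewrite expr2 cReM !(cReD, cImD, cReM, cImM) /=; ring.
set a := Re g; set b := Im g; set p := Re s; set q := Im s.
have ac : `|a| <= c by exact: le_trans (Re_le_cn _) gc.
have bc : `|b| <= c by exact: le_trans (Im_le_cn _) gc.
have pc : `|p| <= c by exact: le_trans (Re_le_cn _) sc.
have qc : `|q| <= c by exact: le_trans (Im_le_cn _) sc.
have ab : mu ^+ 2 <= a ^+ 2 - b ^+ 2.
  have b0 := normr_ge0 b; have -> : b ^+ 2 = `|b| ^+ 2 by rewrite real_normK ?num_real.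
  have -> : a ^+ 2 - `|b| ^+ 2 = (a - `|b|) * (a + `|b|) by ring.
  rewrite expr2; apply: ler_pM; rewrite -?/b in hmu *; rewrite ?(ltW mu0)//; rewrite -/a in hmu; lra.
have apq : `|(a * p - b * q) * x| <= 2 * c ^+ 2 * `|x|.
  rewrite normrM ler_wpM2r//; apply: (le_trans (ler_normB _ _)); rewrite !normrM.
  have : `|a| * `|p| <= c * c by rewrite ler_pM.
  have : `|b| * `|q| <= c * c by rewrite ler_pM.
  rewrite expr2; lra.
have qq : q ^+ 2 <= c ^+ 2.
  by rewrite -(real_normK (num_real q)); apply: lerXn2r; rewrite ?nnegrE//; lra.
have p20 := sqr_ge0 p.
have quad : 4 * c ^+ 2 * `|x| <= mu ^+ 2 / 2 * x ^+ 2 + 8 * c ^+ 4 / mu ^+ 2.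
  rewrite -(real_normK (num_real x)); set y := `|x|.
  have -> : mu ^+ 2 / 2 * y ^+ 2 + 8 * c ^+ 4 / mu ^+ 2 = 4 * c ^+ 2 * y + (mu * y - 4 * c ^+ 2 / mu) ^+ 2 / 2.
    by field; rewrite gt_eqF.
  by rewrite lerDl divr_ge0// sqr_ge0.
have x20 := sqr_ge0 x.
have abx : mu ^+ 2 * x ^+ 2 <= (a ^+ 2 - b ^+ 2) * x ^+ 2 by rewrite ler_wpM2r.
have main : mu ^+ 2 / 2 * x ^+ 2 - (8 * c ^+ 4 / mu ^+ 2 + c ^+ 2) <= (a * x + p) ^+ 2 - (b * x + q) ^+ 2.
  have -> : (a * x + p) ^+ 2 - (b * x + q) ^+ 2 =
     (a ^+ 2 - b ^+ 2) * x ^+ 2 + 2 * ((a * p - b * q) * x) + p ^+ 2 - q ^+ 2 by ring.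
  move: apq; rewrite ler_norml => /andP[apq _]; lra.
have mx : 0 <= mu ^+ 2 / 2 * x ^+ 2 by rewrite mulr_ge0// ltW// divr_gt0.
have h1 : pi * (mu ^+ 2 / 2 * x ^+ 2 - (8 * c ^+ 4 / mu ^+ 2 + c ^+ 2)) <=
   pi * ((a * x + p) ^+ 2 - (b * x + q) ^+ 2) by rewrite ler_wpM2l//; lra.
have h2 : 2 * (mu ^+ 2 / 2 * x ^+ 2) <= pi * (mu ^+ 2 / 2 * x ^+ 2) by rewrite ler_wpM2r.
rewrite mulrBr in h1; lra.
Qed.

Lemma cone_coercive g s : cone g -> exists M m : R, [/\ 0 <= M, 0 < m &
  forall x, cn (gE g s x) <= M * expR (- (2 * m * x ^+ 2))].
Proof.
move=> hg; pose mu := Re g - `|Im g|; pose c := 1 + cn g + cn s.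
have mu0 : 0 < mu by rewrite subr_gt0.
have g0 := cn_ge0 g; have s0 := cn_ge0 s.
exists (expR (pi * (8 * c ^+ 4 / mu ^+ 2 + c ^+ 2))), (mu ^+ 2 / 4); split.
- exact: expR_ge0.
- by rewrite divr_gt0// exprn_gt0.
- by apply: gE_coercive => //; rewrite /c ?/mu; lra.
Qed.

Definition mesh h (j : int) : R := j%:~R * h.

Lemma bsum_gE g s h : cone g -> 0 < h <= 1 -> bsum (fun j => gE g s (mesh h j)).
Proof.
move=> /(cone_coercive s) [M [m [M0 m0 HM]]] hh.
have m2 : 0 < 2 * m by rewrite mulr_gt0.
apply: rbsum_le (rbsumZ M0 (rbsum_gauss_mesh m2 hh)) => j; exact: HM.
Qed.

Lemma bsum_lin_gE g s h (l k : C) : cone g -> 0 < h <= 1 ->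
  bsum (fun j => (l * (mesh h j)%:Co + k) * gE g s (mesh h j)).
Proof.
move=> /(cone_coercive s) [M [m [M0 m0 HM]]] hh.
pose c := cn l + cn k; pose K := 8 * (1 + 6 / m) ^+ 3.
have K0 : 0 <= K by rewrite /K mulr_ge0// exprn_ge0// addr_ge0// divr_ge0// ltW.
have c0 : 0 <= c by rewrite addr_ge0 ?cn_ge0.
have cKM : 0 <= c * K * M by rewrite mulr_ge0// mulr_ge0.
apply: rbsum_le (rbsumZ cKM (rbsum_gauss_mesh m0 hh)) => j.
rewrite -/(mesh h j); set x := mesh h j; rewrite cnM.
have h1 : cn (l * x%:Co + k) <= c * (1 + `|x|).
  by apply: lin_bound; rewrite /c ?lerDl ?lerDr ?cn_ge0.
have X1 : 1 <= 1 + `|x| by rewrite lerDl.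
have h2 : 1 + `|x| <= (1 + `|x|) ^+ 6 by rewrite -[X in X <= _]expr1 ler_weXn2l.
have h3 := poly_gauss x m0; rewrite -/K in h3.
apply: (@le_trans _ _ ((c * (K * expR (m / 2 * x ^+ 2))) * (M * expR (- (2 * m * x ^+ 2))))).
  apply: ler_pM; rewrite ?cn_ge0//.
  by apply: (le_trans h1); rewrite ler_wpM2l//; apply: (le_trans h2).
have -> : c * (K * expR (m / 2 * x ^+ 2)) * (M * expR (- (2 * m * x ^+ 2))) =
   c * K * M * expR (m / 2 * x ^+ 2 - 2 * m * x ^+ 2) by rewrite expRD; ring.
rewrite ler_wpM2l// ler_expR.
have : 0 <= m * x ^+ 2 by rewrite mulr_ge0 ?sqr_ge0// ltW.
lra.
Qed.

Definition Rs h g s : C := h%:Co * tsum (fun j : int => gE g s (mesh h j)).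

Lemma tsum_shift (f : int -> C) (k : int) : bsum f -> tsum (fun j => f (j + k)) = tsum f.
Proof.
move=> bf; apply: tsumP.
apply: (@hassum_bij _ _ _ f (fun j => j + k) (fun j => j - k)) (bsumP bf).
  by move=> j; rewrite addrK.
by move=> j; rewrite subrK.
Qed.

Lemma mesh1 h j : mesh h (j + 1) = mesh h j + h.
Proof. by rewrite /mesh intrD mulrDl mul1r. Qed.
Lemma meshN1 h j : mesh h (j + (-1)) = mesh h j - h.
Proof. by rewrite /mesh intrD mulrDl mulN1r. Qed.

(** The increments of (g' x + s') [gE] subtracted in [stepD] sum to 0 over the mesh, by translation
    invariance; only the error of order h^2 per mesh point remains. *)
Lemma riemann_step (K m h : R) g s g' s' : 0 <= K -> 0 < m -> 0 < h <= 1 ->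
  cone g -> cone (g + g' * h%:Co) ->
  (forall x, cn (stepD g s g' s' x h) <= K * h ^+ 2 * expR (- (m * x ^+ 2))) ->
  cn ((g + g' * h%:Co) * Rs h (g + g' * h%:Co) (s + s' * h%:Co) - g * Rs h g s)
    <= K * gauss_const m * h ^+ 2.
Proof.
move=> K0 m0 hh cg cg1 HD; have h0 : 0 < h by case/andP: hh.
pose chi (j : int) := (g' * (mesh h j)%:Co + s') * gE g s (mesh h j).
have bchi : bsum chi by exact: bsum_lin_gE.
have H1 := hassumZ (g + g' * h%:Co) (bsumP (bsum_gE (s + s' * h%:Co) cg1 hh)).
have H2 := hassumZ g (bsumP (bsum_gE s cg hh)).
have bchi1 : bsum (fun j => chi (j + 1)).
  by apply: (@rbsum_inj _ _ _ (fun j => cn (chi j)) (fun j => j + 1)) => // x y /addIr.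
have H3 := hassumB (bsumP bchi1) (bsumP bchi).
rewrite (tsum_shift 1 bchi) subrr in H3.
have H := hassumB (hassumB H1 H2) H3.
rewrite subr0 in H.
set T1 := tsum _ in H; set T2 := tsum (fun j => gE g s _) in H.
have HT : cn ((g + g' * h%:Co) * T1 - g * T2) <= K * h ^+ 2 * (h^-1 * gauss_const m).
  apply: (hassum_le H) => t ut.
  apply: (@le_trans _ _ (K * h ^+ 2 * \sum_(j <- t) expR (- (m * mesh h j ^+ 2)))).
    rewrite mulr_sumr; apply: ler_sum => j _.
    apply: le_trans (HD (mesh h j)); rewrite /stepD /chi mesh1 le_eqVlt; apply/orP; left.
    by apply/eqP.
  rewrite ler_wpM2l ?mulr_ge0 ?exprn_ge0 ?(ltW h0)//.
  by rewrite ler_pdivlMl//; apply: gauss_int.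
have -> : (g + g' * h%:Co) * Rs h (g + g' * h%:Co) (s + s' * h%:Co) - g * Rs h g s =
   h%:Co * ((g + g' * h%:Co) * T1 - g * T2) by rewrite /Rs -/T1 -/T2; ring.
rewrite cnM cn_real ger0_norm ?(ltW h0)//.
apply: (@le_trans _ _ (h * (K * h ^+ 2 * (h^-1 * gauss_const m)))).
  by rewrite ler_pM2l.
rewrite le_eqVlt; apply/orP; left; apply/eqP; field; exact: lt0r_neq0.
Qed.

(** Both the mesh and the segment from (1, 0) to (g1, s1) are cut into steps of length 1/N: N steps
    with error O(N^-2) each add up to O(1/N). This replaces the change of variable g x + s in the
    Gaussian integral. *)
Lemma riemann_inv g1 s1 : cone g1 -> exists K, 0 <= K /\ exists N0, forall N, (N0 <= N)%N -> (0 < N)%N ->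
  cn (g1 * Rs N%:R^-1 g1 s1 - Rs N%:R^-1 1 0) <= K / N%:R.
Proof.
move=> cg1; pose g' := g1 - 1.
(* By convexity this bounds Re - |Im| from below along the whole segment. *)
pose mu := Num.min 1 (Re g1 - `|Im g1|).
have mu0 : 0 < mu by rewrite lt_min ltr01 subr_gt0.
pose c := 2 + cn g1 + cn s1.
have gp := cn_ge0 g1; have sp := cn_ge0 s1.
have c1 : 1 <= c by rewrite /c; lra.
have m0 : 0 < mu ^+ 2 / 4 by rewrite divr_gt0// exprn_gt0.
set m := mu ^+ 2 / 4 in m0.
pose M := expR (pi * (8 * c ^+ 4 / mu ^+ 2 + c ^+ 2)).
have [K [h0 [K0 h00 HK]]] := stepD_bound c1 m0 (expR_ge0 _ : 0 <= M).
exists (K * gauss_const m); split.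
  by rewrite mulr_ge0// /gauss_const !mulr_ge0 ?expR_ge0// addr_ge0// invr_ge0 ltW.
exists (Num.truncn h0^-1).+1 => N N0 Np.
have Npos : 0 < (N%:R : R) by rewrite ltr0n.
set h := N%:R^-1 : R.
have hp : 0 < h by rewrite invr_gt0.
have h1 : h <= 1 by rewrite invf_le1// ler1n.
have hh : 0 < h <= 1 by rewrite hp.
have hh0 : 0 < h <= h0.
  rewrite hp /= /h -[h0]invrK lef_pV2 ?posrE ?invr_gt0//.
  apply: ltW; apply: (lt_le_trans (truncnS_gt _)); by rewrite ler_nat.
pose gt (t : R) := 1 + g' * t%:Co; pose st (t : R) := s1 * t%:Co.
have rg t : Re (gt t) = 1 + (Re g1 - 1) * t.
  by rewrite /gt /g' !(cReD, cReM, cReN, cImD, cImN) /=; ring.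
have ig t : Im (gt t) = Im g1 * t.
  by rewrite /gt /g' !(cImD, cImM, cImN, cReD, cReN) /=; ring.
have Hmu t : 0 <= t <= 1 -> `|Im (gt t)| + mu <= Re (gt t).
  move=> /andP[t0 t1]; rewrite rg ig normrM (ger0_norm t0).
  have m1 : mu <= 1 by rewrite ge_min lexx.
  have m2 : mu <= Re g1 - `|Im g1| by rewrite ge_min lexx orbT.
  have e1 : mu * t <= (Re g1 - `|Im g1|) * t by rewrite ler_wpM2r.
  have e2 : mu * (1 - t) <= 1 * (1 - t) by rewrite ler_wpM2r// subr_ge0.
  by move: e1 e2; rewrite mulrBl mulrBr; lra.
have cnt t : 0 <= t <= 1 -> cone (gt t).
  by move=> /Hmu H; apply: lt_le_trans H; rewrite ltrDl.
have cg t : 0 <= t <= 1 -> cn (gt t) <= c.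
  move=> /andP[t0 t1]; have -> : gt t = (1 - t)%:Co + g1 * t%:Co by rewrite /gt /g' rmorphB /=; ring.
  apply: (le_trans (cnD _ _)); rewrite cnM !cn_real !ger0_norm ?subr_ge0//.
  have : cn g1 * t <= cn g1 * 1 by rewrite ler_wpM2l.
  by rewrite /c; lra.
have cs t : 0 <= t <= 1 -> cn (st t) <= c.
  move=> /andP[t0 t1]; rewrite /st cnM cn_real ger0_norm//.
  have : cn s1 * t <= cn s1 * 1 by rewrite ler_wpM2l.
  by rewrite /c; lra.
have cg' : cn g' <= c by apply: (le_trans (cnB _ _)); rewrite cn1 /c; lra.
have cs' : cn s1 <= c by rewrite /c; lra.
have step n : (n < N)%N -> cn (gt (n.+1%:R * h) * Rs h (gt (n.+1%:R * h)) (st (n.+1%:R * h))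
      - gt (n%:R * h) * Rs h (gt (n%:R * h)) (st (n%:R * h))) <= K * gauss_const m * h ^+ 2.
  move=> nN; have t01 k : (k <= N)%N -> 0 <= k%:R * h <= 1.
    move=> kN; rewrite mulr_ge0 ?(ltW hp)//= /h ler_pdivrMr// mul1r ler_nat//.
  have E0 : n.+1%:R * h = n%:R * h + h by rewrite -natr1 mulrDl mul1r.
  have E1 : gt (n.+1%:R * h) = gt (n%:R * h) + g' * h%:Co.
    by rewrite /gt E0 rmorphD /=; ring.
  have E2 : st (n.+1%:R * h) = st (n%:R * h) + s1 * h%:Co.
    by rewrite /st E0 rmorphD /=; ring.
  rewrite E1 E2; apply: riemann_step => //.
  - by apply: cnt; apply: t01; exact: ltnW.
  - by rewrite -E1; apply: cnt; exact: t01.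
  - move=> x; have tn := t01 _ (ltnW nN).
    have := HK _ _ g' s1 (cg _ tn) (cs _ tn) cg' cs' _ h x hh0.
    by case=> // y; apply: gE_coercive => //; [exact: cg|exact: cs|exact: Hmu].
have all n : (n <= N)%N -> cn (gt (n%:R * h) * Rs h (gt (n%:R * h)) (st (n%:R * h)) - Rs h 1 0)
    <= n%:R * (K * gauss_const m * h ^+ 2).
  elim: n => [|n IH] nN.
    rewrite !mul0r (_ : gt 0 = 1); last by rewrite /gt rmorph0 mulr0 addr0.
    by rewrite (_ : st 0 = 0) ?mul1r ?subrr ?cn0// /st rmorph0 mulr0.
  have := IH (ltnW nN); have := step n nN.
  set A := gt (n.+1%:R * h) * _; set B := gt (n%:R * h) * _; set D := Rs h 1 0 => u1 u2.
  have -> : A - D = (A - B) + (B - D) by ring.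
  by apply: (le_trans (cnD _ _)); rewrite -natr1 mulrDl mul1r; lra.
have := all N (leqnn N); rewrite (_ : N%:R * h = 1); last by rewrite /h divff// gt_eqF.
rewrite (_ : gt 1 = g1); last by rewrite /gt /g' rmorph1 mulr1 addrC subrK.
rewrite (_ : st 1 = s1); last by rewrite /st rmorph1 mulr1.
move=> H; apply: (le_trans H); rewrite -/h le_eqVlt; apply/orP; left; apply/eqP.
by rewrite /h; field; rewrite gt_eqF.
Qed.

(** Two summations by parts: with Z = exp(-2 pi i k h), the coefficient multiplied by (Z - 1)^2 / Z
    is the coefficient of the second difference, which is O(h^2), while |Z - 1| >= 2 |k h| for |k h|
    <= 1/2. *)
Lemma fourier_decay g s : cone g -> exists K, 0 <= K /\ exists2 h0, 0 < h0 &
  forall h (k : int), 0 < h <= h0 -> h <= 1 -> k != 0 -> `|k%:~R * h| <= 2^-1 ->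
  cn (h%:Co * tsum (fun j => gE g s (mesh h j) * e1 (- (k%:~R * mesh h j)))) <= K * (k%:~R) ^- 2.
Proof.
move=> cg; have [M [m [M0 m0 HM]]] := cone_coercive s cg.
pose c := 1 + cn g + cn s; have gp := cn_ge0 g; have sp := cn_ge0 s.
have c1 : 1 <= c by rewrite /c; lra.
have [K [h0 [K0 h00 HK]]] := stepD_bound c1 m0 M0.
have G0 : 0 <= gauss_const m.
  by rewrite /gauss_const !mulr_ge0 ?expR_ge0// addr_ge0// invr_ge0 ltW.
exists (K * gauss_const m / 4); split; first by rewrite divr_ge0// mulr_ge0.
exists h0 => // h k hh0 h1 k0 kh.
have hp : 0 < h by case/andP: hh0.
have hh : 0 < h <= 1 by rewrite hp.
pose F (j : int) := gE g s (mesh h j); pose z (j : int) := e1 (- (k%:~R * mesh h j)).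
pose Z := e1 (- (k%:~R * h)).
have z1 j : z (j + 1) = z j * Z by rewrite /z /Z mesh1 -e1D mulrDr opprD.
have zN1 j : z (j + (-1)) = z j / Z by rewrite /z /Z meshN1 -e1N -e1D mulrBr opprB opprK addrC.
have Z0 : Z != 0 by exact: cexp_neq0.
have bF : bsum F by exact: bsum_gE.
have bm (f : int -> C) : bsum f -> bsum (fun j => f j * z j).
  by apply: rbsum_le => j; rewrite cnM cn_e1 mulr1.
set b := tsum _.
have binj (f : int -> C) (d : int) : bsum f -> bsum (fun j => f (j + d)).
  move=> bf; apply: (@rbsum_inj _ _ _ (fun j => cn (f j)) (fun j => j + d)) => //.
  by move=> x y /addIr.
have H1 : hassum (fun j => F (j + 1) * z j) (b / Z).
  have E : tsum (fun j => F (j + 1) * z (j + 1)) = b by apply: (tsum_shift 1 (bm _ bF)).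
  rewrite -E mulrC.
  have := hassumZ Z^-1 (bsumP (binj _ 1 (bm _ bF))).
  by apply: hassum_ext => j; rewrite z1; field.
have H2 : hassum (fun j => F (j + (-1)) * z j) (b * Z).
  have E : tsum (fun j => F (j + (-1)) * z (j + (-1))) = b by apply: (tsum_shift (-1) (bm _ bF)).
  rewrite -E mulrC.
  have := hassumZ Z (bsumP (binj _ (-1) (bm _ bF))).
  by apply: hassum_ext => j; rewrite zN1; field.
have H3 := hassumZ 2 (bsumP (bm _ bF)); rewrite -/b in H3.
have H := hassumB (hassumD H1 H2) H3.
have HT : cn (b / Z + b * Z - 2 * b) <= K * h ^+ 2 * (h^-1 * gauss_const m).
  apply: (hassum_le H) => t ut.
  apply: (@le_trans _ _ (K * h ^+ 2 * \sum_(j <- t) expR (- (m * mesh h j ^+ 2)))).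
    rewrite mulr_sumr; apply: ler_sum => j _.
    have gcc : cn g <= c by rewrite /c; lra.
    have scc : cn s <= c by rewrite /c; lra.
    have [_ HD] := HK g s g s gcc scc gcc scc HM h (mesh h j) hh0.
    apply: le_trans HD; rewrite /diff2 /F mesh1 meshN1.
    rewrite (_ : _ - 2 * _ = (gE g s (mesh h j + h) + gE g s (mesh h j - h) - 2 * gE g s (mesh h j)) * z j); last by ring.
    by rewrite cnM cn_e1 mulr1.
  rewrite ler_wpM2l ?mulr_ge0 ?exprn_ge0 ?(ltW hp)//.
  by rewrite ler_pdivlMl//; apply: gauss_int.
have EZ : b / Z + b * Z - 2 * b = b * ((Z - 1) ^+ 2 / Z) by field.
rewrite EZ cnM cnM cnX cnV cn_e1 invr1 mulr1 in HT.
have ch : 2 * `|k%:~R * h| <= cn (Z - 1).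
  by rewrite /Z -(normrN (k%:~R * h)); apply: e1_chord; rewrite normrN.
have ch2 : 4 * (k%:~R * h) ^+ 2 <= cn (Z - 1) ^+ 2.
  rewrite -(real_normK (num_real (k%:~R * h))) (_ : 4 * _ = (2 * `|k%:~R * h|) ^+ 2); last by ring.
  by apply: lerXn2r; rewrite ?nnegrE ?mulr_ge0 ?cn_ge0.
have k2 : 0 < (k%:~R : R) ^+ 2 by rewrite exprn_even_gt0//= intr_eq0.
rewrite cnM cn_real ger0_norm ?(ltW hp)//.
rewrite ler_pdivlMr// -(ler_pM2l (_ : 0 < 4 * h)); last by rewrite mulr_gt0.
apply: (@le_trans _ _ (cn b * cn (Z - 1) ^+ 2)).
  rewrite (_ : 4 * h * _ = cn b * (4 * (k%:~R * h) ^+ 2)); last by ring.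
  by rewrite ler_wpM2l ?cn_ge0.
apply: (le_trans HT); rewrite le_eqVlt; apply/orP; left; apply/eqP; field; exact: lt0r_neq0.
Qed.

End PoissonOne.

(** * From finite Fourier analysis to Poisson summation over the integers *)

Section PoissonOneMain.
Variable R : realType.
Local Notation C := R[i].
Local Notation iC := (Complex 0 1 : C).
Implicit Types (g s : C) (x h : R).

(** The residues modulo 2m + 1, represented by -m, ..., m so that |k| / (2m + 1) stays below 1/2 as
    [fourier_decay] requires. *)
Definition window (m : nat) : seq int := [seq (Posz i - Posz m)%R | i <- iota 0 m.*2.+1].

Lemma window_uniq m : uniq (window m).
Proof. by rewrite map_inj_uniq ?iota_uniq// => i j; lia. Qed.

Lemma mem_window m (k : int) : (k \in window m) = (`|k| <= m)%N.
Proof.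
apply/mapP/idP => [[j]|km].
  rewrite mem_iota add0n => H ->; lia.
exists (absz (k + Posz m)%R); rewrite ?mem_iota; lia.
Qed.

Lemma character_sum m (j : int) : let N := m.*2.+1 in
  \sum_(k <- window m) e1 (- (k%:~R * mesh (N%:R^-1 : R) j)) =
  if (N %| `|j|)%N then N%:R else 0 :> C.
Proof.
move=> N; have N0 : (N%:R : R) != 0 by rewrite pnatr_eq0.
pose z : C := e1 (- (j%:~R / N%:R)).
have zN : z ^+ N = 1.
  rewrite -e1_mulrn (_ : _ *+ N = - j%:~R); last first.
    by rewrite mulNrn -[_ *+ N]mulr_natr divfK.
  by rewrite e1N e1_int invr1.
have z0 : z != 0 by exact: cexp_neq0.
have E k : e1 (- (k%:~R * mesh (N%:R^-1 : R) j)) = z ^ k.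
  rewrite /z /mesh; case: k => k; rewrite ?NegzE.
    by rewrite -exprnP -e1_mulrn -[_ *+ k]mulr_natr; congr e1; rewrite -pmulrn; ring.
  rewrite mulrNz -invr_expz -exprnP -e1_mulrn -e1N -[_ *+ k.+1]mulr_natr; congr e1; rewrite -pmulrn; ring.
rewrite big_map.
have -> : \sum_(i <- iota 0 m.*2.+1) e1 (- ((Posz i - Posz m)%:~R * mesh (N%:R^-1 : R) j)) =
   z ^- m * \sum_(i < N) z ^+ i.
  rewrite sum_ord_iota mulr_sumr; apply: eq_bigr => i _.
  by rewrite E expfzDr// -invr_expz mulrC.
case: ifP => [/dvdnP [q jq]|nd].
  have -> : z = 1.
    have [d Hd] : exists d : int, j = d * N.
      by exists (if 0 <= j then Posz q else - Posz q); case: ifP => h; move: jq; lia.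
    by rewrite /z Hd intrM -pmulrn -mulrA divff// mulr1 e1N e1_int invr1.
  rewrite expr1n invr1 mul1r; under eq_bigr do rewrite expr1n.
  by rewrite sumr_const card_ord.
have z1 : z != 1.
  apply/eqP => /e1_eq1 [q /eqP].
  rewrite eqr_oppLR -mulrNz => /eqP h.
  have {}h : (j%:~R : R) = (- q * N)%:~R.
    by rewrite intrM -h divfK.
  move: h => /eqP; rewrite eqr_int => /eqP h; move: nd.
  by rewrite h abszM /= dvdn_mull.
have : (z - 1) * \sum_(i < N) z ^+ i = 0 by rewrite -subrX1 zN subrr.
move/eqP; rewrite mulf_eq0 subr_eq0 (negbTE z1) /= => /eqP ->.
by rewrite mulr0.
Qed.

(** Poisson summation at finite level: the sum of the N characters vanishes except at the indices
    divisible by N, which are the integer points of the mesh 1/N. *)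
Lemma finite_fourier (f : int -> C) m : bsum f -> let N := m.*2.+1 in
  \sum_(k <- window m) (N%:R^-1 : R)%:Co * tsum (fun j => f j * e1 (- (k%:~R * mesh N%:R^-1 j)))
  = tsum (fun z => f (z * Posz N)).
Proof.
move=> bf N; have N0 : (N%:R : R) != 0 by rewrite pnatr_eq0.
have bfe (k : int) : bsum (fun j => f j * e1 (- (k%:~R * mesh N%:R^-1 j))).
  by apply: rbsum_le bf => j; rewrite cnM cn_e1 mulr1.
rewrite -mulr_sumr.
have H := hassum_sum (window m) (fun k => bsumP (bfe k)).
have {}H := hassumZ (N%:R^-1 : R)%:Co H.
have H1 : hassum (fun j => if (N %| `|j|)%N then f j else 0)
  ((N%:R^-1 : R)%:Co * \sum_(k <- window m) tsum (fun j => f j * e1 (- (k%:~R * mesh N%:R^-1 j)))).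
  apply: hassum_ext H => j; rewrite -mulr_sumr character_sum -/N.
  case: ifP => _; last by rewrite !mulr0.
  have -> : (N%:R : C) = (N%:R : R)%:Co by rewrite rmorph_nat.
  by rewrite mulrCA -rmorphM /= mulVf// rmorph1 mulr1.
symmetry; have bf1 : bsum (fun z : int => f (z * Posz N)).
  by apply: (@rbsum_inj _ _ _ (fun j => cn (f j)) (fun z : int => z * Posz N)) => // x y; apply: mulIf.
apply: hassum_unique H1.
apply: (@hassum_extend _ _ int _ (fun z : int => z * Posz N)
   (fun j => if (N %| `|j|)%N then Some (j %/ (Posz N))%Z else None)).
- by move=> j; rewrite abszM dvdn_mull//= mulzK.
- move=> i j; case: ifP => // d [<-]; rewrite divzK//.
- by move=> i; case: ifP.
- by apply: hassum_ext (bsumP bf1) => j; rewrite abszM dvdn_mull.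
Qed.

(** This is g times the Fourier transform of [gE g s] at k, namely exp(-pi k^2 / g^2 + 2 pi i k s /
    g), written as a constant times a [gE] so that its summability is already known. *)
Definition hatE g s (k : int) : C := gE g^-1 (- (iC * s)) k%:~R * cexp (- (pi%:Co * s ^+ 2)).

Lemma iC2 : iC * iC = -1.
Proof. by apply: complex_ext; rewrite ?cReM ?cImM /=; ring. Qed.

Lemma ipE x : ip x = iC * (2 * pi * x)%:Co.
Proof. by apply: complex_ext; rewrite /ip ?cReM ?cImM /=; ring. Qed.

(** Completing the square: a character only shifts s, so [riemann_inv] applies to each frequency
    separately. *)
Lemma gE_e1 g s x (k : int) : g != 0 ->
  gE g s x * e1 (- (k%:~R * x)) = hatE g s k * gE g (s + iC * (k%:~R : R)%:Co / g) x.
Proof.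
move=> g0; rewrite /hatE /gE /e1 -!cexpD ipE.
have -> : (2 * pi * - (k%:~R * x))%:Co = - (2 * pi%:Co * (k%:~R : R)%:Co * x%:Co) :> C.
  by rewrite mulrN rmorphN !rmorphM /= rmorph_nat; ring.
congr cexp; set P := pi%:Co; set X := x%:Co; set K := (k%:~R)%:Co.
have i2 : iC ^+ 2 = -1 by rewrite expr2 iC2.
have -> : P * (g * X + (s + iC * K / g)) ^+ 2 =
   P * (g * X + s) ^+ 2 + 2 * P * iC * K * X + 2 * P * iC * K * s / g + P * iC ^+ 2 * K ^+ 2 / g ^+ 2.
  by field.
have -> : P * (g^-1 * K - iC * s) ^+ 2 = P * K ^+ 2 / g ^+ 2 - 2 * P * iC * K * s / g + P * iC ^+ 2 * s ^+ 2.
  by field.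
rewrite i2; field; exact: g0.
Qed.

Lemma cone_neq0 g : cone g -> g != 0.
Proof. by apply: contraTneq => ->; rewrite /cone /= normr0 ltxx. Qed.

Lemma coneV g : cone g -> cone g^-1.
Proof.
move=> cg; have g0 := cone_neq0 cg; move: cg; rewrite /cone.
have n0 : 0 < Re g ^+ 2 + Im g ^+ 2 by rewrite -cn_sqr exprn_gt0// cn_gt0.
have -> : g^-1 = Complex (Re g / (Re g ^+ 2 + Im g ^+ 2)) (- Im g / (Re g ^+ 2 + Im g ^+ 2)).
  by case: g {g0 n0} => a b /=; rewrite mulNr.
rewrite [Re (Complex _ _)]/= [Im (Complex _ _)]/= normrM normrN (ger0_norm (x := _^-1)); last by rewrite invr_ge0 ltW.
by move=> h; rewrite ltr_pM2r// invr_gt0.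
Qed.

Lemma cone1 : cone (1 : C).
Proof. by rewrite /cone /= normr0 ltr01. Qed.

Lemma bsum_hatE g s : cone g -> bsum (hatE g s).
Proof.
move=> /coneV cg; have := @bsum_gE R g^-1 (- (iC * s)) 1 cg; rewrite ltr01 lexx => /(_ isT) b.
apply: rbsum_le (rbsumZ (cn_ge0 (cexp (- (pi%:Co * s ^+ 2)))) b) => k.
by rewrite /hatE cnM mulrC /mesh mulr1.
Qed.

Lemma Rs10_bound h : 0 < h <= 1 -> cn (Rs h 1 0 : C) <= gauss_const (pi : R).
Proof.
move=> hh; have h0 : 0 < h by case/andP: hh.
have b := bsum_gE 0 cone1 hh.
rewrite /Rs cnM cn_real ger0_norm ?(ltW h0)// -ler_pdivlMl//.
apply: (hassum_le (bsumP b)) => t ut; rewrite ler_pdivlMl//.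
apply: le_trans (gauss_int (@pi_gt0 R) hh ut); rewrite ler_pM2l//; apply: ler_sum => j _.
rewrite /gE cn_cexp ler_expR addr0 mul1r -rmorphXn -rmorphM cReN /= /mesh//.
Qed.

Definition hN (m : nat) : R := m.*2.+1%:R^-1.

Lemma hN_bound m : 0 < hN m <= 1.
Proof. by rewrite /hN invr_gt0 ltr0n /= invf_le1 ?ltr0n// ler1n. Qed.

Lemma hN_small (e : R) : 0 < e -> exists m0, forall m, (m0 <= m)%N -> hN m <= e.
Proof.
move=> e0; exists (Num.truncn e^-1).+1 => m mm.
rewrite /hN -[e]invrK lef_pV2 ?posrE ?invr_gt0 ?ltr0n//.
apply: ltW; apply: (lt_le_trans (truncnS_gt _)); rewrite ler_nat.
by apply: (leq_trans mm); rewrite -addnn -addSn leq_addl.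
Qed.

Lemma eventually_seq (I : eqType) (P : I -> nat -> Prop) (s : seq I) :
  (forall i, exists m0, forall m, (m0 <= m)%N -> P i m) ->
  exists m0, forall m, (m0 <= m)%N -> forall i, i \in s -> P i m.
Proof.
move=> H; elim: s => [|i s [m0 IH]]; first by exists 0%N.
have [m1 H1] := H i; exists (maxn m0 m1) => m; rewrite geq_max => /andP[h0 h1] j.
by rewrite inE => /orP[/eqP ->|js]; [exact: H1|exact: IH].
Qed.

(** Dominated convergence in k: for fixed k the Fourier coefficient of the Riemann sum is compared
    with [hatE] by [riemann_inv], and [fourier_decay] gives a summable bound for |k| <= m. The
    Riemann sum of exp(-pi x^2) stays as an unevaluated factor. *)
Lemma poisson_approx g s : cone g -> forall e : R, 0 < e -> exists m0, forall m, (m0 <= m)%N ->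
  cn (tsum (fun z : int => gE g s z%:~R) - Rs (hN m) 1 0 / g * tsum (hatE g s)) <= e.
Proof.
move=> cg e e0; have g0 := cone_neq0 cg.
have gp : 0 < cn g by rewrite cn_gt0.
pose T m k := hatE g s k * Rs (hN m) g (s + iC * (k%:~R : R)%:Co / g).
have TE m k : T m k = (hN m)%:Co * tsum (fun j => gE g s (mesh (hN m) j) * e1 (- (k%:~R * mesh (hN m) j))).
  rewrite /T /Rs mulrCA; congr (_ * _); symmetry; apply: tsumP.
  have b := bsum_gE (s + iC * (k%:~R : R)%:Co / g) cg (hN_bound m).
  by apply: hassum_ext (hassumZ _ (bsumP b)) => j; rewrite gE_e1.
have aE m : tsum (fun z : int => gE g s z%:~R) = \sum_(k <- window m) T m k.
  under eq_bigr do rewrite TE.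
  have := finite_fourier m (bsum_gE s cg (hN_bound m)); rewrite /= -/(hN m) => ->.
  apply: eq_tsum => z; rewrite /mesh intrM -mulrA -pmulrn /hN divff ?mulr1//.
  by rewrite pnatr_eq0.
pose r m : C := Rs (hN m) 1 0.
pose G : R := gauss_const pi.
have rG m : cn (r m) <= G by apply: Rs10_bound; exact: hN_bound.
have G0 : 0 <= G by apply: le_trans (rG 0%N); exact: cn_ge0.
have be := bsum_hatE s cg.
have T_lim k : forall e, 0 < e -> exists m0, forall m, (m0 <= m)%N -> cn (T m k - hatE g s k * (r m / g)) <= e.
  move=> d d0; have [K [K0 [N0 HN]]] := riemann_inv (s + iC * (k%:~R : R)%:Co / g) cg.
  pose c := cn (hatE g s k) * K / cn g + 1.
  have c0 : 0 < c by rewrite ltr_wpDl// divr_ge0 ?mulr_ge0 ?cn_ge0.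
  have [m0 Hm0] := hN_small (divr_gt0 d0 c0).
  exists (maxn m0 N0) => m; rewrite geq_max => /andP[h0 h1].
  have NN : (N0 <= m.*2.+1)%N by apply: (leq_trans h1); rewrite -addnn -addnS leq_addr.
  have := HN _ NN (ltn0Sn _); rewrite -/(hN m) -/(r m) => HH.
  rewrite /T -mulrBr cnM.
  have -> : Rs (hN m) g (s + iC * (k%:~R)%:Co / g) - r m / g =
     (g * Rs (hN m) g (s + iC * (k%:~R)%:Co / g) - r m) / g by field.
  rewrite cnM cnV.
  apply: (@le_trans _ _ (cn (hatE g s k) * (K * hN m / cn g))).
    by rewrite ler_wpM2l ?cn_ge0// ler_wpM2r ?invr_ge0 ?cn_ge0.
  have := Hm0 m h0; rewrite ler_pdivlMr// => H1.
  apply: le_trans H1; rewrite (_ : _ * _ = hN m * (cn (hatE g s k) * K / cn g)); last by ring.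
  by rewrite ler_wpM2l// /c ?lerDl// ltW//; case/andP: (hN_bound m).
have [K [K0 [h0 h00 HK]]] := fourier_decay s cg.
have [m1 Hm1] := hN_small h00.
(* Dominates the error at every frequency k != 0. At k = 0 the inverse square is 0 by convention, so
   0 is put into the finite set [S] treated by termwise limits. *)
pose D k := K * (k%:~R : R) ^- 2 + G / cn g * cn (hatE g s k).
have D0 k : 0 <= D k.
  by rewrite addr_ge0// mulr_ge0 ?invr_ge0 ?sqr_ge0 ?cn_ge0// divr_ge0 ?cn_ge0.
have bD : rbsum D.
  apply: rbsumD; first exact: (rbsumZ K0 (rbsum_invsq R)).
  by apply: rbsumZ => //; rewrite divr_ge0 ?cn_ge0.
have Dom m k : (m1 <= m)%N -> k \in window m -> k != 0 -> cn (T m k - hatE g s k * (r m / g)) <= D k.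
  move=> mm kw k0; apply: (le_trans (cnB _ _)); apply: lerD.
    rewrite TE; apply: HK => //.
    - by rewrite Hm1// andbT; case/andP: (hN_bound m).
    - by case/andP: (hN_bound m).
    - rewrite mem_window in kw; rewrite /hN normrM -absz_intr (ger0_norm (x := _^-1)) ?invr_ge0//.
      rewrite ler_pdivrMr ?ltr0n//.
      have : (`|k|%N%:R : R) * 2 <= m.*2.+1%:R by rewrite -natrM ler_nat; lia.
      by lra.
  rewrite cnM cnM cnV mulrC ler_wpM2r ?cn_ge0// ler_wpM2r ?invr_ge0 ?cn_ge0//.
have e3 : 0 < e / 3 by rewrite divr_gt0.
have [s0 Hs0] := rbsum_tail D0 bD e3.
pose S := undup (0 :: s0).
have kS : 0 < (size S).+1%:R :> R by rewrite ltr0n.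
have e4 : 0 < e / 3 / (size S).+1%:R by rewrite divr_gt0.
have [m2 Hm2] := eventually_seq S (fun k => T_lim k _ e4).
have Gg : 0 < G / cn g + 1 by rewrite ltr_wpDl// divr_ge0 ?cn_ge0.
have [s1 Hs1] := bsumP be (divr_gt0 e3 Gg).
exists (maxn m1 (maxn m2 (\max_(k <- s1) `|k|%N))) => m.
rewrite !geq_max => /and3P[h1 h2 h3].
rewrite (aE m) -/(r m).
have -> : \sum_(k <- window m) T m k - r m / g * tsum (hatE g s) =
   \sum_(k <- window m) (T m k - hatE g s k * (r m / g))
   + (r m / g) * (\sum_(k <- window m) hatE g s k - tsum (hatE g s)).
  by rewrite sumrB -mulr_suml; ring.
apply: (le_trans (cnD _ _)); rewrite [X in _ <= X](_ : e = (e / 3 + e / 3) + e / 3); last by field.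
apply: lerD; last first.
  rewrite cnM cnM cnV.
  have H := Hs1 (window m) (window_uniq m).
  have {}H : cn (\sum_(k <- window m) hatE g s k - tsum (hatE g s)) <= e / 3 / (G / cn g + 1).
    apply: H => k ks; rewrite mem_window; apply: leq_trans h3.
    exact: (@leq_bigmax_seq _ _ predT absz).
  move: H; rewrite ler_pdivlMr// => H; apply: le_trans H; rewrite mulrC.
  rewrite ler_wpM2l ?cn_ge0//; apply: (@le_trans _ _ (G / cn g)); last by rewrite lerDl.
  by rewrite ler_wpM2r ?invr_ge0 ?cn_ge0.
rewrite (bigID (mem S)) /=; apply: (le_trans (cnD _ _)); apply: lerD.
  apply: (le_trans (cn_sum _ _ _)); rewrite -big_filter.
  apply: (@le_trans _ _ (\sum_(k <- [seq k <- window m | k \in S]) (e / 3 / (size S).+1%:R))).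
    rewrite big_seq [X in _ <= X]big_seq; apply: ler_sum => k.
    by rewrite mem_filter => /andP[kS' _]; apply: Hm2.
  rewrite big_const_seq count_predT iter_addr_0 -[X in X <= _]mulr_natr.
  rewrite -[X in _ <= X]mulr1 -mulrA ler_wpM2l ?(ltW e3)// mulrC ler_pdivrMr// mul1r ler_nat.
  rewrite leqW//; apply: uniq_leq_size; first by rewrite filter_uniq ?window_uniq.
  by move=> k; rewrite mem_filter => /andP[].
apply: (le_trans (cn_sum _ _ _)).
apply: (@le_trans _ _ (\sum_(k <- window m | k \notin S) D k)).
  rewrite big_seq_cond [X in _ <= X]big_seq_cond; apply: ler_sum => k /andP[kw kS'].
  apply: Dom => //; apply: contra kS' => /eqP ->; by rewrite mem_undup inE eqxx.
rewrite -big_filter; apply: Hs0; first by rewrite filter_uniq ?window_uniq.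
move=> k; rewrite mem_filter => /andP[kS' _]; apply: contra kS' => ks.
by rewrite mem_undup inE ks orbT.
Qed.

Lemma gE10 x : gE 1 0 x = (expR (- (pi * x ^+ 2)))%:Co :> C.
Proof. by rewrite /gE addr0 mul1r -rmorphXn -rmorphM -rmorphN cexp_real. Qed.

(** Evaluation of the Gaussian integral: for g = 1 and s = 0 both sides of [poisson_approx] carry
    the same sum a0, so (1 - r) a0 tends to 0 for the Riemann sums r. As all terms of a0 are
    positive and the term at 0 is 1, a0 stays away from 0. *)
Lemma Rs10_lim (e : R) : 0 < e -> exists m0, forall m, (m0 <= m)%N -> cn (Rs (hN m) 1 0 - 1 : C) <= e.
Proof.
move=> e0; pose a0 : C := tsum (fun z : int => gE 1 0 z%:~R).
have b : bsum (fun z : int => gE 1 0 z%:~R : C).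
  have := @bsum_gE R 1 0 1 cone1; rewrite ltr01 lexx => /(_ isT).
  by apply: rbsum_le => j; rewrite /mesh mulr1.
have E : tsum (hatE 1 0) = a0.
  by apply: eq_tsum => k; rewrite /hatE invr1 mulr0 oppr0 expr0n mulr0 oppr0 cexp0 mulr1.
have a1 : 2^-1 <= cn a0.
  have [|t Ht] := bsumP b (_ : 0 < 2^-1); first by rewrite invr_gt0.
  have := Ht (undup (0 :: t)) (undup_uniq _).
  have st : {subset t <= undup (0 :: t)} by move=> x xt; rewrite mem_undup inE xt orbT.
  move=> /(_ st); set S := \sum_(i <- _) _ => H.
  have S1 : 1 <= Re S.
    have RE (j : int) : Re (gE 1 0 j%:~R : C) = expR (- (pi * j%:~R ^+ 2)) by rewrite gE10.
    have m0 : 0 \in undup (0 :: t) by rewrite mem_undup inE eqxx.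
    rewrite /S (big_morph _ (@cReD R) (erefl : Re (0 : C) = 0)) (eq_bigr _ (fun j _ => RE j)).
    rewrite (bigD1_seq _ m0 (undup_uniq _)) [0%:~R]/(0 : R) expr0n mulr0 oppr0 expR0 lerDl sumr_ge0// => j _.
    exact: expR_ge0.
  have h1 := Re_le_cn S; have h2 := ler_norm (Re S).
  have : cn S <= cn (S - a0) + cn a0.
    by rewrite {1}(_ : S = (S - a0) + a0) ?cnD//; ring.
  lra.
have e2 : 0 < e / 2 by rewrite divr_gt0.
have [m0 Hm0] := poisson_approx 0 cone1 e2.
exists m0 => m /Hm0; rewrite E -/a0 divr1.
rewrite (_ : a0 - _ = (1 - Rs (hN m) 1 0) * a0); last by ring.
rewrite cnM cn_distC => H.
have : cn (Rs (hN m) 1 0 - 1 : C) * 2^-1 <= cn (Rs (hN m) 1 0 - 1 : C) * cn a0.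
  by rewrite ler_wpM2l ?cn_ge0.
by move=> H2; have := le_trans H2 H; lra.
Qed.

Theorem poisson1 g s : cone g ->
  tsum (fun z : int => gE g s z%:~R) = g^-1 * tsum (hatE g s).
Proof.
move=> cg; apply/eqP; rewrite -subr_eq0; apply/eqP; apply: cn_le0 => e e0.
have e2 : 0 < e / 2 by rewrite divr_gt0.
set A := tsum (fun z : int => _); set B := tsum (hatE g s).
pose k := cn (g^-1 * B) + 1.
have k0 : 0 < k by rewrite ltr_wpDl ?cn_ge0.
have [m0 H0] := poisson_approx s cg e2.
have [m1 H1] := Rs10_lim (divr_gt0 e2 k0).
have := H0 _ (leq_maxl m0 m1); have := H1 _ (leq_maxr m0 m1).
set r := Rs _ _ _ => h1 h2.
have -> : A - g^-1 * B = (A - r / g * B) + (r - 1) * (g^-1 * B) by ring.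
apply: (le_trans (cnD _ _)); rewrite [X in _ <= X](_ : e = e / 2 + e / 2); last by field.
apply: lerD => //; rewrite cnM.
move: h1; rewrite ler_pdivlMr// => h1; apply: le_trans h1.
by rewrite ler_wpM2l ?cn_ge0// /k lerDl.
Qed.

End PoissonOneMain.

Section RealEmbedding.
Variable R : realType.
Implicit Types x y : R.
Lemma coM x y : (x * y)%:Co = x%:Co * y%:Co. Proof. exact: rmorphM. Qed.
Lemma coD x y : (x + y)%:Co = x%:Co + y%:Co. Proof. exact: rmorphD. Qed.
Lemma coB x y : (x - y)%:Co = x%:Co - y%:Co. Proof. exact: rmorphB. Qed.
Lemma coN x : (- x)%:Co = - x%:Co. Proof. exact: rmorphN. Qed.
Lemma coX x n : (x ^+ n)%:Co = x%:Co ^+ n. Proof. exact: rmorphXn. Qed.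
Lemma coV x : (x^-1)%:Co = x%:Co^-1. Proof. exact: fmorphV. Qed.
Lemma co_nat n : (n%:R : R)%:Co = n%:R. Proof. exact: rmorph_nat. Qed.
End RealEmbedding.

(** * Poisson summation on selfdual lattices *)

Section DotProduct.
Variable R : realType.

Lemma dotE n (x y : 'rV[R]_n) : dot x y = (x *m y^T) ord0 ord0.
Proof. by rewrite /dot mxE; apply: eq_bigr => i _; rewrite mxE. Qed.
Lemma dotC n (x y : 'rV[R]_n) : dot x y = dot y x.
Proof. by rewrite /dot; apply: eq_bigr => i _; rewrite mulrC. Qed.
Lemma dotDl n (x y z : 'rV[R]_n) : dot (x + y) z = dot x z + dot y z.
Proof. by rewrite !dotE mulmxDl mxE. Qed.
Lemma dotDr n (x y z : 'rV[R]_n) : dot x (y + z) = dot x y + dot x z.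
Proof. by rewrite dotC dotDl !(dotC x). Qed.
Lemma dotZl n (a : R) (x y : 'rV[R]_n) : dot (a *: x) y = a * dot x y.
Proof. by rewrite !dotE -scalemxAl mxE. Qed.
Lemma dotZr n (a : R) (x y : 'rV[R]_n) : dot x (a *: y) = a * dot x y.
Proof. by rewrite dotC dotZl dotC. Qed.
Lemma dotNl n (x y : 'rV[R]_n) : dot (- x) y = - dot x y.
Proof. by rewrite -scaleN1r dotZl mulN1r. Qed.
Lemma dotNr n (x y : 'rV[R]_n) : dot x (- y) = - dot x y.
Proof. by rewrite dotC dotNl dotC. Qed.
Lemma dotBl n (x y z : 'rV[R]_n) : dot (x - y) z = dot x z - dot y z.
Proof. by rewrite dotDl dotNl. Qed.
Lemma dot0l n (x : 'rV[R]_n) : dot 0 x = 0.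
Proof. by rewrite -(scale0r 0) dotZl mul0r. Qed.
Lemma dot0r n (x : 'rV[R]_n) : dot x 0 = 0.
Proof. by rewrite dotC dot0l. Qed.
Lemma dot_mulmx n m (x : 'rV[R]_n) (y : 'rV[R]_m) (A : 'M[R]_(n, m)) : dot (x *m A) y = dot x (y *m A^T).
Proof. by rewrite !dotE trmx_mul trmxK mulmxA. Qed.
Lemma nrm_ge0 n (x : 'rV[R]_n) : 0 <= nrm x.
Proof. by apply: sumr_ge0 => i _; rewrite -expr2 sqr_ge0. Qed.
Lemma nrm_eq0 n (x : 'rV[R]_n) : nrm x = 0 -> x = 0.
Proof.
move=> h; apply/rowP => i; rewrite mxE; apply/eqP; rewrite -sqrf_eq0 eq_le sqr_ge0 andbT.
rewrite -h /nrm /dot (bigD1 i)//= -expr2 lerDl sumr_ge0// => j _.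
by rewrite -expr2 sqr_ge0.
Qed.
Lemma nrmD n (x y : 'rV[R]_n) : nrm (x + y) = nrm x + 2 * dot x y + nrm y.
Proof. by rewrite /nrm !dotDl !dotDr (dotC y x); ring. Qed.
Lemma nrmN n (x : 'rV[R]_n) : nrm (- x) = nrm x.
Proof. by rewrite /nrm dotNl dotNr opprK. Qed.
Lemma nrmB n (x y : 'rV[R]_n) : nrm (x - y) = nrm x - 2 * dot x y + nrm y.
Proof. by rewrite nrmD nrmN dotNr mulrN. Qed.
Lemma nrmZ n (a : R) (x : 'rV[R]_n) : nrm (a *: x) = a ^+ 2 * nrm x.
Proof. by rewrite /nrm dotZl dotZr mulrA expr2. Qed.
Lemma nrm0 n : nrm (0 : 'rV[R]_n) = 0.
Proof. exact: dot0l. Qed.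

Lemma dot_row n (a b : R) (x y : 'rV[R]_n) :
  dot (row_mx a%:M x : 'rV_(1 + n)) (row_mx b%:M y) = a * b + dot x y.
Proof. by rewrite !dotE tr_row_mx mul_row_col mxE tr_scalar_mx -scalar_mxM mxE eqxx. Qed.

Definition qf n (G : 'M[R]_n) (x : 'rV[R]_n) : R := dot (x *m G) x.

Definition zR n (z : 'rV[int]_n) : 'rV[R]_n := map_mx (fun k : int => k%:~R) z.

Lemma zRD n (z w : 'rV[int]_n) : zR (z + w) = zR z + zR w.
Proof. by apply/rowP => i; rewrite !mxE intrD. Qed.
Lemma zRN n (z : 'rV[int]_n) : zR (- z) = - zR z.
Proof. by apply/rowP => i; rewrite !mxE mulrNz. Qed.
Lemma zR0 n : zR (0 : 'rV[int]_n) = 0.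
Proof. by apply/rowP => i; rewrite !mxE. Qed.
Lemma zR_inj n : injective (@zR n).
Proof.
move=> z w /rowP h; apply/rowP => i; have := h i; rewrite !mxE => /eqP.
by rewrite eqr_int => /eqP.
Qed.
Lemma zR_row n (a : int) (z : 'rV[int]_n) : zR (row_mx a%:M z : 'rV_(1 + n)) = row_mx (a%:~R)%:M (zR z).
Proof.
rewrite /zR map_row_mx; congr row_mx; apply/matrixP => i j; rewrite !mxE.
by case: eqP => _; rewrite ?mulr1n ?mulr0n.
Qed.

Definition pairZ n (p : int * 'rV[int]_n) : 'rV[int]_(1 + n) := row_mx p.1%:M p.2.
Definition unpairZ n (z : 'rV[int]_(1 + n)) : int * 'rV[int]_n := (lsubmx z ord0 ord0, rsubmx z).
Lemma pairZK n : cancel (@pairZ n) (@unpairZ n).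
Proof. by case=> a z; rewrite /unpairZ /pairZ row_mxKl row_mxKr mxE eqxx. Qed.
Lemma unpairZK n : cancel (@unpairZ n) (@pairZ n).
Proof. by move=> z; rewrite /unpairZ /pairZ /= -mx11_scalar hsubmxK. Qed.

Lemma row_split n (x : 'rV[R]_(1 + n)) : x = row_mx (lsubmx x ord0 ord0)%:M (rsubmx x).
Proof. by rewrite -mx11_scalar hsubmxK. Qed.

Lemma rbsum_gauss_rV n (c : R) : 0 < c -> rbsum (fun z : 'rV[int]_n => expR (- (c * nrm (zR z)))).
Proof.
move=> c0; elim: n => [|n IH].
  exists 1 => s us.
  have : (size s <= 1)%N.
    case: s us => [|a [|b s]] //=; rewrite inE negb_or -andbA => /andP[+ _].
    by rewrite (_ : a = b) ?eqxx//; apply/rowP => -[].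
  case: s us => [|a [|]] //= _ _; rewrite ?big_nil ?ler01// big_seq1.
  by rewrite -expR0 ler_expR oppr_le0 mulr_ge0 ?nrm_ge0 ?(ltW c0).
have H := bsum_prodM (fun j => expR_ge0 _) (fun z => expR_ge0 _) (rbsum_gauss c0) IH.
have := rbsum_inj (can_inj (@unpairZK n)) H.
apply: rbsum_le => z /=; rewrite -expRD ler_expR.
rewrite -{1}(unpairZK z) /pairZ zR_row /nrm dot_row.
by rewrite -expr2 mulrDr opprD.
Qed.

Lemma rbsum_gauss_shift n (c : R) (u : 'rV[R]_n) : 0 < c ->
  rbsum (fun z : 'rV[int]_n => expR (- (c * nrm (zR z + u)))).
Proof.
move=> c0; have c2 : 0 < c / 2 by rewrite divr_gt0.
apply: rbsum_le (rbsumZ (expR_ge0 (c * nrm u)) (rbsum_gauss_rV n c2)) => z.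
rewrite -expRD ler_expR.
have h : nrm (zR z) / 2 - nrm u <= nrm (zR z + u).
  have := nrm_ge0 (zR z + 2 *: u); rewrite !nrmD nrmZ dotZr; lra.
have := ler_wpM2l (ltW c0) h; lra.
Qed.

End DotProduct.

(** * Poisson summation for positive definite quadratic forms *)

Section PoissonN.
Variable R : realType.
Local Notation C := R[i].
Implicit Types (g w : C).

Definition posform n (q : 'rV[R]_n -> R) := exists2 d : R, 0 < d & forall x, d * nrm x <= q x.

Definition LT n w (q : 'rV[R]_n -> R) (u v : 'rV[R]_n) (z : 'rV[int]_n) : C :=
  cexp (- (pi%:Co * w * (q (zR R z + u))%:Co)) * e1 (dot v (zR R z)).
Definition RT n w (q : 'rV[R]_n -> R) (u v : 'rV[R]_n) (k : 'rV[int]_n) : C :=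
  cexp (- (pi%:Co * w * (q (zR R k - v))%:Co)) * e1 (dot (zR R k - v) u).

Lemma Re_piM w (x : R) : Re (- (pi%:Co * w * x%:Co)) = - (pi * Re w * x).
Proof. by rewrite cReN !cReM /= cImM /=; ring. Qed.

Lemma cn_cexp_pi w (x : R) : cn (cexp (- (pi%:Co * w * x%:Co))) = expR (- (pi * Re w * x)).
Proof. by rewrite cn_cexp Re_piM. Qed.

Lemma rbsum_form n w (q : 'rV[R]_n -> R) u : 0 < Re w -> posform q ->
  rbsum (fun z : 'rV[int]_n => expR (- (pi * Re w * q (zR R z + u)))).
Proof.
move=> w0 [d d0 Hd]; have p0 := @pi_gt0 R.
have c0 : 0 < pi * Re w * d by rewrite !mulr_gt0.
apply: rbsum_le (rbsum_gauss_shift u c0) => z; rewrite ler_expR lerN2 -[X in X <= _]mulrA.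
by rewrite ler_wpM2l// ltW// mulr_gt0.
Qed.

Lemma bsum_LT n w (q : 'rV[R]_n -> R) u v : 0 < Re w -> posform q -> bsum (LT w q u v).
Proof.
move=> w0 pq; apply: rbsum_le (rbsum_form u w0 pq) => z.
by rewrite /LT cnM cn_e1 mulr1 cn_cexp_pi.
Qed.

Lemma bsum_RT n w (q : 'rV[R]_n -> R) u v : 0 < Re w -> posform q -> bsum (RT w q u v).
Proof.
move=> w0 pq; apply: rbsum_le (rbsum_form (- v) w0 pq) => z.
by rewrite /RT cnM cn_e1 mulr1 cn_cexp_pi.
Qed.

Lemma cone_sqr_Re g : cone g -> 0 < Re (g ^+ 2).
Proof.
rewrite /cone expr2 cReM => h.
have -> : Re g * Re g - Im g * Im g = (Re g - `|Im g|) * (Re g + `|Im g|).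
  have : `|Im g| ^+ 2 = Im g ^+ 2 by rewrite real_normK ?num_real.
  by rewrite !expr2 => E; rewrite -E; ring.
by have := normr_ge0 (Im g) => h0; rewrite mulr_gt0//; lra.
Qed.

Lemma cone_sqrV_Re g : cone g -> 0 < Re (g ^- 2).
Proof. by move=> /coneV /cone_sqr_Re; rewrite exprVn. Qed.

Lemma coneZ g (a : R) : 0 < a -> cone g -> cone (a%:Co * g).
Proof.
move=> a0; rewrite /cone => h.
rewrite (_ : Im _ = a * Im g); last by rewrite cImM /=; ring.
rewrite (_ : Re (_ * _) = a * Re g); last by rewrite cReM /=; ring.
by rewrite normrM (ger0_norm (ltW a0)) ltr_pM2l.
Qed.

Lemma poisson_line g (c u v : R) : cone g -> 0 < c ->
  hassum (fun k : int => cexp (- (pi%:Co * g ^- 2 * ((k%:~R - v) ^+ 2 / c)%:Co)) * e1 ((k%:~R - v) * u))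
   (g * (Num.sqrt c)%:Co * tsum (fun z : int => cexp (- (pi%:Co * g ^+ 2 * (c * (z%:~R + u) ^+ 2)%:Co)) * e1 (v * z%:~R))).
Proof.
move=> cg c0; have r0 : 0 < Num.sqrt c by rewrite sqrtr_gt0.
pose h := (Num.sqrt c)%:Co * g.
have ch : cone h by exact: coneZ.
have h0 := cone_neq0 ch; have g0 := cone_neq0 cg.
have rc : (Num.sqrt c)%:Co ^+ 2 = c%:Co :> C by rewrite -rmorphXn /= sqr_sqrtr ?ltW.
have h2 : h ^+ 2 = c%:Co * g ^+ 2 by rewrite exprMn rc.
pose iC := Complex 0 1 : C.
have i2 : iC ^+ 2 = -1 by rewrite expr2 /iC iC2.
(* Completing the square absorbs the translation u and the character v into the complex shift [s],
   at the price of the constant factor [t]. *)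
pose s := h * u%:Co - iC * v%:Co / h.
pose t := cexp (- (2 * pi%:Co * iC * v%:Co * u%:Co) - pi%:Co * v%:Co ^+ 2 / h ^+ 2).
have cC : c%:Co != 0 :> C by rewrite -cn_gt0 cn_real normr_gt0 gt_eqF.
have ipC x : ip x = 2 * pi%:Co * iC * x%:Co.
  by rewrite ipE -/iC !rmorphM rmorph_nat /=; ring.
have E1 (z : int) : cexp (- (pi%:Co * g ^+ 2 * (c * (z%:~R + u) ^+ 2)%:Co)) * e1 (v * z%:~R) = t * gE h s z%:~R.
  rewrite /t /gE /e1 -!cexpD ipC; congr cexp.
  rewrite (coM c) (coX (_ + u)) (coM v) (coD z%:~R); set Z := (z%:~R)%:Co; set U := u%:Co; set V := v%:Co; set P := (pi : R)%:Co.
  have -> : P * g ^+ 2 * (c%:Co * (Z + U) ^+ 2) = P * h ^+ 2 * (Z + U) ^+ 2 by rewrite h2; ring.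
  have -> : P * (h * Z + s) ^+ 2 = P * h ^+ 2 * (Z + U) ^+ 2 - 2 * P * iC * V * (Z + U) + P * iC ^+ 2 * V ^+ 2 / h ^+ 2.
    by rewrite /s; field.
  by rewrite i2; field.
have E2 (k : int) : cexp (- (pi%:Co * g ^- 2 * ((k%:~R - v) ^+ 2 / c)%:Co)) * e1 ((k%:~R - v) * u) = t * hatE h s k.
  rewrite /t /hatE /gE /e1 -!cexpD ipC; congr cexp.
  rewrite (coM (_ ^+ 2)) (coX (_ - v)) coV (coM (_ - v)) (coB k%:~R); set K := (k%:~R)%:Co; set U := u%:Co; set V := v%:Co; set P := (pi : R)%:Co.
  have -> : P * g ^- 2 * ((K - V) ^+ 2 / c%:Co) = P * (K - V) ^+ 2 / h ^+ 2.
    by rewrite h2; field; rewrite g0 cC.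
  have -> : P * (h^-1 * K - Complex 0 1 * s) ^+ 2 = P * K ^+ 2 / h ^+ 2 - 2 * P * iC * K * U
     + 2 * P * iC ^+ 2 * K * V / h ^+ 2 + P * iC ^+ 2 * s ^+ 2.
    by rewrite -/iC /s; field.
  have -> : P * s ^+ 2 = P * h ^+ 2 * U ^+ 2 - 2 * P * iC * U * V + P * iC ^+ 2 * V ^+ 2 / h ^+ 2.
    by rewrite /s; field.
  have -> : P * iC ^+ 2 * s ^+ 2 = iC ^+ 2 * (P * h ^+ 2 * U ^+ 2 - 2 * P * iC * U * V + P * iC ^+ 2 * V ^+ 2 / h ^+ 2).
    by rewrite /s; field.
  by rewrite i2; field.
have -> : tsum (fun z : int => cexp (- (pi%:Co * g ^+ 2 * (c * (z%:~R + u) ^+ 2)%:Co)) * e1 (v * z%:~R))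
   = t * (h^-1 * tsum (hatE h s)).
  rewrite -poisson1//; apply: tsumP.
  have b : bsum (fun z : int => gE h s z%:~R).
    have := @bsum_gE R h s 1 ch; rewrite ltr01 lexx => /(_ isT).
    by apply: rbsum_le => j; rewrite /mesh mulr1.
  by apply: hassum_ext (hassumZ t (bsumP b)) => z; rewrite E1.
have -> : g * (Num.sqrt c)%:Co * (t * (h^-1 * tsum (hatE h s))) = t * tsum (hatE h s).
  by rewrite (mulrC g) -/h; field.
by apply: hassum_ext (hassumZ t (bsumP (bsum_hatE s ch))) => k; rewrite E2.
Qed.

(** [qs] is the form of the inverse matrix, characterised by its values on [x *m G]. The constant
    [kap] is the square root of det G, but it is kept abstract and determined only for selfdual
    lattices. *)
Definition PS n (G : 'M[R]_n) (qs : 'rV[R]_n -> R) (kap : R) :=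
  [/\ posform qs, 0 < kap, forall x, qs (x *m G) = qf G x &
   forall g u v, cone g ->
     tsum (RT (g ^- 2) qs u v) = kap%:Co * g ^+ n * tsum (LT (g ^+ 2) (qf G) u v)].

(** Induction on the rank: completing the square in the first variable splits the form into a
    one-variable form and a form of smaller rank, coupled through a translation on one side and a
    character on the other. *)
Lemma poisson_form n (G : 'M[R]_n) : G^T = G -> posform (qf G) -> exists qs kap, PS G qs kap.
Proof.
elim: n G => [|n IH] G Gs pG.
  exists (fun _ => 0), 1; split => //.
  - exists 1 => // x; rewrite (_ : x = 0) ?nrm0 ?mulr0//; apply/rowP => -[] //.
  - by move=> x; rewrite /qf (_ : x = 0) ?dot0r//; apply/rowP => -[].
  - move=> g u v cg; rewrite expr0 !mul1r; apply: eq_tsum => z.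
    have u0 (x : 'rV[R]_0) : x = 0 by apply/rowP => -[].
    by rewrite /RT /LT /qf !(u0 (_ *m _)) (u0 v) (u0 u) !dot0l !dot0r rmorph0 !mulr0.
pose Gb : 'M[R]_(1 + n) := G.
pose c0 := ulsubmx Gb ord0 ord0; pose b : 'rV[R]_n := ursubmx Gb; pose G2 : 'M[R]_n := drsubmx Gb.
have Gbs : Gb^T = Gb by exact: Gs.
have Gul : ulsubmx Gb = c0%:M by rewrite -mx11_scalar.
have Gdl : dlsubmx Gb = b^T by rewrite /b trmx_ursub Gbs.
have G2s : G2^T = G2 by rewrite /G2 trmx_drsub Gbs.
have mulG (a : R) (y : 'rV[R]_n) : row_mx a%:M y *m Gb = row_mx (a * c0 + dot y b)%:M (a *: b + y *m G2).
  rewrite -[Gb]submxK mul_row_block Gul Gdl -/b -/G2 !mul_scalar_mx; congr row_mx.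
  rewrite scale_scalar_mx [y *m b^T]mx11_scalar -dotE.
  by rewrite -raddfD.
have [d d0 Hd] := pG.
have cp : 0 < c0.
  have := Hd (row_mx 1%:M 0); rewrite /qf mulG mul0mx addr0 !dot_row dot0l !dot0r !addr0 /nrm !dot_row dot0l addr0 !mulr1 mul1r.
  exact: lt_le_trans.
pose c := c0^-1 *: b.
(* Schur complement of the corner entry, the form left in the other variables. *)
pose G1 := G2 - c0^-1 *: (b^T *m b).
have qG1 y : qf G1 y = qf G2 y - c0^-1 * dot y b ^+ 2.
  rewrite /qf /G1 mulmxBr -scalemxAr dotBl dotZl mulmxA [y *m b^T]mx11_scalar -dotE mul_scalar_mx dotZl.
  by rewrite (dotC b y) expr2.
have qG (a : R) y : qf Gb (row_mx a%:M y) = c0 * (a + dot c y) ^+ 2 + qf G1 y.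
  rewrite qG1 {1}/qf mulG dot_row dotDl dotZl -/(qf G2 y) /c dotZl (dotC b y).
  by field; rewrite gt_eqF.
have G1s : G1^T = G1.
  by rewrite /G1 linearB /= G2s linearZ /= trmx_mul trmxK.
have pG1 : posform (qf G1).
  exists d => // y; have := Hd (row_mx (- dot c y)%:M y).
  rewrite [qf G _]qG addNr expr0n mulr0 add0r => H; apply: le_trans H.
  rewrite ler_pM2l// /nrm dot_row -expr2.
  by rewrite lerDr sqr_ge0.
have [qs1 [k1 [pq1 k10 qG1' H1]]] := IH G1 G1s pG1.
pose qs (k : 'rV[R]_(1 + n)) := lsubmx k ord0 ord0 ^+ 2 / c0 + qs1 (rsubmx k - lsubmx k ord0 ord0 *: c).
have qsE a y : qs (row_mx a%:M y) = a ^+ 2 / c0 + qs1 (y - a *: c).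
  by rewrite /qs row_mxKl row_mxKr mxE eqxx.
have pqs : posform qs.
  have [d1 d10 Hd1] := pq1.
  pose N := nrm c; have N0 : 0 <= N by exact: nrm_ge0.
  have k0 : 0 < c0 * (1 + 2 * N) by rewrite mulr_gt0//; lra.
  exists (Num.min (d1 / 2) (c0 * (1 + 2 * N))^-1).
    by rewrite lt_min divr_gt0//= invr_gt0.
  move=> k; rewrite [k](@row_split R n) qsE; set a := lsubmx _ _ _; set y := rsubmx k.
  rewrite /nrm dot_row -/(nrm y) -expr2.
  set de := Num.min _ _.
  have de0 : 0 <= de by rewrite le_min invr_ge0 (ltW k0) andbT divr_ge0// ltW.
  have de1 : de <= d1 / 2 by rewrite ge_min lexx.
  have de2 : de <= (c0 * (1 + 2 * N))^-1 by rewrite ge_min lexx orbT.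
  have h1 := Hd1 (y - a *: c).
  set A := nrm (y - a *: c) in h1.
  have A0 : 0 <= A by exact: nrm_ge0.
  have h2 : nrm y <= 2 * A + 2 * (a ^+ 2 * N).
    have := nrm_ge0 (y - a *: c - a *: c); rewrite -/A.
    have -> : nrm y = nrm ((y - a *: c) + a *: c) by rewrite subrK.
    rewrite nrmB (nrmD (y - a *: c)) -/A nrmZ -/N; lra.
  apply: (@le_trans _ _ (de * (2 * A) + de * (a ^+ 2 * (1 + 2 * N)))).
    by rewrite -mulrDr ler_wpM2l//; lra.
  rewrite addrC; apply: lerD.
    apply: (@le_trans _ _ ((c0 * (1 + 2 * N))^-1 * (a ^+ 2 * (1 + 2 * N)))).
      by rewrite ler_wpM2r// mulr_ge0 ?sqr_ge0//; lra.
    rewrite le_eqVlt; apply/orP; left; apply/eqP; field.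
    by apply/andP; split; rewrite gt_eqF// ltr_wpDr// mulr_ge0.
  apply: le_trans h1; rewrite mulrA ler_wpM2r//; lra.
exists qs, (Num.sqrt c0 * k1); split => //.
- by rewrite mulr_gt0// sqrtr_gt0.
- change (forall x : 'rV[R]_(1 + n), qs (x *m Gb) = qf Gb x).
  move=> x; rewrite (row_split x); set a := lsubmx _ _ _; set y := rsubmx x.
  rewrite mulG qsE qG -qG1' -/c.
  congr (_ + qs1 _).
    by rewrite /c dotZl (dotC b y); field; rewrite gt_eqF.
  rewrite /G1 mulmxBr -scalemxAr mulmxA [y *m b^T]mx11_scalar -dotE mul_scalar_mx.
  rewrite /c scalerDl !scalerA opprD addrACA.
  rewrite (_ : a * c0 / c0 = a); last by field; rewrite gt_eqF.
  by rewrite subrr add0r mulrC.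
change (forall g (u v : 'rV[R]_(1 + n)), cone g -> tsum (RT (g ^- 2) qs u v) =
  (Num.sqrt c0 * k1)%:Co * g ^+ (1 + n) * tsum (LT (g ^+ 2) (qf Gb) u v)).
have pGb : posform (qf Gb) := pG.
move=> g u v cg; have g0 := cone_neq0 cg.
rewrite (row_split u) (row_split v).
set u1 := lsubmx u ord0 ord0; set u2 := rsubmx u; set v1 := lsubmx v ord0 ord0; set v2 := rsubmx v.
set U := row_mx u1%:M u2; set V := row_mx v1%:M v2.
have w0 := cone_sqr_Re cg; have w0' := cone_sqrV_Re cg.
pose E (y : 'rV[int]_n) := LT (g ^+ 2) (qf G1) u2 v2 y.
pose H (k : int) := cexp (- (pi%:Co * g ^- 2 * ((k%:~R - v1) ^+ 2 / c0)%:Co)).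
(* Mixed family, transformed in the first variable only. Summing first over that variable gives the
   left side by [poisson_line]; summing first over the others gives the right side by induction. *)
pose F (p : 'rV[int]_n * int) := E p.1 * (H p.2 * e1 ((p.2%:~R - v1) * (u1 + dot c (zR R p.1 + u2)))).
have bH : bsum H.
  pose q1 (x : 'rV[R]_1) := nrm x / c0.
  have pq : posform q1 by exists c0^-1 => [|x]; rewrite ?invr_gt0// /q1 mulrC.
  have inj1 : injective (fun k : int => (k%:M : 'rV[int]_1)).
    by move=> a a' /matrixP /(_ ord0 ord0); rewrite !mxE eqxx.
  have := rbsum_inj inj1 (rbsum_form (- (v1%:M)) w0' pq).
  apply: rbsum_le => k; rewrite /H cn_cexp_pi ler_expR /q1 /nrm /dot big_ord1 !mxE eqxx /= !mulr1n -expr2.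
  by [].
have bE : bsum E by exact: bsum_LT.
have bF : bsum F.
  apply: rbsum_le (bsum_prodM (fun i => cn_ge0 _) (fun i => cn_ge0 _) bE bH) => p.
  by rewrite /F (cnM (E p.1)) (cnM (H p.2)) cn_e1 mulr1.
pose sc := (Num.sqrt c0)%:Co : C.
have LTp (p : 'rV[int]_n * int) : LT (g ^+ 2) (qf Gb) U V (pairZ (p.2, p.1)) =
    E p.1 * (cexp (- (pi%:Co * g ^+ 2 * (c0 * (p.2%:~R + (u1 + dot c (zR R p.1 + u2))) ^+ 2)%:Co)) * e1 (v1 * p.2%:~R)).
  case: p => y a; rewrite /LT /pairZ /= zR_row /U add_row_mx -raddfD qG /V dot_row e1D.
  rewrite (coD (c0 * _)) mulrDr opprD cexpD /E /LT addrA; ring.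
have RTp (p : int * 'rV[int]_n) : RT (g ^- 2) qs U V (pairZ p) =
    H p.1 * e1 ((p.1%:~R - v1) * (u1 + dot c u2)) * RT (g ^- 2) qs1 u2 (v2 + (p.1%:~R - v1) *: c) p.2.
  case: p => a y; rewrite /RT /pairZ /= zR_row /V /U opp_row_mx add_row_mx -raddfN -raddfD qsE dot_row.
  rewrite (coD (_ / c0)) mulrDr opprD cexpD -/(H a).
  have key (x1 x2 x3 x4 : C) : x1 * x2 * (x3 * x4) = x1 * x3 * (x2 * x4) by ring.
  rewrite [RHS]key -e1D.
  have -> : zR R y - (v2 + (a%:~R - v1) *: c) = zR R y - v2 - (a%:~R - v1) *: c by rewrite opprD addrA.
  by congr (_ * e1 _); rewrite (dotBl (zR R y - v2)) (dotZl (a%:~R - v1)); ring.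
have hF := bsumP bF.
have bL := bsum_LT U V w0 pGb; have bR := bsum_RT U V w0' pqs.
have S1 : tsum F = g * sc * tsum (LT (g ^+ 2) (qf Gb) U V).
  have hL : hassum (fun p : 'rV[int]_n * int => LT (g ^+ 2) (qf Gb) U V (pairZ (p.2, p.1))) (tsum (LT (g ^+ 2) (qf Gb) U V)).
    apply: (@hassum_bij R _ _ _ (fun p : 'rV[int]_n * int => pairZ (p.2, p.1))
       (fun z => ((unpairZ z).2, (unpairZ z).1))) (bsumP bL).
      by case=> y a; rewrite pairZK.
    by move=> z; rewrite -[RHS]unpairZK.
  pose ls (y : 'rV[int]_n) := E y * tsum (fun a : int => cexp (- (pi%:Co * g ^+ 2 * (c0 * (a%:~R + (u1 + dot c (zR R y + u2))) ^+ 2)%:Co)) * e1 (v1 * a%:~R)).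
  have hls : hassum ls (tsum (LT (g ^+ 2) (qf Gb) U V)).
    apply: (hassum_prod hL) => y.
    have bb : bsum (fun a : int => cexp (- (pi%:Co * g ^+ 2 * (c0 * (a%:~R + (u1 + dot c (zR R y + u2))) ^+ 2)%:Co)) * e1 (v1 * a%:~R)).
      pose q1 (x : 'rV[R]_1) := c0 * nrm x.
      have pq : posform q1 by exists c0.
      have inj1 : injective (fun k : int => (k%:M : 'rV[int]_1)).
        by move=> a a' /matrixP /(_ ord0 ord0); rewrite !mxE eqxx.
      have := rbsum_inj inj1 (rbsum_form ((u1 + dot c (zR R y + u2))%:M) w0 pq).
      apply: rbsum_le => k; rewrite cnM cn_e1 mulr1 cn_cexp_pi ler_expR /q1 /nrm /dot big_ord1 !mxE eqxx /= !mulr1n -expr2.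
      by [].
    apply: hassum_ext (hassumZ (E y) (bsumP bb)) => a; by rewrite LTp.
  have hr : hassum (fun y => g * sc * ls y) (tsum F).
    apply: (hassum_prod hF) => y; rewrite /ls mulrCA.
    apply: hassum_ext (hassumZ (E y) (poisson_line (u1 + dot c (zR R y + u2)) v1 cg cp)) => k.
    by rewrite /F.
  exact: hassum_unique hr (hassumZ _ hls).
have S2 : k1%:Co * g ^+ n * tsum F = tsum (RT (g ^- 2) qs U V).
  have hR : hassum (fun p => RT (g ^- 2) qs U V (pairZ p)) (tsum (RT (g ^- 2) qs U V)).
    exact: (@hassum_bij R _ _ _ (@pairZ n) (@unpairZ n) _ (@pairZK n) (@unpairZK n) (bsumP bR)).
  pose rs (k : int) := H k * e1 ((k%:~R - v1) * (u1 + dot c u2)) * tsum (RT (g ^- 2) qs1 u2 (v2 + (k%:~R - v1) *: c)).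
  have hrs : hassum rs (tsum (RT (g ^- 2) qs U V)).
    apply: (hassum_prod hR) => k.
    have bb : bsum (RT (g ^- 2) qs1 u2 (v2 + (k%:~R - v1) *: c)) by exact: bsum_RT.
    apply: hassum_ext (hassumZ _ (bsumP bb)) => y; by rewrite RTp.
  apply: hassum_unique hrs.
  apply: (hassum_prod (hassumZ _ (hassum_swap hF))) => k.
  rewrite /rs H1//.
  have bb : bsum (LT (g ^+ 2) (qf G1) u2 (v2 + (k%:~R - v1) *: c)) by exact: bsum_LT.
  have := hassumZ (H k * e1 ((k%:~R - v1) * (u1 + dot c u2)) * (k1%:Co * g ^+ n)) (bsumP bb).
  rewrite -[X in hassum _ X]mulrA; apply: hassum_ext => y /=.
  have E3 : e1 ((k%:~R - v1) * (u1 + dot c (zR R y + u2))) =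
      e1 ((k%:~R - v1) * (u1 + dot c u2)) * e1 ((k%:~R - v1) * dot c (zR R y)).
    by rewrite -e1D dotDr; congr e1; ring.
  have E4 : e1 (dot (v2 + (k%:~R - v1) *: c) (zR R y)) = e1 (dot v2 (zR R y)) * e1 ((k%:~R - v1) * dot c (zR R y)).
    by rewrite -e1D dotDl (dotZl (k%:~R - v1)).
  by rewrite /F /= /E /LT E3 E4; ring.
by rewrite -S2 S1 (coM (Num.sqrt c0)) -/sc (exprD g 1 n) expr1; ring.
Qed.

End PoissonN.

(** * Uniqueness of power series and exponential moments *)

Section PowerSeriesUnique.
Variable R : realType.
Local Notation C := R[i].

(** If the earlier coefficients vanish, the value 0 at x rho forces |c_k| rho^k <= x M for every x
    in (0, 1], hence c_k = 0. *)
Lemma pser_zero (c : nat -> C) (rho : R) : 0 < rho -> bsum (fun k => c k * rho%:Co ^+ k) ->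
  (forall r, 0 < r <= rho -> hassum (fun k => c k * r%:Co ^+ k) 0) -> forall k, c k = 0.
Proof.
move=> rho0 [M HM] H; elim/ltn_ind => k IH; apply: cn_le0 => e e0.
have M0 : 0 <= M by have := HM [::] isT; rewrite big_nil.
have rk : 0 < rho ^+ k by rewrite exprn_gt0.
suff main x : 0 < x <= 1 -> cn (c k) * rho ^+ k <= x * M.
  pose x := Num.min 1 (e * rho ^+ k / (M + 1)).
  have M1 : 0 < M + 1 by rewrite ltr_wpDl.
  have x0 : 0 < x by rewrite lt_min ltr01 divr_gt0// mulr_gt0.
  have x1 : x <= 1 by rewrite ge_min lexx.
  have := main x; rewrite x0 x1 => /(_ isT) h.
  rewrite -(ler_pM2r rk); apply: (le_trans h).
  have x2 : x <= e * rho ^+ k / (M + 1) by rewrite ge_min lexx orbT.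
  apply: (@le_trans _ _ (e * rho ^+ k / (M + 1) * (M + 1))).
    by rewrite ler_pM ?(ltW x0)// lerDl.
  by rewrite divfK// gt_eqF.
move=> /andP[x0 x1].
have r0 : 0 < x * rho <= rho by rewrite mulr_gt0//= ler_piMl// ltW.
have := hassum_split_nat k.+1 (H _ r0).
rewrite big_nat_recr//= big_nat big1 ?add0r ?sub0r; last by move=> j /andP[_ jk]; rewrite IH// mul0r.
move=> hk.
have xk : 0 < x ^+ k by rewrite exprn_gt0.
have : cn (- (c k * (x * rho)%:Co ^+ k)) <= x ^+ k.+1 * M.
  apply: (hassum_le hk) => s us.
  have us' : uniq [seq (j + k.+1)%N | j <- s] by rewrite map_inj_uniq// => i j /addIn.
  apply: le_trans (ler_wpM2l (exprn_ge0 k.+1 (ltW x0)) (HM _ us')).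
  rewrite big_map mulr_sumr; apply: ler_sum => j _.
  rewrite !cnM !cnX !cn_real !ger0_norm ?mulr_ge0 ?(ltW x0) ?(ltW rho0)// exprMn.
  rewrite [X in _ <= X]mulrCA ler_wpM2l ?cn_ge0// ler_wpM2r ?exprn_ge0 ?(ltW rho0)//.
  by apply: ler_wiXn2l; rewrite ?(ltW x0)// leq_addl.
rewrite cnN cnM cnX cn_real ger0_norm ?mulr_ge0 ?(ltW x0) ?(ltW rho0)// exprMn exprS.
by rewrite mulrCA [x * x ^+ k]mulrC -mulrA ler_pM2l.
Qed.

Lemma hassum_real_gt0 (I : eqType) (f : I -> C) a i0 : hassum f a ->
  (forall i, 0 <= Re (f i)) -> 0 < Re (f i0) -> a != 0.
Proof.
move=> ha f0 fi; apply/eqP => a0.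
have [s Hs] := ha _ (divr_gt0 fi (ltr0n _ 2)).
have := Hs (undup (i0 :: s)) (undup_uniq _).
have ss : {subset s <= undup (i0 :: s)} by move=> x xs; rewrite mem_undup inE xs orbT.
move=> /(_ ss); rewrite a0 subr0; set S := \sum_(i <- _) _ => h.
have m0 : i0 \in undup (i0 :: s) by rewrite mem_undup inE eqxx.
have S1 : Re (f i0) <= Re S.
  rewrite /S (big_morph _ (@cReD R) (erefl : Re (0 : C) = 0)) (bigD1_seq _ m0 (undup_uniq _)).
  by rewrite lerDl sumr_ge0.
have h1 := Re_le_cn S; have h2 := ler_norm (Re S); lra.
Qed.

Lemma bsum_rows (I J : eqType) (F : I * J -> C) (g : I -> C) :
  bsum F -> (forall i, hassum (fun j => F (i, j)) (g i)) -> bsum g.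
Proof.
move=> [M HM] hg; exists M => s us; apply/ler_addgt0Pr => e e0.
pose es := e / (size s).+1%:R.
have es0 : 0 < es by rewrite divr_gt0// ltr0n.
have [T HT] := boolp.choice (fun i => hg i _ es0).
apply: (@le_trans _ _ (\sum_(i <- s) (\sum_(j <- undup (T i)) cn (F (i, j)) + es))).
  apply: ler_sum => i _.
  have := HT i (undup (T i)) (undup_uniq _); set S := \sum_(_ <- _) _ => h.
  have {}h : cn (S - g i) <= es by apply: h => x; rewrite mem_undup.
  have hS : cn S <= \sum_(j <- undup (T i)) cn (F (i, j)) by exact: cn_sum.
  have -> : g i = S - (S - g i) by ring.
  by apply: (le_trans (cnB _ _)); apply: lerD.
rewrite big_split /=; apply: lerD.
  have -> : \sum_(i <- s) \sum_(j <- undup (T i)) cn (F (i, j)) =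
      \sum_(p <- [seq (i, j) | i <- s, j <- undup (T i)]) cn (F p) by rewrite big_allpairs_dep.
  apply: HM; apply: allpairs_uniq_dep => // [k _|]; first exact: undup_uniq.
  by move=> [x1 x2] [y1 y2] _ _ [-> ->].
rewrite big_const_seq count_predT iter_addr_0 -[X in X <= _]mulr_natr /es mulrAC ler_pdivrMr ?ltr0n//.
by rewrite ler_pM2l// ler_nat.
Qed.

(** Expanding the exponential and exchanging sums gives a power series in r whose coefficients are
    the moments of [d]; comparing two such series yields identities between moments. *)
Lemma hassum_exp_moments (I : eqType) (f : I -> C) (d : I -> R) (c : C) :
  rbsum (fun i => cn (f i) * expR (cn c * `|d i|)) ->
  bsum (fun k => c ^+ k / k`!%:R * tsum (fun i => f i * (d i)%:Co ^+ k)) /\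
  forall r, 0 <= r <= 1 ->
    hassum (fun k => c ^+ k / k`!%:R * tsum (fun i => f i * (d i)%:Co ^+ k) * r%:Co ^+ k)
     (tsum (fun i => f i * cexp (c * (r * d i)%:Co))).
Proof.
move=> bf.
have bF : bsum (fun p : I * nat => f p.1 * ((c * (d p.1)%:Co) ^+ p.2 / p.2`!%:R)).
  apply: (@rbsum_prod R I _ _ (fun i => cn (f i) * expR (cn c * `|d i|))) => // [p|i t ut] /=.
    exact: cn_ge0.
  under eq_bigr do rewrite cnM.
  rewrite -mulr_sumr ler_wpM2l ?cn_ge0//.
  under eq_bigr do rewrite cn_expc cnM cn_real.
  by apply: expR_partial => //; rewrite mulr_ge0 ?cn_ge0.
have mk k : hassum (fun i => f i * ((c * (d i)%:Co) ^+ k / k`!%:R))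
     (c ^+ k / k`!%:R * tsum (fun i => f i * (d i)%:Co ^+ k)).
  have bk : bsum (fun i => f i * (d i)%:Co ^+ k * c ^+ k / k`!%:R).
    have := @rbsum_inj R _ I _ (fun i : I => (i, k)) _ bF.
    move=> /(_ (fun x y e => congr1 fst e)); apply: rbsum_le => i /=.
    by rewrite exprMn le_eqVlt; apply/orP; left; apply/eqP; congr cn; ring.
  have [c0|c0] := eqVneq (c ^+ k) 0.
    rewrite c0 !mul0r; apply: hassum_ext (@hassum0 R I) => i.
    by rewrite exprMn c0 !mul0r mulr0.
  have kf : (k`!%:R : C) != 0 by rewrite pnatr_eq0 -lt0n fact_gt0.
  have bd : bsum (fun i => f i * (d i)%:Co ^+ k).
    apply: rbsum_le (rbsumZ (cn_ge0 (k`!%:R / c ^+ k)) bk) => i; rewrite -cnM.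
    by rewrite le_eqVlt; apply/orP; left; apply/eqP; congr cn; field; rewrite kf c0.
  by apply: hassum_ext (hassumZ _ (bsumP bd)) => i; rewrite exprMn; ring.
split.
  have bcol : bsum (fun p : nat * I => f p.2 * ((c * (d p.2)%:Co) ^+ p.1 / p.1`!%:R)).
    have := @rbsum_inj R _ _ _ (fun p : nat * I => (p.2, p.1)) _ bF.
    by apply=> -[x1 x2] [y1 y2] [-> ->].
  exact: (bsum_rows bcol mk).
move=> r /andP[r0 r1].
pose F (p : I * nat) := f p.1 * ((c * (r * d p.1)%:Co) ^+ p.2 / p.2`!%:R).
have bFr : bsum F.
  apply: rbsum_le bF => p; rewrite /F !cnM; rewrite ler_wpM2l ?cn_ge0// ler_wpM2r ?cn_ge0//.
  rewrite !cnX; apply: lerXn2r; rewrite ?nnegrE ?cn_ge0// !cnM ler_wpM2l ?cn_ge0// !cn_real normrM.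
  by rewrite (ger0_norm r0) ler_piMl.
have hF := bsumP bFr.
have h1 : hassum (fun i => f i * cexp (c * (r * d i)%:Co)) (tsum F).
  by apply: (hassum_prod hF) => i; exact: (hassumZ (f i) (hassum_exp (c * (r * d i)%:Co))).
rewrite (tsumP h1).
apply: (hassum_prod (hassum_swap hF)) => k.
have := hassumZ (r%:Co ^+ k) (mk k); rewrite mulrC; apply: hassum_ext => i.
by rewrite /F /= coM !exprMn; ring.
Qed.

End PowerSeriesUnique.

(** * Poisson summation on a selfdual lattice *)

Section LatticePoisson.
Variables (R : realType) (n : nat) (B : 'M[R]_n).
Hypotheses (hB : B \in unitmx) (hL : selfdual (lattice_of B)).
Local Notation C := R[i].
Implicit Types (g : C) (u v s : 'rV[R]_n) (z : 'rV[int]_n).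

Definition lv z : 'rV[R]_n := zR R z *m B.

Lemma dot_delta (j : 'I_n) (y : 'rV[R]_n) : dot (delta_mx ord0 j) y = y ord0 j.
Proof. by rewrite dotE -rowE !mxE. Qed.

Lemma lvP x : lattice_of B x <-> exists z, x = lv z.
Proof. by []. Qed.
Lemma lv_in z : lattice_of B (lv z).
Proof. by exists z. Qed.
Lemma lvD z w : lv (z + w) = lv z + lv w.
Proof. by rewrite /lv zRD mulmxDl. Qed.
Lemma lvN z : lv (- z) = - lv z.
Proof. by rewrite /lv zRN mulNmx. Qed.
Lemma lv0 : lv 0 = 0.
Proof. by rewrite /lv zR0 mul0mx. Qed.
Lemma lv_inj : injective lv.
Proof.
move=> z w; rewrite /lv => h; apply: (@zR_inj R).
by rewrite -(mulmxK hB (zR R z)) h mulmxK.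
Qed.

Lemma cauchy_schwarz (x y : 'rV[R]_n) : dot x y ^+ 2 <= nrm x * nrm y.
Proof.
have [y0|y0] := eqVneq (nrm y) 0.
  by rewrite (nrm_eq0 y0) dot0r nrm0 mulr0 expr0n.
have yp : 0 < nrm y by rewrite lt_def y0 nrm_ge0.
have := nrm_ge0 (nrm y *: x - dot x y *: y).
rewrite nrmB !nrmZ dotZl dotZr => h.
rewrite -(ler_pM2l yp) -subr_ge0; apply: le_trans h _.
by rewrite le_eqVlt; apply/orP; left; apply/eqP; ring.
Qed.

(** The coordinates of x are inner products of [x *m B] with the columns of the inverse matrix, so
    Cauchy-Schwarz bounds them. *)
Lemma lattice_coercive : exists2 d : R, 0 < d & forall x : 'rV[R]_n, d * nrm x <= nrm (x *m B).
Proof.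
pose K := \sum_i nrm (row i (invmx B)^T).
have K0 : 0 <= K by apply: sumr_ge0 => i _; exact: nrm_ge0.
have K1 : 0 < K + 1 by rewrite ltr_wpDl.
exists (K + 1)^-1; first by rewrite invr_gt0.
move=> x; rewrite ler_pdivrMl//.
apply: (@le_trans _ _ (K * nrm (x *m B))); last by rewrite ler_wpM2r ?nrm_ge0// lerDl.
rewrite {1}/nrm /dot /K mulr_suml; apply: ler_sum => i _.
have -> : x ord0 i = dot (x *m B) (row i (invmx B)^T).
  rewrite -{1}(mulmxK hB x) mxE /dot; apply: eq_bigr => j _.
  by rewrite !mxE.
by rewrite -expr2 mulrC; exact: cauchy_schwarz.
Qed.

Lemma int_dot z w : is_int (dot (lv z) (lv w)).
Proof. by apply: hL.1; exact: lv_in. Qed.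

Let G := B *m B^T.

Lemma qfG x : qf G x = nrm (x *m B).
Proof. by rewrite /qf /G mulmxA /nrm dot_mulmx trmxK. Qed.

(** Selfduality in coordinates: the Gram matrix maps Z^n to itself by integrality, and onto itself
    because the dual is no larger than the lattice. *)
Lemma gram_bij : exists h h' : 'rV[int]_n -> 'rV[int]_n,
  [/\ cancel h h', cancel h' h & forall z, zR R (h z) = zR R z *m G].
Proof.
have Gu : G \in unitmx by rewrite unitmx_mul unitmx_tr hB.
have ex1 z : exists k : 'rV[int]_n, zR R k = zR R z *m G.
  have ex j : exists a : int, (zR R z *m G) ord0 j = a%:~R.
    have [a Ha] := int_dot z (delta_mx ord0 j).
    exists a; rewrite -Ha dotC {1}/lv dot_mulmx.
    rewrite (_ : zR R (delta_mx _ _) = delta_mx ord0 j); last first.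
      by apply/rowP => l; rewrite !mxE; case: (_ && _).
    by rewrite dot_delta /lv /G mulmxA.
  have [a Ha] := boolp.choice ex.
  by exists (\row_j a j); apply/rowP => j; rewrite Ha !mxE.
have ex2 k : exists z : 'rV[int]_n, zR R z *m G = zR R k.
  have [|z Hz] := (hL.2 (zR R k *m invmx B^T)).1.
    move=> x [z ->]; rewrite -/(zR R z) dot_mulmx -mulmxA mulVmx ?unitmx_tr// mulmx1.
    exists (\sum_j z ord0 j * k ord0 j); rewrite /dot rmorph_sum /=; apply: eq_bigr => j _.
    by rewrite !mxE intrM.
  by exists z; rewrite /G mulmxA -/(zR R z) -Hz mulmxKV ?unitmx_tr.
have [h Hh] := boolp.choice ex1; have [h' Hh'] := boolp.choice ex2.
exists h, h'; split => // z.
  apply: (@zR_inj R); have := Hh' (h z); rewrite Hh => E.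
  by rewrite -(mulmxK Gu (zR R (h' (h z)))) E mulmxK.
by apply: (@zR_inj R); rewrite Hh Hh'.
Qed.

(** Reindexing by z -> z G, a bijection of Z^n, turns the dual form back into the norm of the
    lattice. *)
Lemma poisson_lattice g u v : cone g ->
  tsum (fun z => cexp (- (pi%:Co * g ^- 2 * (nrm (lv z - v))%:Co)) * e1 (dot (lv z - v) u)) =
  g ^+ n * tsum (fun z => cexp (- (pi%:Co * g ^+ 2 * (nrm (lv z + u))%:Co)) * e1 (dot v (lv z))).
Proof.
have Gs : G^T = G by rewrite /G trmx_mul trmxK.
have pG : posform (qf G).
  by have [d d0 Hd] := lattice_coercive; exists d => // x; rewrite qfG.
have [qs [kap [pqs k0 qsG H]]] := poisson_form Gs pG.
have [h [h' [hK h'K Hh]]] := gram_bij.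
have LE u' v' z (w : C) : LT w (qf G) (u' *m invmx B) (v' *m B^T) z =
    cexp (- (pi%:Co * w * (nrm (lv z + u'))%:Co)) * e1 (dot v' (lv z)).
  rewrite /LT qfG mulmxDl mulmxKV// -/(lv z); congr (_ * e1 _).
  by rewrite dot_mulmx trmxK.
have RE u' v' z (w : C) : RT w qs (u' *m invmx B) (v' *m B^T) (h z) =
    cexp (- (pi%:Co * w * (nrm (lv z - v'))%:Co)) * e1 (dot (lv z - v') u').
  have E : zR R (h z) - v' *m B^T = (zR R z - v' *m invmx B) *m G.
    by rewrite Hh mulmxBl /G [v' *m _ *m _]mulmxA mulmxKV.
  rewrite /RT E qsG qfG mulmxBl mulmxKV// -/(lv z); congr (_ * e1 _).
  by rewrite /G mulmxA mulmxBl mulmxKV// -/(lv z) dot_mulmx trmxK mulmxKV.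
have main g' u' v' : cone g' ->
  tsum (fun z => cexp (- (pi%:Co * g' ^- 2 * (nrm (lv z - v'))%:Co)) * e1 (dot (lv z - v') u')) =
  kap%:Co * g' ^+ n * tsum (fun z => cexp (- (pi%:Co * g' ^+ 2 * (nrm (lv z + u'))%:Co)) * e1 (dot v' (lv z))).
  move=> cg'; have := H g' (u' *m invmx B) (v' *m B^T) cg'.
  rewrite (eq_tsum (fun z => LE u' v' z (g' ^+ 2))) => <-.
  apply: tsumP.
  have b := bsum_RT (u' *m invmx B) (v' *m B^T) (cone_sqrV_Re cg') pqs.
  by apply: hassum_ext (hassum_bij hK h'K (bsumP b)) => z; rewrite RE.
(* At g = 1 and u = v = 0 the two sums coincide and are nonzero, which determines the constant. *)
have k1 : kap%:Co = 1 :> C.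
  have := main 1 0 0 (cone1 R); rewrite !expr1n invr1 mulr1.
  set A := tsum _; set A' := tsum _.
  have -> : A' = A.
    by apply: eq_tsum => z; rewrite subr0 addr0 dot0l dot0r.
  have A0 : A != 0.
    have bA : bsum (fun z => cexp (- (pi%:Co * 1 * (nrm (lv z - 0))%:Co)) * e1 (dot (lv z - 0) 0) : C).
      have := bsum_LT (0 *m invmx B) (0 *m B^T) (ltr01 : 0 < Re (1 : C)) pG.
      by apply: rbsum_le => z; rewrite LE subr0 addr0 dot0l dot0r lexx.
    apply: (hassum_real_gt0 (i0 := 0) (bsumP bA)) => [z|]; rewrite subr0 dot0r e10 mulr1 mulr1 -coM -coN cexp_real /=.
      exact: expR_ge0.
    exact: expR_gt0.
  by move=> E; apply: (mulIf A0); rewrite -E mul1r.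
by move=> cg; rewrite main// k1 mul1r.
Qed.

End LatticePoisson.

(** * Theta series with harmonic coefficients *)

Section ThetaTransform.
Variables (R : realType) (n : nat) (B : 'M[R]_n).
Hypotheses (hB : B \in unitmx) (hL : selfdual (lattice_of B)).
Local Notation C := R[i].
Local Notation iC := (Complex 0 1 : C).
Local Notation lv := (lv B).
Implicit Types (g : C) (u v s a : 'rV[R]_n) (z : 'rV[int]_n).

Lemma rbsum_lattice s (c : R) : 0 < c -> rbsum (fun z => expR (- (c * nrm (lv z + s)))).
Proof.
move=> c0; have [d d0 Hd] := lattice_coercive hB.
have cd : 0 < c * d by rewrite mulr_gt0.
apply: rbsum_le (rbsum_gauss_shift (s *m invmx B) cd) => z.
rewrite ler_expR lerN2 -mulrA ler_pM2l//.
by apply: le_trans (Hd _) _; rewrite mulmxDl mulmxKV.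
Qed.

(** Half of the Gaussian pays for the linear exponential, by 2 K |x.a| <= c |x|^2 + K^2 |a|^2 /
    c. *)
Lemma rbsum_lattice_exp s a (c K : R) : 0 < c -> 0 <= K ->
  rbsum (fun z => expR (- (c * nrm (lv z + s))) * expR (K * `|dot (lv z + s) a|)).
Proof.
move=> c0 K0; have c2 : 0 < c / 2 by rewrite divr_gt0.
apply: rbsum_le (rbsumZ (expR_ge0 (K ^+ 2 * nrm a / (2 * c))) (rbsum_lattice s c2)) => z.
rewrite -!expRD ler_expR; set x := lv z + s.
have h e : e ^+ 2 = 1 -> 2 * K * (e * dot x a) <= c * nrm x + K ^+ 2 * nrm a / c.
  move=> e2; have := nrm_ge0 (c *: x - (e * K) *: a).
  rewrite nrmB !nrmZ dotZl dotZr exprMn e2 mul1r => h.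
  rewrite -(ler_pM2l c0) (_ : c * (c * nrm x + _) = c ^+ 2 * nrm x + K ^+ 2 * nrm a); last first.
    by field; rewrite gt_eqF.
  by lra.
have h1 : 2 * (K * `|dot x a|) <= c * nrm x + K ^+ 2 * nrm a / c.
  case: (lerP 0 (dot x a)) => xa.
    by rewrite ger0_norm//; have := h 1 (expr1n _ _); rewrite mul1r; lra.
  by rewrite ltr0_norm//; have := h (-1); rewrite sqrrN expr1n mulN1r => /(_ erefl); lra.
rewrite (_ : K ^+ 2 * nrm a / (2 * c) = K ^+ 2 * nrm a / c / 2); last by field; rewrite gt_eqF.
lra.
Qed.

Lemma bsum_moment (I : eqType) (f : I -> C) (d : I -> R) k :
  rbsum (fun i => cn (f i) * expR (1 * `|d i|)) -> bsum (fun i => f i * (d i)%:Co ^+ k).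
Proof.
move=> b; have kf : 0 <= k`!%:R :> R by [].
apply: rbsum_le (rbsumZ kf b) => i; rewrite cnM cnX cn_real mulrCA ler_wpM2l ?cn_ge0// mul1r.
have := expR_partial (normr_ge0 (d i)) (s := [:: k]) isT; rewrite big_seq1.
by rewrite ler_pdivrMr ?ltr0n ?fact_gt0// mulrC.
Qed.

(** Forms of degree k are given as weighted sums of k-th powers of linear forms, for which
    translation of the argument is easy to expand. *)
Definition pf (k : nat) (fam : seq (R * 'rV[R]_n)) (x : 'rV[R]_n) : R :=
  \sum_(l <- fam) l.1 * dot x l.2 ^+ k.
(** The Laplacian sends (x.a)^k to k (k - 1) |a|^2 (x.a)^(k-2), so up to a nonzero scalar the left
    side is the j-th iterated Laplacian. *)
Definition harm (k : nat) (fam : seq (R * 'rV[R]_n)) := forall j (x : 'rV[R]_n), (0 < j)%N -> (j.*2 <= k)%N ->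
  \sum_(l <- fam) l.1 * nrm l.2 ^+ j * dot x l.2 ^+ (k - j.*2) = 0.

Definition char_term g s z : C := cexp (- (pi%:Co * g ^+ 2 * (nrm (lv z))%:Co)) * e1 (dot s (lv z)).
Definition shift_term g s z : C := cexp (- (pi%:Co * g ^- 2 * (nrm (lv z - s))%:Co)).

Lemma rbsum_char_term g s a (K : R) : cone g -> 0 <= K -> rbsum (fun z => cn (char_term g s z) * expR (K * `|dot (lv z) a|)).
Proof.
move=> cg K0; have w0 := cone_sqr_Re cg.
have c0 : 0 < pi * Re (g ^+ 2) by rewrite mulr_gt0// pi_gt0.
apply: rbsum_le (rbsum_lattice_exp 0 a c0 K0) => z.
by rewrite addr0 /char_term (cnM (cexp _)) cn_e1 mulr1 cn_cexp_pi.
Qed.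

Lemma rbsum_shift_term g s a (K : R) : cone g -> 0 <= K -> rbsum (fun z => cn (shift_term g s z) * expR (K * `|dot (lv z - s) a|)).
Proof.
move=> cg K0; have w0 := cone_sqrV_Re cg.
have c0 : 0 < pi * Re (g ^- 2) by rewrite mulr_gt0// pi_gt0.
apply: rbsum_le (rbsum_lattice_exp (- s) a c0 K0) => z.
by rewrite /shift_term cn_cexp_pi.
Qed.

Definition M1 g s a k := tsum (fun z => char_term g s z * (dot (lv z) a)%:Co ^+ k).
Definition M2 g s a k := tsum (fun z => shift_term g s z * (dot (lv z - s) a)%:Co ^+ k).

(** Coefficients of the power series of exp(c r^2) in r. *)
Definition gcoef (c : C) (k : nat) : C := if odd k then 0 else c ^+ k./2 / k./2`!%:R.

Lemma bsum_gcoef c : bsum (gcoef c).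
Proof.
exists (expR (cn c)) => s us.
rewrite (bigID (fun k => ~~ odd k)) /= [X in _ + X]big1 ?addr0; last first.
  by move=> k; rewrite negbK /gcoef => ->; rewrite cn0.
rewrite -big_filter.
apply: le_trans (expR_partial (cn_ge0 c) (_ : uniq [seq k./2 | k <- s & ~~ odd k])).
  rewrite big_map big_seq [X in _ <= X]big_seq; apply: ler_sum => k; rewrite mem_filter => /andP[ok _].
  by rewrite /gcoef (negbTE ok) cn_expc.
rewrite map_inj_in_uniq ?filter_uniq// => x y; rewrite !mem_filter => /andP[ox _] /andP[oy _] E.
by rewrite -[x]even_halfK// -[y]even_halfK// E.
Qed.

Lemma hassum_gcoef c (r : R) : hassum (fun k => gcoef c k * r%:Co ^+ k) (cexp (c * r%:Co ^+ 2)).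
Proof.
apply: (@hassum_extend _ _ nat _ (fun j => j.*2) (fun k => if odd k then None else Some k./2)).
- by move=> j; rewrite odd_double doubleK.
- by move=> k j; case: ifP => // ok [<-]; rewrite even_halfK// ok.
- by move=> k; rewrite /gcoef; case: ifP => // _ _; rewrite mul0r.
- apply: hassum_ext (hassum_exp _) => j.
  by rewrite /gcoef odd_double doubleK exprMn -exprM mul2n; ring.
Qed.

(** In [poisson_lattice] the translation is taken to be r a. Then |x + r a|^2 splits into |x|^2, a
    term linear in r and r^2 |a|^2, the last giving [gcoef]; both sides are power series in r on (0,
    1], and the coefficients of r^k are compared. *)
Lemma moments_transform g s a k : cone g ->
  ip 1 ^+ k / k`!%:R * M2 g s a k = g ^+ n * \sum_(i < k.+1)
    gcoef (- (pi%:Co * g ^+ 2 * (nrm a)%:Co)) i *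
    ((- (2 * pi%:Co * g ^+ 2)) ^+ (k - i) / (k - i)`!%:R * M1 g s a (k - i)).
Proof.
move=> cg; set c1 := - (2 * pi%:Co * g ^+ 2); set c2 := ip 1; set c3 := - (pi%:Co * g ^+ 2 * (nrm a)%:Co).
have [b1 h1] := hassum_exp_moments (rbsum_char_term s a cg (cn_ge0 c1)).
have [b2 h2] := hassum_exp_moments (rbsum_shift_term s a cg (cn_ge0 c2)).
pose A i := c1 ^+ i / i`!%:R * M1 g s a i.
pose D i := c2 ^+ i / i`!%:R * M2 g s a i.
have b1' : bsum A := b1.
have bA r : 0 <= r <= 1 -> bsum (fun i => A i * r%:Co ^+ i).
  move=> /andP[r0 r1]; apply: rbsum_le b1' => i; rewrite (cnM (A i)) ler_piMr ?cn_ge0//.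
  by rewrite cnX cn_real exprn_ile1// ger0_norm.
have bG r : 0 <= r <= 1 -> bsum (fun i => gcoef c3 i * r%:Co ^+ i).
  move=> /andP[r0 r1]; apply: rbsum_le (bsum_gcoef c3) => i; rewrite (cnM (gcoef c3 i)) ler_piMr ?cn_ge0//.
  by rewrite cnX cn_real exprn_ile1// ger0_norm.
pose E k := g ^+ n * \sum_(i < k.+1) gcoef c3 i * A (k - i)%N.
have hE r : 0 <= r <= 1 -> bsum (fun k => E k * r%:Co ^+ k) /\
   hassum (fun k => E k * r%:Co ^+ k) (tsum (fun z => shift_term g s z * cexp (c2 * (r * dot (lv z - s) a)%:Co))).
  move=> r01.
  have [bc hc] := hassum_cauchy (bG r r01) (bA r r01) (hassum_gcoef c3 r) (h1 r r01).
  have ee m : g ^+ n * \sum_(i < m.+1) (gcoef c3 i * r%:Co ^+ i) * (A (m - i)%N * r%:Co ^+ (m - i)) = E m * r%:Co ^+ m.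
    rewrite /E -mulrA mulr_suml; congr (_ * _); apply: eq_bigr => i _.
    have : r%:Co ^+ i * r%:Co ^+ (m - i) = r%:Co ^+ m :> C by rewrite -exprD subnKC// -ltnS.
    by move=> <-; ring.
  split.
    apply: rbsum_le (rbsumZ (cn_ge0 (g ^+ n)) bc) => m.
    by rewrite -ee cnM.
  have -> : tsum (fun z => shift_term g s z * cexp (c2 * (r * dot (lv z - s) a)%:Co)) =
     g ^+ n * (cexp (c3 * r%:Co ^+ 2) * tsum (fun z => char_term g s z * cexp (c1 * (r * dot (lv z) a)%:Co))).
    have := poisson_lattice hB hL (r *: a) s cg.
    rewrite (eq_tsum (g := fun z => shift_term g s z * cexp (c2 * (r * dot (lv z - s) a)%:Co))); last first.
      move=> z; rewrite /shift_term dotZr; congr (_ * _); rewrite /e1; congr cexp.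
      by rewrite /c2 !ipE !coM; ring.
    move=> ->; congr (_ * _).
    have b := rbsum_char_term s a cg (cn_ge0 c1).
    have bb : bsum (fun z => char_term g s z * cexp (c1 * (r * dot (lv z) a)%:Co)).
      apply: rbsum_le b => z; rewrite cnM ler_wpM2l ?cn_ge0// cn_cexp ler_expR.
      apply: (le_trans (ler_norm _)); apply: (le_trans (Re_le_cn _)); rewrite cnM ler_wpM2l ?cn_ge0//.
      by case/andP: r01 => r0 r1; rewrite cn_real normrM (ger0_norm r0) ler_piMl.
    apply: tsumP; apply: hassum_ext (hassumZ _ (bsumP bb)) => z.
    have key (x1 x2 x3 x4 : C) : x1 * (x2 * x3 * x4) = x1 * x2 * x4 * x3 by ring.
    rewrite /char_term key -cexpD -cexpD; congr (cexp _ * _).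
    rewrite nrmD nrmZ dotZr /c1 /c3 (coD (_ + _)) (coD (nrm _)) (coM (r ^+ 2)) coX (coM 2) (coM r) co_nat.
    by ring.
  by apply: hassum_ext (hassumZ (g ^+ n) hc) => m; rewrite ee.
have key m : D m - E m = 0.
  have one01 : 0 <= (1 : R) <= 1 by rewrite ler01 lexx.
  have [bE1 _] := hE 1 one01.
  apply: (@pser_zero R (fun m => D m - E m) 1 ltr01 _ _ m).
    apply: rbsum_le (rbsumD b2 bE1) => i.
    by rewrite rmorph1 !expr1n !mulr1; exact: cnB.
  move=> r /andP[r0 r1]; have r01 : 0 <= r <= 1 by rewrite (ltW r0).
  have := hassumB (h2 r r01) (hE r r01).2; rewrite subrr; apply: hassum_ext => i.
  by rewrite mulrBl.
by apply/eqP; rewrite -subr_eq0; apply/eqP; exact: key.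
Qed.

Lemma tsum_pf (f : 'rV[int]_n -> C) (y : 'rV[int]_n -> 'rV[R]_n) fam k :
  (forall a, bsum (fun z => f z * (dot (y z) a)%:Co ^+ k)) ->
  \sum_(l <- fam) l.1%:Co * tsum (fun z => f z * (dot (y z) l.2)%:Co ^+ k) =
  tsum (fun z => f z * (pf k fam (y z))%:Co).
Proof.
move=> H; symmetry; apply: tsumP.
have h (l : R * 'rV[R]_n) := hassumZ l.1%:Co (bsumP (H l.2)).
apply: hassum_ext (hassum_sum fam h) => z.
rewrite /pf rmorph_sum mulr_sumr; apply: eq_bigr => l _.
by rewrite /= coM coX mulrCA.
Qed.

(** Summed over the family, the term of index i in [moments_transform] vanishes for odd i by parity
    and for i = 2j > 0 by harmonicity. The term i = 0 leaves the ratio of (-2 pi g^2)^k to (2 pi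
    i)^k, which is (i g^2)^k. *)
Lemma theta_transform k fam g s : cone g -> harm k fam ->
  tsum (fun z => shift_term g s z * (pf k fam (lv z - s))%:Co) =
  g ^+ n * (iC * g ^+ 2) ^+ k * tsum (fun z => char_term g s z * (pf k fam (lv z))%:Co).
Proof.
move=> cg hf.
have b1 a m : bsum (fun z => char_term g s z * (dot (lv z) a)%:Co ^+ m) by apply: bsum_moment; apply: rbsum_char_term.
have b2 a m : bsum (fun z => shift_term g s z * (dot (lv z - s) a)%:Co ^+ m) by apply: bsum_moment; apply: rbsum_shift_term.
rewrite -(tsum_pf fam (fun a => b1 a k)) -(tsum_pf fam (fun a => b2 a k)).
have kf : (k`!%:R : C) != 0 by rewrite pnatr_eq0 -lt0n fact_gt0.
pose c1 := - (2 * pi%:Co * g ^+ 2).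
pose V i := \sum_(l <- fam) l.1%:Co * (gcoef (- (pi%:Co * g ^+ 2 * (nrm l.2)%:Co)) i *
    (c1 ^+ (k - i) / (k - i)`!%:R * M1 g s l.2 (k - i))).
have V0 i : (0 < i <= k)%N -> V i = 0.
  move=> /andP[i0 ik]; rewrite /V /gcoef; case oi: (odd i).
    by rewrite big1// => l _; rewrite mul0r mulr0.
  pose j := i./2; have ij : i = j.*2 by rewrite even_halfK ?oi.
  have j0 : (0 < j)%N by move: i0; rewrite ij; lia.
  pose c := (- (pi%:Co * g ^+ 2)) ^+ j / j`!%:R * (c1 ^+ (k - i) / (k - i)`!%:R).
  have -> : \sum_(l <- fam) l.1%:Co * ((- (pi%:Co * g ^+ 2 * (nrm l.2)%:Co)) ^+ i./2 / i./2`!%:R *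
     (c1 ^+ (k - i) / (k - i)`!%:R * M1 g s l.2 (k - i))) =
     c * \sum_(l <- [seq (l.1 * nrm l.2 ^+ j, l.2) | l <- fam]) l.1%:Co * M1 g s l.2 (k - i).
    rewrite big_map mulr_sumr; apply: eq_bigr => l _ /=.
    by rewrite coM coX /c -/j -mulNr exprMn; ring.
  rewrite /M1 (tsum_pf _ (fun a => b1 a (k - i)%N)).
  rewrite (eq_tsum (g := fun _ => 0)) ?(tsumP (@hassum0 R _)) ?mulr0// => z.
  by rewrite /pf big_map /= ij hf ?mulr0 ?rmorph0 ?mulr0// -ij.
have main : ip 1 ^+ k / k`!%:R * \sum_(l <- fam) l.1%:Co * M2 g s l.2 k =
   g ^+ n * (c1 ^+ k / k`!%:R * \sum_(l <- fam) l.1%:Co * M1 g s l.2 k).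
  have -> : ip 1 ^+ k / k`!%:R * \sum_(l <- fam) l.1%:Co * M2 g s l.2 k = g ^+ n * \sum_(i < k.+1) V i.
    rewrite mulr_sumr /V exchange_big /= mulr_sumr; apply: eq_bigr => l _.
    by rewrite mulrCA (moments_transform s l.2 k cg) mulrCA -mulr_sumr.
  rewrite big_ord_recl big1 ?addr0; last by move=> i _; rewrite V0//= /bump /= add1n ltn_ord.
  rewrite /V; congr (_ * _); rewrite mulr_sumr; apply: eq_bigr => l _.
  by rewrite /gcoef /= expr0 invr1 !mul1r subn0 mulrCA.
have i1 : ip (1 : R) = iC * (2 * pi%:Co) by rewrite ipE mulr1 coM co_nat.
have p0 : (pi : R)%:Co != 0 :> C by rewrite -cn_gt0 cn_real normr_gt0 gt_eqF// pi_gt0.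
have ip0 : ip (1 : R) ^+ k != 0.
  rewrite expf_neq0// i1 mulf_neq0 ?mulf_neq0 ?pnatr_eq0//.
  by rewrite eq_complex /= oner_eq0 andbF.
have c1E : c1 = ip 1 * (iC * g ^+ 2).
  by rewrite i1 mulrACA iC2 /c1; ring.
rewrite -/(M2 g s) -/(M1 g s).
rewrite c1E exprMn in main.
have kk : ip (1 : R) ^+ k / k`!%:R != 0 by rewrite mulf_neq0 ?invr_eq0.
apply: (mulfI kk); rewrite main; ring.
Qed.

End ThetaTransform.

(** * q-expansions *)

Section QSeries.
Variable R : realType.
Local Notation C := R[i].
Implicit Types (t tau : C) (a b : nat -> C) (rho : R).

(** A bound on the weighted l^1 norm at radius [rho], for which convolution is submultiplicative. *)
Definition l1_bounded rho a (M : R) := forall s : seq nat, uniq s -> \sum_(k <- s) cn (a k) * rho ^+ k <= M.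

Definition conv a b (n : nat) : C := \sum_(i < n.+1) a i * b (n - i)%N.

Lemma l1_bounded_ge0 rho a M : l1_bounded rho a M -> 0 <= M.
Proof. by move=> /(_ [::] isT); rewrite big_nil. Qed.

Lemma l1_bounded_bsum rho a M t : l1_bounded rho a M -> cn t <= rho -> bsum (fun k => a k * t ^+ k).
Proof.
move=> H tr; exists M => s us; apply: le_trans (H s us); apply: ler_sum => k _.
by rewrite cnM cnX ler_wpM2l ?cn_ge0//; apply: lerXn2r; rewrite ?nnegrE ?cn_ge0// (le_trans _ tr) ?cn_ge0.
Qed.

Lemma l1_bounded_conv rho a b M N : 0 <= rho -> l1_bounded rho a M -> l1_bounded rho b N -> l1_bounded rho (conv a b) (M * N).
Proof.
move=> r0 ha hb s us.
pose f n i := (i, (n - i)%N).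
pose big := [seq f n i | n <- s, i <- iota 0 n.+1].
pose F (p : nat * nat) := (cn (a p.1) * rho ^+ p.1) * (cn (b p.2) * rho ^+ p.2).
have F0 p : 0 <= F p by rewrite !mulr_ge0 ?cn_ge0 ?exprn_ge0.
have ub : uniq big.
  apply: allpairs_uniq_dep => // [n _|]; first exact: iota_uniq.
  move=> _ _ /allpairsPdep [n [i [_ + ->]]] /allpairsPdep [m [j [_ + ->]]] /=.
  rewrite !mem_iota !add0n !ltnS /= => h1 h2 [E1 E2].
  have -> : n = m by lia.
  by have -> : i = j by lia.
apply: (@le_trans _ _ (\sum_(p <- big) F p)).
  rewrite big_allpairs_dep; apply: ler_sum => n _.
  rewrite -(sum_ord_iota n.+1 (fun i => F (f n i))) /conv.
  apply: (@le_trans _ _ ((\sum_(i < n.+1) cn (a i * b (n - i)%N)) * rho ^+ n)).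
    by rewrite ler_wpM2r ?exprn_ge0// cn_sum.
  rewrite mulr_suml; apply: ler_sum => i _; rewrite /F /= cnM.
  have : rho ^+ i * rho ^+ (n - i) = rho ^+ n by rewrite -exprD subnKC// -ltnS.
  by move=> <-; rewrite le_eqVlt; apply/orP; left; apply/eqP; ring.
pose A := undup (map fst big); pose D := undup (map snd big).
apply: (@le_trans _ _ (\sum_(p <- [seq (i, j) | i <- A, j <- D]) F p)).
  apply: subset_sum_le => //.
    by apply: allpairs_uniq; rewrite ?undup_uniq// => [[x1 x2] [y1 y2] _ _ [-> ->]].
  move=> [i j] ij; apply/allpairsP; exists (i, j) => /=.
  by split=> //; rewrite mem_undup; apply/mapP; exists (i, j).
rewrite big_allpairs_dep /F /=.
under eq_bigr do rewrite -mulr_sumr.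
rewrite -mulr_suml; apply: ler_pM; rewrite ?ha ?hb ?undup_uniq//.
  by apply: sumr_ge0 => i _; rewrite mulr_ge0 ?cn_ge0 ?exprn_ge0.
by apply: sumr_ge0 => i _; rewrite mulr_ge0 ?cn_ge0 ?exprn_ge0.
Qed.

Lemma hassum_conv rho a b M N t x y : l1_bounded rho a M -> l1_bounded rho b N -> cn t <= rho ->
  hassum (fun k => a k * t ^+ k) x -> hassum (fun k => b k * t ^+ k) y ->
  hassum (fun k => conv a b k * t ^+ k) (x * y).
Proof.
move=> ha hb tr hx hy.
have [_ H] := hassum_cauchy (l1_bounded_bsum ha tr) (l1_bounded_bsum hb tr) hx hy.
apply: hassum_ext H => n; rewrite /conv mulr_suml; apply: eq_bigr => i _.
have : t ^+ i * t ^+ (n - i) = t ^+ n by rewrite -exprD subnKC// -ltnS.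
by move=> <-; ring.
Qed.

(** A sum of powers t^(m i) is grouped by exponent. Since t != 0, summability of the whole family
    descends to each coefficient; the last clause evaluates coefficients with finite fibres. *)
Lemma fiber_series (I : eqType) (f : I -> C) (m : I -> nat) rho M : 0 <= rho ->
  (forall s, uniq s -> \sum_(i <- s) cn (f i) * rho ^+ m i <= M) ->
  let a k := tsum (fun i => if m i == k then f i else 0) in
  [/\ (0 < rho -> l1_bounded rho a M), 
    forall t, t != 0 -> cn t <= rho -> hassum (fun k => a k * t ^+ k) (tsum (fun i => f i * t ^+ m i)) &
    forall k s, uniq s -> (forall i, i \in s <-> m i = k) -> a k = \sum_(i <- s) f i].
Proof.
move=> r0 HM a.
have Ht t : t != 0 -> cn t <= rho -> bsum (fun i => f i * t ^+ m i).
  move=> t0 tr; exists M => s us; apply: le_trans (HM s us); apply: ler_sum => i _.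
  rewrite cnM cnX ler_wpM2l ?cn_ge0//; apply: lerXn2r; rewrite ?nnegrE ?cn_ge0//.
have aE t k : t != 0 -> cn t <= rho ->
    hassum (fun i => if m i == k then f i * t ^+ m i else 0) (a k * t ^+ k).
  move=> t0 tr.
  have bk : bsum (fun i => if m i == k then f i else 0).
    have tk0 : 0 <= cn (t ^- k) by exact: cn_ge0.
    apply: rbsum_le (rbsumZ tk0 (Ht t t0 tr)) => i; case: eqP => [<-|_].
      by rewrite -cnM mulrCA mulVf ?mulr1 ?expf_neq0.
    by rewrite cn0 mulr_ge0 ?cn_ge0.
  have := hassumZ (t ^+ k) (bsumP bk); rewrite mulrC; apply: hassum_ext => i.
  by case: eqP => [<-|_]; rewrite ?mulr0// mulrC.
have Ft t : t != 0 -> cn t <= rho -> hassum (fun k => a k * t ^+ k) (tsum (fun i => f i * t ^+ m i)).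
  move=> t0 tr; apply: hassum_ext (hassum_fiber m (Ht t t0 tr) (bsumP (Ht t t0 tr))) => k.
  exact: tsumP (aE t k t0 tr).
split => //.
- move=> rp s us; apply/ler_addgt0Pr => e e0.
  have r0' : rho%:Co != 0 :> C by rewrite -cn_gt0 cn_real normr_gt0 gt_eqF.
  have rr : cn (rho%:Co : C) <= rho by rewrite cn_real ger0_norm.
  pose es := e / (size s).+1%:R.
  have es0 : 0 < es by rewrite divr_gt0// ltr0n.
  have [T HT] := boolp.choice (fun k => aE _ k r0' rr _ es0).
  apply: (@le_trans _ _ (\sum_(k <- s) (\sum_(i <- [seq i <- undup (T k) | m i == k]) cn (f i) * rho ^+ m i + es))).
    apply: ler_sum => k _.
    have := HT k (undup (T k)) (undup_uniq _); set S := \sum_(_ <- _) _ => h.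
    have {}h : cn (S - a k * rho%:Co ^+ k) <= es by apply: h => x; rewrite mem_undup.
    have hS : cn S <= \sum_(i <- [seq i <- undup (T k) | m i == k]) cn (f i) * rho ^+ m i.
      rewrite /S -big_mkcond -big_filter; apply: (le_trans (cn_sum _ _ _)); apply: ler_sum => i _.
      by rewrite cnM cnX cn_real ger0_norm.
    have -> : cn (a k) * rho ^+ k = cn (a k * rho%:Co ^+ k) by rewrite cnM cnX cn_real ger0_norm.
    rewrite (_ : a k * _ = S - (S - a k * rho%:Co ^+ k)); last by ring.
    by apply: (le_trans (cnB _ _)); apply: lerD.
  rewrite big_split /=; apply: lerD; last first.
    rewrite big_const_seq count_predT iter_addr_0 -[X in X <= _]mulr_natr /es mulrAC ler_pdivrMr ?ltr0n//.
    by rewrite ler_pM2l// ler_nat.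
  have -> : \sum_(k <- s) \sum_(i <- [seq i <- undup (T k) | m i == k]) cn (f i) * rho ^+ m i =
      \sum_(i <- [seq i | k <- s, i <- [seq i <- undup (T k) | m i == k]]) cn (f i) * rho ^+ m i.
    by rewrite big_allpairs_dep.
  apply: HM; apply: allpairs_uniq_dep => // [k _|]; first by rewrite filter_uniq ?undup_uniq.
  move=> _ _ /allpairsPdep [k [i [_ + ->]]] /allpairsPdep [l [j [_ + ->]]] /=.
  by rewrite !mem_filter => /andP[/eqP <- _] /andP[/eqP <- _] ->.
- move=> k s us hs; apply: tsumP.
  rewrite (_ : \sum_(i <- s) f i = \sum_(i <- s) (if m i == k then f i else 0)); last first.
    by rewrite big_seq [RHS]big_seq; apply: eq_bigr => i /hs ->; rewrite eqxx.
  by apply: hassum_fin => // i; case: eqP => // mi /negP []; apply/hs.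
Qed.

Lemma hassum_geometric t : cn t < 1 -> hassum (fun k => t ^+ k) (1 - t)^-1.
Proof.
move=> t1; have t0 := cn_ge0 t.
have b : bsum (fun k => t ^+ k).
  exists (1 - cn t)^-1 => s us; under eq_bigr do rewrite cnX.
  by apply: geometric_partial; rewrite ?t0.
have t1' : 1 - t != 0.
  by rewrite subr_eq0; apply: contraTneq t1 => <-; rewrite cn1 ltxx.
have H := bsumP b.
have H2 := hassum_split_nat 1 H; rewrite big_nat1 expr0 in H2.
have H3 := hassumZ t H.
have E : tsum (fun k => t ^+ k) - 1 = t * tsum (fun k => t ^+ k).
  by apply: hassum_unique H2 _; apply: hassum_ext H3 => k; rewrite addn1 exprS.
rewrite (_ : (1 - t)^-1 = tsum (fun k => t ^+ k))//.
apply: (mulfI t1'); rewrite divff// mulrBl mul1r -E; ring.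
Qed.

Fixpoint cpow a (j : nat) : nat -> C := if j is i.+1 then conv a (cpow a i) else fun k => (k == 0%N)%:R.

Lemma l1_bounded_cpow rho a M j : 0 <= rho -> l1_bounded rho a M -> l1_bounded rho (cpow a j) (M ^+ j).
Proof.
move=> r0 ha; elim: j => [|j IH]; last by rewrite exprS; exact: l1_bounded_conv.
move=> s us; rewrite expr0.
have -> : \sum_(k <- s) cn ((k == 0%N)%:R : C) * rho ^+ k = \sum_(k <- s) (k == 0%N)%:R.
  by apply: eq_bigr => -[|k] _; rewrite ?cn1 ?expr0 ?mulr1//= cn0 mul0r.
have h : (\sum_(k <- s) (k == 0%N) = count_mem 0%N s)%N.
  by rewrite -sum1_count [RHS]big_mkcond; apply: eq_bigr => k _ /=; case: eqP.
by rewrite -natr_sum h count_uniq_mem// lern1 leq_b1.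
Qed.

Lemma hassum_cpow rho a M j t x : 0 <= rho -> l1_bounded rho a M -> cn t <= rho ->
  hassum (fun k => a k * t ^+ k) x -> hassum (fun k => cpow a j k * t ^+ k) (x ^+ j).
Proof.
move=> r0 ha tr hx; elim: j => [|j IH].
  rewrite expr0.
  have -> : 1 = \sum_(k <- [:: 0%N]) cpow a 0 k * t ^+ k by rewrite big_seq1 /= expr0 mulr1.
  by apply: hassum_fin => // k; rewrite inE /= => /negbTE ->; rewrite mul0r.
rewrite exprS; exact: (hassum_conv ha (l1_bounded_cpow j r0 ha) tr hx IH).
Qed.

(* Neumann series in the Banach algebra of absolutely convergent power series. *)
Lemma inverse_series rho a M : 0 <= rho -> M < 1 -> l1_bounded rho a M ->
  exists b N, l1_bounded rho b N /\ forall t x, t != 0 -> cn t <= rho ->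
    hassum (fun k => a k * t ^+ k) x -> 1 - x != 0 /\ hassum (fun k => b k * t ^+ k) (1 - x)^-1.
Proof.
move=> r0 M1 ha; have M0 := l1_bounded_ge0 ha.
pose F (p : nat * nat) := cpow a p.2 p.1.
have gM s : uniq s -> \sum_(j <- s) M ^+ j <= (1 - M)^-1.
  by move=> us; apply: geometric_partial; rewrite ?M0.
have HF (s : seq (nat * nat)) : uniq s -> \sum_(p <- s) cn (F p) * rho ^+ p.1 <= (1 - M)^-1.
  move=> us.
  have b : rbsum (fun p : nat * nat => cn (cpow a p.1 p.2) * rho ^+ p.2).
    apply: (@rbsum_prod R _ _ _ (fun j => M ^+ j)) => [p|j u uu|].
    - by rewrite mulr_ge0 ?cn_ge0 ?exprn_ge0.
    - exact: l1_bounded_cpow.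
    - by exists (1 - M)^-1.
  pose A := undup (map snd s); pose D := undup (map fst s).
  have s2 : {subset [seq (p.2, p.1) | p <- s] <= [seq (j, k) | j <- A, k <- D]}.
    move=> _ /mapP [[k j] kj ->]; apply/allpairsP; exists (j, k) => /=.
    by split=> //; rewrite mem_undup; apply/mapP; exists (k, j).
  have -> : \sum_(p <- s) cn (F p) * rho ^+ p.1 =
      \sum_(p <- [seq (p.2, p.1) | p <- s]) cn (cpow a p.1 p.2) * rho ^+ p.2 by rewrite big_map.
  apply: (@le_trans _ _ (\sum_(p <- [seq (j, k) | j <- A, k <- D]) cn (cpow a p.1 p.2) * rho ^+ p.2)).
    apply: subset_sum_le => //.
    - by move=> p; rewrite mulr_ge0 ?cn_ge0 ?exprn_ge0.
    - by rewrite map_inj_uniq// => -[x1 x2] [y1 y2] [-> ->].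
    - by apply: allpairs_uniq; rewrite ?undup_uniq// => [[x1 x2] [y1 y2] _ _ [-> ->]].
  rewrite big_allpairs_dep /=; apply: le_trans (gM A (undup_uniq _)).
  by apply: ler_sum => j _; apply: l1_bounded_cpow => //; exact: undup_uniq.
have [N [b [Hb Hsum]]] : exists N b, l1_bounded rho b N /\ forall t, cn t <= rho -> t != 0 ->
    hassum (fun k => b k * t ^+ k) (tsum (fun p : nat * nat => F p * t ^+ p.1)).
  have [f1 f2 _] := fiber_series r0 HF.
  have [r00|rp] := eqVneq rho 0.
    exists 0, (fun _ => 0); split=> [s us|t].
      by rewrite big1// => k _; rewrite cn0 mul0r.
    by rewrite r00 -cn_gt0 => h1 h2; have := lt_le_trans h2 h1; rewrite ltxx.
  exists (1 - M)^-1, (fun k => tsum (fun i : nat * nat => if i.1 == k then F i else 0)).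
  split; first by apply: f1; rewrite lt_def rp.
  by move=> t tr t0; apply: f2.
exists b, N; split=> // t x t0 tr hx.
have cx : cn x <= M.
  apply: hassum_le hx _ => s us; apply: le_trans (ha s us); apply: ler_sum => k _.
  by rewrite cnM cnX ler_wpM2l ?cn_ge0//; apply: lerXn2r; rewrite ?nnegrE ?cn_ge0.
have x1 : 1 - x != 0.
  rewrite subr_eq0; apply/eqP => x1; move: cx; rewrite -x1 cn1 => h.
  by have := le_lt_trans h M1; rewrite ltxx.
split=> //.
have bF : bsum (fun p : nat * nat => F p * t ^+ p.1).
  exists (1 - M)^-1 => s us; apply: le_trans (HF s us); apply: ler_sum => p _.
  by rewrite cnM cnX ler_wpM2l ?cn_ge0//; apply: lerXn2r; rewrite ?nnegrE ?cn_ge0.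
have <- : tsum (fun p : nat * nat => F p * t ^+ p.1) = (1 - x)^-1; last exact: Hsum.
apply: hassum_unique (hassum_geometric (le_lt_trans cx M1)).
apply: (hassum_prod (hassum_swap (bsumP bF))) => j /=.
exact: hassum_cpow r0 ha tr hx.
Qed.

(** An average over the N-th roots of unity replaces the contour integral. It extracts the
    coefficients of index congruent to k modulo N; those other than k have index at least N, and N
    exceeds every element of the finite set outside which the tail is at most e. *)
Lemma cauchy_estimate rho a M (D : R) : 0 <= rho -> l1_bounded rho a M ->
  (forall x y, hassum (fun k => a k * (rho%:Co * e1 x) ^+ k) y -> cn y <= D) ->
  forall k, cn (a k) * rho ^+ k <= D.
Proof.
move=> r0 ha HD k; apply/ler_addgt0Pr => e e0.
have hc : rbsum (fun l => cn (a l) * rho ^+ l) by exists M.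
have nn l : 0 <= cn (a l) * rho ^+ l by rewrite mulr_ge0 ?cn_ge0 ?exprn_ge0.
have [s0 Hs0] := rbsum_tail nn hc e0.
pose m := (k + \sum_(i <- s0) i)%N; pose N := m.*2.+1.
have N0 : (N%:R : C) != 0 by rewrite pnatr_eq0.
pose x (j : int) : R := - (j%:~R / N%:R).
have cx j : cn (rho%:Co * e1 (x j)) <= rho by rewrite cnM cn_e1 mulr1 cn_real ger0_norm.
have bs j := l1_bounded_bsum ha (cx j).
pose h j := tsum (fun l => a l * (rho%:Co * e1 (x j)) ^+ l).
have hh j : hassum (fun l => a l * (rho%:Co * e1 (x j)) ^+ l * e1 (- (k%:R * x j))) (h j * e1 (- (k%:R * x j))).
  have := hassumZ (e1 (- (k%:R * x j))) (bsumP (bs j)); rewrite [X in hassum _ X]mulrC; apply: hassum_ext => l; exact: mulrC.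
have H := hassum_sum (window m) hh.
have H1 : hassum (fun l => a l * rho%:Co ^+ l * (if (N %| `|Posz l - Posz k|)%N then N%:R else 0))
    (\sum_(j <- window m) h j * e1 (- (k%:R * x j))).
  apply: hassum_ext H => l; rewrite -(character_sum R) mulr_sumr; apply: eq_bigr => j _.
  have reassoc (p q u v : C) : p * (q * u) * v = p * q * (u * v) by ring.
  rewrite exprMn reassoc -(e1_mulrn (x j)) -(e1D (x j *+ l)); congr (_ * e1 _).
  rewrite /x /mesh rmorphB /= -mulr_natr; ring.
have {}H1 := hassumZ (N%:R^-1) H1; set S := \sum_(_ <- _) _ in H1.
have cS : cn S <= N%:R * D.
  apply: (le_trans (cn_sum _ _ _)).
  apply: (@le_trans _ _ (\sum_(j <- window m) D)).
    apply: ler_sum => j _; rewrite cnM cn_e1 mulr1; exact: HD (bsumP (bs j)).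
  by rewrite big_const_seq count_predT iter_addr_0 /window size_map size_iota [X in _ <= X]mulr_natl.
have H2 := hassum_fin (f := fun l => if l == k then a k * rho%:Co ^+ k else 0) (s := [:: k]) isT.
have {}H2 : hassum (fun l => if l == k then a k * rho%:Co ^+ k else 0) (a k * rho%:Co ^+ k).
  have := H2 _; rewrite big_seq1 eqxx; apply => l; rewrite inE; by case: eqP.
have H3 := hassumB H1 H2.
have : cn (N%:R^-1 * S - a k * rho%:Co ^+ k) <= e.
  apply: hassum_le H3 _ => s us.
  rewrite (bigID (fun l => (l == k) || (l < N)%N)) /= big1 ?add0r; last first.
    move=> l; case: eqP => [-> _|/eqP lk /= lN].
      by rewrite subrr dvdn0 mulrCA mulVf// mulr1 subrr cn0.
    rewrite subr0; case: ifP => [dv|]; last by rewrite !mulr0 cn0.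
    have : (`|Posz l - Posz k| < N)%N by rewrite /N /m -addnn in lN *; lia.
    have : (0 < `|Posz l - Posz k|)%N by lia.
    by move=> p0 pN; move: (dvdn_leq p0 dv); rewrite leqNgt pN.
  rewrite -big_filter; apply: (@le_trans _ _ (\sum_(i <- [seq i <- s | ~~ ((i == k) || (i < N)%N)]) cn (a i) * rho ^+ i)).
    rewrite big_seq [X in _ <= X]big_seq; apply: ler_sum => l; rewrite mem_filter => /andP[/norP[/negbTE -> _] _].
    rewrite subr0; case: ifP => _; last by rewrite !mulr0 cn0.
    by rewrite mulrCA mulVf// mulr1 cnM cnX cn_real ger0_norm.
  apply: Hs0; first exact: filter_uniq.
  move=> l; rewrite mem_filter => /andP[/norP[_ lN] _]; apply/negP => ls.
  move: lN; rewrite -leqNgt /N /m.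
  have : (l <= \sum_(i <- s0) i)%N by rewrite (big_rem l ls) /= leq_addr.
  by rewrite -addnn; lia.
have -> : cn (a k) * rho ^+ k = cn (N%:R^-1 * S - (N%:R^-1 * S - a k * rho%:Co ^+ k)).
  by rewrite opprB addrCA subrr addr0 cnM cnX cn_real ger0_norm.
move=> he; apply: (le_trans (cnB _ _)); apply: lerD => //.
rewrite cnM cnV cn_nat mulrC ler_pdivrMr ?ltr0n// mulrC; exact: cS.
Qed.
End QSeries.

(** * Expansions in t = exp(pi i tau) with a real leading exponent *)

Section QExpansions.
Variable R : realType.
Local Notation C := R[i].
Local Notation iC := (Complex 0 1 : C).
Implicit Types (t tau : C) (a b : nat -> C) (f g : C -> C) (Y e x : R).

(** The power t^x for real x, defined from tau so that no branch of the logarithm of t is chosen. *)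
Definition qexp tau x : C := cexp (iC * pi%:Co * tau * x%:Co).
Definition tt tau : C := qexp tau 1.

Lemma qexpD tau x y : qexp tau (x + y) = qexp tau x * qexp tau y.
Proof. by rewrite /qexp (coD x) mulrDr cexpD. Qed.

Lemma qexp0 tau : qexp tau 0 = 1.
Proof. by rewrite /qexp mulr0 cexp0. Qed.

Lemma qexpN tau x : qexp tau (- x) = (qexp tau x)^-1.
Proof. by rewrite /qexp (coN x) mulrN cexpN. Qed.

Lemma qexp_neq0 tau x : qexp tau x != 0. Proof. exact: cexp_neq0. Qed.

Lemma qexpNK tau x : qexp tau x * qexp tau (- x) = 1.
Proof. by rewrite -qexpD subrr qexp0. Qed.

Lemma qexp_mulrn tau x (k : nat) : qexp tau (x *+ k) = qexp tau x ^+ k.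
Proof. by elim: k => [|k IH]; rewrite ?mulr0n ?qexp0// mulrS qexpD IH exprS. Qed.

Lemma qexp_nat tau (k : nat) : qexp tau k%:R = tt tau ^+ k.
Proof. exact: qexp_mulrn. Qed.

Lemma cn_qexp tau x : cn (qexp tau x) = expR (- (pi * Im tau * x)).
Proof.
rewrite /qexp cn_cexp; congr expR; rewrite !cReM !cImM /=; ring.
Qed.

Lemma tt_neq0 tau : tt tau != 0. Proof. exact: qexp_neq0. Qed.

Lemma cn_tt tau Y : Y <= Im tau -> cn (tt tau) <= expR (- (pi * Y)).
Proof. by move=> h; rewrite cn_qexp ler_expR mulr1 lerN2 ler_wpM2l ?pi_ge0. Qed.

Lemma qexp_translate tau x : qexp (tau + 1) x = qexp tau x * e1 (x / 2).
Proof.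
rewrite /qexp /e1 ipE -cexpD; congr cexp.
have -> : 2 * pi * (x / 2) = pi * x by field.
by rewrite (coM pi); ring.
Qed.

Lemma qexp_double tau x : qexp (2 * tau) x = qexp tau (2 * x).
Proof. by rewrite /qexp (coM 2) co_nat; congr cexp; ring. Qed.

Lemma tt_imag (y : R) : tt (Complex 0 y) = (expR (- (pi * y)))%:Co.
Proof.
rewrite -cexp_real /tt /qexp; congr cexp; apply: complex_ext; rewrite !(cReM, cImM) /=; ring.
Qed.

Lemma tt_line Y x : tt (Complex (2 * x) Y) = (expR (- (pi * Y)))%:Co * e1 x.
Proof.
rewrite /e1 -cexp_real -cexpD /tt /qexp ipE; congr cexp.
by apply: complex_ext; rewrite !(cReM, cImM, cReD, cImD) /=; ring.
Qed.

(* [f tau = t^e * sum_k a_k t^k] on [Im tau >= Y], where [t = tt tau = exp (pi i tau)]. *)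
Definition qe Y e a f := (exists M, l1_bounded (expR (- (pi * Y))) a M) /\
  forall tau, Y <= Im tau -> hassum (fun k => a k * tt tau ^+ k) (qexp tau (- e) * f tau).

Lemma qe_mul Y e e' a b f g : qe Y e a f -> qe Y e' b g ->
  qe Y (e + e') (conv a b) (fun tau => f tau * g tau).
Proof.
move=> [[M ha] Ha] [[N hb] Hb]; split=> [|tau hY].
  by exists (M * N); apply: l1_bounded_conv; rewrite ?expR_ge0.
have := hassum_conv ha hb (cn_tt hY) (Ha _ hY) (Hb _ hY).
by rewrite opprD qexpD mulrACA.
Qed.

Lemma qe_ext Y e a f g : (forall tau, Y <= Im tau -> f tau = g tau) -> qe Y e a f -> qe Y e a g.
Proof. by move=> E [h H]; split=> // tau hY; rewrite -E//; exact: H. Qed.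

Lemma qe_add Y e a b f g : qe Y e a f -> qe Y e b g ->
  qe Y e (fun k => a k + b k) (fun tau => f tau + g tau).
Proof.
move=> [[M ha] Ha] [[N hb] Hb]; split=> [|tau hY].
  exists (M + N) => s us; apply: le_trans (lerD (ha s us) (hb s us)); rewrite -big_split /=.
  by apply: ler_sum => k _; rewrite -mulrDl ler_wpM2r ?exprn_ge0 ?expR_ge0// cnD.
rewrite mulrDr; apply: hassum_ext (hassumD (Ha _ hY) (Hb _ hY)) => k; by rewrite mulrDl.
Qed.

Lemma qe_scale Y e a f (c : C) : qe Y e a f -> qe Y e (fun k => c * a k) (fun tau => c * f tau).
Proof.
move=> [[M ha] Ha]; split=> [|tau hY].
  exists (cn c * M) => s us; apply: le_trans (ler_wpM2l (cn_ge0 c) (ha s us)).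
  by rewrite mulr_sumr; apply: ler_sum => k _; rewrite cnM mulrA.
by rewrite mulrCA; apply: hassum_ext (hassumZ c (Ha _ hY)) => k; rewrite mulrA.
Qed.

Lemma qe_one Y : qe Y 0 (fun k => (k == 0%N)%:R) (fun=> 1).
Proof.
have ha : l1_bounded (expR (- (pi * Y))) (fun _ => 0 : C) 0 by move=> s _; rewrite big1// => k _; rewrite cn0 mul0r.
have r0 := expR_ge0 (- (pi * Y)).
split=> [|tau hY]; first by exists (0 ^+ 0); exact: (l1_bounded_cpow 0 r0 ha).
rewrite oppr0 qexp0 mul1r.
have h0 : hassum (fun k : nat => (0 : C) * tt tau ^+ k) 0.
  by apply: hassum_ext (@hassum0 R _) => k; rewrite mul0r.
have := hassum_cpow 0 r0 ha (cn_tt hY) h0; by rewrite expr0.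
Qed.

Lemma qe_pow Y e a f p : qe Y e a f -> qe Y (e *+ p) (cpow a p) (fun tau => f tau ^+ p).
Proof.
move=> h; elim: p => [|p IH]; first by rewrite mulr0n; apply: qe_ext (qe_one Y) => tau _; rewrite expr0.
rewrite mulrS; apply: qe_ext (qe_mul h IH) => tau _; by rewrite exprS.
Qed.

Lemma qe_shift Y e a f j : (forall k, (k < j)%N -> a k = 0) -> qe Y e a f ->
  qe Y (e + j%:R) (fun k => a (k + j)%N) f.
Proof.
move=> a0 [[M ha] Ha]; have r0 := expR_gt0 (- (pi * Y)); set rho := expR _ in ha r0 *.
split=> [|tau hY].
  exists (M / rho ^+ j) => s us; rewrite ler_pdivlMr ?exprn_gt0// mulr_suml.
  have u2 : uniq [seq (k + j)%N | k <- s] by rewrite map_inj_uniq// => x y /addIn.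
  apply: le_trans (ha _ u2); rewrite big_map; apply: ler_sum => k _.
  by rewrite exprD mulrA.
have := hassum_split_nat j (Ha _ hY).
rewrite big_nat big1 ?subr0 => [H|k /andP[_ kj]]; last by rewrite a0// mul0r.
have -> : qexp tau (- (e + j%:R)) * f tau = tt tau ^- j * (qexp tau (- e) * f tau).
  by rewrite opprD qexpD [qexp tau (- j%:R)]qexpN qexp_nat; ring.
apply: hassum_ext (hassumZ (tt tau ^- j) H) => k.
by rewrite exprD mulrCA [tt tau ^+ k * _]mulrC mulKf// expf_neq0// tt_neq0.
Qed.

Lemma qe_unshift Y e a f j : qe Y (e + j%:R) a f ->
  qe Y e (fun k => if (k < j)%N then 0 else a (k - j)%N) f.
Proof.
move=> [[M ha] Ha]; have r0 := expR_gt0 (- (pi * Y)); set rho := expR _ in ha r0 *.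
split=> [|tau hY].
  exists (M * rho ^+ j) => s us.
  rewrite (bigID (fun k => (k < j)%N)) /= big1 ?add0r => [|k ->]; last by rewrite cn0 mul0r.
  rewrite -big_filter.
  have u2 : uniq [seq (k - j)%N | k <- [seq k <- s | ~~ (k < j)%N]].
    rewrite map_inj_in_uniq ?filter_uniq// => x y; rewrite !mem_filter -!leqNgt => /andP[hx _] /andP[hy _].
    by move=> E; lia.
  apply: le_trans (ler_wpM2r (exprn_ge0 j (ltW r0)) (ha _ u2)).
  rewrite big_map mulr_suml big_seq [X in _ <= X]big_seq; apply: ler_sum => k; rewrite mem_filter => /andP[/negbTE kj _].
  by rewrite kj -mulrA -exprD subnK// leqNgt kj.
have -> : qexp tau (- e) * f tau = tt tau ^+ j * (qexp tau (- (e + j%:R)) * f tau).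
  rewrite opprD qexpD [qexp tau (- j%:R)]qexpN qexp_nat; field.
  by rewrite expf_neq0// tt_neq0.
have H := hassumZ (tt tau ^+ j) (Ha _ hY).
apply: (hassum_extend (g := fun k => (k + j)%N) (g' := fun k => if (k < j)%N then None else Some (k - j)%N)) _.
- by move=> k; rewrite ltnNge leq_addl /= addnK.
- by move=> i k; case: ltnP => // ji [<-]; rewrite subnK.
- by move=> k; case: ltnP => //; rewrite mul0r.
apply: hassum_ext H => k; rewrite ltnNge leq_addl /= addnK exprD; ring.
Qed.

Lemma qe_bound Y e a f : 0 <= e -> 0 <= Y -> qe Y e a f ->
  exists M, forall tau, Y <= Im tau -> cn (f tau) <= M.
Proof.
move=> e0 Y0 [[M ha] Ha]; exists M => tau hY.
have -> : f tau = qexp tau e * (qexp tau (- e) * f tau) by rewrite mulrA qexpNK mul1r.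
have h : cn (qexp tau (- e) * f tau) <= M.
  apply: hassum_le (Ha _ hY) _ => s us; apply: le_trans (ha s us); apply: ler_sum => k _.
  by rewrite cnM cnX ler_wpM2l ?cn_ge0//; apply: lerXn2r; rewrite ?nnegrE ?cn_ge0 ?expR_ge0//; exact: cn_tt.
rewrite cnM -[M]mul1r; apply: ler_pM; rewrite ?cn_ge0//.
by rewrite cn_qexp -expR0 ler_expR oppr_le0 !mulr_ge0 ?pi_ge0// (le_trans Y0).
Qed.

(** On the imaginary axis t takes every value in (0, exp(-pi Y)], which is all that [pser_zero]
    needs. *)
Lemma qe_zero_coef Y e a f : qe Y e a f -> (forall tau, Y <= Im tau -> f tau = 0) -> forall k, a k = 0.
Proof.
move=> [[M ha] Ha] f0; have r0 := expR_gt0 (- (pi * Y)).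
apply: (pser_zero r0).
  by apply: (l1_bounded_bsum ha); rewrite cn_real ger0_norm// ltW.
move=> r /andP[rp rr].
have E : r = expR (- (pi * - (ln r / pi))) by rewrite mulrN opprK mulrCA divff ?gt_eqF ?pi_gt0// mulr1 lnK// posrE.
have hY : Y <= Im (Complex 0 (- (ln r / pi))).
  by rewrite /= -(ler_pM2l (pi_gt0 R)) -lerN2 -ler_expR -E.
by have := Ha _ hY; rewrite f0// mulr0 tt_imag -E.
Qed.

Lemma qe_unique Y e a b f : qe Y e a f -> qe Y e b f -> forall k, a k = b k.
Proof.
move=> ha hb k; apply/eqP; rewrite -subr_eq0; apply/eqP.
have H := qe_add ha (qe_scale (-1) hb).
have := qe_zero_coef H _ k; rewrite mulN1r; apply=> tau _; ring.
Qed.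

Lemma qe_zero_fun Y e a f : qe Y e a f -> (forall k, a k = 0) -> forall tau, Y <= Im tau -> f tau = 0.
Proof.
move=> [_ Ha] a0 tau hY.
have h0 : qexp tau (- e) * f tau = 0.
  apply: hassum_unique (Ha _ hY) _; apply: hassum_ext (@hassum0 R _) => k; by rewrite a0 mul0r.
by move/eqP: h0; rewrite mulf_eq0 (negbTE (qexp_neq0 _ _)) /= => /eqP.
Qed.

(** Under tau -> tau + 1, t becomes -t and t^e acquires the factor exp(pi i e). *)
Lemma qe_translate Y e a f : qe Y e a f ->
  qe Y e (fun k => e1 (e / 2) * ((-1) ^+ k * a k)) (fun tau => f (tau + 1)).
Proof.
move=> [[M ha] Ha]; split=> [|tau hY].
  exists M => s us; apply: le_trans (ha s us); apply: ler_sum => k _.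
  by rewrite (cnM (e1 _)) cn_e1 (cnM ((-1) ^+ k)) cnX cnN cn1 expr1n !mul1r.
have hY' : Y <= Im (tau + 1) by rewrite cImD /= addr0.
have tt1 : tt (tau + 1) = - tt tau by rewrite /tt qexp_translate mul1r e1_half mulrN1.
have := hassumZ (e1 (e / 2)) (Ha _ hY'); rewrite tt1 qexp_translate mulNr e1N.
have h0 : e1 (e / 2) != 0 :> C by exact: cexp_neq0.
have -> : e1 (e / 2) * (qexp tau (- e) / e1 (e / 2) * f (tau + 1)) = qexp tau (- e) * f (tau + 1).
  by field.
by apply: hassum_ext => k; rewrite [(- tt tau) ^+ k]exprNn; ring.
Qed.

Lemma qe_double Y e a f : 0 <= Y -> qe Y e a f ->
  qe Y (2 * e) (fun k => if odd k then 0 else a k./2) (fun tau => f (2 * tau)).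
Proof.
move=> Y0 [[M ha] Ha]; have r0 := expR_ge0 (- (pi * Y)).
have r1 : expR (- (pi * Y)) <= 1 by rewrite -expR0 ler_expR oppr_le0 mulr_ge0 ?pi_ge0.
split=> [|tau hY].
  exists M => s us; rewrite (bigID odd) /= big1 ?add0r => [|k ->]; last by rewrite cn0 mul0r.
  rewrite -big_filter.
  have u2 : uniq [seq k./2 | k <- [seq k <- s | ~~ odd k]].
    rewrite map_inj_in_uniq ?filter_uniq// => x y; rewrite !mem_filter => /andP[hx _] /andP[hy _] E.
    by rewrite -(odd_double_half x) -(odd_double_half y) (negbTE hx) (negbTE hy) E.
  apply: le_trans (ha _ u2); rewrite big_map big_seq [X in _ <= X]big_seq.
  apply: ler_sum => k; rewrite mem_filter => /andP[/negbTE kj _].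
  rewrite kj ler_wpM2l ?cn_ge0//; apply: ler_wiXn2l => //.
  by rewrite -{2}(odd_double_half k) kj add0n -addnn leq_addr.
have hY' : Y <= Im (2 * tau).
  by rewrite mulr2n mulrDl mul1r cImD; lra.
have H := Ha _ hY'; rewrite qexp_double mulrN in H.
apply: (hassum_extend (g := fun k => k.*2) (g' := fun k => if odd k then None else Some k./2)) _.
- by move=> k; rewrite odd_double doubleK.
- move=> i k; case: ifP => // ok [<-]; by rewrite -[RHS](odd_double_half i) ok.
- by move=> k; case: ifP => //; rewrite mul0r.
apply: hassum_ext H => k; rewrite odd_double doubleK; congr (_ * _).
have -> : tt (2 * tau) = tt tau ^+ 2 by rewrite {1}/tt qexp_double mulr1; exact: qexp_nat.
by rewrite -mul2n exprM.
Qed.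

(** The constant coefficient 1 outweighs all the others in norm, so the Neumann series of
    [inverse_series] inverts t^(-e) f. *)
Lemma qe_inverse Y e a f (M : R) : a 0%N = 1 -> M < 1 ->
  l1_bounded (expR (- (pi * Y))) (fun k => if k == 0%N then 0 else a k) M -> qe Y e a f ->
  (forall tau, Y <= Im tau -> f tau != 0) /\ exists b, qe Y (- e) b (fun tau => (f tau)^-1).
Proof.
move=> a0 M1 hs [[N ha] Ha]; have r0 := expR_ge0 (- (pi * Y)).
pose c k := - (if k == 0%N then 0 else a k).
have hc : l1_bounded (expR (- (pi * Y))) c M.
  by move=> s us; apply: le_trans (hs s us); apply: ler_sum => k _; rewrite /c cnN.
have [b [K [hb Hb]]] := inverse_series r0 M1 hc.
have key tau : Y <= Im tau -> hassum (fun k => c k * tt tau ^+ k) (1 - qexp tau (- e) * f tau).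
  move=> hY; have H1 : hassum (fun k => (k == 0%N)%:R * tt tau ^+ k) (1 : C).
    by have := (qe_one Y).2 _ hY; rewrite oppr0 qexp0 mulr1.
  apply: hassum_ext (hassumB H1 (Ha _ hY)) => -[|k]; rewrite /c /=; first by rewrite a0; ring.
  by ring.
have sub tau : 1 - (1 - qexp tau (- e) * f tau) = qexp tau (- e) * f tau by ring.
split=> [tau hY|].
  have [+ _] := Hb _ _ (tt_neq0 tau) (cn_tt hY) (key _ hY).
  by rewrite sub mulf_eq0 negb_or => /andP[].
exists b; split=> [|tau hY]; first by exists K.
have [_ +] := Hb _ _ (tt_neq0 tau) (cn_tt hY) (key _ hY).
by rewrite sub invfM qexpN invrK opprK.
Qed.

Lemma qe_family (I : eqType) (w : I -> C) (N : I -> R) (m : I -> nat) e : 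
  (forall i, N i = e + (m i)%:R) ->
  (forall Y, 0 < Y -> rbsum (fun i => cn (w i) * expR (- (pi * Y * N i)))) ->
  let a k := tsum (fun i => if m i == k then w i else 0) in
  (forall Y, 0 < Y -> qe Y e a (fun tau => tsum (fun i => w i * qexp tau (N i)))) /\
  forall k s, uniq s -> (forall i, i \in s <-> m i = k) -> a k = \sum_(i <- s) w i.
Proof.
move=> hN hw a.
have base Y : 0 < Y -> exists M, forall s, uniq s -> \sum_(i <- s) cn (w i) * expR (- (pi * Y)) ^+ m i <= M.
  move=> Y0; have [M HM] := rbsumZ (expR_ge0 (pi * Y * e)) (hw Y Y0).
  exists M => s us; apply: le_trans (HM s us); apply: ler_sum => i _.
  rewrite mulrCA -expRD -expRM_natl ler_wpM2l ?cn_ge0// le_eqVlt; apply/orP; left; apply/eqP; congr expR.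
  by rewrite hN; ring.
split=> [Y Y0|k s us hs]; last first.
  have [M HM] := base 1 ltr01.
  by have [_ _ h3] := fiber_series (expR_ge0 (- (pi * 1))) HM; exact: h3.
have [M HM] := base Y Y0.
have [h1 h2 _] := fiber_series (expR_ge0 (- (pi * Y))) HM.
split=> [|tau hY]; first by exists M; apply: h1; exact: expR_gt0.
have := h2 _ (tt_neq0 tau) (cn_tt hY).
rewrite (_ : tsum (fun i => w i * tt tau ^+ m i) = qexp tau (- e) * tsum (fun i => w i * qexp tau (N i)))//.
apply: tsumP.
have b : bsum (fun i => w i * qexp tau (N i)).
  have It : 0 < Im tau by exact: lt_le_trans hY.
  by apply: rbsum_le (hw _ It) => i; rewrite cnM cn_qexp.
apply: hassum_ext (hassumZ (qexp tau (- e)) (bsumP b)) => i.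
rewrite hN qexpD qexp_nat mulrCA; congr (_ * _).
by rewrite mulrA [qexp tau (- e) * _]mulrC qexpNK mul1r.
Qed.
End QExpansions.

(** * Modular triples *)

Section HalfPlaneRoot.
Variable R : realType.
Local Notation C := R[i].
Local Notation iC := (Complex 0 1 : C).
Implicit Types (tau : C).

(* The holomorphic square root of [tau / i] on the upper half-plane. *)
Definition sq tau : C :=
  let r := Num.sqrt ((cn tau + Im tau) / 2) in Complex r (- Re tau / (2 * r)).

Lemma sq_spec tau : 0 < Im tau -> sq tau ^+ 2 = - (iC * tau) /\ cone (sq tau).
Proof.
move=> It; rewrite /sq; set r := Num.sqrt _.
have c0 := cn_ge0 tau.
have r2 : r ^+ 2 = (cn tau + Im tau) / 2 by rewrite sqr_sqrtr// divr_ge0// addr_ge0// ltW.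
have rp : 0 < r by rewrite sqrtr_gt0 divr_gt0// ltr_wpDl.
have r0 : r != 0 by rewrite gt_eqF.
have cs := cn_sqr tau.
split.
  apply: complex_ext; rewrite expr2 !(cReM, cImM, cReN, cImN) /=; last by field.
  have -> : r * r - - Re tau / (2 * r) * (- Re tau / (2 * r)) = r ^+ 2 - Re tau ^+ 2 / (4 * r ^+ 2) by field.
  rewrite r2; have -> : Re tau ^+ 2 = (cn tau + Im tau) * (cn tau - Im tau) by transitivity (cn tau ^+ 2 - Im tau ^+ 2); [rewrite cs|]; ring.
  by field; rewrite gt_eqF// ltr_wpDl.
rewrite /cone /= normrM normrN normfV [`|2 * r|]gtr0_norm ?mulr_gt0// ltr_pdivrMr ?mulr_gt0//.
have -> : r * (2 * r) = cn tau + Im tau by rewrite mulrCA -expr2 r2; field.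
by apply: le_lt_trans (Re_le_cn tau) _; rewrite ltrDl.
Qed.

Lemma sq_sqr tau : 0 < Im tau -> sq tau ^+ 2 = - (iC * tau).
Proof. by case/sq_spec. Qed.

Lemma cone_sq tau : 0 < Im tau -> cone (sq tau).
Proof. by case/sq_spec. Qed.

Lemma sq_neq0 tau : 0 < Im tau -> sq tau != 0.
Proof. by move=> /cone_sq /cone_neq0. Qed.

Lemma upper_neq0 tau : 0 < Im tau -> tau != 0.
Proof. by move=> h; apply: contraTneq h => ->; rewrite ltxx. Qed.

Lemma Im_inv tau : tau != 0 -> Im (- tau^-1) = Im tau / cn tau ^+ 2.
Proof.
move=> t0; rewrite cn_sqr cImN; case: tau t0 => a b t0 /=.
exact: opprK.
Qed.

Lemma upper_inv tau : 0 < Im tau -> 0 < Im (- tau^-1).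
Proof.
move=> h; rewrite Im_inv ?upper_neq0// divr_gt0// exprn_gt0// cn_gt0; exact: upper_neq0.
Qed.

Lemma invNK tau : - (- tau^-1)^-1 = tau :> C.
Proof. by rewrite invrN invrK opprK. Qed.

Lemma iC_sq tau : 0 < Im tau -> iC * sq tau ^+ 2 = tau.
Proof. by move=> h; rewrite sq_sqr// mulrN mulrA iC2 mulN1r opprK. Qed.

(** The two sides have the same square, and both have positive real part since they lie in the
    cone. *)
Lemma sq_inv tau : 0 < Im tau -> sq (- tau^-1) = (sq tau)^-1.
Proof.
move=> It; have Is := upper_inv It; have t0 := upper_neq0 It.
have s0 := sq_neq0 It.
have H : (sq (- tau^-1) * sq tau) ^+ 2 = 1.
  rewrite exprMn !sq_sqr//; transitivity (iC * iC * (- (tau^-1 * tau))); first by ring.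
  by rewrite iC2 mulVf//; ring.
have [E|E] : sq (- tau^-1) * sq tau = 1 \/ sq (- tau^-1) * sq tau = -1.
  by move/eqP: H; rewrite sqrf_eq1 => /orP[/eqP|/eqP]; [left|right].
  by rewrite -[LHS](mulfK s0) E mul1r.
have E2 : sq (- tau^-1) = - (sq tau)^-1 by rewrite -[LHS](mulfK s0) E mulN1r.
have h1 := cone_sq Is; have h2 := coneV (cone_sq It).
move: h1 h2; rewrite E2 /cone cReN => h1 h2.
have p1 := le_lt_trans (normr_ge0 _) h1; have p2 := le_lt_trans (normr_ge0 _) h2.
by exfalso; lra.
Qed.
End HalfPlaneRoot.

Section ModularTriples.
Variable R : realType.
Local Notation C := R[i].
Implicit Types (tau : C) (W : C -> C) (z : C) (f g : C -> C).

(* The triples transform like (theta_3, theta_4, theta_2) under tau |-> tau + 1 and tau |-> -1/tau. *)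
Definition mt W z f1 f2 f3 := forall tau : C, 0 < Im tau ->
  [/\ f1 (tau + 1) = f2 tau, f2 (tau + 1) = f1 tau & f3 (tau + 1) = z * f3 tau] /\
  [/\ f1 (- tau^-1) = W tau * f1 tau, f2 (- tau^-1) = W tau * f3 tau & f3 (- tau^-1) = W tau * f2 tau].

Lemma mt_add W z f1 f2 f3 g1 g2 g3 : mt W z f1 f2 f3 -> mt W z g1 g2 g3 ->
  mt W z (fun tau => f1 tau + g1 tau) (fun tau => f2 tau + g2 tau) (fun tau => f3 tau + g3 tau).
Proof.
move=> hf hg tau It; have [[e1 e2 e3] [e4 e5 e6]] := hf _ It; have [[d1 d2 d3] [d4 d5 d6]] := hg _ It.
by rewrite e1 e2 e3 e4 e5 e6 d1 d2 d3 d4 d5 d6; split; split => //; ring.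
Qed.

Lemma mt_scale c W z f1 f2 f3 : mt W z f1 f2 f3 ->
  mt W z (fun tau => c * f1 tau) (fun tau => c * f2 tau) (fun tau => c * f3 tau).
Proof.
move=> hf tau It; have [[e1 e2 e3] [e4 e5 e6]] := hf _ It.
by rewrite e1 e2 e3 e4 e5 e6; split; split => //; ring.
Qed.

Lemma mt_pow W z f1 f2 f3 p : mt W z f1 f2 f3 ->
  mt (fun tau => W tau ^+ p) (z ^+ p) (fun tau => f1 tau ^+ p) (fun tau => f2 tau ^+ p) (fun tau => f3 tau ^+ p).
Proof.
move=> hf tau It; have [[e1 e2 e3] [e4 e5 e6]] := hf _ It.
by rewrite e1 e2 e3 e4 e5 e6 !exprMn.
Qed.

(* Both eigenvalues are read off from the relation (ST)^3 = 1. *)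
Lemma mt_zeta W z z' f1 f2 f3 g1 g2 g3 tau : 0 < Im tau ->
  (forall t : C, 0 < Im t -> W t != 0) -> mt W z f1 f2 f3 -> mt W z' g1 g2 g3 ->
  f3 tau != 0 -> g3 tau != 0 -> z = z'.
Proof.
move=> It W0.
have It1 : 0 < Im (tau + 1) by rewrite cImD /= addr0.
pose u := 1 - (tau + 1)^-1.
have Iu : 0 < Im u by rewrite /u addrC cImD /= addr0; exact: upper_inv.
have t0 := upper_neq0 It; have t10 := upper_neq0 It1.
have uE : u = tau / (tau + 1) by rewrite /u; field.
have key y h1 h2 h3 : mt W y h1 h2 h3 -> h3 tau != 0 -> W tau = y * (W u * W (tau + 1)).
  move=> hm h0.
  have [[_ _ e3] [_ e5 _]] := hm _ It.
  have [_ [_ d5 _]] := hm _ It1.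
  have [_ [c4 _ _]] := hm _ Iu.
  have Iv : 0 < Im (- u^-1) by exact: upper_inv.
  have [[b1 _ _] _] := hm _ Iv.
  have E1 : - u^-1 + 1 = - tau^-1 by rewrite uE; field; rewrite t0 t10.
  have [[a1 a2 _] _] := hm _ (upper_inv It1).
  have E2 : - (tau + 1)^-1 + 1 = u by rewrite /u addrC.
  have H : W tau * h3 tau = y * (W u * W (tau + 1)) * h3 tau.
    rewrite -e5 -E1; have [[_ b2 _] _] := hm _ Iv.
    have -> : h2 (- u^-1 + 1) = h1 (- u^-1) by exact: b2.
    rewrite c4 -E2 a1 d5 e3 E2; ring.
  exact: (mulIf h0).
move=> hf hg f0 g0.
have := key _ _ _ _ hf f0; rewrite (key _ _ _ _ hg g0) => /esym.
by apply: mulIf; rewrite mulf_neq0 ?W0.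
Qed.
End ModularTriples.

(** * The theta triple of a selfdual lattice *)

Section LatticeTheta.
Variables (R : realType) (n : nat) (B : 'M[R]_n).
Hypotheses (hB : B \in unitmx) (hL : selfdual (lattice_of B)).
Local Notation C := R[i].
Local Notation iC := (Complex 0 1 : C).
Local Notation lv := (lv B).
Implicit Types (tau : C) (s u : 'rV[R]_n) (z w : 'rV[int]_n) (k : nat) (fam : seq (R * 'rV[R]_n)).

Lemma is_intD (x y : R) : is_int x -> is_int y -> is_int (x + y).
Proof. by move=> [a ->] [b ->]; exists (a + b); rewrite rmorphD. Qed.

Lemma is_intN (x : R) : is_int x -> is_int (- x).
Proof. by move=> [a ->]; exists (- a); rewrite rmorphN. Qed.

Lemma e1_is_int (x : R) : is_int x -> e1 x = 1 :> C.
Proof. by move=> [m ->]; exact: e1_int. Qed.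

(** Says that 2s is a characteristic vector. The sign exp(pi i |x|^2) of the alternating series is
    then the character exp(2 pi i s.x), and the shadow is the translate L - s. *)
Definition half_char s := forall z, is_int (dot s (lv z) - nrm (lv z) / 2).

(** On an integral lattice |x|^2 / 2 is additive modulo 1, so a linear form with the right values on
    a basis has them everywhere. *)
Lemma half_char_ex : exists s, half_char s.
Proof.
pose c : 'rV[R]_n := \row_j (nrm (lv (delta_mx ord0 j)) / 2).
pose s := c *m (invmx B)^T.
have sE z : dot s (lv z) = dot c (zR R z).
  by rewrite dotC (_ : lv z = zR R z *m B)// dot_mulmx dotC /s -mulmxA -trmx_mul mulmxV// trmx1 mulmx1.
exists s; pose P z := is_int (dot s (lv z) - nrm (lv z) / 2).
have PD z w : P z -> P w -> P (z + w).
  move=> hz hw; rewrite /P lvD dotDr nrmD.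
  have [m Em] := int_dot hL z w.
  have := is_intD (is_intD hz hw) (is_intN (ex_intro _ m Em)); rewrite /is_int.
  rewrite (_ : dot s (lv z) - nrm (lv z) / 2 + (dot s (lv w) - nrm (lv w) / 2) - dot (lv z) (lv w) =
     dot s (lv z) + dot s (lv w) - (nrm (lv z) + 2 * dot (lv z) (lv w) + nrm (lv w)) / 2)//.
  by field.
have P0 : P 0 by exists 0; rewrite lv0 dot0r nrm0 mul0r subrr.
have PN z : P z -> P (- z).
  move=> hz; rewrite /P lvN dotNr nrmN.
  have [m Em] := int_dot hL z z.
  have := is_intD (is_intN hz) (is_intN (ex_intro _ m Em)); rewrite /is_int.
  rewrite (_ : - (dot s (lv z) - nrm (lv z) / 2) - dot (lv z) (lv z) = - dot s (lv z) - nrm (lv z) / 2)//.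
  by rewrite -/(nrm (lv z)); field.
move=> z; rewrite -/(P z) (row_sum_delta z); apply: (big_ind P) => // j _.
have Pd : P (delta_mx ord0 j).
  exists 0; rewrite sE.
  have -> : zR R (delta_mx ord0 j) = delta_mx ord0 j.
    by apply/rowP => l; rewrite !mxE; case: andP.
  by rewrite dotC dot_delta mxE subrr.
case: (z ord0 j) => m.
  elim: m => [|m IH]; first by rewrite scale0r.
  by rewrite intS scalerDl scale1r; apply: PD.
rewrite NegzE scaleNr; apply: (PN _); elim: m.+1 => [|l IH]; first by rewrite scale0r.
by rewrite intS scalerDl scale1r; apply: PD.
Qed.

Definition Th k fam u (chi : 'rV[int]_n -> C) tau : C :=
  tsum (fun z => (pf k fam (lv z + u))%:Co * chi z * qexp tau (nrm (lv z + u))).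

Lemma bsum_pf (f : 'rV[int]_n -> C) (y : 'rV[int]_n -> 'rV[R]_n) fam k :
  (forall a, bsum (fun z => f z * (dot (y z) a)%:Co ^+ k)) ->
  bsum (fun z => f z * (pf k fam (y z))%:Co).
Proof.
move=> h; elim: fam => [|l fam IH].
  by exists 0 => s _; rewrite big1// => z _; rewrite /pf big_nil mulr0 cn0.
apply: rbsum_le (rbsumD (rbsumZ (cn_ge0 l.1%:Co) (h l.2)) IH) => z.
rewrite /pf big_cons (coD (l.1 * _)) mulrDr (coM l.1) coX mulrCA -(cnM l.1%:Co); exact: cnD.
Qed.

Lemma rbsum_Th k fam u (chi : 'rV[int]_n -> C) (Y : R) : (forall z, cn (chi z) = 1) -> 0 < Y ->
  rbsum (fun z => cn ((pf k fam (lv z + u))%:Co * chi z) * expR (- (pi * Y * nrm (lv z + u)))).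
Proof.
move=> hchi Y0.
have c0 : 0 < pi * Y by rewrite mulr_gt0 ?pi_gt0.
have := @bsum_pf (fun z => (expR (- (pi * Y * nrm (lv z + u))))%:Co) (fun z => lv z + u) fam k.
case=> [a|M HM].
  apply: bsum_moment; apply: rbsum_le (rbsum_lattice_exp hB u a c0 ler01) => z.
  by rewrite cn_real ger0_norm ?expR_ge0.
exists M => s us; apply: le_trans (HM s us); apply: ler_sum => z _.
by rewrite (cnM (pf _ _ _)%:Co) hchi mulr1 (cnM (expR _)%:Co) mulrC [cn (expR _)%:Co]cn_real ger0_norm ?expR_ge0.
Qed.

Lemma Th_qe k fam u chi (e : R) : (forall z, cn (chi z) = 1) ->
  (forall z, exists m : nat, nrm (lv z + u) = e + m%:R) ->
  exists a, (forall Y, 0 < Y -> qe Y e a (Th k fam u chi)) /\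
   forall (j : nat) (t : seq 'rV[int]_n), uniq t -> (forall z, z \in t <-> nrm (lv z + u) = e + j%:R) ->
    a j = \sum_(z <- t) (pf k fam (lv z + u))%:Co * chi z.
Proof.
move=> hchi hm; have [m Hm] := boolp.choice hm.
have [h1 h2] := qe_family Hm (fun Y Y0 => rbsum_Th k fam u hchi Y0).
eexists; split; first exact: h1.
move=> j t ut ht; apply: h2 => // z; rewrite ht Hm.
split=> [/addrI/eqP|->//]; by rewrite eqr_nat => /eqP.
Qed.

Definition chi_of s z : C := e1 (dot s (lv z)).

(** Translation uses that |x|^2 / 2 is s.x modulo 1, so the norms of L - s are congruent to |s|^2
    modulo 2. Inversion is [theta_transform] with the shifts 0 and s. *)
Lemma lattice_mt k fam s : harm k fam -> ~~ odd k -> half_char s ->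
  mt (fun tau => sq tau ^+ n * tau ^+ k) (e1 (nrm s / 2))
    (Th k fam 0 (fun=> 1)) (Th k fam 0 (chi_of s)) (Th k fam (- s) (fun=> 1)).
Proof.
move=> hf ko hs.
have tr u tau (It : 0 < Im tau) : Th k fam (- u) (fun=> 1) (- tau^-1) = sq tau ^+ n * tau ^+ k * Th k fam 0 (chi_of u) tau.
  have := theta_transform hB hL u (cone_sq It) hf; rewrite iC_sq// => H.
  transitivity (tsum (fun z => shift_term B (sq tau) u z * (pf k fam (lv z - u))%:Co)).
    apply: eq_tsum => z; rewrite mulr1 mulrC; congr (_ * _); rewrite /shift_term /qexp; congr cexp.
    rewrite -exprVn -(sq_inv It) sq_sqr ?upper_inv//; ring.
  rewrite H; congr (_ * _); apply: eq_tsum => z; rewrite addr0 /char_term sq_sqr//.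
  have -> : cexp (- (pi%:Co * - (iC * tau) * (nrm (lv z))%:Co)) = qexp tau (nrm (lv z)).
    by rewrite /qexp; congr cexp; ring.
  by rewrite /chi_of; ring.
have Th0 tau : Th k fam 0 (chi_of 0) tau = Th k fam 0 (fun=> 1) tau.
  by apply: eq_tsum => z; rewrite /chi_of dot0l e10.
have half z : e1 (nrm (lv z) / 2) = chi_of s z.
  by rewrite /chi_of -[dot s (lv z)](subrK (nrm (lv z) / 2)) e1D (e1_is_int (hs z)) mul1r.
have chi2 z : chi_of s z * chi_of s z = 1.
  rewrite -half -e1D (_ : nrm (lv z) / 2 + nrm (lv z) / 2 = nrm (lv z)); last by field.
  by apply: e1_is_int; exact: int_dot.
move=> tau It; split; split.
- by apply: eq_tsum => z; rewrite qexp_translate addr0 half; ring.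
- apply: eq_tsum => z; rewrite qexp_translate addr0 half.
  have -> (p c q : C) : p * c * (q * c) = p * (c * c) * q by ring.
  by rewrite chi2.
- rewrite /Th -(tsumP (hassumZ (e1 (nrm s / 2)) (bsumP _))); last first.
    by apply: rbsum_le (rbsum_Th k fam (- s) (fun _ => cn1 R) It) => z; rewrite (cnM (_ * 1)) cn_qexp.
  apply: eq_tsum => z; rewrite qexp_translate.
  have -> : e1 (nrm (lv z - s) / 2) = e1 (nrm s / 2) :> C.
    have -> : nrm (lv z - s) / 2 = - (dot s (lv z) - nrm (lv z) / 2) + nrm s / 2.
      by rewrite nrmB [dot s _]dotC; field.
    by rewrite e1D e1_is_int ?mul1r//; apply: is_intN; exact: hs.
  by ring.
- by have := tr 0 tau It; rewrite oppr0 Th0.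
(* The relation for the shadow, read at -1/tau and solved for the alternating series; evenness of k
   removes the sign of (-1)^k. *)
- have := tr s _ (upper_inv It); rewrite invNK => ->.
  rewrite (sq_inv It) mulrA mulrACA -!exprMn divff ?sq_neq0// mulrN divff ?upper_neq0//.
  by rewrite expr1n mul1r -signr_odd (negbTE ko) expr0 mul1r.
- exact: tr.
Qed.
End LatticeTheta.

(** * Jacobi theta functions *)

Section JacobiTheta.
Variable R : realType.
Local Notation C := R[i].
Implicit Types (tau : C).

(** The default value of [tsum] makes this true also of families without a sum. *)
Lemma tsum_bij (I J : eqType) (f : I -> C) (g : J -> I) (g' : I -> J) :
  cancel g g' -> cancel g' g -> tsum (fun j => f (g j)) = tsum f.
Proof.
move=> gK g'K; have [[a ha]|no] := pselect (exists a, hassum f a).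
  by rewrite (tsumP ha); apply: tsumP; exact: hassum_bij gK g'K ha.
have no' : ~ exists a, hassum (fun j => f (g j)) a.
  move=> [a ha]; apply: no; exists a; have := hassum_bij g'K gK ha.
  by apply: hassum_ext => i; rewrite g'K.
by rewrite /tsum; case: pselect => // _; case: pselect.
Qed.

Definition th3 tau : C := tsum (fun m : int => qexp tau (m%:~R ^+ 2)).
Definition th4 tau : C := tsum (fun m : int => e1 (m%:~R / 2) * qexp tau (m%:~R ^+ 2)).
Definition th2 tau : C := tsum (fun m : int => qexp tau ((m%:~R - 2^-1) ^+ 2)).

Lemma even_consecutive (m : int) : exists j : int, m * (m - 1) = 2 * j.
Proof.
have nat_case (p : nat) : exists j : int, Posz p * (Posz p - 1) = 2 * j.
  elim: p => [|p [j Ej]]; first by exists 0; rewrite mul0r mulr0.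
  exists (j + Posz p); have -> : 2 * (j + Posz p) = 2 * j + 2 * Posz p by ring.
  by rewrite -Ej intS; ring.
case: m => p; first exact: nat_case.
have [j Ej] := nat_case p.+2; exists j; rewrite -Ej NegzE; lia.
Qed.

Let I1 : 'M[R]_1 := 1%:M.

Lemma lv1 (z : 'rV[int]_1) : lv I1 z = zR R z. Proof. exact: mulmx1. Qed.

Lemma selfdual1 : selfdual (lattice_of I1).
Proof.
have lat x : lattice_of I1 x <-> is_int (x ord0 ord0).
  split=> [[z ->]|[m Em]]; first by exists (z ord0 ord0); rewrite mulmx1 mxE.
  by exists (const_mx m); rewrite mulmx1; apply/rowP => j; rewrite !mxE ord1.
have d (x y : 'rV[R]_1) : dot x y = x ord0 ord0 * y ord0 ord0 by rewrite /dot big_ord1.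
split=> [x y /lat [a Ea] /lat [b Eb]|y].
  by exists (a * b); rewrite d Ea Eb rmorphM.
split=> [h|/lat [b Eb] x /lat [a Ea]]; last by exists (a * b); rewrite d Ea Eb rmorphM.
apply/lat; have /h : lattice_of I1 (const_mx 1) by apply/lat; exists 1; rewrite mxE.
by rewrite d mxE mul1r.
Qed.

Let s1 : 'rV[R]_1 := const_mx 2^-1.
Let fam1 : seq (R * 'rV[R]_1) := [:: (1, 0)].

(** The Jacobi functions are the triple of the lattice Z with the constant form 1 and s = 1/2, for
    which |s|^2 / 2 = 1/8. *)
Lemma theta_mt : mt (@sq R) (e1 8^-1) th3 th4 th2.
Proof.
have hB : I1 \in unitmx by exact: unitmx1.
have d (x y : 'rV[R]_1) : dot x y = x ord0 ord0 * y ord0 ord0 by rewrite /dot big_ord1.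
have hh : half_char I1 s1.
  move=> z; rewrite lv1 /nrm !d !mxE; have [j Ej] := even_consecutive (z ord0 ord0).
  have two : (2 : R) != 0 by rewrite pnatr_eq0.
  exists (- j); apply: (mulfI two).
  have : ((z ord0 ord0 * (z ord0 ord0 - 1))%:~R : R) = (2 * j)%:~R by rewrite Ej.
  by rewrite !rmorphM rmorphB /= => E; rewrite rmorphN /= mulrN -E; field.
have hf : harm 0 fam1 by move=> [|j].
have H := lattice_mt hB selfdual1 hf isT hh.
have pf1 (x : 'rV[R]_1) : pf 0 fam1 x = 1 by rewrite /pf big_seq1 expr0 mulr1.
pose g (m : int) : 'rV[int]_1 := const_mx m; pose g' (z : 'rV[int]_1) := z ord0 ord0.
have gK : cancel g g' by move=> m; rewrite /g' mxE.
have g'K : cancel g' g by move=> z; apply/rowP => j; rewrite mxE ord1.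
have ng u m : nrm (lv I1 (g m) + const_mx u) = (m%:~R + u) ^+ 2.
  by rewrite lv1 /nrm d !mxE expr2.
have E3 : Th I1 0 fam1 0 (fun=> 1) = th3.
  apply/funext => tau; rewrite /Th -(tsum_bij _ gK g'K); apply: eq_tsum => m.
  have -> : (0 : 'rV[R]_1) = const_mx 0 by apply/rowP => j; rewrite !mxE.
  by rewrite pf1 !mul1r ng addr0.
have E4 : Th I1 0 fam1 0 (chi_of I1 s1) = th4.
  apply/funext => tau; rewrite /Th -(tsum_bij _ gK g'K); apply: eq_tsum => m.
  have -> : (0 : 'rV[R]_1) = const_mx 0 by apply/rowP => j; rewrite !mxE.
  by rewrite pf1 !mul1r ng addr0 /chi_of lv1 d !mxE [2^-1 * _]mulrC.
have E2 : Th I1 0 fam1 (- s1) (fun=> 1) = th2.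
  apply/funext => tau; rewrite /Th -(tsum_bij _ gK g'K); apply: eq_tsum => m.
  have -> : - s1 = const_mx (- 2^-1) by apply/rowP => j; rewrite !mxE.
  by rewrite pf1 !mul1r ng.
have z8 : nrm s1 / 2 = 8^-1 by rewrite /nrm d !mxE; field.
rewrite E3 E4 E2 z8 in H; move=> tau It; have := H tau It.
by rewrite expr1 expr0 mulr1.
Qed.

Lemma fiber_tail (w : int -> C) (m : int -> nat) (rho M : R) : 0 < rho ->
  (forall s, uniq s -> \sum_(i <- s) (if m i == 0%N then 0 else cn (w i) * rho ^+ m i) <= M) ->
  l1_bounded rho (fun k => if k == 0%N then 0 else tsum (fun i => if m i == k then w i else 0)) M.
Proof.
move=> r0 HM; pose f i := if m i == 0%N then 0 else w i.
have HM' s : uniq s -> \sum_(i <- s) cn (f i) * rho ^+ m i <= M.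
  move=> us; apply: le_trans (HM s us); apply: ler_sum => i _; rewrite /f.
  by case: eqP => _; rewrite ?cn0 ?mul0r.
have [/(_ r0) h _ _] := fiber_series (ltW r0) HM'.
move=> s us; apply: le_trans (h s us); apply: ler_sum => k _.
case: eqP => [->|k0]; first by rewrite cn0 mul0r mulr_ge0 ?cn_ge0 ?exprn_ge0 ?ltW.
rewrite (_ : tsum (fun i => if m i == k then w i else 0) = tsum (fun i => if m i == k then f i else 0))//.
apply: eq_tsum => i; case: eqP => // mk; rewrite /f; case: eqP => // m0.
by case: k0; rewrite -mk.
Qed.

(** The modulus of t on the line Im tau = 1/2. *)
Definition rho0 : R := expR (- (pi * 2^-1)).

Lemma rho0_gt0 : 0 < rho0. Proof. exact: expR_gt0. Qed.

(** It suffices that pi >= 2 and e >= (9/8)^8 >= 100/39. The bound makes rho0 / (1 - rho0) at most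
    39/61, the factor of [contraction_zero]. *)
Lemma rho0_le : rho0 <= 39 / 100.
Proof.
have e8 : 9 / 8 <= expR (8^-1 : R) by apply: le_trans (expR_ge1Dx _); lra.
have e1 : (100 / 39 : R) <= expR 1.
  have -> : expR 1 = expR (8^-1 : R) ^+ 8 by rewrite -expRM_natl; congr expR; field.
  apply: (@le_trans _ _ ((9 / 8) ^+ 8)); first by lra.
  by apply: lerXn2r => //; rewrite nnegrE ?expR_ge0//; lra.
apply: (@le_trans _ _ (expR (-1))).
  by rewrite /rho0 ler_expR; have := pi_ge2 R; lra.
rewrite expRN -[39 / 100]invrK lef_pV2 ?posrE ?expR_gt0 ?invr_gt0//; last by lra.
by apply: le_trans e1; rewrite invf_div.
Qed.

Lemma rbsum_int_gauss (Y u : R) : 0 < Y ->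
  rbsum (fun m : int => cn (1 : C) * expR (- (pi * Y * (m%:~R + u) ^+ 2))).
Proof.
move=> Y0; have c0 : 0 < pi * Y by rewrite mulr_gt0 ?pi_gt0.
pose g (m : int) : 'rV[int]_1 := const_mx m.
have gi : injective g by move=> a b /rowP /(_ ord0); rewrite !mxE.
apply: rbsum_le (rbsum_inj gi (rbsum_gauss_shift (const_mx u : 'rV[R]_1) c0)) => m.
by rewrite cn1 mul1r /nrm /dot big_ord1 !mxE expr2.
Qed.

Lemma th3_qe : exists a, [/\ forall Y, 0 < Y -> qe Y 0 a th3, a 0%N = 1, a 1%N = 2, a 2%N = 0 &
  exists2 M, M < 1 & l1_bounded rho0 (fun k => if k == 0%N then 0 else a k) M].
Proof.
pose m (i : int) : nat := (`|i| ^ 2)%N.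
have hN i : (i%:~R : R) ^+ 2 = 0 + (m i)%:R.
  by rewrite add0r natrX absz_intr -normrX ger0_norm ?sqr_ge0.
have hb Y : 0 < Y -> rbsum (fun i : int => cn (1 : C) * expR (- (pi * Y * i%:~R ^+ 2))).
  by move=> Y0; apply: rbsum_le (rbsum_int_gauss 0 Y0) => i; rewrite addr0.
pose a (k : nat) : C := tsum (fun i : int => if m i == k then 1 else 0).
have [h1 h2] : (forall Y, 0 < Y -> qe Y 0 a (fun tau => tsum (fun i : int => 1 * qexp tau (i%:~R ^+ 2)))) /\
    (forall k s, uniq s -> (forall i, i \in s <-> m i = k) -> a k = \sum_(i <- s) 1) := qe_family hN hb.
exists a; split.
- move=> Y Y0; apply: qe_ext (h1 Y Y0) => tau _; apply: eq_tsum => i; exact: mul1r.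
- by rewrite (h2 0%N [:: 0]) ?big_seq1// => i; rewrite inE /m; split=> [/eqP ->//|]; lia.
- rewrite (h2 1%N [:: 1; -1]) ?big_cons ?big_nil ?addr0// => i; rewrite !inE /m.
  by split=> [/orP[/eqP ->//|/eqP ->//]|]; nia.
- rewrite (h2 2%N [::]) ?big_nil// => i; rewrite in_nil /m; split=> //.
  by case: (absz i) => [|[|k]]//; rewrite expnS expn1; lia.
have r0 := rho0_gt0; have r1 := rho0_le.
have r2 : 0 <= rho0 ^+ 2 < 1.
  by rewrite exprn_ge0 ?ltW// exprn_ilt1 ?ltW//; lra.
(* Since i^2 >= 2 |i| - 1 for i != 0, the tail is at most two geometric series of ratio rho0^2, less
   than 1 in total for rho0 <= 0.39. *)
exists (rho0 / (1 - rho0 ^+ 2) + rho0 / (1 - rho0 ^+ 2)).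
  rewrite -mulrDl ltr_pdivrMr ?subr_gt0 ?(andP r2).2// mul1r.
  by have : rho0 ^+ 2 <= (39 / 100) ^+ 2; [apply: lerXn2r => //; rewrite nnegrE; lra|lra].
apply: (@fiber_tail (fun _ => 1) m) => // s us.
pose f (k : nat) : R := if k == 0%N then 0 else rho0 ^+ (k.*2.-1).
have f0 k : 0 <= f k by rewrite /f; case: ifP => // _; rewrite exprn_ge0 ?ltW.
apply: (@le_trans _ _ (\sum_(i <- s) f `|i|%N)).
  apply: ler_sum => i _; rewrite /m /f cn1 mul1r expn_eq0 andbT; case: eqP => // /eqP i0.
  apply: ler_wiXn2l; rewrite ?ltW//; first by lra.
  by rewrite -lt0n in i0; nia.
apply: rbsum_int_of_nat => // t ut.
rewrite (bigID (pred1 0%N)) /= big1 ?add0r => [|k /eqP ->//].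
apply: (@le_trans _ _ (rho0 * \sum_(k <- [seq k.-1 | k <- t & k != 0%N]) (rho0 ^+ 2) ^+ k)).
  rewrite big_map big_filter mulr_sumr; apply: ler_sum => -[|k] // _.
  by rewrite /f /= -exprM -exprS mul2n.
apply: ler_wpM2l; first exact: ltW.
apply: geometric_partial => //.
rewrite map_inj_in_uniq ?filter_uniq// => x y; rewrite !mem_filter; clear; lia.
Qed.

Lemma th4_translate tau : 0 < Im tau -> th3 (tau + 1) = th4 tau.
Proof. by move=> It; have [[-> _ _] _] := theta_mt It. Qed.

Lemma th4_qe : exists a, [/\ forall Y, 0 < Y -> qe Y 0 a th4, a 0%N = 1, a 1%N = -2 &
  exists2 M, M < 1 & l1_bounded rho0 (fun k => if k == 0%N then 0 else a k) M].
Proof.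
have [a [h a0 a1 a2 [M M1 hM]]] := th3_qe.
exists (fun k => (-1) ^+ k * a k); split.
- move=> Y Y0; have := qe_translate (h Y Y0); rewrite mul0r e10 => H.
  have {}H : qe Y 0 (fun k => 1 * ((-1) ^+ k * a k)) th4.
    by apply: qe_ext H => tau hY; apply: th4_translate; exact: lt_le_trans hY.
  case: H => hs Hs; split.
    by case: hs => K hK; exists K => s us; apply: le_trans (hK s us); apply: ler_sum => k _; rewrite mul1r.
  by move=> tau hY; apply: hassum_ext (Hs tau hY) => k; rewrite mul1r.
- by rewrite a0 mulr1.
- by rewrite a1 expr1 mulN1r.
exists M => // s us; apply: le_trans (hM s us); apply: ler_sum => k _.
by case: eqP => // _; rewrite (cnM ((-1) ^+ k)) cnX cnN cn1 expr1n mul1r.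
Qed.

(** Since (i - 1/2)^2 = 1/4 + i (i - 1), the exponents lie in 1/4 + 2 Z. Halving makes the leading
    coefficient 1, as [qe_inverse] requires. *)
Lemma th2_qe : exists a, [/\ forall Y, 0 < Y -> qe Y 4^-1 a (fun tau => th2 tau / 2), a 0%N = 1, a 1%N = 0 &
  exists2 M, M < 1 & l1_bounded rho0 (fun k => if k == 0%N then 0 else a k) M].
Proof.
pose m (i : int) : nat := absz (i * (i - 1)).
have hN i : (i%:~R - 2^-1 : R) ^+ 2 = 4^-1 + (m i)%:R.
  rewrite absz_intr ger0_norm; last by rewrite ler0z; nia.
  by rewrite rmorphM rmorphB /=; field.
have hb Y : 0 < Y -> rbsum (fun i : int => cn (2^-1 : C) * expR (- (pi * Y * (i%:~R - 2^-1) ^+ 2))).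
  move=> Y0; apply: rbsum_le (rbsumZ (cn_ge0 (2^-1 : C)) (rbsum_int_gauss (- 2^-1) Y0)) => i.
  by rewrite cn1 mul1r.
pose a (k : nat) : C := tsum (fun i : int => if m i == k then 2^-1 else 0).
have [h1 h2] : (forall Y, 0 < Y -> qe Y 4^-1 a (fun tau => tsum (fun i : int => 2^-1 * qexp tau ((i%:~R - 2^-1) ^+ 2)))) /\
    (forall k s, uniq s -> (forall i, i \in s <-> m i = k) -> a k = \sum_(i <- s) 2^-1) := qe_family hN hb.
exists a; split.
- move=> Y Y0; apply: qe_ext (h1 Y Y0) => tau hY; rewrite /th2 mulrC.
  have It : 0 < Im tau by exact: lt_le_trans hY.
  have b : bsum (fun i : int => qexp tau ((i%:~R - 2^-1) ^+ 2)).
    by apply: rbsum_le (rbsum_int_gauss (- 2^-1) It) => i; rewrite cn1 mul1r cn_qexp.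
  exact: tsumP (hassumZ 2^-1 (bsumP b)).
- rewrite (h2 0%N [:: 0; 1]) ?big_cons ?big_nil ?addr0//; first by field.
  by move=> i; rewrite !inE /m; split=> [/orP[/eqP ->//|/eqP ->//]|]; nia.
- rewrite (h2 1%N [::]) ?big_nil// => i; rewrite in_nil /m; split=> //.
  by have [j ->] := even_consecutive i; lia.
have r0 := rho0_gt0; have r1 := rho0_le.
have r2 : 0 <= rho0 < 1 by rewrite ltW//=; lra.
(* Apart from i = 0 and i = 1, which give the leading term, i (i - 1) >= |i|. *)
exists (rho0 / (1 - rho0) / 2 + rho0 / (1 - rho0) / 2).
  by rewrite -splitr ltr_pdivrMr; lra.
apply: (@fiber_tail (fun _ => 2^-1) m) => // s us.
pose f (k : nat) : R := if k == 0%N then 0 else rho0 ^+ k / 2.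
have f0 k : 0 <= f k by rewrite /f; case: ifP => // _; rewrite divr_ge0// exprn_ge0// ltW.
apply: (@le_trans _ _ (\sum_(i <- s) f `|i|%N)).
  apply: ler_sum => i _; case: eqP => [//|/eqP mi].
  rewrite /f; case: eqP => [i0|_]; first by exfalso; move: mi; rewrite /m; lia.
  rewrite cnV cn_nat mulrC ler_wpM2r ?invr_ge0//; apply: ler_wiXn2l; rewrite ?ltW//; first by lra.
  by move: mi; rewrite /m; nia.
apply: rbsum_int_of_nat => // t ut.
rewrite (bigID (pred1 0%N)) /= big1 ?add0r => [|k /eqP ->//].
apply: (@le_trans _ _ (rho0 / 2 * \sum_(k <- [seq k.-1 | k <- t & k != 0%N]) rho0 ^+ k)).
  rewrite big_map big_filter mulr_sumr; apply: ler_sum => -[|k] // _.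
  by rewrite /f /= mulrAC -exprS.
rewrite [X in _ <= X]mulrAC; apply: ler_wpM2l; first by rewrite divr_ge0// ltW.
apply: geometric_partial => //.
rewrite map_inj_in_uniq ?filter_uniq// => x y; rewrite !mem_filter; clear; lia.
Qed.
End JacobiTheta.
Arguments rho0 {R}.

(** * The vanishing criterion *)

Section Vanishing.
Variable R : realType.
Local Notation C := R[i].
Implicit Types (tau : C) (W : C -> C) (z : C) (f g F : C -> C) (a b c : nat -> C).

(* Cauchy's estimate on the line Im tau = 1/2 bounds F on Im tau >= 1 by a fixed fraction of its own supremum there. *)
Lemma contraction_zero F c (e : R) : 1 <= e -> qe 2^-1 e c F ->
  (forall tau, Im tau = 2^-1 -> exists2 tau', 1 <= Im tau' & cn (F tau) = cn (F tau')) ->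
  forall tau, 1 <= Im tau -> F tau = 0.
Proof.
move=> e1 hF hline.
have r0 := rho0_gt0 R; have r1 := rho0_le R.
have e0 : 0 <= e by lra.
have half : (2^-1 : R) <= 1 by lra.
have [M HM] : exists M, forall tau, 2^-1 <= Im tau -> cn (F tau) <= M.
  by apply: qe_bound hF => //; lra.
pose S := [set x | exists2 tau, 1 <= Im tau & x = cn (F tau)]%classic.
have hS : has_sup S.
  split; first by exists (cn (F (Complex 0 1))); exists (Complex 0 1).
  by exists M => _ [tau h ->]; apply: HM; exact: le_trans h.
pose D := sup S.
have HD tau : 1 <= Im tau -> cn (F tau) <= D.
  by move=> h; apply: ub_le_sup; [case: hS|exists tau].
have D0 : 0 <= D by apply: le_trans (cn_ge0 _) (HD (Complex 0 1) _).
have [[N hN] HF] := hF; rewrite -/rho0 in hN.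
pose K := expR (pi * 2^-1 * e).
have K0 : 0 < K by exact: expR_gt0.
have hc k : cn (c k) * rho0 ^+ k <= K * D.
  apply: (cauchy_estimate (ltW r0) hN) => x y hy.
  have It : Im (Complex (2 * x) 2^-1 : C) = 2^-1 by [].
  have hy2 : 2^-1 <= Im (Complex (2 * x) 2^-1 : C) by [].
  have := HF _ hy2; rewrite tt_line -/rho0 => /(hassum_unique hy) ->.
  rewrite cnM cn_qexp It mulrN opprK ler_wpM2l ?expR_ge0//.
  by have [tau' h ->] := hline _ It; exact: HD.
have q0 : 0 <= (rho0 : R) < 1 by rewrite ltW//=; lra.
have bound tau : 1 <= Im tau -> cn (F tau) <= 39 / 61 * D.
  move=> h; have h2 : 2^-1 <= Im tau by exact: le_trans h.
  have -> : F tau = qexp tau e * (qexp tau (- e) * F tau) by rewrite mulrA qexpNK mul1r.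
  have b1 : cn (qexp tau (- e) * F tau) <= K * D / (1 - rho0).
    apply: hassum_le (HF _ h2) _ => s us.
    apply: le_trans (ler_wpM2l (mulr_ge0 (ltW K0) D0) (geometric_partial q0 us)).
    rewrite mulr_sumr; apply: ler_sum => k _; rewrite cnM cnX.
    apply: le_trans (ler_wpM2r (exprn_ge0 k (ltW r0)) (hc k)).
    rewrite -mulrA ler_wpM2l ?cn_ge0// -exprMn; apply: lerXn2r; rewrite ?nnegrE ?cn_ge0//.
      by rewrite mulr_ge0 ?ltW.
    apply: le_trans (cn_tt h) _; rewrite /rho0 -expRD ler_expR; lra.
  rewrite cnM; apply: (@le_trans _ _ (expR (- (pi * e)) * (K * D / (1 - rho0)))).
    apply: ler_pM; rewrite ?cn_ge0// cn_qexp ler_expR lerN2 ler_wpM2r// -[X in X <= _]mulr1.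
    by rewrite ler_wpM2l ?pi_ge0.
  have -> : expR (- (pi * e)) * (K * D / (1 - rho0)) = expR (- (pi * e)) * K / (1 - rho0) * D by ring.
  rewrite ler_wpM2r// ler_pdivrMr; last by lra.
  apply: (@le_trans _ _ rho0); last by lra.
  rewrite /K -expRD /rho0 ler_expR; have := pi_gt0 R; nra.
have : D <= 39 / 61 * D.
  apply: ge_sup; first by case: hS.
  by move=> _ [tau h ->]; exact: bound.
move=> DD tau h; apply: cn_eq0; apply/le_anti; rewrite cn_ge0 andbT.
by apply: le_trans (HD _ h) _; lra.
Qed.

(** The product of the lowest nonzero coefficients is a coefficient of the product: formal power
    series over a field form a domain. *)
Lemma conv_zero a b : (forall k, conv a b k = 0) -> (forall k, a k = 0) \/ (forall k, b k = 0).
Proof.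
move=> h; have [?|na] := pselect (forall k, a k = 0); first by left.
have [?|nb] := pselect (forall k, b k = 0); first by right.
have /existsNP [i0 /eqP hi0] := na; have /existsNP [j0 /eqP hj0] := nb.
have exa : exists i, a i != 0 by exists i0.
have exb : exists j, b j != 0 by exists j0.
case: (ex_minnP exa) => i ai imin; case: (ex_minnP exb) => j bj jmin.
have := h (i + j)%N; rewrite /conv.
have il : (i < (i + j).+1)%N by lia.
rewrite (bigD1 (Ordinal il)) //= big1 => [|l li].
  rewrite addr0 addKn => /eqP; by rewrite mulf_eq0 (negbTE ai) (negbTE bj).
have [lt|ge] := ltnP l i.
  have -> : a l = 0 by apply/eqP/negPn/negP => /imin; rewrite leqNgt lt.
  by rewrite mul0r.
have lt : ((i + j - l) < j)%N.
  have : (l : nat) != i by apply: contra li => /eqP E; apply/eqP/val_inj.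
  by have := ltn_ord l; lia.
have -> : b (i + j - l)%N = 0 by apply/eqP/negPn/negP => /jmin; rewrite leqNgt lt.
by rewrite mulr0.
Qed.

Lemma theta_inverses : exists b3 b4 b2, [/\ qe 2^-1 0 b3 (fun tau => (th3 tau)^-1),
   qe 2^-1 0 b4 (fun tau => (th4 tau)^-1), qe 2^-1 (- 4^-1) b2 (fun tau => (th2 tau / 2)^-1) &
   forall tau : C, 2^-1 <= Im tau -> [/\ th3 tau != 0, th4 tau != 0 & th2 tau != 0]].
Proof.
have hp : (0 : R) < 2^-1 by lra.
have [a3 [h3 a30 _ _ [M3 M31 hM3]]] := th3_qe R.
have [a4 [h4 a40 _ [M4 M41 hM4]]] := th4_qe R.
have [a2 [h2 a20 _ [M2 M21 hM2]]] := th2_qe R.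
have [n3 [b3 q3]] := qe_inverse a30 M31 hM3 (h3 _ hp).
have [n4 [b4 q4]] := qe_inverse a40 M41 hM4 (h4 _ hp).
have [n2 [b2 q2]] := qe_inverse a20 M21 hM2 (h2 _ hp).
exists b3, b4, b2; rewrite oppr0 in q3 q4; split=> // tau ht; split; [exact: n3|exact: n4|].
by have := n2 _ ht; rewrite mulf_eq0 negb_or => /andP[].
Qed.

Lemma cn_invariant_int F : (forall tau, 0 < Im tau -> cn (F (tau + 1)) = cn (F tau)) ->
  forall (m : int) tau, 0 < Im tau -> cn (F (tau + m%:~R)) = cn (F tau).
Proof.
move=> h m tau It.
have up (k : nat) t : 0 < Im t -> cn (F (t + k%:R)) = cn (F t).
  move=> It'; elim: k => [|k IH]; first by rewrite addr0.
  rewrite -IH -natr1 addrA h// cImD -co_nat /= addr0//.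
have Imz (p : int) : Im (tau + p%:~R) = Im tau.
  rewrite cImD; have -> : (p%:~R : C) = (p%:~R : R)%:Co by rewrite rmorph_int.
  by rewrite /= addr0.
case: m => k; first by rewrite -pmulrn; exact: up.
rewrite -(up k.+1 (tau + (Negz k)%:~R)) ?Imz//; congr (cn (F _)).
by rewrite NegzE rmorphN /= -pmulrn subrK.
Qed.

(** A translation achieves |Re t| <= 1/2, so |t|^2 <= 1/4 + 1/4 and Im(-1/t) = (1/2) / |t|^2 >=
    1. *)
Lemma line_to_cusp F : (forall tau, 0 < Im tau -> cn (F (tau + 1)) = cn (F tau)) ->
  (forall tau, 0 < Im tau -> cn (F (- tau^-1)) = cn (F tau)) ->
  forall tau, Im tau = 2^-1 -> exists2 tau', 1 <= Im tau' & cn (F tau) = cn (F tau').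
Proof.
move=> hT hS tau It; have It0 : 0 < Im tau by rewrite It; lra.
pose m := - Num.floor (Re tau + 2^-1); pose t := tau + m%:~R.
have mE : (m%:~R : C) = (m%:~R : R)%:Co by rewrite rmorph_int.
have Imt : Im t = 2^-1 by rewrite /t mE cImD It /= addr0.
have Itt : 0 < Im t by rewrite Imt; lra.
have Ret : - 2^-1 <= Re t <= 2^-1.
  rewrite /t mE cReD /= /m rmorphN /=.
  have := floor_le (Re tau + 2^-1); have := floorD1_gt (Re tau + 2^-1); rewrite intrD /=; lra.
exists (- t^-1).
  rewrite Im_inv ?upper_neq0// ler_pdivlMr ?exprn_gt0 ?cn_gt0 ?upper_neq0// mul1r cn_sqr Imt.
  by case/andP: Ret; nra.
by rewrite hS// cn_invariant_int.
Qed.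

Lemma vanishing W z f1 f2 f3 (o o3 : R) a1 a2 a3 N : mt W z f1 f2 f3 ->
  (forall tau, 0 < Im tau -> cn (W tau) = cn (sq tau) ^+ N) -> cn z = 1 ->
  (forall Y, 0 < Y -> qe Y o a1 f1) -> (forall Y, 0 < Y -> qe Y o a2 f2) -> (forall Y, 0 < Y -> qe Y o3 a3 f3) ->
  N%:R / 4 < 2 * o + o3 ->
  forall tau, 0 < Im tau -> [/\ f1 tau = 0, f2 tau = 0 & f3 tau = 0].
Proof.
move=> hm hW hz q1 q2 q3 ho.
have hp : (0 : R) < 2^-1 by lra.
have [b3 [b4 [b2 [p3 p4 p2 pn]]]] := theta_inverses.
pose H tau := (th3 tau)^-1 * (th4 tau)^-1 * (th2 tau / 2)^-1.
pose G tau := f1 tau * f2 tau * f3 tau * H tau ^+ N.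
have [c qG] : exists c, qe 2^-1 (2 * o + o3 - N%:R / 4) c G.
  have := qe_mul (qe_mul (qe_mul (q1 _ hp) (q2 _ hp)) (q3 _ hp)) (qe_pow N (qe_mul (qe_mul p3 p4) p2)).
  rewrite (_ : o + o + o3 + (0 + 0 - 4^-1) *+ N = 2 * o + o3 - N%:R / 4).
    by move=> h; eexists; exact: h.
  by rewrite -[_ *+ N]mulr_natr; ring.
have G1 tau : 0 < Im tau -> cn (G (tau + 1)) = cn (G tau).
  move=> It; have [[r1 r2 r3] _] := hm _ It; have [[d1 d2 d3] _] := theta_mt It.
  move: (cn_e1 (8^-1 : R)) d3; move: (e1 (8^-1 : R)) => u hu d3.
  have HE : H (tau + 1) = u^-1 * H tau by rewrite /H d1 d2 d3 !invfM; ring.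
  have GE : G (tau + 1) = z * u^-1 ^+ N * G tau by rewrite /G r1 r2 r3 HE exprMn; ring.
  by rewrite GE (cnM (z * _)) (cnM z) cnX cnV hz hu invr1 expr1n !mul1r.
have GS tau : 0 < Im tau -> cn (G (- tau^-1)) = cn (G tau).
  move=> It; have [_ [e1 e2 e3]] := hm _ It; have [_ [d1 d2 d3]] := theta_mt It.
  have s0 : cn (sq tau) != 0 by rewrite gt_eqF// cn_gt0 sq_neq0.
  have HE : H (- tau^-1) = (sq tau)^-1 ^+ 3 * H tau by rewrite /H d1 d2 d3 !invfM; ring.
  have GE : G (- tau^-1) = W tau ^+ 3 * ((sq tau)^-1 ^+ 3) ^+ N * G tau.
    by rewrite /G e1 e2 e3 HE exprMn; ring.
  rewrite GE (cnM (_ ^+ 3 * _)) (cnM (W tau ^+ 3)) !cnX cnV hW// -!exprM mulnC -exprMn divff// expr1n mul1r //.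
pose e := 2 * o + o3 - N%:R / 4.
have e0 : 0 < e by rewrite subr_gt0.
(* The contraction needs a leading exponent of at least 1, so it is applied to G^p with p e >= 1. *)
pose p := (Num.bound e^-1).
have pe : 1 <= e *+ p.
  rewrite -[_ *+ p]mulr_natr -ler_pdivrMl// mulr1; apply: ltW; apply: archi_boundP.
  by rewrite invr_ge0 ltW.
have cinv (x y : C) : cn x = cn y -> cn (x ^+ p) = cn (y ^+ p) by rewrite !cnX => ->.
have hl := @line_to_cusp (fun tau => G tau ^+ p) (fun tau It => cinv _ _ (G1 tau It)) (fun tau It => cinv _ _ (GS tau It)).
have Gp0 := contraction_zero pe (qe_pow p qG) hl.
have prod0 tau : 1 <= Im tau -> f1 tau * f2 tau * f3 tau = 0.
  move=> h; have h2 : 2^-1 <= Im tau by apply: le_trans h; lra.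
  have [n3 n4 n2] := pn _ h2; apply/eqP.
  have /eqP := Gp0 _ h; rewrite expf_eq0 => /andP[_].
  rewrite /G mulf_eq0 => /orP[//|]; rewrite expf_eq0 => /andP[_].
  by rewrite /H !mulf_eq0 !invr_eq0 mulf_eq0 invr_eq0 (negbTE n3) (negbTE n4) (negbTE n2) pnatr_eq0.
(* The product of the three expansions is zero, so one of them is zero; the translation and
   inversion relations then carry the vanishing to the other two functions. *)
have c0 := qe_zero_coef (qe_mul (qe_mul (q1 _ ltr01) (q2 _ ltr01)) (q3 _ ltr01)) prod0.
have zf e' a f : (forall Y, 0 < Y -> qe Y e' a f) -> (forall k, a k = 0) -> forall tau, 0 < Im tau -> f tau = 0.
  by move=> q a0 tau It; exact: (qe_zero_fun (q _ It) a0 (lexx _)).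
have W0 tau : 0 < Im tau -> W tau != 0.
  by move=> It; rewrite -cn_gt0 hW// exprn_gt0// cn_gt0 sq_neq0.
have from1 : (forall tau, 0 < Im tau -> f1 tau = 0) -> forall tau, 0 < Im tau -> f2 tau = 0.
  move=> h tau It; have [[<- _ _] _] := hm _ It; apply: h; by rewrite cImD /= addr0.
have to1 : (forall tau, 0 < Im tau -> f2 tau = 0) -> forall tau, 0 < Im tau -> f1 tau = 0.
  move=> h tau It; have [[_ <- _] _] := hm _ It; apply: h; by rewrite cImD /= addr0.
have from2 : (forall tau, 0 < Im tau -> f2 tau = 0) -> forall tau, 0 < Im tau -> f3 tau = 0.
  move=> h tau It; have [_ [_ e5 _]] := hm _ It; move: e5; rewrite h ?upper_inv// => /esym/eqP.
  by rewrite mulf_eq0 (negbTE (W0 _ It)) /= => /eqP.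
have to2 : (forall tau, 0 < Im tau -> f3 tau = 0) -> forall tau, 0 < Im tau -> f2 tau = 0.
  move=> h tau It; have [_ [_ _ e6]] := hm _ It; move: e6; rewrite h ?upper_inv// => /esym/eqP.
  by rewrite mulf_eq0 (negbTE (W0 _ It)) /= => /eqP.
have all : (forall tau, 0 < Im tau -> f2 tau = 0) -> forall tau, 0 < Im tau -> [/\ f1 tau = 0, f2 tau = 0 & f3 tau = 0].
  by move=> h tau It; split; [exact: to1|exact: h|exact: from2].
case: (conv_zero c0) => [/conv_zero [] h|h]; apply: all.
- exact: from1 (zf _ _ _ q1 h).
- exact: zf q2 h.
- exact: to2 (zf _ _ _ q3 h).
Qed.
End Vanishing.

(** * Landen's transformation and coefficients at powers of 4 *)

Section Landen.
Variable R : realType.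
Local Notation C := R[i].
Implicit Types (tau : C) (a b c : nat -> C).

Lemma bsum_th3 tau : 0 < Im tau -> bsum (fun m : int => qexp tau (m%:~R ^+ 2)).
Proof.
move=> It; apply: rbsum_le (rbsum_int_gauss 0 It) => m; by rewrite cn1 mul1r addr0 cn_qexp.
Qed.

Lemma bsum_th2 tau : 0 < Im tau -> bsum (fun m : int => qexp tau ((m%:~R - 2^-1) ^+ 2)).
Proof.
move=> It; apply: rbsum_le (rbsum_int_gauss (- 2^-1) It) => m; by rewrite cn1 mul1r cn_qexp.
Qed.

Lemma upper_double tau : 0 < Im tau -> 0 < Im (2 * tau).
Proof. by move=> It; rewrite mulr2n mulrDl mul1r cImD addr_gt0. Qed.

Definition halfz (m : int) : int := (m %/ 2)%Z.

Lemma halfz_even (m : int) : (m %% 2)%Z = 0 -> m = 2 * halfz m.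
Proof. by move=> h; rewrite {1}(divz_eq m 2) h addr0 mulrC. Qed.

Lemma halfz_odd (m : int) : (m %% 2)%Z <> 0 -> m = 2 * halfz m + 1.
Proof.
move=> h; rewrite {1}(divz_eq m 2) mulrC; congr (_ + _).
have := modz_ge0 m (isT : 2 != 0 :> int); have := ltz_pmod m (isT : 0 < 2 :> int); lia.
Qed.

Lemma halfz2 (m : int) : halfz (2 * m) = m /\ ((2 * m) %% 2)%Z = 0.
Proof. by rewrite /halfz mulrC mulzK// modzMl. Qed.

Lemma halfz21 (m : int) : halfz (2 * m + 1) = m /\ ((2 * m + 1) %% 2)%Z = 1.
Proof. by rewrite /halfz mulrC divzMDl// modzMDl addr0. Qed.

(* (a, b) |-> (a + b, a - b) is a bijection onto the pairs of equal parity, (a, b) |-> (a + b - 1, a - b) onto the others. *)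
Lemma hassum_parity (f : int * int -> C) x y :
  hassum (fun p : int * int => f (p.1 + p.2, p.1 - p.2)) x ->
  hassum (fun p : int * int => f (p.1 + p.2 - 1, p.1 - p.2)) y ->
  hassum f (x + y).
Proof.
move=> hx hy.
pose ev (p : int * int) := ((p.1 - p.2) %% 2)%Z == 0.
have h1 : hassum (fun p => if ev p then f p else 0) x.
  apply: (hassum_extend (g := fun p : int * int => (p.1 + p.2, p.1 - p.2))
     (g' := fun p : int * int => if ev p then Some (halfz (p.1 + p.2), halfz (p.1 - p.2)) else None)).
  - move=> [u v] /=; rewrite /ev /=.
    have -> : u + v - (u - v) = 2 * v by ring.
    have -> : u + v + (u - v) = 2 * u by ring.
    by rewrite (halfz2 v).2 (halfz2 v).1 (halfz2 u).1 eqxx.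
  - move=> [u v] [a b] /=; rewrite /ev /=; case: eqP => // /halfz_even h [<- <-].
    move: (halfz (u - v)) h => q /eqP; rewrite subr_eq => /eqP ->.
    have -> : 2 * q + v + v = 2 * (q + v) by ring.
    by rewrite (halfz2 _).1; congr (_, _); ring.
  - by move=> p /=; case: ifP.
  apply: hassum_ext hx => -[u v] /=; rewrite /ev /=.
  have -> : u + v - (u - v) = 2 * v by ring.
  by rewrite (halfz2 v).2 eqxx.
have h2 : hassum (fun p => if ev p then 0 else f p) y.
  apply: (hassum_extend (g := fun p : int * int => (p.1 + p.2 - 1, p.1 - p.2))
     (g' := fun p : int * int => if ev p then None else Some (halfz (p.1 + p.2) + 1, halfz (p.1 - p.2) + 1))).
  - move=> [u v] /=; rewrite /ev /=.
    have -> : u + v - 1 - (u - v) = 2 * (v - 1) + 1 by ring.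
    have -> : u + v - 1 + (u - v) = 2 * (u - 1) + 1 by ring.
    by rewrite (halfz21 (v - 1)).2 (halfz21 (v - 1)).1 (halfz21 (u - 1)).1 !subrK.
  - move=> [u v] [a b] /=; rewrite /ev /=; case: eqP => // /halfz_odd h [<- <-].
    move: (halfz (u - v)) h => q /eqP; rewrite subr_eq => /eqP ->.
    have -> : 2 * q + 1 + v + v = 2 * (q + v) + 1 by ring.
    by rewrite (halfz21 _).1; congr (_, _); ring.
  - by move=> p /=; case: ifP.
  apply: hassum_ext hy => -[u v] /=; rewrite /ev /=.
  have -> : u + v - 1 - (u - v) = 2 * (v - 1) + 1 by ring.
  by rewrite (halfz21 _).2.
apply: hassum_ext (hassumD h1 h2) => p; case: ifP => _; ring.
Qed.

(** The substitution of [hassum_parity] doubles a^2 + b^2; one parity class gives pairs of integers,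
    the other pairs of half-integers. *)
Lemma th3_sqr tau : 0 < Im tau -> th3 tau ^+ 2 = th3 (2 * tau) ^+ 2 + th2 (2 * tau) ^+ 2.
Proof.
move=> It; have It2 := upper_double It.
have b3 := bsum_th3 It; have c3 := bsum_th3 It2; have c2 := bsum_th2 It2.
have H := hassumM b3 b3 (bsumP b3) (bsumP b3).
rewrite expr2; apply: hassum_unique H _.
apply: hassum_parity.
- rewrite expr2; apply: hassum_ext (hassumM c3 c3 (bsumP c3) (bsumP c3)) => -[u v] /=.
  by rewrite !qexp_double -!qexpD; congr qexp; rewrite rmorphB rmorphD /=; ring.
- rewrite expr2; apply: hassum_ext (hassumM c2 c2 (bsumP c2) (bsumP c2)) => -[u v] /=.
  by rewrite !qexp_double -!qexpD; congr qexp; rewrite !rmorphB rmorphD /=; field.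
Qed.

Lemma th2_sqr tau : 0 < Im tau -> th2 tau ^+ 2 = 2 * th2 (2 * tau) * th3 (2 * tau).
Proof.
move=> It; have It2 := upper_double It.
have b2 := bsum_th2 It; have c3 := bsum_th3 It2; have c2 := bsum_th2 It2.
have H := hassumM b2 b2 (bsumP b2) (bsumP b2).
have -> : 2 * th2 (2 * tau) * th3 (2 * tau) = th2 (2 * tau) * th3 (2 * tau) + th3 (2 * tau) * th2 (2 * tau) by ring.
rewrite expr2; apply: hassum_unique H _.
apply: hassum_parity.
- apply: hassum_ext (hassumM c2 c3 (bsumP c2) (bsumP c3)) => -[u v] /=.
  by rewrite !qexp_double -!qexpD; congr qexp; rewrite rmorphB rmorphD /=; field.
- have H2 := hassumM c3 c2 (bsumP c3) (bsumP c2).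
  have H3 := hassum_bij (g := fun p : int * int => (p.1 - 1, p.2)) (g' := fun p : int * int => (p.1 + 1, p.2)) _ _ H2.
  apply: hassum_ext (H3 _ _) => -[u v] /=; rewrite ?subrK ?addrK//.
  by rewrite !qexp_double -!qexpD; congr qexp; rewrite !rmorphB rmorphD /=; field.
Qed.

Lemma e1_8_pow4 : e1 (8^-1 : R) ^+ 4 = -1 :> C.
Proof. by rewrite -e1_mulrn -e1_half; congr e1; rewrite -[_ *+ 4]mulr_natr; field. Qed.

Lemma theta_translate tau : 0 < Im tau ->
  [/\ th3 (tau + 1) = th4 tau, th4 (tau + 1) = th3 tau & th2 (tau + 1) ^+ 4 = - th2 tau ^+ 4].
Proof.
move=> It; have [[-> -> ->] _] := theta_mt It; split=> //.
by rewrite exprMn e1_8_pow4 mulN1r.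
Qed.

(** This is [th3_sqr] translated by 1: the argument 2 tau moves by 2, which fixes theta_3 and
    changes the sign of theta_2^2. *)
Lemma th4_sqr tau : 0 < Im tau -> th4 tau ^+ 2 = th3 (2 * tau) ^+ 2 - th2 (2 * tau) ^+ 2.
Proof.
move=> It; have It2 := upper_double It.
have It1 : 0 < Im (tau + 1) by rewrite cImD /= addr0.
have It3 : 0 < Im (2 * tau + 1) by rewrite cImD /= addr0.
have [[<- _ _] _] := theta_mt It; rewrite th3_sqr//.
have -> : 2 * (tau + 1) = 2 * tau + 1 + 1 by ring.
have [[a1 a2 a3] _] := theta_mt It2; have [[b1 b2 b3] _] := theta_mt It3.
rewrite b1 a2 b3 a3 mulrA exprMn; congr (_ + _).
have -> : (e1 (8^-1 : R) * e1 8^-1 : C) ^+ 2 = -1 by rewrite -expr2 -exprM e1_8_pow4.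
by rewrite mulN1r.
Qed.

Lemma jacobi_identity tau : 0 < Im tau -> th3 tau ^+ 4 = th4 tau ^+ 4 + th2 tau ^+ 4.
Proof.
move=> It; rewrite (exprM (th3 tau) 2 2) (exprM (th4 tau) 2 2) (exprM (th2 tau) 2 2) (th3_sqr It) (th4_sqr It) (th2_sqr It); ring.
Qed.

(** The discriminant eta^24, as theta_2 theta_3 theta_4 = 2 eta^3. *)
Definition Dl tau : C := (th2 tau / 2 * th3 tau * th4 tau) ^+ 8.
(** Not the Eisenstein series. [E4], [H4] and [J4] are products of weight 14 closed under taking
    even parts: [E4] at tau is [H4] at 2 tau, the even part of [H4] is [J4] at 2 tau, and the even
    part of [J4] is 2^12 [E4]. *)
Definition E4 tau : C := Dl tau * (th3 tau ^+ 4 + th4 tau ^+ 4).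
Definition H4 tau : C := 8^-1 * (th2 tau ^+ 4 * th3 tau ^+ 4 * th4 tau ^+ 16 * (th3 tau ^+ 4 + th2 tau ^+ 4)).
Definition J4 tau : C := 2 ^+ 13 * (Dl tau * (th3 tau ^+ 4 + th2 tau ^+ 4)).

Lemma Dl_translate tau : 0 < Im tau -> Dl (tau + 1) = Dl tau.
Proof.
move=> It; have [e3 e4 e2] := theta_translate It; rewrite /Dl e3 e4.
rewrite !exprMn (exprM (th2 (tau + 1)) 4 2) e2 sqrrN -exprM; ring.
Qed.

Lemma E4_double tau : 0 < Im tau -> E4 tau = H4 (2 * tau).
Proof.
move=> It; have It2 := upper_double It; have := jacobi_identity It2.
rewrite /E4 /H4 /Dl.
have -> : (th2 tau / 2 * th3 tau * th4 tau) ^+ 8 = (2 ^+ 8)^-1 * ((th2 tau ^+ 2) ^+ 4 * (th3 tau ^+ 2) ^+ 4 * (th4 tau ^+ 2) ^+ 4).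
  by rewrite -!exprM; field.
rewrite (exprM (th3 tau) 2 2) (exprM (th4 tau) 2 2) (th3_sqr It) (th4_sqr It) (th2_sqr It).
move: (th2 _) (th3 _) (th4 _) => x y z h.
have -> : z ^+ 16 = ((y ^+ 2 + x ^+ 2) * (y ^+ 2 - x ^+ 2)) ^+ 4.
  have -> : (y ^+ 2 + x ^+ 2) * (y ^+ 2 - x ^+ 2) = y ^+ 4 - x ^+ 4 by ring.
  by rewrite h addrK -exprM.
have : (y ^+ 2 + x ^+ 2) ^+ 2 + (y ^+ 2 - x ^+ 2) ^+ 2 = 2 * (y ^+ 4 + x ^+ 4) by ring.
move=> ->; move: (y ^+ 2 + x ^+ 2) (y ^+ 2 - x ^+ 2) (y ^+ 4 + x ^+ 4) => P Q S.
by field.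
Qed.

Lemma H4_even tau : 0 < Im tau -> H4 tau + H4 (tau + 1) = 2 * J4 (2 * tau).
Proof.
move=> It; have It2 := upper_double It; have j2 := jacobi_identity It2.
have [e3 e4 e2] := theta_translate It.
rewrite /H4 e3 e4 e2 /J4 /Dl.
rewrite (exprM (th3 tau) 2 2) (exprM (th4 tau) 2 2) (exprM (th3 tau) 2 8) (exprM (th4 tau) 2 8) (exprM (th2 tau) 2 2).
rewrite (th3_sqr It) (th4_sqr It) (th2_sqr It).
move: (th2 _) (th3 _) (th4 _) j2 => x y z h.
have -> : (x / 2 * y * z) ^+ 8 = (2 ^+ 8)^-1 * (x * y) ^+ 8 * (z ^+ 4) ^+ 2 by rewrite -exprM; field.
have -> : z ^+ 4 = (y ^+ 2 + x ^+ 2) * (y ^+ 2 - x ^+ 2).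
  have -> : (y ^+ 2 + x ^+ 2) * (y ^+ 2 - x ^+ 2) = y ^+ 4 - x ^+ 4 by ring.
  by rewrite h addrK.
set P := y ^+ 2 + x ^+ 2; set Q := y ^+ 2 - x ^+ 2; set D := (2 * x * y) ^+ 2.
have hS : y ^+ 4 + x ^+ 4 = 2^-1 * (P ^+ 2 + Q ^+ 2) by rewrite /P /Q; field.
have hD : D = P ^+ 2 - Q ^+ 2 by rewrite /D /P /Q; ring.
have hx : (x * y) ^+ 8 = (2 ^+ 8)^-1 * D ^+ 4 by rewrite /D; field.
rewrite hS hx hD; move: P Q {hS hD hx D} => P Q.
by field.
Qed.

Lemma J4_even tau : 0 < Im tau -> J4 tau + J4 (tau + 1) = 2 ^+ 13 * E4 tau.
Proof.
move=> It; have j := jacobi_identity It.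
have [e3 e4 e2] := theta_translate It.
by rewrite /J4 /E4 Dl_translate// e3 e2; ring.
Qed.

(** Adding the translate by 1, where t becomes -t, doubles the even coefficients and kills the odd
    ones. *)
Lemma qe_even f a (c : C) g b : (forall Y : R, 0 < Y -> qe Y 0 a f) -> (forall Y : R, 0 < Y -> qe Y 0 b g) ->
  (forall tau : C, 0 < Im tau -> f tau + f (tau + 1) = c * g tau) ->
  forall k, a k.*2 *+ 2 = c * b k.*2.
Proof.
move=> qf qg h k; have q := qf _ ltr01.
have H1 := qe_add q (qe_translate q).
have H2 := qe_scale c (qg _ ltr01).
have := qe_unique (qe_ext _ H1) H2 k.*2; rewrite mul0r e10 mul1r -signr_odd odd_double expr0 mul1r mulr2n.
by apply=> tau ht; apply: h; exact: lt_le_trans ht.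
Qed.

(** Expansion with integral exponents together with its first three coefficients, the ones that
    [vanish3] inspects. *)
Definition qc (f : C -> C) (c0 c1 c2 : C) := exists a, (forall Y : R, 0 < Y -> qe Y 0 a f) /\
  [/\ a 0%N = c0, a 1%N = c1 & a 2%N = c2].

Lemma qc_ext (f g : C -> C) (c0 c1 c2 : C) : f =1 g -> qc f c0 c1 c2 -> qc g c0 c1 c2.
Proof. by move=> /funext ->. Qed.

Lemma qc_mul (f g : C -> C) (a0 a1 a2 b0 b1 b2 : C) : qc f a0 a1 a2 -> qc g b0 b1 b2 ->
  qc (fun tau => f tau * g tau) (a0 * b0) (a0 * b1 + a1 * b0) (a0 * b2 + a1 * b1 + a2 * b0).
Proof.
move=> [a [qa [<- <- <-]]] [b [qb [<- <- <-]]]; exists (conv a b); split=> [Y Y0|].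
  by have := qe_mul (qa Y Y0) (qb Y Y0); rewrite addr0.
by rewrite /conv !big_ord_recr !big_ord0 /= !subn0 !add0r.
Qed.

Lemma qc_add (f g : C -> C) (a0 a1 a2 b0 b1 b2 : C) : qc f a0 a1 a2 -> qc g b0 b1 b2 ->
  qc (fun tau => f tau + g tau) (a0 + b0) (a1 + b1) (a2 + b2).
Proof.
move=> [a [qa [<- <- <-]]] [b [qb [<- <- <-]]]; exists (fun k => a k + b k); split=> // Y Y0.
exact: qe_add (qa Y Y0) (qb Y Y0).
Qed.

Lemma qc_scale (c : C) (f : C -> C) (a0 a1 a2 : C) : qc f a0 a1 a2 -> qc (fun tau => c * f tau) (c * a0) (c * a1) (c * a2).
Proof.
move=> [a [qa [<- <- <-]]]; exists (fun k => c * a k); split=> // Y Y0; exact: qe_scale (qa Y Y0).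
Qed.

Lemma qc_pow (f : C -> C) (x y : C) p : qc f 1 x y -> qc (fun tau => f tau ^+ p) 1 (p%:R * x) (p%:R * y + 'C(p, 2)%:R * x ^+ 2).
Proof.
move=> h; elim: p => [|p IH].
  rewrite (bin_small (isT : (0 < 2)%N)) !mul0r addr0; exists (fun k => (k == 0%N)%:R); split=> // Y Y0; exact: qe_one.
have := qc_mul h IH; rewrite !mul1r mulr1.
have -> : p%:R * x + x = p.+1%:R * x by rewrite -natr1; ring.
have -> : p%:R * y + 'C(p, 2)%:R * x ^+ 2 + x * (p%:R * x) + y * 1 = p.+1%:R * y + 'C(p.+1, 2)%:R * x ^+ 2.
  by rewrite binS bin1 natrD -natr1; ring.
by apply: qc_ext => tau; rewrite exprS.
Qed.

Lemma th3_qc : qc (@th3 R) 1 2 0.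
Proof. by have [a [qa a0 a1 a2 _]] := th3_qe R; exists a. Qed.

Lemma th4_qc : qc (@th4 R) 1 (-2) 0.
Proof.
have [b [qb b0 b1 _]] := th4_qe R; exists b; split=> //; split=> //.
have [a [qa a0 a1 a2 _]] := th3_qe R.
have H := qe_translate (qa _ ltr01).
have {}H := qe_ext (fun tau ht => th4_translate (lt_le_trans ltr01 ht)) H.
by rewrite (qe_unique (qb _ ltr01) H) a2 !mulr0.
Qed.

Lemma th2_pow4_qc : qc (fun tau => (th2 tau / 2) ^+ 4) 0 1 0.
Proof.
have [a [qa a0 a1 _]] := th2_qe R.
have h Y : 0 < Y -> qe Y (0 + 1%:R) (cpow a 4) (fun tau => (th2 tau / 2) ^+ 4).
  move=> Y0; have := qe_pow 4 (qa Y Y0).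
  by rewrite (_ : 4^-1 *+ 4 = 0 + 1%:R :> R)// -[LHS]mulr_natr; field.
eexists; split=> [Y Y0|]; first exact: qe_unshift (h Y Y0).
by rewrite /= /conv !big_ord_recr !big_ord0 /= !subn0 ?subn1 a0 a1; split=> //; ring.
Qed.

Lemma th2_pow8_qc : qc (fun tau => (th2 tau / 2) ^+ 8) 0 0 1.
Proof.
have := qc_mul th2_pow4_qc th2_pow4_qc; rewrite !(mul0r, mul1r, mulr0, addr0, add0r).
by apply: qc_ext => tau; rewrite -exprD.
Qed.

Lemma Dl_qc : qc Dl 0 0 1.
Proof.
have := qc_mul (qc_mul th2_pow8_qc (qc_pow 8 th3_qc)) (qc_pow 8 th4_qc).
rewrite !(mul0r, mul1r, mulr0, addr0, add0r, mulr1); apply: qc_ext => tau.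
by rewrite /Dl !exprMn.
Qed.

(** In coefficients, a_(2k) = h_k, h_(2k) = j_k and 2 j_(2k) = 2^13 a_(2k). Hence a_(4k) = j_k, and
    j_(2k) = 0 as soon as a_(2k) = 0; the induction starts from a_4 = j_1 = 0, because [Dl] starts
    with t^2. *)
Lemma E4_coef a : (forall Y : R, 0 < Y -> qe Y 0 a E4) -> forall k, a (4 ^ k.+1)%N = 0.
Proof.
move=> qa.
have t24 : qc (fun tau => th2 tau ^+ 4) (2 ^+ 4 * 0) (2 ^+ 4 * 1) (2 ^+ 4 * 0).
  by apply: qc_ext (qc_scale (2 ^+ 4) th2_pow4_qc) => tau; rewrite -exprMn mulrC divfK// pnatr_eq0.
have [h [qh' _]] := qc_scale 8^-1 (qc_mul (qc_mul (qc_mul t24 (qc_pow 4 th3_qc)) (qc_pow 16 th4_qc)) (qc_add (qc_pow 4 th3_qc) t24)).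
have qh : forall Y : R, 0 < Y -> qe Y 0 h H4 := qh'.
have [j [qj' [_ j1 _]]] := qc_scale (2 ^+ 13) (qc_mul Dl_qc (qc_add (qc_pow 4 th3_qc) t24)).
have qj : forall Y : R, 0 < Y -> qe Y 0 j J4 := qj'.
rewrite !mul0r addr0 mulr0 in j1.
have ah k : a k.*2 = h k.
  have H := qe_double ler01 (qh _ ltr01); rewrite mulr0 in H.
  have := qe_unique (qa _ ltr01) (qe_ext _ H) k.*2; rewrite odd_double doubleK; apply=> tau ht.
  by rewrite -E4_double//; exact: lt_le_trans ht.
have qj2 Y : 0 < Y -> qe Y 0 (fun k => if odd k then 0 else j k./2) (fun tau => J4 (2 * tau)).
  by move=> Y0; have := qe_double (ltW Y0) (qj _ Y0); rewrite mulr0.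
have two : (2 : C) != 0 by rewrite pnatr_eq0.
have hj k : h k.*2 = j k.
  have := qe_even qh qj2 H4_even k; rewrite odd_double doubleK -[_ *+ 2]mulr_natl; exact: mulfI.
have ja k : a k.*2 = 0 -> j k.*2 = 0.
  move=> ak; have := qe_even qj qa J4_even k; rewrite ak mulr0 -[_ *+ 2]mulr_natl => /eqP.
  by rewrite mulf_eq0 (negbTE two) /= => /eqP.
have aj k : a (4 * k)%N = j k by rewrite (_ : (4 * k = k.*2.*2)%N) ?ah ?hj//; lia.
elim=> [|k IH]; first by rewrite expn1 (aj 1%N).
rewrite expnS aj; have E : (4 ^ k.+1 = (2 * 4 ^ k).*2)%N by rewrite expnS; lia.
by rewrite E; apply: ja; rewrite -E.
Qed.
End Landen.

(** * Harmonic polynomials as sums of powers *)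

Section Polarization.
Variables (R : realType) (n : nat).
Implicit Types (v x : 'rV[R]_n) (fam : seq (R * 'rV[R]_n)) (p q : {mpoly R[n]}).

Definition linp v : {mpoly R[n]} := \sum_(i < n) v ord0 i *: 'X_i.
Definition pfp k fam : {mpoly R[n]} := \sum_(l <- fam) l.1 *: linp l.2 ^+ k.

Lemma evalv_linp v x : evalv (linp v) x = dot x v.
Proof.
rewrite /evalv /linp raddf_sum /dot; apply: eq_bigr => i _ /=.
by rewrite mevalZ mevalXU mulrC.
Qed.

Lemma evalv_pfp k fam x : evalv (pfp k fam) x = pf k fam x.
Proof.
rewrite /evalv /pfp raddf_sum /pf; apply: eq_bigr => l _ /=.
by rewrite mevalZ rmorphXn /= -evalv_linp.
Qed.

Definition power_span k p := exists fam, p = pfp k fam.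

Lemma power_spanD k p q : power_span k p -> power_span k q -> power_span k (p + q).
Proof. by move=> [f ->] [g ->]; exists (f ++ g); rewrite /pfp big_cat. Qed.

Lemma power_spanZ k c p : power_span k p -> power_span k (c *: p).
Proof.
move=> [f ->]; exists [seq (c * l.1, l.2) | l <- f]; rewrite /pfp big_map scaler_sumr.
by apply: eq_bigr => l _; rewrite scalerA.
Qed.

Lemma power_span_sum k (I : Type) (r : seq I) (F : I -> {mpoly R[n]}) :
  (forall i, power_span k (F i)) -> power_span k (\sum_(i <- r) F i).
Proof.
move=> h; elim: r => [|i r IH]; first by exists [::]; rewrite /pfp !big_nil.
by rewrite big_cons; apply: power_spanD.
Qed.

Lemma linpD v x (t : R) : linp (v + t *: x) = linp v + t *: linp x.
Proof.
rewrite /linp scaler_sumr -big_split; apply: eq_bigr => i _ /=.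
by rewrite !mxE scalerDl scalerA.
Qed.

Lemma linp_delta i : linp (delta_mx ord0 i) = 'X_i.
Proof.
rewrite /linp (bigD1 i) //= mxE !eqxx scale1r big1 ?addr0// => j ji.
by rewrite mxE eqxx /= (negbTE ji) scale0r.
Qed.

Lemma select_linear (k : nat) : exists c : 'I_k.+2 -> R,
  forall j : 'I_k.+2, \sum_t c t * (t%:R : R) ^+ j = (j == 1%N :> nat)%:R.
Proof.
pose a : 'rV[R]_k.+2 := \row_t (t : nat)%:R.
pose V := Vandermonde k.+2 a.
have hV : V \in unitmx.
  rewrite unitmxE unitfE det_Vandermonde; apply/prodf_neq0 => i _; apply/prodf_neq0 => j ij.
  by rewrite !mxE subr_eq0 eqr_nat neq_ltn ij orbT.
pose c := invmx V *m (\col_(j < k.+2) (j == 1%N :> nat)%:R).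
exists (fun t => c t ord0) => j.
have /matrixP /(_ j ord0) : V *m c = \col_(j < k.+2) (j == 1%N :> nat)%:R by rewrite mulmxA mulmxV// mul1mx.
rewrite !mxE => <-; apply: eq_bigr => t _; by rewrite !mxE mulrC.
Qed.

(* A Vandermonde combination of the powers (l + t X_i)^(k+1) isolates the term linear in t. *)
Lemma power_span_mulX k p i : power_span k p -> power_span k.+1 (p * 'X_i).
Proof.
move=> [fam ->]; rewrite /pfp mulr_suml; apply: power_span_sum => l.
rewrite -scalerAl; apply: power_spanZ; set v := l.2.
have [c hc] := select_linear k.
exists [seq (k.+1%:R^-1 * c t, v + (t : nat)%:R *: delta_mx ord0 i) | t <- enum 'I_k.+2].
rewrite /pfp big_map big_enum /=.
have E (t : 'I_k.+2) : (k.+1%:R^-1 * c t) *: linp (v + (t : nat)%:R *: delta_mx ord0 i) ^+ k.+1 =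
   \sum_(j < k.+2) (k.+1%:R^-1 * (c t * t%:R ^+ j)) *: (linp v ^+ (k.+1 - j) * 'X_i ^+ j *+ 'C(k.+1, j)).
  rewrite linpD linp_delta exprDn scaler_sumr; apply: eq_bigr => j _.
  rewrite exprZn -scalerAr -[(_ *: _) *+ _]scaler_nat -[linp v ^+ _ * _ *+ _]scaler_nat !scalerA.
  by congr (_ *: _); ring.
rewrite (eq_bigr _ (fun t _ => E t)) exchange_big /=.
have F (j : 'I_k.+2) : \sum_(t < k.+2) (k.+1%:R^-1 * (c t * t%:R ^+ j)) *: (linp v ^+ (k.+1 - j) * 'X_i ^+ j *+ 'C(k.+1, j)) =
   (k.+1%:R^-1 * (j == 1%N :> nat)%:R) *: (linp v ^+ (k.+1 - j) * 'X_i ^+ j *+ 'C(k.+1, j)).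
  by rewrite -scaler_suml -mulr_sumr hc.
rewrite (eq_bigr _ (fun t _ => F t)).
have l1 : (1 < k.+2)%N by [].
rewrite (bigD1 (Ordinal l1)) //= mulr1 subn1 /= expr1 bin1 big1 ?addr0 => [|j j1].
  by rewrite -[(linp v ^+ k * _) *+ _]scaler_nat scalerA mulVf ?scale1r// pnatr_eq0.
have -> : (j == 1%N :> nat) = false by apply/negbTE; apply: contra j1 => /eqP E1; apply/eqP/val_inj.
by rewrite mulr0 scale0r.
Qed.

Lemma power_span_monomial (m : 'X_{1..n}) : power_span (mdeg m) 'X_[m].
Proof.
have one : power_span 0 1 by exists [:: (1, 0)]; rewrite /pfp big_seq1 expr0 scale1r.
rewrite mpolyXE_id mdegE.
have -> : (\sum_i m i = \sum_(i <- enum 'I_n) m i)%N by rewrite big_enum.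
have -> : \prod_(i < n) 'X_i ^+ m i = \prod_(i <- enum 'I_n) 'X_i ^+ m i :> {mpoly R[n]} by rewrite big_enum.
elim: (enum _) => [|i r IH]; first by rewrite !big_nil.
rewrite !big_cons; elim: (m i) => [|e IHe]; first by rewrite expr0 mul1r.
by rewrite exprSr mulrAC addSn; apply: power_span_mulX.
Qed.

Lemma homog_power_span k p : p \is k.-homog -> power_span k p.
Proof.
move/dhomogP => hp; rewrite (mpolyE p) big_seq big_mkcond; apply: power_span_sum => m.
case: ifP => [mp|_]; last by exists [::]; rewrite /pfp big_nil.
apply: power_spanZ; rewrite -(hp m mp); exact: power_span_monomial.
Qed.

Lemma mderiv_linp i v : mderiv i (linp v) = (v ord0 i)%:MP.
Proof.
rewrite /linp raddf_sum (bigD1 i) //= big1 => [|j ji].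
  have U0 : (U_(i) - U_(i) = 0)%MM by apply/mnmP => j; rewrite mnmBE mnm0E subnn.
  by rewrite addr0 mderivZ mderivX mnm1E eqxx scale1r U0 mpolyX0 -mul_mpolyC mulr1.
by rewrite mderivZ mderivX mnm1E (negbTE ji) scale0r scaler0.
Qed.

Lemma mderiv_exp i p k : mderiv i (p ^+ k) = p ^+ k.-1 * mderiv i p *+ k.
Proof.
elim: k => [|k IH]; first by rewrite expr0 mulr0n -mpolyC1 mderivC.
rewrite exprS mderivM IH /=; case: k IH => [|k] IH; first by rewrite expr0 !mulr0n mulr0 addr0 mulr1 mul1r.
by rewrite [in RHS]mulrS mulrC mulrnAr mulrA -exprS.
Qed.

Definition lap p := \sum_(i < n) mderiv i (mderiv i p).

Lemma lap_sum (I : Type) (r : seq I) (c : I -> R) (F : I -> {mpoly R[n]}) :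
  lap (\sum_(l <- r) c l *: F l) = \sum_(l <- r) c l *: lap (F l).
Proof.
elim: r => [|l r IH].
  by rewrite !big_nil /lap big1// => i _; rewrite !mderiv0.
rewrite !big_cons -IH /lap scaler_sumr -big_split; apply: eq_bigr => i _ /=.
by rewrite !mderivD !mderivZ.
Qed.

Lemma lap_linp_exp v k : lap (linp v ^+ k) = (k%:R * k.-1%:R * nrm v) *: linp v ^+ k.-2.
Proof.
rewrite /lap /nrm /dot mulr_sumr scaler_suml; apply: eq_bigr => i _.
rewrite mderiv_exp mderivMn mderivM mderiv_exp mderiv_linp mderivC mulr0 addr0.
transitivity ((v ord0 i * v ord0 i)%:MP * linp v ^+ k.-2 *+ (k.-1 * k)).
  by rewrite mpolyCM mulrnA; ring.
rewrite mul_mpolyC -[_ *+ (_ * _)]scaler_nat scalerA natrM; congr (_ *: _); ring.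
Qed.

(** [Q j] is the j-th Laplacian of the form up to a scalar, and the factor (k - 2j)(k - 2j - 1)
    relating [Q j] to [Q j.+1] is nonzero as long as 2(j + 1) <= k. *)
Lemma harmonic_harm k fam : Defs.harmonic (pfp k fam) -> harm k fam.
Proof.
move=> h0.
pose Q j := \sum_(l <- fam) (l.1 * nrm l.2 ^+ j) *: linp l.2 ^+ (k - j.*2).
have lapQ j : lap (Q j) = ((k - j.*2)%:R * (k - j.*2).-1%:R) *: Q j.+1.
  rewrite lap_sum /Q scaler_sumr; apply: eq_bigr => l _.
  have E : ((k - j.*2).-2 = k - j.+1.*2)%N by lia.
  rewrite lap_linp_exp E !scalerA.
  by congr (_ *: _); rewrite exprS; ring.
have Q0 j : (j.+1.*2 <= k)%N -> Q j.+1 = 0.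
  elim: j => [|j IH] hj.
    have := lapQ 0%N; rewrite (_ : lap (Q 0%N) = 0) => [/esym/eqP|]; last first.
      rewrite -[RHS]h0 /Q /lap /pfp subn0.
      by under [in LHS]eq_bigr do under eq_bigr do rewrite expr0 mulr1.
    rewrite scaler_eq0 mulf_eq0 !pnatr_eq0 => /orP[|/eqP//]; lia.
  have := lapQ j.+1; rewrite IH; last by lia.
  rewrite /lap big1 => [/esym/eqP|i _]; last by rewrite !mderiv0.
  rewrite scaler_eq0 mulf_eq0 !pnatr_eq0 => /orP[|/eqP//]; lia.
move=> [//|j] x _ hj; have := Q0 j hj => /(congr1 (fun p => evalv p x)).
rewrite /evalv /Q raddf_sum meval0 => E; rewrite -[RHS]E; apply: eq_bigr => l _ /=.
by rewrite mevalZ rmorphXn /= -evalv_linp.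
Qed.

Lemma condC_of_families (X : 'rV[R]_n -> Prop) k :
  (forall s, uniq s -> (forall x, x \in s <-> X x) -> forall fam, harm k fam -> \sum_(x <- s) pf k fam x = 0) ->
  condC X k.
Proof.
move=> h s us hs p /homog_power_span [fam Ep] hp; rewrite Ep in hp *.
under eq_bigr do rewrite evalv_pfp.
by apply: h => //; exact: harmonic_harm.
Qed.
End Polarization.

(** * Shadows and designs *)

Section ShadowDesigns.
Variables (R : realType) (n : nat) (B : 'M[R]_n).
Hypotheses (hB : B \in unitmx) (hL : selfdual (lattice_of B)).
Variable s : 'rV[R]_n.
Hypothesis hs : half_char B s.
Local Notation C := R[i].
Local Notation iC := (Complex 0 1 : C).
Local Notation lv := (lv B).
Local Notation L := (lattice_of B).
Local Notation Th := (Th B).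
Implicit Types (tau : C) (z w : 'rV[int]_n) (k : nat) (fam : seq (R * 'rV[R]_n)) (x y : 'rV[R]_n).

Lemma is_int_nat (r : R) : is_int r -> 0 <= r -> exists m : nat, r = m%:R.
Proof. by move=> [[m|m] ->]; [exists m|rewrite NegzE ler0z]. Qed.

Lemma nrm_nat z : exists m : nat, nrm (lv z) = m%:R.
Proof. by apply: is_int_nat; [exact: int_dot|exact: nrm_ge0]. Qed.

Lemma shadow_norm z : exists m : int, nrm (lv z - s) = nrm s + 2 * m%:~R.
Proof.
by have [m Em] := hs z; exists (- m); rewrite rmorphN /= -Em nrmB dotC; field.
Qed.

Lemma qexp_imag (x : R) : qexp iC x = (expR (- (pi * x)))%:Co.
Proof. by rewrite -cexp_real; congr cexp; apply: complex_ext; rewrite !(cReM, cImM) /=; ring. Qed.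

(** The constant form 1, since the zeroth power of 0 is 1. *)
Let fam0 : seq (R * 'rV[R]_n) := [:: (1, 0)].

Lemma harm0 : harm 0 fam0. Proof. by move=> [|j]. Qed.

Lemma pf0 x : pf 0 fam0 x = 1. Proof. by rewrite /pf big_seq1 expr0 mulr1. Qed.

(** The congruence |2s|^2 = n modulo 8 for characteristic vectors: by [mt_zeta] the theta triple of
    the lattice and the n-th powers of the Jacobi functions have the same eigenvalue under
    translation, as their third members do not vanish at i. *)
Lemma norm_congruence : exists m : int, nrm s = n%:R / 4 + 2 * m%:~R.
Proof.
have Ii : 0 < Im iC by exact: ltr01.
have h1 := lattice_mt hB hL harm0 isT hs.
have h2 := mt_pow n (@theta_mt R).
have E : (fun tau : C => sq tau ^+ n * tau ^+ 0) = (fun tau => sq tau ^+ n).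
  by apply/funext => tau; rewrite expr0 mulr1.
rewrite E in h1.
have W0 (t : C) : 0 < Im t -> sq t ^+ n != 0 by move=> It; rewrite expf_neq0 ?sq_neq0.
have n2 : th2 iC ^+ n != 0.
  have [_ [_ [_ [_ _ _ h]]]] := theta_inverses R.
  by rewrite expf_neq0//; case: (h iC) => //=; lra.
have n1 : Th 0 fam0 (- s) (fun=> 1) iC != 0.
  have b : bsum (fun z => (pf 0 fam0 (lv z - s))%:Co * 1 * qexp iC (nrm (lv z - s))).
    apply: rbsum_le (rbsum_Th hB 0 fam0 (- s) (fun _ => cn1 R) Ii) => z.
    by rewrite (cnM (_ * 1)) cn_qexp.
  have pos z : 0 < Re ((pf 0 fam0 (lv z - s))%:Co * 1 * qexp iC (nrm (lv z - s))).
    by rewrite pf0 mulr1 mul1r qexp_imag /= expR_gt0.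
  by apply: (hassum_real_gt0 (i0 := 0) (bsumP b)) => // z; exact: ltW.
have := mt_zeta Ii W0 h1 h2 n1 n2; rewrite -e1_mulrn => E2.
have : e1 (nrm s / 2 - 8^-1 *+ n) = 1 :> C by rewrite e1D E2 e1N divff//; exact: cexp_neq0.
by move=> /e1_eq1 [m Em]; exists m; rewrite -Em -[_ *+ n]mulr_natr; field.
Qed.

Lemma shadow_norm_mod z : exists m : int, nrm (lv z - s) = n%:R / 4 + 2 * m%:~R.
Proof.
have [m ->] := shadow_norm z; have [m' ->] := norm_congruence.
by exists (m' + m); rewrite rmorphD /=; ring.
Qed.

(** Shadow norms lie in one class modulo 2, so excluding those up to e - 2 raises the lower bound to
    e. *)
Lemma shadow_ge (e : R) (j : int) : e = n%:R / 4 + 2 * j%:~R -> (forall z, e - 2 < nrm (lv z - s)) ->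
  forall z, exists m : nat, nrm (lv z - s) = e + (2 * m)%:R.
Proof.
move=> -> h z; have [m Em] := shadow_norm_mod z; have := h z; rewrite Em => h1.
have : (0 : R) <= (m - j)%:~R.
  have : (-1 : R) < (m - j)%:~R by rewrite rmorphB /=; lra.
  by rewrite -(rmorphN1 (intmul (1 : R))) ltr_int ler0z; lia.
rewrite ler0z => mj; exists `|m - j|%N; rewrite natrM absz_intr ger0_norm ?ler0z// rmorphB /=; ring.
Qed.

Lemma is_even_half (r : R) : is_even_num r <-> is_int (r / 2).
Proof.
split=> -[m h]; exists m; first by rewrite h rmorphM /= mulrC mulKf// pnatr_eq0.
by rewrite rmorphM /= -h mulrC divfK// pnatr_eq0.
Qed.

Lemma in_dual y : (forall z, is_int (dot (lv z) y)) -> L y.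
Proof. by move=> h; apply/(hL.2 y) => _ /lvP [z ->]. Qed.

Lemma int_halfP (r : R) : is_int (2 * r) -> is_int r \/ is_int (r - 2^-1).
Proof.
move=> [m Em]; have [h|h] := eqVneq (m %% 2)%Z 0.
  left; exists (halfz m); apply: (mulfI (_ : (2 : R) != 0)); first by rewrite pnatr_eq0.
  by rewrite Em (halfz_even h) (halfz2 _).1 rmorphM.
right; exists (halfz m); apply: (mulfI (_ : (2 : R) != 0)); first by rewrite pnatr_eq0.
have hm := halfz_odd (elimN eqP h); rewrite mulrBr Em divff ?pnatr_eq0// {1}hm rmorphD rmorphM /=; ring.
Qed.

(** The lattice is even exactly when s lies in it. For odd L, a vector x of the dual of the even
    sublattice takes a single class modulo 1 on the vectors of odd norm, and twice this class is 0.
    The class is not 0, else x would lie in L; so it is 1/2, as for s, and x + s is integral on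
    L. *)
Lemma shadowP x : shadow L x <-> exists z, x = lv z - s.
Proof.
have half z : is_int (dot (lv z) s - nrm (lv z) / 2) by rewrite dotC; exact: hs.
have idot z y : L y -> is_int (dot (lv z) y) by move=> /lvP [w ->]; exact: int_dot.
have evenP : even_lattice L <-> L s.
  split=> [ev|Ls y /lvP [z ->]].
    apply: in_dual => z; have /is_even_half hz := ev _ (lv_in B z).
    by have := is_intD (half z) hz; rewrite subrK.
  apply/is_even_half; have := is_intD (idot z s Ls) (is_intN (half z)).
  by rewrite opprB addrCA subrr addr0.
have Lz y : (exists z, y = lv z - s) <-> L (y + s).
  split=> [[z ->]|/lvP [z E]]; first by rewrite subrK; exact: lv_in.
  by exists z; rewrite -E addrK.
have LD y y' : L y -> L y' -> L (y + y').
  by move=> /lvP [a ->] /lvP [b ->]; rewrite -lvD; exact: lv_in.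
have LN y : L y -> L (- y) by move=> /lvP [a ->]; rewrite -lvN; exact: lv_in.
rewrite Lz /shadow; have [/[dup] ev /evenP Ls|nev] := pselect (even_lattice L).
  split=> [[[_ Lx]|[//]]|h]; first exact: LD.
  by left; split=> //; rewrite -[x](addrK s); apply: LD => //; exact: LN.
have nLs : ~ L s by move=> /evenP.
split=> [[[//]|[_ [hd nLx]]]|h]; last first.
  right; split=> //; split=> [_ [/lvP [z ->] /is_even_half hz]|Lx]; last first.
    by apply: nLs; rewrite -[s](addKr x); apply: LD => //; exact: LN.
  have -> : dot (lv z) x = dot (lv z) (x + s) - (dot (lv z) s - nrm (lv z) / 2) - nrm (lv z) / 2.
    by rewrite dotDr; ring.
  by apply: is_intD; [apply: is_intD; [exact: idot|exact: is_intN]|exact: is_intN].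
have ddual z : is_int (nrm (lv z) / 2) -> is_int (dot (lv z) x).
  by move=> /is_even_half hz; apply: hd; split=> //; exact: lv_in.
have [z0 nz0] : exists z0, ~ is_int (nrm (lv z0) / 2).
  apply: contrapT => h; apply: nev => _ /lvP [z ->]; apply/is_even_half; apply: contrapT => h2.
  by apply: h; exists z.
have halfint z : ~ is_int (nrm (lv z) / 2) -> is_int (nrm (lv z) / 2 - 2^-1).
  move=> hz; case: (@int_halfP (nrm (lv z) / 2)) => //.
  by rewrite mulrC divfK ?pnatr_eq0//; exact: int_dot.
have diff z : ~ is_int (nrm (lv z) / 2) -> is_int (dot (lv z) x - dot (lv z0) x).
  move=> hz; have := ddual (z - z0); rewrite lvD lvN dotBl; apply.
  have := is_intD (is_intD (halfint z hz) (halfint z0 nz0)) (is_intN (int_dot hL z z0)).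
  move=> h; have := is_intD h (ex_intro _ 1 (erefl _ : (1 : R) = 1%:~R)).
  by rewrite (_ : _ + 1 = nrm (lv z - lv z0) / 2)// nrmB; field.
have x0half : is_int (dot (lv z0) x - 2^-1).
  case: (@int_halfP (dot (lv z0) x)) => //.
    have := ddual (z0 + z0); rewrite lvD dotDl (_ : dot (lv z0) x + _ = 2 * dot (lv z0) x); last by ring.
    apply.
    rewrite nrmD (_ : (_ + _ + _) / 2 = nrm (lv z0) + nrm (lv z0)); last by rewrite /nrm; field.
    by apply: is_intD; exact: int_dot.
  move=> i0; case: nLx; apply: in_dual => z.
  have [/ddual//|nz] := pselect (is_int (nrm (lv z) / 2)).
  by have := is_intD (diff z nz) i0; rewrite subrK.
apply: in_dual => z; rewrite dotDr.
have [hz|nz] := pselect (is_int (nrm (lv z) / 2)).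
  apply: is_intD; first exact: ddual.
  by have := is_intD (half z) hz; rewrite subrK.
have := is_intD (is_intD (diff z nz) x0half) (is_intD (half z) (halfint z nz)).
move=> h; have := is_intD h (ex_intro _ 1 (erefl _ : (1 : R) = 1%:~R)).
by rewrite (_ : _ + 1 = dot (lv z) x + dot (lv z) s)//; field.
Qed.

Lemma latticeP x : L x <-> exists z, x = lv z + 0.
Proof. by rewrite lvP; split=> -[z E]; exists z; rewrite E addr0. Qed.

(** Shells are enumerated by vectors, theta series by integer coordinates; this passes from one to
    the other. *)
Lemma shell_list u (S : seq 'rV[R]_n) (r : R) : uniq S ->
  (forall x, x \in S <-> (exists z, x = lv z + u) /\ nrm x = r) ->
  exists t : seq 'rV[int]_n, [/\ uniq t, (forall z, z \in t <-> nrm (lv z + u) = r) & S = [seq lv z + u | z <- t]].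
Proof.
move=> uS hS.
have hg x : exists z, (exists z', x = lv z' + u) -> x = lv z + u.
  have [[z E]|no] := pselect (exists z, x = lv z + u); first by exists z.
  by exists 0.
have [g Hg] := boolp.choice hg.
have inj z w : lv z + u = lv w + u -> z = w by move=> /addIr /(lv_inj hB).
have SE : S = [seq lv z + u | z <- [seq g x | x <- S]].
  rewrite -map_comp -[LHS]map_id; apply/eq_in_map => x /hS [hx _] /=; exact: Hg.
exists [seq g x | x <- S]; split=> //.
  by apply: (@map_uniq _ _ (fun z => lv z + u)); rewrite -SE.
move=> z; split=> [/mapP [x /hS [hx <-] ->]|hz]; first by rewrite -Hg.
have xS : lv z + u \in S by apply/hS; split=> //; exists z.
apply/mapP; exists (lv z + u) => //; apply: inj; apply: Hg; by exists z.
Qed.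

Lemma Th_zero_sum k fam u (e : R) : (forall tau, 0 < Im tau -> Th k fam u (fun=> 1) tau = 0) ->
  (forall z, exists m : nat, nrm (lv z + u) = e + m%:R) ->
  forall (S : seq 'rV[R]_n) (r : R), uniq S -> (forall x, x \in S <-> (exists z, x = lv z + u) /\ nrm x = r) ->
  \sum_(x <- S) pf k fam x = 0.
Proof.
move=> h0 hm S r uS hS.
have [t [ut ht ES]] := shell_list uS hS.
have [a [qa ha]] := Th_qe hB k fam (fun _ => cn1 R) hm.
case: t ut ht ES => [|z0 t] ut ht ES; first by rewrite ES big_nil.
have [j Ej] := hm z0.
have rE : r = e + j%:R by rewrite -Ej; apply/esym/ht; rewrite inE eqxx.
have : a j = 0 by apply: (qe_zero_coef (qa _ ltr01)) => tau ht1; apply: h0; exact: lt_le_trans ht1.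
rewrite (ha j (z0 :: t)) -?rE// => E; apply: complexI; rewrite -[RHS]E ES big_map rmorph_sum /=.
by apply: eq_bigr => z _; rewrite mulr1.
Qed.

Lemma cn_weight k tau : 0 < Im tau -> cn (sq tau ^+ n * tau ^+ k) = cn (sq tau) ^+ (n + k.*2).
Proof.
move=> It; rewrite (cnM (sq tau ^+ n)) !cnX -{2}(iC_sq It) (cnM iC) cnX.
have -> : cn iC = 1 by rewrite /cn /= expr0n /= add0r expr1n sqrtr1.
by rewrite mul1r -exprM -exprD mul2n.
Qed.

Lemma pf_at0 k fam : (0 < k)%N -> pf k fam 0 = 0.
Proof. by move=> k0; rewrite /pf big1// => l _; rewrite dot0l expr0n eqn0Ngt k0 mulr0. Qed.

Lemma hm0 z : exists m : nat, nrm (lv z + 0) = 0 + m%:R.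
Proof. by have [m Em] := nrm_nat z; exists m; rewrite addr0 add0r. Qed.

(** The zero vector contributes P(0) = 0 because k > 0, and all other vectors have norm at least
    [o]. *)
Lemma low_coef k fam chi o a : (0 < k)%N -> (forall x, L x -> x != 0 -> o%:R <= nrm x) ->
  (forall (j : nat) (t : seq 'rV[int]_n), uniq t -> (forall z, z \in t <-> nrm (lv z + 0) = 0 + j%:R) ->
    a j = \sum_(z <- t) (pf k fam (lv z + 0))%:Co * chi z) ->
  forall j, (j < o)%N -> a j = 0 :> C.
Proof.
move=> k0 ho ha [|j] jo.
  rewrite (ha 0%N [:: 0]) ?big_seq1 ?lv0 ?addr0 ?pf_at0 ?mul0r// => z; rewrite inE addr0; split=> [/eqP ->|].
    by rewrite lv0 nrm0.
  by move/nrm_eq0; rewrite -(lv0 B) => /(lv_inj hB) ->.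
rewrite (ha j.+1 [::]) ?big_nil// => z; rewrite in_nil; split=> //.
rewrite addr0 add0r => E; have : o%:R <= nrm (lv z).
  by apply: ho; [exact: lv_in|apply: contra_eq_neq E => ->; rewrite nrm0 eq_sym pnatr_eq0].
by rewrite E ler_nat leqNgt jo.
Qed.

Lemma Th_vanish k fam o (e : R) : (0 < k)%N -> ~~ odd k -> harm k fam ->
  (forall x, L x -> x != 0 -> o%:R <= nrm x) ->
  (forall z, exists m : nat, nrm (lv z - s) = e + m%:R) ->
  (n + k.*2)%:R / 4 < 2 * o%:R + e ->
  forall tau, 0 < Im tau -> Th k fam 0 (fun=> 1) tau = 0 /\ Th k fam (- s) (fun=> 1) tau = 0.
Proof.
move=> k0 ko hf ho he hlt.
have [a1 [q1 c1]] := Th_qe hB k fam (fun _ => cn1 R) hm0.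
have [a2 [q2 c2]] := Th_qe hB k fam (chi := chi_of B s) (fun z => cn_e1 _) hm0.
have [a3 [q3 c3]] := Th_qe hB k fam (fun _ => cn1 R) he.
have q1' Y (Y0 : 0 < Y) := qe_shift (low_coef k0 ho c1) (q1 Y Y0).
have q2' Y (Y0 : 0 < Y) := qe_shift (low_coef k0 ho c2) (q2 Y Y0).
rewrite add0r in q1' q2'.
have V := vanishing (lattice_mt hB hL hf ko hs) (@cn_weight k) (cn_e1 _) q1' q2' q3 hlt.
by move=> tau It; have [-> _ ->] := V tau It.
Qed.

Lemma shells_harmonic k o (e : R) : (0 < k)%N -> ~~ odd k ->
  (forall x, L x -> x != 0 -> o%:R <= nrm x) ->
  (forall z, exists m : nat, nrm (lv z - s) = e + m%:R) ->
  (n + k.*2)%:R / 4 < 2 * o%:R + e ->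
  forall r, condC (shell L r) k /\ condC (shell (shadow L) r) k.
Proof.
move=> k0 ko ho he hlt r; split; apply: condC_of_families => S uS hS fam hf.
  apply: (@Th_zero_sum k fam 0 0 _ hm0 S r uS) => [tau It|x].
    by have [] := Th_vanish k0 ko hf ho he hlt It.
  by rewrite hS /shell latticeP.
apply: (@Th_zero_sum k fam (- s) e _ he S r uS) => [tau It|x].
  by have [] := Th_vanish k0 ko hf ho he hlt It.
by rewrite hS /shell shadowP.
Qed.
End ShadowDesigns.

(** * Finiteness of shells *)

Section ShellFinite.
Variables (R : realType) (n : nat) (B : 'M[R]_n).
Hypotheses (hB : B \in unitmx) (hL : selfdual (lattice_of B)).
Local Notation lv := (lv B).

(** Every vector of the shell contributes exp(-r) to a bounded Gaussian sum, so duplicate-free lists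
    in the shell have bounded length and a longest one exhausts it. *)
Lemma shell_finite u (r : R) : exists t : seq 'rV[int]_n, uniq t /\ forall z, z \in t <-> nrm (lv z + u) = r.
Proof.
have [M HM] := rbsum_lattice hB u (ltr01 : (0 : R) < 1).
pose P (k : nat) := `[< exists t : seq 'rV[int]_n, [/\ uniq t, size t = k & forall z, z \in t -> nrm (lv z + u) = r] >].
have P0 : exists k, P k by exists 0%N; apply/asboolP; exists [::].
have bound k : P k -> (k <= Num.bound (M * expR r))%N.
  move=> /asboolP [t [ut <- ht]]; have := HM t ut.
  rewrite big_seq (eq_bigr (fun _ => expR (- r))); last by move=> z /ht ->; rewrite mul1r.
  rewrite -big_seq big_const_seq count_predT iter_addr_0 -[_ *+ _]mulr_natl expRN ler_pdivrMr ?expR_gt0// => h.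
  have M0 : 0 <= M * expR r by exact: le_trans h.
  by rewrite -(ler_nat R); apply: le_trans h (ltW (archi_boundP M0)).
have [k /asboolP [t [ut st ht]] kmax] := ex_maxnP P0 bound.
exists t; split=> // z; split=> [|hz]; first exact: ht.
apply: contrapT => /negP zt; have : P k.+1.
  apply/asboolP; exists (z :: t); split=> /=; rewrite ?st ?zt// => w; rewrite inE => /orP[/eqP ->//|]; exact: ht.
by move=> /kmax; rewrite ltnn.
Qed.
End ShellFinite.

(** * The shadow in rank 23 and minimum 3 *)

Section ShorterLeech.
Variables (R : realType) (B : 'M[R]_23).
Hypotheses (hB : B \in unitmx) (hL : selfdual (lattice_of B)).
Variable s : 'rV[R]_23.
Hypothesis hs : half_char B s.
Local Notation lv := (lv B).
Local Notation L := (lattice_of B).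
Hypothesis hmin : forall x, L x -> x != 0 -> 3%:R <= nrm x.

(** The zonal harmonic of degree 2 with axis y. *)
Definition quad_fam n (y : 'rV[R]_n) : seq (R * 'rV[R]_n) :=
  (1, y) :: [seq (- (nrm y / n%:R), delta_mx ord0 j) | j <- enum 'I_n].

Lemma harm_quad_fam n (y : 'rV[R]_n) : (0 < n)%N -> harm 2 (quad_fam y).
Proof.
move=> n0 [//|[|j]] x // _ _; rewrite big_cons big_map big_enum /= !mul1r.
have d (j : 'I_n) : nrm (delta_mx ord0 j : 'rV[R]_n) = 1 by rewrite /nrm dot_delta mxE !eqxx.
under eq_bigr do rewrite d expr0 expr1 !mulr1.
rewrite sumr_const card_ord expr0 mulr1 expr1 mulNrn -[_ *+ n]mulr_natr divfK ?subrr//.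
by rewrite pnatr_eq0 -lt0n.
Qed.

Lemma pf_quad_fam n (y x : 'rV[R]_n) : pf 2 (quad_fam y) x = dot x y ^+ 2 - nrm y / n%:R * nrm x.
Proof.
rewrite /pf big_cons big_map big_enum /= mul1r; congr (_ + _).
rewrite -mulr_sumr mulNr; congr (- (_ * _)); rewrite [RHS](_ : _ = \sum_j x ord0 j * x ord0 j)//.
by apply: eq_bigr => j _; rewrite dotC dot_delta expr2.
Qed.

Lemma twice_in : L (s + s).
Proof.
apply: (in_dual hL) => z; rewrite dotDr; have [m Em] := hs z.
have := is_intD (is_intD (ex_intro _ m Em) (ex_intro _ m Em)) (int_dot hL z z).
rewrite (_ : _ + _ = dot (lv z) s + dot (lv z) s)//.
by rewrite [dot s _]dotC -/(nrm (lv z)); field.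
Qed.

(* The C_2 condition for N vectors with pairwise inner products +-1/4 would give 26 N = 2208. *)
Lemma no_norm_7_4 z0 : nrm (lv z0 - s) <> 7 / 4.
Proof.
move=> h0.
have he z : exists m : nat, nrm (lv z - s) = 7 / 4 + m%:R.
  have [||m Em] := @shadow_ge _ _ B hB hL s hs (7 / 4) (-2) _ _ z.
  - by rewrite rmorphN /=; lra.
  - by move=> w; have := nrm_ge0 (lv w - s); lra.
  by exists (2 * m)%N.
have [t [ut ht]] := shell_finite hB (- s) (7 / 4).
pose S := [seq lv z - s | z <- t].
have inj : injective (fun z => lv z - s) by move=> z w /addIr /(lv_inj hB).
have uS : uniq S by rewrite map_inj_uniq.
have hS x : x \in S <-> (exists z, x = lv z - s) /\ nrm x = 7 / 4.
  split=> [/mapP [z /ht hz ->]|[[z ->] hz]]; first by split=> //; exists z.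
  by apply: map_f; apply/ht.
set y0 := lv z0 - s.
have y0S : y0 \in S by apply/hS; split=> //; exists z0.
have [w Ew] : exists w, s + s = lv w by have /lvP := twice_in.
have Ny0S : - y0 \in S.
  apply/hS; rewrite nrmN; split=> //; exists (w - z0); rewrite lvD lvN -Ew /y0 opprB; by rewrite addrAC addrK addrC.
have E0 : \sum_(x <- S) pf 2 (quad_fam y0) x = 0.
  apply: (@Th_zero_sum _ _ B hB 2 _ (- s) (7 / 4) _ he S (7 / 4) uS hS) => tau It.
  have hlt : (23 + 2.*2)%:R / 4 < 2 * 3%:R + 7 / 4 :> R.
    by rewrite (_ : (23 + 2.*2 = 27)%N)//; lra.
  by have [] := Th_vanish hB hL hs (k := 2) isT isT (harm_quad_fam y0 isT) hmin he hlt It.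
have yN : y0 != - y0.
  apply/eqP => E; have : y0 = 0.
    have /eqP := E; rewrite -addr_eq0 -mulr2n -scaler_nat scaler_eq0 pnatr_eq0 /= => /eqP //.
  by move: h0; rewrite -/y0 => h /eqP; rewrite -[y0 == 0]negbK => /negP; apply; apply: contra_eq_neq h => ->; rewrite nrm0; apply/eqP; lra.
have dots x : x \in S -> dot x y0 ^+ 2 = 16^-1 + (x == y0)%:R * 3 + (x == - y0)%:R * 3.
  move=> /hS [[z Ez] nx].
  have [->|xy] := eqVneq x y0; first by rewrite (negbTE yN) -/(nrm y0) h0 /=; lra.
  have [->|xNy] := eqVneq x (- y0); first by rewrite dotNl -/(nrm y0) h0 sqrrN /=; lra.
  have L1 : L (x - y0).
    by rewrite Ez /y0 opprB addrA subrK -lvN -lvD; exact: lv_in.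
  have L2 : L (x + y0).
    rewrite Ez /y0 addrACA -opprD Ew -lvN -!lvD; exact: lv_in.
  (* The norms of x - y0 and x + y0 are integers, at least 3, with sum 7: they are 3 and 4 in some
     order, so the inner product is 1/4 or -1/4. *)
  have g1 : 3 <= nrm (x - y0) by apply: hmin => //; rewrite subr_eq0.
  have g2 : 3 <= nrm (x + y0) by apply: hmin => //; rewrite addr_eq0.
  have [m Em] : is_int (nrm (x - y0)) by apply: (proj1 hL).
  have ny0 : nrm y0 = 7 / 4 := h0.
  move: g1 g2 Em; rewrite (nrmB x y0) (nrmD x y0) nx ny0 => g1 g2 Em.
  have m3 : (3 <= m)%R by rewrite -(ler_int R) -Em; lra.
  have m4 : (m <= 4)%R by rewrite -(ler_int R) -Em; lra.
  have [mE|mE] : m = 3 \/ m = 4 by clear -m3 m4; lia.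
    by have -> : dot x y0 = 4^-1; [move: Em; rewrite mE /=; lra|rewrite /=; lra].
  by have -> : dot x y0 = - 4^-1; [move: Em; rewrite mE /=; lra|rewrite /=; lra].
have E1 : \sum_(x <- S) dot x y0 ^+ 2 = (size S)%:R / 16 + 6.
  rewrite big_seq (eq_bigr _ dots) -big_seq !big_split /= -!mulr_suml.
  rewrite big_const_seq count_predT iter_addr_0 -[_ *+ size S]mulr_natl.
  have cnt y : y \in S -> \sum_(x <- S) (x == y)%:R = 1 :> R.
    move=> yS; rewrite (bigD1_seq y) //= eqxx big1 ?addr0// => x /negbTE ->//.
  by rewrite !cnt//; lra.
have E2 : \sum_(x <- S) nrm y0 / 23 * nrm x = 49 / 16 / 23 * (size S)%:R.
  rewrite big_seq (eq_bigr (fun=> 49 / 16 / 23)); last by move=> x /hS [_ ->]; rewrite h0; lra.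
  by rewrite -big_seq big_const_seq count_predT iter_addr_0 [RHS]mulr_natr.
have : 26 * (size S)%:R = 2208 :> R.
  move: E0; under eq_bigr do rewrite pf_quad_fam; rewrite sumrB E1 E2; lra.
rewrite -natrM => /eqP; rewrite eqr_nat => /eqP; lia.
Qed.

Lemma shorter_leech_shadow z : exists m : nat, nrm (lv z - s) = 15 / 4 + m%:R.
Proof.
have [||m Em] := @shadow_ge _ _ B hB hL s hs (15 / 4) (-1) _ _ z.
- by rewrite rmorphN /=; lra.
- move=> w; have [||m Em] := @shadow_ge _ _ B hB hL s hs (7 / 4) (-2) _ _ w.
  + by rewrite rmorphN /=; lra.
  + by move=> w'; have := nrm_ge0 (lv w' - s); lra.
  case: m Em => [|m] Em; first by case: (@no_norm_7_4 w); rewrite Em addr0.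
  by rewrite Em -natr1 mulnS natrD; have : (0 : R) <= (2 * m)%:R by []; lra.
by exists (2 * m)%N.
Qed.
End ShorterLeech.

(** * Triples determined by three coefficients *)

Section Comparison.
Variable R : realType.
Local Notation C := R[i].
Implicit Types (tau : C) (W : C -> C) (f g h : C -> C).
Local Notation u8 := (e1 (8^-1 : R) : C).

Lemma u8_pow8 : u8 ^+ 8 = 1.
Proof. by rewrite (exprM _ 4 2) e1_8_pow4 sqrrN expr1n. Qed.

(** By translation f2 vanishes to order 3 at t = 0 together with f1, so the two account for 6 in
    [vanishing]. *)
Lemma vanish3 W z f1 f2 f3 (e : R) a3 N : mt W z f1 f2 f3 ->
  (forall tau, 0 < Im tau -> cn (W tau) = cn (sq tau) ^+ N) -> cn z = 1 ->
  qc f1 0 0 0 -> (forall Y, 0 < Y -> qe Y e a3 f3) -> N%:R / 4 < 6 + e ->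
  forall tau, 0 < Im tau -> [/\ f1 tau = 0, f2 tau = 0 & f3 tau = 0].
Proof.
move=> hm hW hz [a [qa [a0 a1 a2]]] q3 hlt.
have low j : (j < 3)%N -> a j = 0 by case: j => [|[|[|]]].
have q1 Y (Y0 : 0 < Y) := qe_shift low (qa Y Y0).
have qa2 Y : 0 < Y -> qe Y 0 (fun k => e1 (0 / 2) * ((-1) ^+ k * a k)) f2.
  move=> Y0; apply: qe_ext (qe_translate (qa Y Y0)) => tau ht.
  by have [[-> _ _] _] := hm tau (lt_le_trans Y0 ht).
have low2 j : (j < 3)%N -> e1 (0 / 2) * ((-1) ^+ j * a j) = 0 :> C by move=> /low ->; rewrite !mulr0.
have q2 Y (Y0 : 0 < Y) := qe_shift low2 (qa2 Y Y0).
apply: (vanishing hm hW hz q1 q2 q3).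
by rewrite add0r (_ : 2 * 3%:R = 6 :> R)//; lra.
Qed.

Lemma qe_lower f (e e' : R) b j : (forall Y : R, 0 < Y -> qe Y e' b f) -> e' = e + j%:R ->
  exists bb, forall Y : R, 0 < Y -> qe Y e bb f.
Proof. 
move=> h E; exists (fun k => if (k < j)%N then 0 else b (k - j)%N) => Y Y0.
by apply: qe_unshift; rewrite -E; exact: h.
 Qed.

Lemma th2_pow_qe p : exists a, forall Y : R, 0 < Y -> qe Y (p%:R / 4) a (fun tau => th2 tau ^+ p).
Proof.
have [a [qa _ _ _]] := th2_qe R; exists (fun k => 2 ^+ p * cpow a p k) => Y Y0.
have := qe_scale (2 ^+ p) (qe_pow p (qa Y Y0)); rewrite -[_ *+ p]mulr_natl; apply: qe_ext => tau _.
by rewrite -exprMn mulrC divfK// pnatr_eq0.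
Qed.

Lemma qc_qe f c0 c1 c2 : qc f c0 c1 c2 -> exists a, forall Y : R, 0 < Y -> qe Y 0 a f.
Proof. by move=> [a [qa _]]; exists a. Qed.

Lemma th34_pow_qe p q : exists a, forall Y : R, 0 < Y -> qe Y 0 a (fun tau => th3 tau ^+ p * th4 tau ^+ q).
Proof. exact: qc_qe (qc_mul (qc_pow p (th3_qc R)) (qc_pow q (th4_qc R))). Qed.

(* Up to t^2, theta_3^n - 2 n g1 (n = m + 8) is the theta series of a unimodular lattice with no vector
   of norm 1 and 2 n (23 - n) vectors of norm 2. *)
Definition g1 m tau : C := (th2 tau / 2) ^+ 4 * th4 tau ^+ 4 * th3 tau ^+ m.
Definition g2 m tau : C := - ((th2 tau / 2) ^+ 4 * th3 tau ^+ 4 * th4 tau ^+ m).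
Definition g3 m tau : C := - ((2 ^+ 4)^-1 * (th2 tau ^+ m * (th3 tau ^+ 4 * th4 tau ^+ 4))).

Lemma g_mt m : mt (fun tau => sq tau ^+ (m + 8)) (u8 ^+ (m + 8)) (g1 m) (g2 m) (g3 m).
Proof.
move=> tau It; have [[d1 d2 d3] [c1 c2 c3]] := theta_mt It.
have u4 := e1_8_pow4 R; have u8 := u8_pow8; move: (e1 (8^-1 : R)) d3 u4 u8 => u d3 u4 u8.
rewrite /g1 /g2 /g3 d1 d2 d3 c1 c2 c3 !exprMn !exprVn u4 !exprD u8.
by split; split; ring.
Qed.

Lemma g1_qc m : qc (g1 m) 0 1 (m%:R * 2 - 8).
Proof.
have := qc_mul (qc_mul (th2_pow4_qc R) (qc_pow 4 (th4_qc R))) (qc_pow m (th3_qc R)).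
rewrite !(mul0r, mul1r, mulr0, addr0, add0r, mulr1).
by rewrite (_ : 4 * -2 = - 8 :> C)//; ring.
Qed.

Lemma g3_qe m : exists b, forall Y : R, 0 < Y -> qe Y (m%:R / 4) b (g3 m).
Proof.
have [c qc3] := th2_pow_qe m; have [d qd] := th34_pow_qe 4 4.
eexists=> Y Y0.
apply: (qe_ext (f := fun tau => - (2 ^+ 4)^-1 * (th2 tau ^+ m * (th3 tau ^+ 4 * th4 tau ^+ 4)))).
  by move=> tau _; rewrite /g3 mulNr.
by apply: qe_scale; rewrite -[m%:R / 4]addr0; exact: qe_mul (qc3 Y Y0) (qd Y Y0).
Qed.

Lemma bin2_natr p : 2 * 'C(p, 2)%:R = p%:R * (p%:R - 1) :> C.
Proof.
elim: p => [|p IH]; first by rewrite bin0n mulr0 mul0r.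
by rewrite binS bin1 natrD mulrDr IH -natr1; ring.
Qed.
End Comparison.

(** * Selfdual lattices of minimum 2 with a prescribed number of roots *)

Section RootedLattice.
Variables (R : realType) (m : nat).
Local Notation n := (m + 8)%N.
Variable B : 'M[R]_n.
Hypotheses (hB : B \in unitmx) (hL : selfdual (lattice_of B)).
Variable s : 'rV[R]_n.
Hypothesis hs : half_char B s.
Local Notation C := R[i].
Local Notation lv := (lv B).
Local Notation L := (lattice_of B).
Local Notation Th := (Th B).
Local Notation u8 := (e1 (8^-1 : R) : C).
Hypothesis hmin : forall x, L x -> x != 0 -> 2%:R <= nrm x.

Lemma zeta_eq : e1 (nrm s / 2) = u8 ^+ n.
Proof.
have [j ->] := norm_congruence hB hL hs; rewrite -e1_mulrn.
have -> : (n%:R / 4 + 2 * j%:~R) / 2 = 8^-1 *+ n + j%:~R :> R by rewrite -[_ *+ n]mulr_natr; field.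
by rewrite e1D e1_int mulr1.
Qed.

(** The rank is below 24, so n/4 - 6 < 0 is not a norm, and norms are congruent to n/4 modulo 2. *)
Lemma shadow_bound_weak : (m < 16)%N -> forall z, exists j : nat, nrm (lv z - s) = n%:R / 4 - 4 + j%:R.
Proof.
move=> m16 z.
have [||j Ej] := @shadow_ge _ _ B hB hL s hs (n%:R / 4 - 4) (-2) _ _ z.
- by rewrite rmorphN /=; lra.
- move=> w; have := nrm_ge0 (lv w - s); have : (n%:R : R) < 24 by rewrite (ltr_nat R n 24); lia.
  lra.
by exists (2 * j)%N.
Qed.

Section ShadowBound.
Variable t2 : seq 'rV[int]_n.
Hypotheses (ut2 : uniq t2) (ht2 : forall z, z \in t2 <-> nrm (lv z + 0) = 2).
Hypothesis st2 : (size t2)%:R = 2 * n%:R * (23 - n%:R) :> C.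
Hypothesis he : forall z, exists j : nat, nrm (lv z - s) = n%:R / 4 - 4 + j%:R.
Let fam0 : seq (R * 'rV[R]_n) := [:: (1, 0)].

Lemma theta_qc : qc (Th 0 fam0 0 (fun=> 1)) 1 0 (2 * n%:R * (23 - n%:R)).
Proof.
have [a [qa ca]] := Th_qe hB 0 fam0 (fun _ => cn1 R) (hm0 hL).
exists a; split=> //; split.
- rewrite (ca 0%N [:: 0]) ?big_seq1 ?(pf0 (R := R)) ?mulr1// => z; rewrite inE !addr0; split=> [/eqP ->|].
    by rewrite lv0 nrm0.
  by move/nrm_eq0; rewrite -(lv0 B) => /(lv_inj hB) ->.
- rewrite (ca 1%N [::]) ?big_nil// => z; rewrite in_nil; split=> //.
  rewrite addr0 add0r => E; have : 2%:R <= nrm (lv z).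
    by apply: hmin; [exact: lv_in|apply: contra_eq_neq E => ->; rewrite nrm0 eq_sym oner_eq0].
  by rewrite E ler_nat.
- rewrite (ca 2%N t2)//; last by move=> z; rewrite add0r; exact: ht2.
  rewrite -st2 (eq_bigr (fun=> 1)); last by move=> z _; rewrite (pf0 (R := R)) mulr1.
  by rewrite big_const_seq count_predT iter_addr_0.
Qed.

(** The triple of the lattice minus theta^n plus 2 n g has three vanishing coefficients, by the
    number of roots, and [vanish3] applies since the weak bound gives n/4 < 6 + (n/4 - 4). *)
Lemma shadow_theta tau : 0 < Im tau -> Th 0 fam0 (- s) (fun=> 1) tau = th2 tau ^+ n - 2 * n%:R * g3 m tau.
Proof.
have h1 := lattice_mt hB hL (@harm0 R n) isT hs.
have E : (fun tau : C => sq tau ^+ n * tau ^+ 0) = (fun tau => sq tau ^+ n).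
  by apply/funext => t; rewrite expr0 mulr1.
rewrite E zeta_eq in h1.
have hm := mt_add (mt_add h1 (mt_scale (-1) (mt_pow n (@theta_mt R)))) (mt_scale (2 * n%:R) (@g_mt R m)).
have hc : qc (fun tau => Th 0 fam0 0 (fun=> 1) tau + -1 * th3 tau ^+ n + 2 * n%:R * g1 m tau) 0 0 0.
  have := qc_add (qc_add theta_qc (qc_scale (-1) (qc_pow n (th3_qc R)))) (qc_scale (2 * n%:R) (@g1_qc R m)).
  have -> : 1 + -1 * 1 + 2 * n%:R * 0 = 0 :> C by ring.
  have -> : 0 + -1 * (n%:R * 2) + 2 * n%:R * 1 = 0 :> C by ring.
  have -> : 2 * n%:R * (23 - n%:R) + -1 * (n%:R * 0 + 'C(n, 2)%:R * 2 ^+ 2) + 2 * n%:R * (m%:R * 2 - 8) = 0 :> C.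
    have -> : 'C(n, 2)%:R * 2 ^+ 2 = 2 * (n%:R * (n%:R - 1)) :> C by rewrite -bin2_natr; ring.
    by rewrite natrD; ring.
  by [].
have [a3 [q3 _]] := Th_qe hB 0 fam0 (fun _ => cn1 R) he.
have [b qb] := th2_pow_qe R n; have [c qc3] := g3_qe R m.
have [b' qb'] : exists b', forall Y : R, 0 < Y -> qe Y (n%:R / 4 - 4) b' (fun tau => th2 tau ^+ n).
  by apply: (qe_lower (j := 4) qb); rewrite subrK.
have [c' qg] : exists c', forall Y : R, 0 < Y -> qe Y (n%:R / 4 - 4) c' (g3 m).
  by apply: (qe_lower (j := 2) qc3); rewrite natrD; field.
have q3' Y (Y0 : 0 < Y) := qe_add (qe_add (q3 Y Y0) (qe_scale (-1) (qb' Y Y0))) (qe_scale (2 * n%:R) (qg Y Y0)).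
have hW (tau' : C) : 0 < Im tau' -> cn (sq tau' ^+ n) = cn (sq tau') ^+ n by move=> _; rewrite cnX.
have hz : cn (u8 ^+ n) = 1 by rewrite cnX cn_e1 expr1n.
have hlt : n%:R / 4 < 6 + (n%:R / 4 - 4) :> R by lra.
move=> It; have [_ _ /eqP] := vanish3 hm hW hz hc q3' hlt It.
rewrite mulN1r addr_eq0 subr_eq => /eqP ->; ring.
Qed.

(** In [shadow_theta] the terms start at t^(n/4) and t^(n/4 - 2). The coefficients of a shadow theta
    series count vectors, so smaller norms do not occur. *)
Lemma shadow_bound z : exists j : nat, nrm (lv z - s) = n%:R / 4 - 2 + j%:R.
Proof.
have [a3 [q3 c3]] := Th_qe hB 0 fam0 (fun _ => cn1 R) he.
have [b qb] := th2_pow_qe R n; have [c qc3] := g3_qe R m.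
have [b' qb'] : exists b', forall Y : R, 0 < Y -> qe Y (m%:R / 4) b' (fun tau => th2 tau ^+ n).
  by apply: (qe_lower (j := 2) qb); rewrite natrD; field.
have Y0 : (0 : R) < 1 by [].
have q := qe_add (qb' 1 Y0) (qe_scale (- (2 * n%:R)) (qc3 1 Y0)).
rewrite (_ : m%:R / 4 = n%:R / 4 - 4 + 2%:R) in q; last by rewrite natrD; field.
have low j : (j < 2)%N -> a3 j = 0.
  move=> j2; have := qe_unique (q3 1 Y0) (qe_ext _ (qe_unshift q)) j; rewrite j2; apply=> tau ht.
  by rewrite shadow_theta ?mulNr//; exact: lt_le_trans ht.
have none j : (j < 2)%N -> nrm (lv z - s) <> n%:R / 4 - 4 + j%:R.
  move=> j2 hz; have [t [ut ht]] := shell_finite hB (- s) (n%:R / 4 - 4 + j%:R).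
  have := low j j2; rewrite (c3 j t ut ht) (eq_bigr (fun=> 1)); last by move=> w _; rewrite (pf0 (R := R)) mulr1.
  rewrite big_const_seq count_predT iter_addr_0 => /eqP; rewrite pnatr_eq0 size_eq0 => /eqP t0.
  by move/ht: hz; rewrite t0.
have [[|[|j]] Ej] := he z; [by case: (none 0%N)|by case: (none 1%N)|].
by exists j; rewrite Ej -!natr1; lra.
Qed.
End ShadowBound.

Section Comparison.
Hypothesis he : forall z, exists j : nat, nrm (lv z - s) = n%:R / 4 - 2 + j%:R.
Variables (k : nat) (h1 h2 h3 : C -> C) (b b3 : nat -> C).
Hypotheses (k0 : (0 < k)%N) (ko : ~~ odd k) (k8 : (k < 8)%N).
Hypothesis hmt : mt (fun tau => sq tau ^+ n * tau ^+ k) (u8 ^+ n) h1 h2 h3.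
Hypotheses (qb : forall Y : R, 0 < Y -> qe Y 0 b h1) (b0 : b 0%N = 0) (b1 : b 1%N = 0) (b2 : b 2%N = 1).
Hypothesis qb3 : forall Y : R, 0 < Y -> qe Y (n%:R / 4 - 2) b3 h3.

(** Subtracting from the weighted theta triple a multiple of the triple h, the multiple being its
    coefficient at t^2, leaves a triple whose first three coefficients vanish, hence 0; k < 8 is the
    inequality needed. All weighted shell sums are thus multiples of the coefficients of h1. *)
Lemma condC_compare j : b j = 0 -> condC (shell L j%:R) k.
Proof.
move=> bj; apply: condC_of_families => S uS hS fam hf.
have [a [qa ca]] := Th_qe hB k fam (fun _ => cn1 R) (hm0 hL).
have [a3 [q3 _]] := Th_qe hB k fam (fun _ => cn1 R) he.
have low := low_coef hB k0 hmin ca.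
have hm := lattice_mt hB hL hf ko hs; rewrite zeta_eq in hm.
have hd := mt_add hm (mt_scale (- a 2%N) hmt).
have hc : qc (fun tau => Th k fam 0 (fun=> 1) tau + - a 2%N * h1 tau) 0 0 0.
  exists (fun l => a l + - a 2%N * b l); split=> [Y Y0|].
    exact: qe_add (qa Y Y0) (qe_scale _ (qb Y0)).
  by split=> /=; rewrite ?(low 0%N) ?(low 1%N)// ?b0 ?b1 ?b2; ring.
have q3' Y (Y0 : 0 < Y) := qe_add (q3 Y Y0) (qe_scale (- a 2%N) (qb3 Y0)).
have hz : cn (u8 ^+ n) = 1 by rewrite cnX cn_e1 expr1n.
have hlt : (n + k.*2)%:R / 4 < 6 + (n%:R / 4 - 2) :> R.
  have k8' : (k%:R : R) < 8 by rewrite (ltr_nat R k 8).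
  by rewrite -addnn natrD [(k + k)%:R]natrD; lra.
have V := vanish3 hd (@cn_weight R n k) hz hc q3' hlt.
have aj : a j = 0.
  have Y0 : (0 : R) < 1 by [].
  have := qe_unique (qa 1 Y0) (qe_ext _ (qe_scale (a 2%N) (qb Y0))) j; rewrite bj mulr0; apply=> tau ht.
  have [/eqP + _ _] := V tau (lt_le_trans Y0 ht); rewrite mulNr subr_eq0 => /eqP ->//.
have hS' x : x \in S <-> (exists z, x = lv z + 0) /\ nrm x = j%:R by rewrite hS /shell latticeP.
have [t [ut ht ES]] := shell_list hB uS hS'.
apply: complexI; rewrite ES big_map rmorph_sum /= -[RHS]aj (ca j t ut); last by move=> z; rewrite add0r.
by apply: eq_bigr => z _; rewrite mulr1.
Qed.
End Comparison.
End RootedLattice.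

(** * Counting roots *)

Section RootCounts.
Variable R : realType.

(** The vector with a sign at each of the two positions given by [p], a true bit meaning -1. *)
Definition rvec N (p : nat * nat) (ab : bool * bool) : 'rV[R]_N :=
  \row_(x < N) (((x : nat) == p.1)%:R * (-1) ^+ ab.1 + ((x : nat) == p.2)%:R * (-1) ^+ ab.2).

Definition block_pairs N l : seq (nat * nat) :=
  [seq p <- [seq (i, j) | i <- iota 0 N, j <- iota 0 N] | (p.1 < p.2)%N && (p.1 %/ l == p.2 %/ l)%N].

Lemma mem_block_pairs N l p : (p \in block_pairs N l) = [&& (p.1 < p.2)%N, (p.2 < N)%N & (p.1 %/ l == p.2 %/ l)%N].
Proof.
rewrite mem_filter -andbA; case: ltnP => //= lt; rewrite andbC; congr (_ && _).
apply/allpairsP/idP => [[[i j] /= [_ + ->]]|h]; first by rewrite mem_iota.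
by exists p; rewrite !mem_iota /= !add0n h (ltn_trans lt h); case: p {lt h}.
Qed.

Lemma block_pairs_uniq N l : uniq (block_pairs N l).
Proof. by rewrite filter_uniq// allpairs_uniq ?iota_uniq// => -[a b] [c d] _ _ [-> ->]. Qed.

Lemma sum_indicator N (P : pred nat) (q : nat) (A : R) : (q < N)%N ->
  \sum_(x < N | P x) ((x : nat) == q)%:R * A = if P q then A else 0.
Proof.
move=> qN; rewrite big_mkcond (bigD1 (Ordinal qN)) //= eqxx mul1r big1 ?addr0// => x xq.
have -> : ((x : nat) == q) = false by apply/negbTE; apply: contra xq => /eqP E; apply/eqP/val_inj.
by rewrite mul0r if_same.
Qed.

Lemma sign_sqr (a : bool) : ((-1) ^+ a : R) ^+ 2 = 1.
Proof. by rewrite sqrr_sign. Qed.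

Lemma nrm_rvec N p ab : (p.1 < p.2)%N -> (p.2 < N)%N -> nrm (rvec N p ab) = 2.
Proof.
move=> lt h; have h1 := ltn_trans lt h.
rewrite /nrm /dot (eq_bigr (fun x : 'I_N => ((x : nat) == p.1)%:R * 1 + ((x : nat) == p.2)%:R * 1)); last first.
  move=> x _; rewrite !mxE -expr2; have [->|x1] := eqVneq (x : nat) p.1.
    by rewrite (ltn_eqF lt) !mul0r !addr0 !mul1r sign_sqr.
  have [_|_] := eqVneq (x : nat) p.2; first by rewrite !mul0r !add0r !mul1r sign_sqr.
  by rewrite !mul0r addr0 expr0n.
by rewrite big_split /= !(sum_indicator predT)//.
Qed.

Lemma rvec_entry N p ab (x : 'I_N) : rvec N p ab ord0 x != 0 -> (x : nat) = p.1 \/ (x : nat) = p.2.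
Proof.
rewrite mxE; have [->|_] := eqVneq (x : nat) p.1; first by left.
have [->|_] := eqVneq (x : nat) p.2; first by right.
by rewrite !mul0r addr0 eqxx.
Qed.

Lemma rvec_int N p ab : intvec (rvec N p ab).
Proof.
have h (c a : bool) : is_int (c%:R * (-1) ^+ a : R).
  by exists (c%:R * (-1) ^+ a); rewrite rmorphM rmorphXn rmorph_nat rmorphN1.
by move=> x; rewrite mxE; apply: is_intD; exact: h.
Qed.

Lemma rvec_inj N p ab p' ab' : (p.1 < p.2)%N -> (p.2 < N)%N -> (p'.1 < p'.2)%N -> (p'.2 < N)%N ->
  rvec N p ab = rvec N p' ab' -> p = p' /\ ab = ab'.
Proof.
move=> lt h lt' h' E.
have s0 (a : bool) : (-1) ^+ a != 0 :> R by rewrite signr_eq0.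
have e1 q qb (h1 : (q.1 < q.2)%N) (hq : (q.1 < N)%N) : rvec N q qb ord0 (Ordinal hq) = (-1) ^+ qb.1.
  by rewrite mxE /= eqxx (ltn_eqF h1) mul1r mul0r addr0.
have e2 q qb (h1 : (q.1 < q.2)%N) (hq : (q.2 < N)%N) : rvec N q qb ord0 (Ordinal hq) = (-1) ^+ qb.2.
  by rewrite mxE /= eqxx (gtn_eqF h1) mul1r mul0r add0r.
have h1 := ltn_trans lt h; have h1' := ltn_trans lt' h'.
have a1 : p.1 = p'.1 \/ p.1 = p'.2 by apply: (@rvec_entry N p' ab' (Ordinal h1)); rewrite -E e1.
have a2 : p.2 = p'.1 \/ p.2 = p'.2 by apply: (@rvec_entry N p' ab' (Ordinal h)); rewrite -E e2.
have pp : p = p' by case: p p' lt lt' a1 a2 {E h h' h1 h1' e1 e2} => i j [i' j'] /=; intuition; subst; try lia.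
split=> //; rewrite -pp in E lt' h' h1'.
case: ab ab' E => [a b] [a' b'] E.
have A1 := e1 p (a, b) lt h1; rewrite E e1 //= in A1.
have A2 := e2 p (a, b) lt h; rewrite E e2 //= in A2.
by have [-> ->] : a = a' /\ b = b' by split; apply/esym; apply: (@signr_inj R).
Qed.

(** If squares of integers add up to 2, exactly two of them are 1 and the others vanish. *)
Lemma root_shape N (y : 'rV[R]_N) : intvec y -> nrm y = 2 ->
  exists p ab, [/\ (p.1 < p.2)%N, (p.2 < N)%N & y = rvec N p ab].
Proof.
move=> yi ny; have [c hc] := boolp.choice yi.
have sum2 : (\sum_(i < N) `|c i| ^ 2 = 2)%N.
  apply/eqP; rewrite -(eqr_nat R) -ny /nrm /dot natr_sum; apply/eqP; apply: eq_bigr => i _.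
  by rewrite hc natrX absz_intr -normrX ger0_norm ?sqr_ge0// expr2.
have nz (P : pred 'I_N) : (0 < \sum_(i < N | P i) `|c i| ^ 2)%N -> exists2 i, P i & (0 < `|c i| ^ 2)%N.
  move=> h; apply: contrapT => no; move: h; rewrite big1// => i Pi.
  by apply/eqP; rewrite -leqn0 leqNgt; apply/negP => h; apply: no; exists i.
have [i _ ci] : exists2 i : 'I_N, true & (0 < `|c i| ^ 2)%N by apply: nz; rewrite sum2.
have sq1 q : (0 < `|c q| ^ 2 <= 2)%N -> `|c q|%N = 1%N.
  by case: `|c q|%N => [|[|k]]//; rewrite expnS expn1; lia.
have si : (`|c i| ^ 2 + \sum_(j < N | j != i) `|c j| ^ 2 = 2)%N by rewrite -[RHS]sum2 [RHS](bigD1 i).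
have ci1 : `|c i|%N = 1%N by apply: sq1; rewrite ci; lia.
rewrite ci1 in si.
have [j ji cj] : exists2 j : 'I_N, j != i & (0 < `|c j| ^ 2)%N by apply: nz; lia.
have sj : (`|c j| ^ 2 + \sum_(q < N | (q != i) && (q != j)) `|c q| ^ 2 = 1)%N.
  by move: si; rewrite (bigD1 j ji) /= exp1n add1n => -[].
have cj1 : `|c j|%N = 1%N by apply: sq1; rewrite cj; lia.
rewrite cj1 in sj.
have rest q : q != i -> q != j -> c q = 0.
  move=> qi qj; apply/eqP; rewrite -absz_eq0.
  have : (\sum_(q < N | (q != i) && (q != j)) `|c q| ^ 2 = 0)%N by lia.
  by move/eqP; rewrite sum_nat_eq0 => /forallP /(_ q); rewrite qi qj /= expn_eq0 andbT.
have sg q : `|c q|%N = 1%N -> y ord0 q = (-1) ^+ (c q == -1).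
  by move=> h; rewrite hc; have [->|->] : c q = 1 \/ c q = -1 by lia.
have build (a b : 'I_N) : (a < b)%N -> `|c a|%N = 1%N -> `|c b|%N = 1%N -> (forall q, q != a -> q != b -> c q = 0) ->
    exists p ab, [/\ (p.1 < p.2)%N, (p.2 < N)%N & y = rvec N p ab].
  move=> ab ca cb r; exists (a : nat, b : nat), (c a == -1, c b == -1); split=> //=.
  apply/rowP => q; rewrite mxE /=; have [->|qa] := eqVneq q a.
    by rewrite eqxx (ltn_eqF ab) mul1r mul0r addr0 sg.
  have -> : ((q : nat) == a) = false by exact: negbTE.
  have [->|qb] := eqVneq q b; first by rewrite eqxx mul1r mul0r add0r sg.
  have -> : ((q : nat) == b) = false by exact: negbTE.
  by rewrite !mul0r addr0 hc r.
have [ij|ij|E] := ltngtP i j; [exact: build ij ci1 cj1 rest| |by case/eqP: ji; apply: val_inj].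
by apply: build ij cj1 ci1 _ => q qj qi; exact: rest.
Qed.

(** [AB] lists the admissible sign pairs: all four in type D, the two opposite ones in type A. *)
Definition root_list N l (AB : seq (bool * bool)) : seq 'rV[R]_N :=
  [seq rvec N p ab | p <- block_pairs N l, ab <- AB].

Lemma root_list_uniq N l AB : uniq AB -> uniq (root_list N l AB).
Proof.
move=> uAB; apply: allpairs_uniq => //; first exact: block_pairs_uniq.
move=> _ _ /allpairsP [[p ab] [/= + _ ->]] /allpairsP [[p' ab'] [/= + _ ->]] /=.
rewrite !mem_block_pairs => /and3P [a b _] /and3P [c d _] E.
by have [-> ->] := rvec_inj a b c d E.
Qed.

Definition all_signs : seq (bool * bool) := [:: (false, false); (false, true); (true, false); (true, true)].

Lemma root_listD k l y : y \in root_list (k * l) l all_signs <-> @rootsD R k l y.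
Proof.
split=> [/allpairsP [[p ab] /= [+ _ ->]]|[yi [ny hb]]].
  rewrite mem_block_pairs => /and3P [lt h /eqP bl]; split; first exact: rvec_int.
  split=> [|i j /rvec_entry hi /rvec_entry hj]; first exact: nrm_rvec.
  by case: hi => ->; case: hj => ->; rewrite ?bl.
have [p [ab [lt h E]]] := root_shape yi ny.
apply/allpairsP; exists (p, ab) => /=; split=> //; last by case: ab {E} => -[] [].
rewrite mem_block_pairs lt h /=; apply/eqP.
have s0 (a : bool) : (-1) ^+ a != 0 :> R by rewrite signr_eq0.
have := hb (Ordinal (ltn_trans lt h)) (Ordinal h); apply; rewrite E mxE /= eqxx.
  by rewrite (ltn_eqF lt) mul1r mul0r addr0.
by rewrite (gtn_eqF lt) mul1r mul0r add0r.
Qed.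

Lemma root_listA k l y : y \in root_list (k * l) l [:: (false, true); (true, false)] <-> @rootsA R k l y.
Proof.
have bsum p ab b : (p.1 < p.2)%N -> (p.2 < k * l)%N ->
    \sum_(i < k * l | (i %/ l == b)%N) rvec (k * l) p ab ord0 i =
    (if (p.1 %/ l == b)%N then (-1) ^+ ab.1 else 0) + (if (p.2 %/ l == b)%N then (-1) ^+ ab.2 else 0).
  move=> lt h; rewrite (eq_bigr (fun x : 'I_(k * l) => ((x : nat) == p.1)%:R * (-1) ^+ ab.1 + ((x : nat) == p.2)%:R * (-1) ^+ ab.2)).
    by rewrite big_split /= !(sum_indicator (fun x => (x %/ l == b)%N))// (ltn_trans lt h).
  by move=> x _; rewrite mxE.
have sub : {subset [:: (false, true); (true, false)] <= all_signs} by move=> x; rewrite !inE => /orP[] /eqP ->.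
split=> [/allpairsP [[p ab] /= [hp hab E]]|[]].
  split; first by apply/root_listD/allpairsP; exists (p, ab); split=> //; exact: sub.
  move: hp; rewrite mem_block_pairs => /and3P [lt h /eqP bl] b; rewrite E bsum// bl.
  case: ifP => _; last by rewrite addr0.
  by move: hab; rewrite !inE => /orP[] /eqP ->; rewrite /= expr0 expr1 ?subrr ?addNr.
move=> /root_listD/allpairsP [[p ab] /= [hp _ E]] hb; apply/allpairsP; exists (p, ab); split=> //=.
move: (hp); rewrite mem_block_pairs => /and3P [lt h /eqP bl].
have := hb (p.1 %/ l)%N; rewrite E bsum// -bl eqxx; case: ab {E} => -[] [] //=; rewrite ?expr0 ?expr1 => /eqP.
  by rewrite -opprD oppr_eq0 -mulr2n pnatr_eq0.
by rewrite -mulr2n pnatr_eq0.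
Qed.

(** [f] preserves inner products of roots, which is enough for injectivity there: the norm of a
    difference of roots is computed from such products. *)
Lemma roots_iso_count n N (B : 'M[R]_n) (S : 'rV[R]_N -> Prop) (V : seq 'rV[R]_N) (t : seq 'rV[int]_n) :
  B \in unitmx -> roots_iso (lattice_of B) S -> uniq V -> (forall y, y \in V <-> S y) ->
  uniq t -> (forall z, z \in t <-> nrm (lv B z + 0) = 2) -> size t = size V.
Proof.
move=> hB [f [f1 [f2 f3]]] uV hV ut ht.
have rz z : z \in t -> Defs.roots (lattice_of B) (lv B z).
  by move=> /ht; rewrite addr0 => h; split=> //; exact: lv_in.
have ifz : {in t &, injective (fun z => f (lv B z))}.
  move=> z w zt wt E; apply: (lv_inj hB); apply/eqP; rewrite -subr_eq0; apply/eqP/nrm_eq0.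
  have [_ nz] := rz z zt; have [_ nw] := rz w wt.
  have := f3 _ _ (rz z zt) (rz w wt); rewrite E f3; [|exact: rz|exact: rz].
  by rewrite nrmB nz -/(nrm (lv B w)) nw => <-; lra.
rewrite -(size_map (fun z => f (lv B z)) t); apply: perm_size; apply: uniq_perm => //.
  by rewrite map_inj_in_uniq.
move=> y; apply/mapP/idP => [[z zt ->]|/hV /f2 [x [[Lx nx] <-]]]; first by apply/hV/f1; exact: rz.
by have /lvP [z E] := Lx; exists z; rewrite ?E//; apply/ht; rewrite addr0 -E.
Qed.
End RootCounts.

(** * Designs from conditions in even degrees *)

Section DesignCriteria.
Variables (R : realType) (n : nat) (X : 'rV[R]_n -> Prop).

Lemma design3P : condC X 2 -> design 3 X.
Proof. by move=> h2 j j1 jt; have -> : j = 1%N by lia. Qed.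

Lemma design5P : condC X 2 -> condC X 4 -> design 5 X.
Proof. by move=> h2 h4 j j1 jt; have [->|->] : j = 1%N \/ j = 2%N by lia. Qed.

Lemma design7P : condC X 2 -> condC X 4 -> condC X 6 -> design 7 X.
Proof. by move=> h2 h4 h6 j j1 jt; have [->|[->|->]] : j = 1%N \/ j = 2%N \/ j = 3%N by lia. Qed.
End DesignCriteria.

(** * Comparison triples in ranks 16 and 20 *)

Section RootLatticeDesigns.
Variable R : realType.
Local Notation C := R[i].
Local Notation iC := (Complex 0 1 : C).
Local Notation u8 := (e1 (8^-1 : R) : C).

Lemma tau_pow4 (tau : C) : 0 < Im tau -> tau ^+ 4 = sq tau ^+ 8.
Proof.
move=> It; rewrite -{1}(iC_sq It) exprMn -exprM (exprM iC 2 2) (expr2 iC) iC2; ring.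
Qed.

Lemma tau_pow6 (tau : C) : 0 < Im tau -> tau ^+ 6 = - sq tau ^+ 12.
Proof.
move=> It; rewrite -{1}(iC_sq It) exprMn -exprM (exprM iC 2 3) (expr2 iC) iC2; ring.
Qed.

(** Comparison form in rank 20 and degree 4: weight 14, that is 28 Jacobi factors. Adding its
    translate by 1 gives [E4]. *)
Definition hA tau : C := (th2 tau / 2) ^+ 8 * th4 tau ^+ 8 * th3 tau ^+ 12.

Lemma hA_mt : mt (fun tau => sq tau ^+ 20 * tau ^+ 4) (u8 ^+ 20) hA
  (fun tau => (th2 tau / 2) ^+ 8 * th3 tau ^+ 8 * th4 tau ^+ 12)
  (fun tau => (2 ^+ 8)^-1 * (th2 tau ^+ 12 * (th3 tau ^+ 8 * th4 tau ^+ 8))).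
Proof.
move=> tau It; have [[d1 d2 d3] [c1 c2 c3]] := theta_mt It; have t4 := tau_pow4 It.
have u8 := u8_pow8 R; move: (e1 (8^-1 : R)) d3 u8 => u d3 u8.
have u12 : u ^+ 12 = u ^+ 4 by rewrite (exprD u 8 4) u8 mul1r.
have u20 : u ^+ 20 = u ^+ 4 by rewrite (exprD u 8 12) u8 mul1r.
rewrite /hA d1 d2 d3 c1 c2 c3 t4 !exprMn !exprVn u8 u12 u20.
by split; split; ring.
Qed.

(** Comparison form in rank 16 and degree 4, of weight 12; all three members of its triple
    coincide. *)
Definition hD4 tau : C := Dl tau.

Lemma hD4_mt : mt (fun tau => sq tau ^+ 16 * tau ^+ 4) (u8 ^+ 16) hD4 hD4 hD4.
Proof.
move=> tau It; have [[d1 d2 d3] [c1 c2 c3]] := theta_mt It; have t4 := tau_pow4 It.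
have u8 := u8_pow8 R; move: (e1 (8^-1 : R)) d3 u8 => u d3 u8.
have u16 : u ^+ 16 = 1 by rewrite (exprD u 8 8) u8 mul1r.
rewrite /hD4 /Dl d1 d2 d3 c1 c2 c3 t4 !exprMn !exprVn u8 u16.
by split; split; ring.
Qed.

(** Comparison form in rank 16 and degree 6, again of weight 14 and with [E4] as the sum of it and
    its translate by 1. *)
Definition hD6 tau : C := Dl tau * (th4 tau ^+ 4 - th2 tau ^+ 4).

Lemma hD6_mt : mt (fun tau => sq tau ^+ 16 * tau ^+ 6) (u8 ^+ 16) hD6
  (fun tau => Dl tau * (th3 tau ^+ 4 + th2 tau ^+ 4)) (fun tau => - E4 tau).
Proof.
move=> tau It; have [[d1 d2 d3] [c1 c2 c3]] := theta_mt It; have t6 := tau_pow6 It.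
have u8 := u8_pow8 R; have u4 := e1_8_pow4 R; move: (e1 (8^-1 : R)) d3 u8 u4 => u d3 u8 u4.
have u16 : u ^+ 16 = 1 by rewrite (exprD u 8 8) u8 mul1r.
rewrite /hD6 /E4 /Dl d1 d2 d3 c1 c2 c3 t6 !exprMn !exprVn u8 u4 u16.
by split; split; ring.
Qed.

(** The even coefficients of [h] are half those of [E4], and 4^(k+1) is even. *)
Lemma even_coef (h : C -> C) a : (forall Y : R, 0 < Y -> qe Y 0 a h) ->
  (forall tau : C, 0 < Im tau -> h tau + h (tau + 1) = E4 tau) -> forall k, a (4 ^ k.+1)%N = 0.
Proof.
move=> qa hE k.
have [b qb] := qc_qe (qc_mul (Dl_qc R) (qc_add (qc_pow 4 (th3_qc R)) (qc_pow 4 (th4_qc R)))).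
have bk := E4_coef qb k.
have E : (4 ^ k.+1 = (2 * 4 ^ k).*2)%N by rewrite expnS; lia.
have hE' (tau : C) : 0 < Im tau -> h tau + h (tau + 1) = 1 * E4 tau by rewrite mul1r; exact: hE.
have := qe_even qa qb hE' (2 * 4 ^ k)%N; rewrite -E bk mulr0 -[_ *+ 2]mulr_natl => /eqP.
by rewrite mulf_eq0 pnatr_eq0 /= => /eqP.
Qed.

(** With n = m + 8 the count is 2 n (23 - n): 224 for two copies of D_8, 120 for four copies of A_5
    and for five copies of D_4. *)
Lemma rooted_shadow m (B : 'M[R]_(m + 8)) (s : 'rV[R]_(m + 8)) N (S : 'rV[R]_N -> Prop) (V : seq 'rV[R]_N) :
  (m < 16)%N -> B \in unitmx -> selfdual (lattice_of B) -> min_ge (lattice_of B) 2 -> half_char B s ->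
  roots_iso (lattice_of B) S -> uniq V -> (forall y, y \in V <-> S y) ->
  size V = (2 * (m + 8) * (15 - m))%N ->
  forall z, exists j : nat, nrm (lv B z - s) = (m + 8)%:R / 4 - 2 + j%:R.
Proof.
move=> m16 hB hL hm hs hr uV hV sV.
have [t [ut ht]] := shell_finite hB 0 2.
have st := roots_iso_count hB hr uV hV ut ht.
apply: (shadow_bound hB hL hs hm ut ht _ (shadow_bound_weak hB hL hs m16)).
by rewrite st sV !natrM natrB ?natrD; [ring|lia].
Qed.

Lemma condC2 m (B : 'M[R]_(m + 8)) (s : 'rV[R]_(m + 8)) : B \in unitmx -> selfdual (lattice_of B) ->
  min_ge (lattice_of B) 2 -> half_char B s ->
  (forall z, exists j : nat, nrm (lv B z - s) = (m + 8)%:R / 4 - 2 + j%:R) ->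
  forall r, condC (shell (lattice_of B) r) 2.
Proof.
move=> hB hL hm hs he r.
have hlt : (m + 8 + 2.*2)%:R / 4 < 2 * 2%:R + ((m + 8)%:R / 4 - 2) :> R.
  by rewrite [(m + 8 + _)%:R]natrD (_ : (2.*2)%:R = 4%:R :> R)//; lra.
by have [] := shells_harmonic hB hL hs (k := 2) isT isT hm he hlt r.
Qed.

Lemma design5_rank20 (B : 'M[R]_20) N (S : 'rV[R]_N -> Prop) (V : seq 'rV[R]_N) :
  B \in unitmx -> selfdual (lattice_of B) -> min_ge (lattice_of B) 2 -> roots_iso (lattice_of B) S ->
  uniq V -> (forall y, y \in V <-> S y) -> size V = 120 ->
  forall a, (1 <= a)%N -> design 5 (shell (lattice_of B) (4 ^ a)%:R).
Proof.
move=> hB hL hm hr uV hV sV [//|a] _.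
have [s hs] := half_char_ex hB hL.
have he := @rooted_shadow 12 B s N S V isT hB hL hm hs hr uV hV sV.
have [b [qb [b0 b1 b2]]] : qc hA 0 0 1.
  have := qc_mul (qc_mul (th2_pow8_qc R) (qc_pow 8 (th4_qc R))) (qc_pow 12 (th3_qc R)).
  by rewrite !(mul0r, mul1r, mulr0, addr0, add0r, mulr1).
have [c qc3] := th2_pow_qe R 12; have [d qd] := th34_pow_qe R 8 8.
have q3 Y (Y0 : 0 < Y) := qe_scale (2 ^+ 8)^-1 (qe_mul (qc3 Y Y0) (qd Y Y0)).
have e3 : 12%:R / 4 + 0 = (12 + 8)%:R / 4 - 2 :> R by rewrite natrD; lra.
rewrite e3 in q3.
have ba : b (4 ^ a.+1)%N = 0.
  apply: (even_coef qb) => tau It; have [e3' e4 _] := theta_translate It.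
  have [[_ _ d2] _] := theta_mt It.
  have u8 := u8_pow8 R; move: (e1 (8^-1 : R)) d2 u8 => u d2 u8.
  by rewrite /hA /E4 /Dl e3' e4 d2 !exprMn u8; ring.
apply: design5P; first exact: (@condC2 12 B s hB hL hm hs he).
exact: (@condC_compare R 12 B hB hL s hs hm he 4 _ _ _ b _ isT isT isT hA_mt qb b0 b1 b2 q3 _ ba).
Qed.

Lemma rank16_shadow (B : 'M[R]_16) (s : 'rV[R]_16) : B \in unitmx -> selfdual (lattice_of B) ->
  min_ge (lattice_of B) 2 -> half_char B s -> roots_iso (lattice_of B) (@rootsD R 2 8) ->
  forall z, exists j : nat, nrm (lv B z - s) = (8 + 8)%:R / 4 - 2 + j%:R.
Proof.
move=> hB hL hm hs hr.
have sz : size (root_list R (2 * 8) 8 all_signs) = (2 * (8 + 8) * (15 - 8))%N.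
  by rewrite size_allpairs; vm_compute.
have uV : uniq (root_list R (2 * 8) 8 all_signs) by exact: root_list_uniq.
have := @rooted_shadow 8 B s _ (@rootsD R 2 8) (root_list R (2 * 8) 8 all_signs) isT hB hL hm hs hr uV (@root_listD R 2 8) sz.
by [].
Qed.

Lemma Dl_qe : exists b, forall Y : R, 0 < Y -> qe Y 2 b (fun tau : C => Dl tau).
Proof.
have [c qc3] := th2_pow_qe R 8; have [d qd] := th34_pow_qe R 8 8.
exists (fun k => (2 ^+ 8)^-1 * conv c d k) => Y Y0.
have := qe_scale (2 ^+ 8)^-1 (qe_mul (qc3 Y Y0) (qd Y Y0)).
rewrite (_ : 8%:R / 4 + 0 = 2 :> R); last by lra.
by apply: qe_ext => tau _; rewrite /Dl !exprMn exprVn; ring.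
Qed.
End RootLatticeDesigns.

Theorem theorem12p3 (R : realType) :
  (* (i) *)
  (forall (n : nat) (B : 'M[R]_n), B \in unitmx ->
     selfdual (lattice_of B) -> sigma_is (lattice_of B) (n%:R - 8) ->
     min_is (lattice_of B) 2 ->
     forall m : R,
       ((exists x, shell (lattice_of B) m x) -> design 3 (shell (lattice_of B) m)) /\
       ((exists x, shell (shadow (lattice_of B)) m x) ->
          design 3 (shell (shadow (lattice_of B)) m))) /\
  (* (ii) : (2D_8)^+ *)
  (forall B : 'M[R]_16, B \in unitmx ->
     selfdual (lattice_of B) -> min_ge (lattice_of B) 2 ->
     roots_iso (lattice_of B) (@rootsD R 2 8) ->
     forall a : nat, (1 <= a)%N ->
       design_3half (shell (lattice_of B) (4 ^ a)%:R)) /\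
  (* (iii) : (4A_5)^+, (5D_4)^+ with m = 4^a, and (2D_8)^+ with m = 2a+1 *)
  (forall B : 'M[R]_20, B \in unitmx ->
     selfdual (lattice_of B) -> min_ge (lattice_of B) 2 ->
     roots_iso (lattice_of B) (@rootsA R 4 6) ->
     forall a : nat, (1 <= a)%N -> design 5 (shell (lattice_of B) (4 ^ a)%:R)) /\
  (forall B : 'M[R]_20, B \in unitmx ->
     selfdual (lattice_of B) -> min_ge (lattice_of B) 2 ->
     roots_iso (lattice_of B) (@rootsD R 5 4) ->
     forall a : nat, (1 <= a)%N -> design 5 (shell (lattice_of B) (4 ^ a)%:R)) /\
  (forall B : 'M[R]_16, B \in unitmx ->
     selfdual (lattice_of B) -> min_ge (lattice_of B) 2 ->
     roots_iso (lattice_of B) (@rootsD R 2 8) ->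
     forall a : nat, (1 <= a)%N -> design 5 (shell (lattice_of B) (2 * a + 1)%:R)) /\
  (* (iv) : shorter Leech lattice *)
  (forall B : 'M[R]_23, B \in unitmx ->
     selfdual (lattice_of B) -> min_is (lattice_of B) 3 ->
     forall m : R,
       ((exists x, shell (lattice_of B) m x) -> design 7 (shell (lattice_of B) m)) /\
       ((exists x, shell (shadow (lattice_of B)) m x) ->
          design 7 (shell (shadow (lattice_of B)) m))).
Proof.
split=> [n B hB hL [[x0 [sx0 ex0]] hsig] [_ hmin] r|].
  have [s hs] := half_char_ex hB hL.
  (* Shadow norms differ by even integers, so the attained minimum (n - 8)/4 is the exponent from
     which all of them are counted. *)
  have he z : exists m : nat, nrm (lv B z - s) = (n%:R - 8) / 4 + m%:R.
    have /(shadowP hL hs) [z0 E0] := sx0; have [m0 Em0] := shadow_norm hs z0; have [m Em] := shadow_norm hs z.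
    have h1 : n%:R - 8 <= 4 * nrm (lv B z - s) by apply: hsig; apply/(shadowP hL hs); exists z.
    have h2 : nrm (lv B z - s) = (n%:R - 8) / 4 + 2 * (m - m0)%:~R.
      by move: ex0; rewrite E0 Em0 Em rmorphB /=; lra.
    have : (0 : R) <= (m - m0)%:~R by lra.
    rewrite ler0z => h0; exists (2 * `|m - m0|)%N.
    by rewrite h2 natrM absz_intr ger0_norm ?ler0z.
  have hlt : (n + 2.*2)%:R / 4 < 2 * 2%:R + (n%:R - 8) / 4 :> R.
    by rewrite natrD (_ : (2.*2)%:R = 4%:R :> R)//; lra.
  have [c1 c2] := shells_harmonic hB hL hs (k := 2) isT isT hmin he hlt r.
  by split=> _; apply: design3P.
split=> [B hB hL hm hr [//|a] _|].
  have [s hs] := half_char_ex hB hL.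
  have he := rank16_shadow hB hL hm hs hr.
  split; first exact: (@condC2 R 8 B s hB hL hm hs he).
  have t24 : qc (fun tau : R[i] => -1 * th2 tau ^+ 4) (-1 * (2 ^+ 4 * 0)) (-1 * (2 ^+ 4 * 1)) (-1 * (2 ^+ 4 * 0)).
    apply: qc_ext (qc_scale (-1) (qc_scale (2 ^+ 4) (th2_pow4_qc R))) => tau.
    by rewrite -exprMn [2 * _]mulrC divfK// pnatr_eq0.
  have [b [qb [b0 b1 b2]]] : qc (@hD6 R) 0 0 1.
    have := qc_mul (Dl_qc R) (qc_add (qc_pow 4 (th4_qc R)) t24).
    rewrite !(mul0r, mul1r, mulr0, addr0, add0r, mulr1); apply: qc_ext => tau.
    by rewrite /hD6 mulN1r.
  have [c qD] := Dl_qe R.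
  have [d qd] := qc_qe (qc_add (qc_pow 4 (th3_qc R)) (qc_pow 4 (th4_qc R))).
  (* [Dl] has order 2 at t = 0, which is the least shadow exponent 16/4 - 2. *)
  have [b3 q3] : exists b3, forall Y : R, 0 < Y -> qe Y ((8 + 8)%:R / 4 - 2) b3 (fun tau : R[i] => - E4 tau).
    exists (fun k => -1 * conv c d k) => Y Y0.
    have := qe_scale (-1) (qe_mul (qD Y Y0) (qd Y Y0)).
    rewrite (_ : 2 + 0 = (8 + 8)%:R / 4 - 2 :> R); last by rewrite natrD; lra.
    by apply: qe_ext => tau _; rewrite mulN1r.
  have ba : b (4 ^ a.+1)%N = 0.
    apply: (even_coef qb) => tau It; have [e3 e4 e2] := theta_translate It.
    by rewrite /hD6 /E4 Dl_translate// e4 e2; ring.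
  exact: (@condC_compare R 8 B hB hL s hs hm he 6 _ _ _ b b3 isT isT isT (@hD6_mt R) qb b0 b1 b2 q3 _ ba).
split=> [B hB hL hm hr|].
  have sz : size (root_list R (4 * 6) 6 [:: (false, true); (true, false)]) = 120.
    by rewrite size_allpairs; vm_compute.
  have uV : uniq (root_list R (4 * 6) 6 [:: (false, true); (true, false)]) by exact: root_list_uniq.
  exact: (design5_rank20 hB hL hm hr uV (@root_listA R 4 6) sz).
split=> [B hB hL hm hr|].
  have sz : size (root_list R (5 * 4) 4 all_signs) = 120 by rewrite size_allpairs; vm_compute.
  have uV : uniq (root_list R (5 * 4) 4 all_signs) by exact: root_list_uniq.
  exact: (design5_rank20 hB hL hm hr uV (@root_listD R 5 4) sz).
split=> [B hB hL hm hr a _|].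
  have [s hs] := half_char_ex hB hL.
  have he := rank16_shadow hB hL hm hs hr.
  apply: design5P; first exact: (@condC2 R 8 B s hB hL hm hs he).
  have [b [qb [b0 b1 b2]]] := Dl_qc R.
  have [c qD] := Dl_qe R.
  have q3 Y : 0 < Y -> qe Y ((8 + 8)%:R / 4 - 2) c (@hD4 R).
    move=> Y0; rewrite (_ : (8 + 8)%:R / 4 - 2 = 2 :> R); first exact: qD.
    by rewrite natrD; lra.
  (* [Dl] is invariant under tau -> tau + 1, that is under t -> -t, so its odd coefficients
     vanish. *)
  have ba : b (2 * a + 1)%N = 0.
    have H := qe_ext (fun tau ht => Dl_translate (lt_le_trans ltr01 ht)) (qe_translate (qb _ ltr01)).
    have := qe_unique (qb _ ltr01) H (2 * a + 1)%N.
    rewrite mul0r e10 mul1r -signr_odd oddD oddM /= expr1 mulN1r => /eqP.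
    by rewrite -addr_eq0 -mulr2n -[_ *+ 2]mulr_natl mulf_eq0 pnatr_eq0 /= => /eqP.
  exact: (@condC_compare R 8 B hB hL s hs hm he 4 _ _ _ b c isT isT isT (@hD4_mt R) qb b0 b1 b2 q3 _ ba).
move=> B hB hL [_ hmin] r.
have [s hs] := half_char_ex hB hL.
have he := shorter_leech_shadow hB hL hs hmin.
(* 23/4 + k/2 < 6 + 15/4 amounts to k < 8, so degrees 2, 4 and 6 are covered. *)
have hlt k : (k < 8)%N -> (23 + k.*2)%:R / 4 < 2 * 3%:R + 15 / 4 :> R.
  move=> k8; have k8' : (k%:R : R) < 8 by rewrite (ltr_nat R k 8).
  by rewrite -addnn natrD [(k + k)%:R]natrD; lra.
have H2 := shells_harmonic hB hL hs (k := 2) isT isT hmin he (hlt 2%N isT) r.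
have H4 := shells_harmonic hB hL hs (k := 4) isT isT hmin he (hlt 4%N isT) r.
have H6 := shells_harmonic hB hL hs (k := 6) isT isT hmin he (hlt 6%N isT) r.
by split=> _; apply: design7P; [case: H2|case: H4|case: H6|case: H2|case: H4|case: H6].
Qed.
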